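(* Let $\hat M^{cKP}$ be the almost duality of the Frobenius manifold $M^{cKP}$. Then the Hamiltonian densities of the principal hierarchy for $\hat M^{cKP}$ are given by $$F_{\tilde\gamma,p}=\frac1{2\pi\mathrm i}\int_{\tilde\gamma}\frac{(\log(\lambda(z)))^{p+1}}{(p+1)!}\,dz,$$ where $\tilde\gamma$ is a simple closed curve in the complex plane $\mathbb C$ such that the winding number of $\lambda(z)$ along $\tilde\gamma$ is zero. In particular, let $q_1,\dots,q_k$ and $p_1,\dots,p_k$ be the zeros and poles of $\lambda(z)$, respectively, within the region enclosed by $\tilde\gamma$. Then $$F_{\tilde\gamma,0}=\sum_{s=1}^kp_s-\sum_{s=1}^kq_s .$$
   Context: **The manifold.** Let $n_0,\dots,n_m$ be positive integers. $M^{cKP}$ is the space of rational functions $\lambda(z)=\frac1{n_0}z^{n_0}+a_{0,n_0-2}z^{n_0-2}+\dots+a_{0,0}+\sum_{i=1}^m\sum_{j=1}^{n_i}a_{i,j}(z-a_{i,0})^{-j}$ with $a_{i,n_i}\ne0$ and $a_{1,0},\dots,a_{m,0}$ pairwise distinct; the $a_{i,j}$ are coordinates. A tangent vector $\partial$ is identified with $\partial\lambda(z)$; $'=d/dz$. The Frobenius structure is: $\eta(\partial',\partial'')=\sum_{\lambda'(z_0)=0}\operatorname{Res}_{z_0}\frac{\partial'\lambda\,\partial''\lambda}{\lambda'}dz$; $\ \eta(\partial'\circ\partial'',\partial''')=\sum_{\lambda'(z_0)=0}\operatorname{Res}_{z_0}\frac{\partial'\lambda\,\partial''\lambda\,\partial'''\lambda}{\lambda'}dz$;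 unit field $e$ with $e\lambda=1$; Euler field $E$ with $E\lambda=\lambda-\frac z{n_0}\lambda'$. **Almost duality.** For a Frobenius manifold $M$ with flat coordinates $t^\alpha$ of $\eta$, the intersection form is $g^{\alpha\beta}=i_E(dt^\alpha\circ dt^\beta)$, where the product on $T^*M$ is the one transported from $TM$ by $\eta$. Put $\hat M=M\setminus\{\det(g^{\alpha\beta})=0\}$ and $u\star v=E^{-1}\circ u\circ v$ on $T\hat M$, with $E^{-1}$ the inverse of $E$ for $\circ$. The data $(\hat M,g^{\alpha\beta},\star)$ is the almost duality of $M$. **Principal hierarchy of the almost duality.** Let $\hat t^1,\dots,\hat t^n$ be flat coordinates of the flat metric $g$ and $\hat c^{\,\epsilon}_{\beta\gamma}$ the structure constants of $\star$ in them. The Hamiltonian densities $\hat\theta_{\alpha,p}$ ($1\le\alpha\le n$, $p\ge0$) satisfy $\frac{\partial^2\hat\theta_{\alpha,p+1}}{\partial\hat t^\beta\partial\hat t^\gamma}=\hat c^{\,\epsilon}_{\beta\gamma}\frac{\partial\hat\theta_{\alpha,p}}{\partial\hat t^\epsilon}$ and $\hat\theta_{\alpha,0}=g_{\alpha\beta}\hat t^\beta$, and the principal hierarchy for $\hat M$ is the Hamiltonian system $\frac{\partial\hat t^\gamma}{\partial\hat T^{\alpha,p}}=g^{\gamma\beta}\frac{\partial}{\partial x}\Big(\frac{\partial\hat\theta_{\alpha,p+1}}{\partial\hat t^\beta}\Big)$ on the loop space of $\hat M$. The vanishing of the winding number of $\lambda$ along $\tilde\gamma$ presupposes that $\lambda$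 has no zeros or poles on $\tilde\gamma$, and makes $\log\lambda$ single-valued along $\tilde\gamma$.
   Formalization: That the F_{γ,p} supply all the Hamiltonian densities is claimed only for m ≥ 1: with no finite poles (m = 0) zero winding means no enclosed zeros, so every F_{γ,p} vanishes, e.g. λ = z²/2 + a. That each F_{γ,p} is a density and the formula for F_{γ,0} are claimed for all m. *)

(* Defs.v *)
From HB Require Import structures.
From mathcomp Require Import all_boot all_order all_algebra.
From mathcomp Require Import complex.
From mathcomp Require Import all_classical all_reals all_analysis.

Set Implicit Arguments.
Unset Strict Implicit.
Unset Printing Implicit Defensive.

Import Order.TTheory GRing.Theory Num.Theory numFieldNormedType.Exports.

Local Open Scope classical_set_scope.
Local Open Scope ring_scope.
Local Open Scope complex_scope.

(* [R[i]] is already a module over [R], which prevents it from being also a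
   normed module over itself; the alias [cplx R] carries the latter structure,
   so that ['D_v f], [differentiable f] and [derive1 f] over [cplx R] are
   complex derivatives. *)
Definition cplx (R : realType) : Type := R[i].
HB.instance Definition _ (R : realType) := Num.ClosedField.on (cplx R).
HB.instance Definition _ (R : realType) :=
  GRing.ComAlgebra.copy (cplx R) (cplx R)^o.
HB.instance Definition _ (R : realType) := Vector.copy (cplx R) (cplx R)^o.
HB.instance Definition _ (R : realType) := NormedModule.copy (cplx R) (cplx R)^o.

Section ComplexAnalysis.
Variable R : realType.
Local Notation C := (cplx R).
Implicit Types (f h : C -> C) (z w r : C) (g gam : R -> C).

Definition cexp z : C :=
  (expR (complex.Re z) * cos (complex.Im z)) +i*
  (expR (complex.Re z) * sin (complex.Im z)).

Definition two_pi_i : C := 0 +i* (2 * pi).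

Definition holomorphic_at h (z0 : C) := \forall z \near z0, derivable h z 1.

(* [r] is the coefficient of (z - z0)^-1 in the Laurent expansion of [f], which
   has at most a pole at [z0]. *)
Definition is_residue f (z0 : C) r :=
  exists (N : nat) (c : nat -> C) h,
    [/\ holomorphic_at h z0, c 0%N = r &
        \forall z \near z0^',
          f z = \sum_(k < N.+1) c k / (z - z0) ^+ k.+1 + h z].

Definition residue f (z0 : C) : C := xget 0 [set r | is_residue f z0 r].

Definition is_mero_order f (z0 : C) (k : int) :=
  exists h, [/\ holomorphic_at h z0, h z0 != 0 &
                \forall z \near z0^', f z = (z - z0) ^ k * h z].

Definition mero_order f (z0 : C) : int := xget 0 [set k | is_mero_order f z0 k].

Definition zero_mult f (z0 : C) : nat := if mero_order f z0 is Posz k then k else 0.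
Definition pole_mult f (z0 : C) : nat := if mero_order f z0 is Negz k then k.+1 else 0.

(* [s] lists the points of [A], each repeated [mult] times. *)
Definition lists_in (A : set C) (mult : C -> nat) (s : seq C) :=
  forall w, count_mem w s = if `[< A w >] then mult w else 0%N.

(* Curves are parametrized by [0, 1]; the values of [gam : R -> C] elsewhere
   are irrelevant. *)
Definition curve_image gam : set C := gam @` `[0, 1].

Definition piecewise_C1 gam :=
  exists (k : nat) (u : nat -> R),
    [/\ u 0%N = 0, u k = 1 &
        forall i, (i < k)%N -> u i < u i.+1 /\
          exists x y : R -> R,
            [/\ forall t, derivable x t 1 /\ derivable y t 1,
                continuous (derive1 x), continuous (derive1 y) &
                forall t, u i <= t <= u i.+1 -> gam t = x t +i* y t]].

Definition simple_closed_curve gam :=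
  [/\ {within `[0, 1], continuous gam}, piecewise_C1 gam, gam 0 = gam 1 &
      forall s t, 0 <= s < 1 -> 0 <= t < 1 -> gam s = gam t -> s = t].

(* Derivative with respect to the real parameter; it may fail to exist at the
   finitely many break points, which no integral sees. *)
Definition velocity gam (t : R) : C :=
  derive1 (fun s => complex.Re (gam s)) t +i*
  derive1 (fun s => complex.Im (gam s)) t.

Definition cintegral01 g : C :=
  (\int[lebesgue_measure]_(t in `[0, 1]) complex.Re (g t)) +i*
  (\int[lebesgue_measure]_(t in `[0, 1]) complex.Im (g t)).

Definition winding_number gam w : C :=
  two_pi_i^-1 * cintegral01 (fun t => velocity gam t / (gam t - w)).

(* The region enclosed by [gam]: the bounded components of its complement. *)
Definition enclosed gam : set C :=
  [set w | ~ curve_image gam w /\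
           bounded_set (connected_component (~` curve_image gam) w)].

Definition positively_oriented gam :=
  forall w, enclosed gam w -> winding_number gam w = 1.

(* [l] is a continuous determination of log f along [gam]. *)
Definition log_along gam f (l : R -> C) :=
  {within `[0, 1], continuous l} /\
  (forall t, 0 <= t <= 1 -> cexp (l t) = f (gam t)).

(* (2 pi i)^-1 \int_gam l^(p+1) / (p+1)! dz for a function [l] on [gam]. *)
Definition log_density gam (l : R -> C) (p : nat) : C :=
  two_pi_i^-1 *
  cintegral01 (fun t => l t ^+ p.+1 / (p.+1)`!%:R * velocity gam t).

End ComplexAnalysis.

Section CKP.
Variables (R : realType) (m : nat) (n : 'I_m.+1 -> nat).
Local Notation C := (cplx R).

(* The coordinates are a_{0,j} for j < n_0 - 1 and a_{i,j} for 1 <= i <= m and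
   j <= n_i. *)
Definition ckp_width (i : 'I_m.+1) : nat :=
  if i == ord0 then (n i).-1 else (n i).+1.

Definition ckp_dim : nat := #|{: {i : 'I_m.+1 & 'I_(ckp_width i)}}|.

Local Notation pt := 'rV[C]_ckp_dim.
Implicit Types (a b u v w om : pt) (U : set pt) (t : pt -> pt).

(* The coordinate a_{i,j}, with value 0 when [j] is out of range. *)
Definition coeff a (i : 'I_m.+1) (j : nat) : C :=
  if insub j is Some k
  then a 0 (enum_rank (existT (fun i => 'I_(ckp_width i)) i k))
  else 0.

Definition lam a (z : C) : C :=
  (n ord0)%:R^-1 * z ^+ n ord0
  + \sum_(j < (n ord0).-1) coeff a ord0 j * z ^+ j
  + \sum_(i < m.+1 | i != ord0) \sum_(1 <= j < (n i).+1)
      coeff a i j / (z - coeff a i 0) ^+ j.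

Definition MCKP : set pt :=
  [set a | (forall i, i != ord0 -> coeff a i (n i) != 0) /\
           (forall i j, i != ord0 -> j != ord0 -> i != j ->
              coeff a i 0 != coeff a j 0)].

Definition is_pole a (z : C) := exists2 i, i != ord0 & z = coeff a i 0.

Definition critical a : set C :=
  [set z | ~ is_pole a z /\ derive1 (lam a) z = 0].

(* A tangent vector is the row of its components in the coordinates a_{i,j};
   [dlam a v] is the function z |-> (v lambda)(z). *)
Definition dlam a v (z : C) : C := 'D_v (lam^~ z) a.

Local Notation basis k := (delta_mx 0 k : pt).

Definition eta a u v : C :=
  \sum_(z0 \in critical a)
    residue (fun z => dlam a u z * dlam a v z / derive1 (lam a) z) z0.

Definition eta3 a u v w : C :=
  \sum_(z0 \in critical a)
    residue (fun z => dlam a u z * dlam a v z * dlam a w z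
                      / derive1 (lam a) z) z0.

Definition eta_mx a : 'M[C]_ckp_dim := \matrix_(k, l) eta a (basis k) (basis l).

(* The solution [u o v] of eta (u o v, w) = eta3 u v w for all w. *)
Definition frob_mul a u v : pt :=
  (\row_k eta3 a u v (basis k)) *m invmx (eta_mx a).

(* The unit of the multiplication: it satisfies e lambda = 1 if n_0 > 1, and
   e lambda = 1 - lambda' if n_0 = 1, where the constant 1 is not tangent. *)
Definition unit_field a : pt := xget 0 [set e | forall v, frob_mul a e v = v].

Definition euler_field a : pt :=
  xget 0 [set v | forall z, ~ is_pole a z ->
    dlam a v z = lam a z - z / (n ord0)%:R * derive1 (lam a) z].

(* Covectors are rows of components in the basis da_{i,j}. *)
Definition sharp a om : pt := om *m invmx (eta_mx a).
Definition flat a v : pt := v *m eta_mx a.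
Definition comul a om1 om2 : pt := flat a (frob_mul a (sharp a om1) (sharp a om2)).

(* The intersection form g(om1, om2) = i_E (om1 o om2) on covectors. *)
Definition cometric a om1 om2 : C :=
  (comul a om1 om2 *m (euler_field a)^T) 0 0.

Definition cometric_mx a : 'M[C]_ckp_dim :=
  \matrix_(k, l) cometric a (basis k) (basis l).

Definition Mhat : set pt := [set a | MCKP a /\ \det (cometric_mx a) != 0].

Definition euler_inv a : pt :=
  xget 0 [set v | frob_mul a (euler_field a) v = unit_field a].

Definition star a u v : pt := frob_mul a (euler_inv a) (frob_mul a u v).

(* Local coordinates [t]. By convention ['J t a] has entries
   ('J t a) k alpha = d t^alpha / d a_k. *)
Definition local_coordinates U t :=
  [/\ open U,
      forall a, U a -> differentiable t a /\ 'J t a \in unitmx &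
      {in U &, injective t}].

Definition dcoord t a (al : 'I_ckp_dim) : pt := (col al ('J t a))^T.
Definition coord_field t a (be : 'I_ckp_dim) : pt := row be (invmx ('J t a)).

(* g^{alpha beta}, its inverse matrix being g_{alpha beta}. *)
Definition gup t a : 'M[C]_ckp_dim :=
  \matrix_(al, be) cometric a (dcoord t a al) (dcoord t a be).
Definition gdown t a : 'M[C]_ckp_dim := invmx (gup t a).

Definition flat_coordinates U t :=
  [/\ U `<=` Mhat, local_coordinates U t &
      forall a b, U a -> U b -> gup t a = gup t b].

(* The structure constants c^eps_{be gam} of [star] in the coordinates [t]. *)
Definition star_const t a (eps be ga : 'I_ckp_dim) : C :=
  (star a (coord_field t a be) (coord_field t a ga) *m 'J t a) 0 eps.

Definition pderiv t (be : 'I_ckp_dim) (f : pt -> C) a : C :=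
  'D_(coord_field t a be) f a.

Definition theta0 t (al : 'I_ckp_dim) a : C :=
  \sum_be gdown t a al be * t a 0 be.

Definition density_chain U t (f : nat -> pt -> C) :=
  (forall p a, U a -> differentiable (f p) a) /\
  (forall p be ga a, U a ->
     pderiv t be (pderiv t ga (f p.+1)) a =
     \sum_eps star_const t a eps be ga * pderiv t eps (f p) a).

Definition hamiltonian_densities U t (theta : 'I_ckp_dim -> nat -> pt -> C) :=
  forall al, density_chain U t (theta al) /\
             (forall a, U a -> theta al 0%N a = theta0 t al a).

(* A single chain of densities which is, at level 0, a constant combination of
   the theta_{alpha,0}, up to an additive constant. *)
Definition hamiltonian_density_chain U t (f : nat -> pt -> C) :=
  density_chain U t f /\
  (exists (c : 'I_ckp_dim -> C) (c0 : C),
     forall a, U a -> f 0%N a = \sum_al c al * theta0 t al a + c0).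

(* No zeros or poles of lambda on [gam], and zero winding number. *)
Definition zero_winding a (gam : R -> C) :=
  (forall s, 0 <= s <= 1 -> ~ is_pole a (gam s) /\ lam a (gam s) != 0) /\
  winding_number (lam a \o gam) 0 = 0.

(* [L a] is log lambda_a along [gam], chosen continuously in [a]. *)
Definition log_branch U (gam : R -> C) (L : pt -> R -> C) :=
  (forall a, U a -> log_along gam (lam a) (L a)) /\
  {within U `*` `[0 : R, 1], continuous (fun x : pt * R => L x.1 x.2)}.

Definition F_density (gam : R -> C) (L : pt -> R -> C) (p : nat) a : C :=
  log_density gam (L a) p.

End CKP.

Arguments ckp_dim {m} n.
Arguments Mhat R {m} n.

(* Main.v *)
(* Let X_r run over the zeros and the poles p_j of lambda, with eps_r = 1 at the
   zeros and eps_r = - n_j at p_j, so that lambda'/lambda = sum_r eps_r / (z - X_r).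
   Residue computations and Lagrange interpolation at the X_r show that the metric
   of the almost duality is g(u, v) = - sum_r eps_r u(X_r) v(X_r), and that
     (u log lambda) (v log lambda) = (u * v) log lambda
        + (log lambda)' sum_r eps_r u(X_r) v(X_r) / (z - X_r).
   By Koszul's formula the X_r are affine functions of the flat coordinates;
   differentiating F_{gam,p+1} twice under the integral sign and integrating by
   parts therefore turns this identity into the recursion of the densities.
   Another integration by parts gives
     F_{gam,0} = - sum_r eps_r X_r (winding number of gam around X_r),
   which is affine in the flat coordinates and yields the last formula.  For
   complete systems, any set of the X_r is the set of those enclosed by a suitable
   star-shaped curve around a generic point; the sets made of one pole p_j and n_j
   zeros provide enough sums of eps_r X_r to form flat coordinates. *)
From HB Require Import structures.
Require Import Defs.
From mathcomp Require Import all_boot all_order all_algebra.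
From mathcomp Require Import complex.
From mathcomp Require Import all_classical all_reals all_analysis.
From mathcomp Require Import ring lra zify.
Import Order.TTheory GRing.Theory Num.Theory numFieldNormedType.Exports.
Set Implicit Arguments.
Unset Strict Implicit.
Unset Printing Implicit Defensive.
Local Open Scope classical_set_scope.
Local Open Scope ring_scope.

(** The Frobenius geometry takes place in one quotient ring. With D = prod_j (z - p_j)^(n_j+1) and
    [P] = D lambda', which is monic of degree the dimension, v |-> D v(lambda) identifies tangent
    vectors with polynomials modulo [P]; sums of residues over the critical points become top
    coefficients of remainders; eta, the product, e, E and the star product become congruences
    modulo [P]. The analytic obstacle is regularity. Flat coordinates are only assumed to be once
    complex differentiable, while the Koszul argument needs second derivatives and their symmetry.
    Goursat's theorem gives Cauchy's formula on circles, which makes partial derivatives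
    differentiable again. Derivatives are encoded by continuous slopes, jointly in the point and the
    curve parameter, so that integrating the slopes differentiates an integral. A positively
    oriented curve of zero winding number encloses X_r whose eps_r sum to 0. Relations over all such
    sets leave only multiples of eps undetermined; that direction disappears because sum_r eps_r X_r
    is constant while sum_r eps_r = n_0 is not 0. *)

(** * Moduli and limits in [cplx R] *)

Section ComplexBasics.
Local Open Scope complex_scope.
Variable R : realType.
Local Notation C := (cplx R).
Local Notation Re := complex.Re.
Local Notation Im := complex.Im.
Implicit Types (z w : C) (x y : R).

Definition rc (x : R) : C := x +i* 0.
Definition nc (z : C) : R := Normc.normc z.

Lemma normE z : `|z| = rc (nc z). Proof. by case: z. Qed.
Lemma cplx_eq z w : Re z = Re w -> Im z = Im w -> z = w.
Proof. by case: z => a b; case: w => c d /= -> ->. Qed.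
Lemma ReD z w : Re (z + w) = Re z + Re w. Proof. by case: z => a b; case: w. Qed.
Lemma ImD z w : Im (z + w) = Im z + Im w. Proof. by case: z => a b; case: w. Qed.
Lemma ReN z : Re (- z) = - Re z. Proof. by case: z. Qed.
Lemma ImN z : Im (- z) = - Im z. Proof. by case: z. Qed.
Lemma ReB z w : Re (z - w) = Re z - Re w. Proof. by rewrite ReD ReN. Qed.
Lemma ImB z w : Im (z - w) = Im z - Im w. Proof. by rewrite ImD ImN. Qed.
Lemma ReM z w : Re (z * w) = Re z * Re w - Im z * Im w.
Proof. by case: z => a b; case: w. Qed.
Lemma ImM z w : Im (z * w) = Re z * Im w + Im z * Re w.
Proof. by case: z => a b; case: w => c d /=; rewrite addrC (mulrC b). Qed.

Lemma rcD x y : rc (x + y) = rc x + rc y.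
Proof. by apply: cplx_eq => //=; rewrite addr0. Qed.
Lemma rcN x : rc (- x) = - rc x.
Proof. by apply: cplx_eq => //=; rewrite oppr0. Qed.
Lemma rcB x y : rc (x - y) = rc x - rc y. Proof. by rewrite rcD rcN. Qed.
Lemma rcM x y : rc (x * y) = rc x * rc y.
Proof. by apply: cplx_eq; rewrite (ReM, ImM)/= ?mulr0 ?mul0r ?subr0 ?addr0. Qed.
Lemma rc1 : rc 1 = 1. Proof. by []. Qed.
Lemma rc0 : rc 0 = 0. Proof. by []. Qed.
Lemma rcI : injective rc. Proof. by move=> x y []. Qed.
Lemma rc_eq0 x : (rc x == 0) = (x == 0).
Proof. by apply/eqP/eqP => [[]//|->]. Qed.
Lemma rcV x : rc x^-1 = (rc x)^-1.
Proof.
have [->|x0] := eqVneq x 0; first by rewrite !invr0.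
by apply: (mulIf (x := rc x)); rewrite ?rc_eq0// -rcM !mulVf ?rc_eq0.
Qed.
Lemma rc_nat k : rc k%:R = k%:R.
Proof. by elim: k => // k IH; rewrite -!natr1 rcD IH. Qed.
Lemma ReMr x z : Re (rc x * z) = x * Re z.
Proof. by rewrite ReM /= mul0r subr0. Qed.
Lemma ImMr x z : Im (rc x * z) = x * Im z.
Proof. by rewrite ImM /= mul0r addr0. Qed.
Lemma cplxE z : z = rc (Re z) + 'i%C * rc (Im z).
Proof.
by apply: cplx_eq; rewrite (ReD, ImD) (ReM, ImM) /= ?mul0r ?mul1r ?mulr0 ?subr0 ?addr0 ?add0r.
Qed.

Lemma nc_ge0 z : 0 <= nc z. Proof. by case: z => a b; exact: sqrtr_ge0. Qed.
Lemma nc0 : nc 0 = 0. Proof. exact: Normc.normc0. Qed.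
Lemma nc1 : nc 1 = 1. Proof. exact: Normc.normc1. Qed.
Lemma nc_eq0 z : (nc z == 0) = (z == 0).
Proof. by apply/eqP/eqP => [/Normc.eq0_normc//|->]; exact: nc0. Qed.
Lemma nc_gt0 z : (0 < nc z) = (z != 0).
Proof. by rewrite lt_neqAle nc_ge0 andbT eq_sym nc_eq0. Qed.
Lemma ncM z w : nc (z * w) = nc z * nc w. Proof. exact: Normc.normcM. Qed.
Lemma ncV z : nc z^-1 = (nc z)^-1. Proof. exact: Normc.normcV. Qed.
Lemma ncN z : nc (- z) = nc z. Proof. exact: normcN. Qed.
Lemma ncB z w : nc (z - w) = nc (w - z). Proof. by rewrite -ncN opprB. Qed.
Lemma ncD z w : nc (z + w) <= nc z + nc w. Proof. exact: le_normcD. Qed.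
Lemma ncDB z w : nc (z - w) <= nc z + nc w.
Proof. by rewrite -(ncN w); exact: ncD. Qed.
Lemma nc_rc x : nc (rc x) = `|x|.
Proof. by rewrite /nc /= expr0n addr0 sqrtr_sqr. Qed.
Lemma nc_i : nc 'i%C = 1.
Proof. by rewrite /nc /= expr0n expr1n add0r sqrtr1. Qed.
Lemma nc_sqr z : nc z ^+ 2 = Re z ^+ 2 + Im z ^+ 2.
Proof. by case: z => a b; rewrite /nc/= sqr_sqrtr// addr_ge0 ?sqr_ge0. Qed.
Lemma Re_le_nc z : `|Re z| <= nc z.
Proof.
rewrite -[leLHS]sqrtr_sqr; case: z => a b /=.
by rewrite ler_sqrt ?lerDl ?addr_ge0 ?sqr_ge0.
Qed.
Lemma Im_le_nc z : `|Im z| <= nc z.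
Proof.
rewrite -[leLHS]sqrtr_sqr; case: z => a b /=.
by rewrite ler_sqrt ?lerDr ?addr_ge0 ?sqr_ge0.
Qed.
Lemma nc_le z : nc z <= `|Re z| + `|Im z|.
Proof.
rewrite {1}(cplxE z); apply: (le_trans (ncD _ _)).
by rewrite ncM nc_i mul1r !nc_rc.
Qed.
Lemma nc_sum (I : Type) (r : seq I) (P : pred I) (F : I -> C) :
  nc (\sum_(i <- r | P i) F i) <= \sum_(i <- r | P i) nc (F i).
Proof.
elim/big_ind2 : _ => [|u v w y h1 h2|//]; first by rewrite nc0.
by apply: (le_trans (ncD _ _)); exact: lerD.
Qed.
Lemma nc_prod (I : Type) (r : seq I) (P : pred I) (F : I -> C) :
  nc (\prod_(i <- r | P i) F i) = \prod_(i <- r | P i) nc (F i).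
Proof. by elim/big_ind2 : _ => [|u v w y <- <-|//]; rewrite ?nc1 ?ncM. Qed.

(** The norm of [cplx R] takes values in [cplx R], so its epsilons are complex; a positive one has
    zero imaginary part and is [rc] of a positive real. This lemma and [nbhs_ncP] reduce all
    estimates to the real modulus [nc]. *)
Lemma cvg_ncP {T : Type} (F : set_system T) {FF : Filter F} (f : T -> C) (a : C) :
  (f @ F --> a) <-> forall e : R, 0 < e -> \forall t \near F, nc (f t - a) < e.
Proof.
split=> [fa e e0|H].
  have ce : (0 : C) < rc e by rewrite -rc0 ltcR.
  move/cvgrPdist_lt : fa => /(_ _ ce); apply: filterS => t.
  by rewrite normE ltcR ncB.
apply/cvgrPdist_lt => e e0.
have [e' -> e'0] : exists2 e', e = rc e' & 0 < e'.
  move: e0; case: e => e1 e2; rewrite ltcE /= => /andP[/eqP-> ?].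
  by exists e1.
by apply: filterS (H _ e'0) => t; rewrite normE ltcR ncB.
Qed.

Lemma nbhs_ncP (a : C) (A : set C) :
  nbhs a A <-> exists2 e : R, 0 < e & forall z, nc (z - a) < e -> A z.
Proof.
split=> [|[e e0 H]].
  case/nbhs_ballP => e /= e0 H.
  have [e' ee e'0] : exists2 e', e = rc e' & 0 < e'.
    move: e0; case: (e) => e1 e2; rewrite ltcE /= => /andP[/eqP-> ?].
    by exists e1.
  exists e' => // z ze; apply: H; rewrite -ball_normE /ball_ /= ee normE ltcR.
  by rewrite ncB.
apply/nbhs_ballP; exists (rc e) => /=; first by rewrite -rc0 ltcR.
move=> z; rewrite -ball_normE /ball_ /= normE ltcR ncB; exact: H.
Qed.

Lemma cvg_ReIm {T : Type} (F : set_system T) {FF : Filter F} (f : T -> C) (a : C) :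
  (f @ F --> a) <-> ((fun t => Re (f t)) @ F --> Re a /\ (fun t => Im (f t)) @ F --> Im a).
Proof.
split=> [/cvg_ncP H|[/cvgrPdist_lt H1 /cvgrPdist_lt H2]].
  split; apply/cvgrPdist_lt => e e0; apply: filterS (H e e0) => t te.
    by apply: le_lt_trans te; rewrite distrC -ReB Re_le_nc.
  by apply: le_lt_trans te; rewrite distrC -ImB Im_le_nc.
apply/cvg_ncP => e e0; have e20 : 0 < e / 2 by rewrite divr_gt0.
apply: filterS2 (H1 _ e20) (H2 _ e20) => t t1 t2.
apply: (le_lt_trans (nc_le _)); rewrite ReB ImB !(distrC (_ (f t))).
by rewrite [ltRHS]splitr; exact: ltrD.
Qed.

Lemma cvg_rc {T : Type} (F : set_system T) {FF : Filter F} (f : T -> R) (a : R) :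
  f @ F --> a -> (fun t => rc (f t)) @ F --> rc a.
Proof. by move=> fa; apply/cvg_ReIm; split; [exact: fa|exact: cvg_cst]. Qed.

Lemma cvg_sumc {T : Type} (F : set_system T) {FF : Filter F} (I : Type) (r : seq I)
    (P : pred I) (f : I -> T -> C) (a : I -> C) :
  (forall i, P i -> f i @ F --> a i) ->
  (fun t => \sum_(i <- r | P i) f i t) @ F --> \sum_(i <- r | P i) a i.
Proof.
move=> H; elim: r => [|i r IH].
  under eq_fun do rewrite big_nil.
  rewrite big_nil; exact: cvg_cst.
rewrite big_cons; under eq_fun do rewrite big_cons.
by case: ifPn => Pi; [apply: cvgD IH; exact: H|].
Qed.

Lemma cvg_prodc {T : Type} (F : set_system T) {FF : Filter F} (I : Type) (r : seq I)
    (P : pred I) (f : I -> T -> C) (a : I -> C) :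
  (forall i, P i -> f i @ F --> a i) ->
  (fun t => \prod_(i <- r | P i) f i t) @ F --> \prod_(i <- r | P i) a i.
Proof.
move=> H; elim: r => [|i r IH].
  under eq_fun do rewrite big_nil.
  rewrite big_nil; exact: cvg_cst.
rewrite big_cons; under eq_fun do rewrite big_cons.
by case: ifPn => Pi; [apply: cvgM IH; exact: H|].
Qed.

Lemma cvg_expc {T : Type} (F : set_system T) {FF : Filter F} (f : T -> C) (a : C) k :
  f @ F --> a -> (fun t => f t ^+ k) @ F --> a ^+ k.
Proof.
move=> fa; elim: k => [|k IH].
  under eq_fun do rewrite expr0.
  rewrite expr0; exact: cvg_cst.
under eq_fun do rewrite exprS.
rewrite exprS; exact: (cvgM fa IH).
Qed.

Lemma cvg_neq0 {T : Type} (F : set_system T) {FF : Filter F} (f : T -> C) (a : C) :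
  f @ F --> a -> a != 0 -> \forall t \near F, f t != 0.
Proof.
move=> /cvg_ncP H; rewrite -nc_gt0 => a0; apply: filterS (H _ a0) => t.
by apply: contraTN => /eqP ->; rewrite sub0r ncN ltxx.
Qed.

Lemma near_nc (a : C) (e : R) : 0 < e -> \forall z \near a, nc (z - a) < e.
Proof. by move=> e0; apply/nbhs_ncP; exists e. Qed.

Lemma rc_cvg (a : R) : rc x @[x --> a] --> rc a.
Proof. by apply: cvg_rc; exact: cvg_id. Qed.

Lemma nc_small z : (forall e : R, 0 < e -> nc z <= e) -> z = 0.
Proof.
move=> H; apply/eqP; rewrite -nc_eq0 eq_le nc_ge0 andbT.
by apply/ler_addgt0Pl => e e0; rewrite addr0; exact: H.
Qed.

End ComplexBasics.
Arguments rc {R} x.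
Arguments nc {R} z.

(** * Differentiability by continuous slopes, uniform in a curve parameter *)

Section Calculus.
Local Open Scope complex_scope.
Variable R : realType.
Local Notation C := (cplx R).

Lemma near_all (T : topologicalType) (I : finType) (a : T) (P : I -> T -> Prop) :
  (forall i, \forall b \near a, P i b) -> \forall b \near a, forall i, P i b.
Proof. by move=> H; apply: filter_forall. Qed.

(** Tube lemma: compactness of [0, 1] makes the neighbourhood of [a] independent of [t]. *)
Lemma near_I01 (T : topologicalType) (a : T) (P : T -> R -> Prop) :
  (forall t : R, 0 <= t <= 1 -> \forall p \near (a, t), P p.1 p.2) ->
  \forall b \near a, forall t : R, 0 <= t <= 1 -> P b t.
Proof.
move=> H; have cK := @segment_compact R 0 1.
move/compact_near_coveringP : cK => /(_ T (nbhs a) P) cK.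
have : \forall b \near a, `[0, 1] `<=` P b.
  apply: cK => t; rewrite /= in_itv /= => /H.
  case=> -[A B] /= [aA tB] AB; exists (B, A) => //= -[u v] /= [? ?].
  by apply: (AB (v, u)).
by apply: filterS => b bP t t01; apply: bP; rewrite /= in_itv.
Qed.

Lemma cvg_slice (T : topologicalType) (a : T) (t : R) : (fun b => (b, t)) @ a --> (a, t).
Proof.
move=> Z [[A B] /= [aA tB] AB]; rewrite /nbhs /=; apply: filterS aA => b Ab.
by apply: AB; split => //=; exact: nbhs_singleton tB.
Qed.

Section Spaces.
Variables (T : topologicalType) (d : nat) (x : 'I_d -> T -> C).
Implicit Types (a b : T) (f h : T -> R -> C) (g : 'I_d -> R -> C) (t : R).

(* The parameter [t] ranges over [0, 1]; scalar-valued statements are those in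
   which nothing depends on [t]. *)
Definition jc a f :=
  (forall t, 0 <= t <= 1 -> f p.1 p.2 @[p --> (a, t)] --> f a t) /\
  \forall b \near a, forall t, 0 <= t <= 1 -> f b s @[s --> t] --> f b t.

(* Caratheodory's form of differentiability with respect to the coordinates
   [x], uniformly in [t]. *)
Definition ucder a f g :=
  jc a f /\ exists Phi : 'I_d -> T -> R -> C,
  [/\ forall k, jc a (Phi k), forall k t, 0 <= t <= 1 -> Phi k a t = g k t &
    \forall b \near a, forall t, 0 <= t <= 1 ->
      f b t - f a t = \sum_k (x k b - x k a) * Phi k b t].

Lemma jc_fix a f : jc a f -> jc a (fun _ => f a).
Proof.
case=> _ /nbhs_singleton H2; split=> [t t01|]; last by apply: nearW => _; exact: H2.
by apply: (cvg_comp _ _ _ (H2 t t01)); exact: cvg_snd.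
Qed.

Lemma jc_t a (h : R -> C) :
  (forall t, 0 <= t <= 1 -> h s @[s --> t] --> h t) -> jc a (fun _ => h).
Proof.
move=> H; split=> [t t01|]; last by apply: nearW => _; exact: H.
by apply: (cvg_comp _ _ _ (H t t01)); exact: cvg_snd.
Qed.

Lemma jc_s a (f : T -> C) : f b @[b --> a] --> f a -> jc a (fun b _ => f b).
Proof.
move=> H; split=> [t t01|]; last by apply: nearW => b t _; exact: cvg_cst.
by apply: (cvg_comp _ _ _ H); exact: cvg_fst.
Qed.

Lemma jc_sE a (f : T -> C) : jc a (fun b _ => f b) -> f b @[b --> a] --> f a.
Proof.
case=> /(_ 0); rewrite lexx ler01 => /(_ isT) H _.
exact: (cvg_comp _ _ (@cvg_slice _ a 0) H).
Qed.

Lemma jc_cst a (c : C) : jc a (fun _ _ => c).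
Proof. by apply: jc_t => t _; exact: cvg_cst. Qed.

Lemma jcD a f h : jc a f -> jc a h -> jc a (fun b t => f b t + h b t).
Proof.
case=> f1 f2 [h1 h2]; split=> [t t01|].
  exact: (cvgD (f1 t t01) (h1 t t01)).
apply: filterS2 f2 h2 => b f2 h2 t t01; exact: (cvgD (f2 t t01) (h2 t t01)).
Qed.

Lemma jcM a f h : jc a f -> jc a h -> jc a (fun b t => f b t * h b t).
Proof.
case=> f1 f2 [h1 h2]; split=> [t t01|].
  exact: (cvgM (f1 t t01) (h1 t t01)).
apply: filterS2 f2 h2 => b f2 h2 t t01; exact: (cvgM (f2 t t01) (h2 t t01)).
Qed.

Lemma jcN a f : jc a f -> jc a (fun b t => - f b t).
Proof.
case=> f1 f2; split=> [t t01|].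
  exact: (cvgN (f1 t t01)).
apply: filterS f2 => b f2 t t01; exact: (cvgN (f2 t t01)).
Qed.

Lemma jcB a f h : jc a f -> jc a h -> jc a (fun b t => f b t - h b t).
Proof. by move=> jf jh; exact: (jcD jf (jcN jh)). Qed.




Lemma jc_near a f (P : C -> Prop) : jc a f ->
  (forall t, 0 <= t <= 1 -> nbhs (f a t) P) ->
  \forall b \near a, forall t, 0 <= t <= 1 -> P (f b t).
Proof. by case=> f1 _ HP; apply: near_I01 => t t01; apply: f1 => //; exact: HP. Qed.

Lemma jc_neq0 a f : jc a f -> (forall t, 0 <= t <= 1 -> f a t != 0) ->
  \forall b \near a, forall t, 0 <= t <= 1 -> f b t != 0.
Proof.
move=> jf f0; apply: (jc_near (P := fun z => z != 0)) => // t t01.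
apply/nbhs_ncP; exists (nc (f a t)); first by rewrite nc_gt0 f0.
by move=> z; apply: contraTN => /eqP ->; rewrite sub0r ncN ltxx.
Qed.

Lemma jcV a f : jc a f -> (forall t, 0 <= t <= 1 -> f a t != 0) ->
  jc a (fun b t => (f b t)^-1).
Proof.
move=> jf f0; have := jc_neq0 jf f0; case: jf => f1 f2 f3; split=> [t t01|].
  exact: (cvgV (f0 t t01) (f1 t t01)).
apply: filterS2 f2 f3 => b f2 f3 t t01; exact: (cvgV (f3 t t01) (f2 t t01)).
Qed.

Lemma jc_comp a f (h : C -> C) : jc a f -> (forall z, h w @[w --> z] --> h z) ->
  jc a (fun b t => h (f b t)).
Proof.
case=> f1 f2 H; split=> [t t01|].
  exact: (cvg_comp _ _ (f1 t t01) (H _)).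
apply: filterS f2 => b f2 t t01; exact: (cvg_comp _ _ (f2 t t01) (H _)).
Qed.

Lemma jc_ext a f h : jc a f -> (\forall b \near a, forall t, f b t = h b t) -> jc a h.
Proof.
case=> f1 f2 fh; split=> [t t01|].
  have fa := nbhs_singleton fh; rewrite -fa; apply: cvg_trans (f1 t t01).
  apply: near_eq_cvg; exists ([set b | forall t, f b t = h b t], setT) => /=.
    by split; [exact: fh|exact: filterT].
  by move=> [b s] [/= H _]; rewrite H.
apply: filterS2 f2 fh => b f2 e t t01.
have -> : h b = f b by apply/funext => s; rewrite e.
exact: f2.
Qed.

Opaque jc.

Lemma ucder_jc a f g : ucder a f g -> jc a f. Proof. by case. Qed.

Lemma ucder_eq a f g1 g2 : (forall k t, 0 <= t <= 1 -> g1 k t = g2 k t) ->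
  ucder a f g1 -> ucder a f g2.
Proof.
move=> e [jf [Phi [P1 P2 P3]]]; split; first exact: jf.
exists Phi; split; [exact: P1|move=> k t t01; by rewrite P2// e|exact: P3].
Qed.

Lemma ucder_ext a f h g : (\forall b \near a, forall t, f b t = h b t) ->
  ucder a f g -> ucder a h g.
Proof.
move=> fh [jf [Phi [P1 P2 P3]]]; split; first exact: jc_ext fh.
exists Phi; split; [exact: P1|exact: P2|]; have fa := nbhs_singleton fh.
by apply: filterS2 P3 fh => b H e t t01; rewrite -!e -fa; exact: H.
Qed.

Lemma ucder_cst a (c : C) : ucder a (fun _ _ => c) (fun _ _ => 0).
Proof.
split; first exact: jc_cst.
exists (fun _ _ _ => 0); split=> [k|k t _ //|]; first exact: jc_cst.
by apply: nearW => b t _; rewrite subrr big1// => k _; rewrite mulr0.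
Qed.

Lemma ucder_t a (h : R -> C) :
  (forall t, 0 <= t <= 1 -> h s @[s --> t] --> h t) ->
  ucder a (fun _ => h) (fun _ _ => 0).
Proof.
move=> H; split; first exact: jc_t.
exists (fun _ _ _ => 0); split=> [k|k t _ //|]; first exact: jc_cst.
by apply: nearW => b t _; rewrite subrr big1// => k _; rewrite mulr0.
Qed.

Lemma ucder_coord a k : x k b @[b --> a] --> x k a ->
  ucder a (fun b _ => x k b) (fun l _ => (l == k)%:R).
Proof.
move=> H; split; first exact: jc_s.
exists (fun l _ _ => (l == k)%:R); split=> [l|l t _ //|]; first exact: jc_cst.
apply: nearW => b t _; rewrite (bigD1 k)//= eqxx mulr1 big1 ?addr0// => l lk.
by rewrite (negPf lk) mulr0.
Qed.

Lemma ucderD a f1 f2 g1 g2 : ucder a f1 g1 -> ucder a f2 g2 ->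
  ucder a (fun b t => f1 b t + f2 b t) (fun k t => g1 k t + g2 k t).
Proof.
case=> j1 [P1 [P11 P12 P13]] [j2 [P2 [P21 P22 P23]]]; split; first exact: (jcD j1 j2).
exists (fun k b t => P1 k b t + P2 k b t); split=> [k|k t t01|].
- exact: (jcD (P11 k) (P21 k)).
- by rewrite P12// P22.
- apply: filterS2 P13 P23 => b H1 H2 t t01.
  rewrite opprD addrACA H1// H2// -big_split; apply: eq_bigr => k _.
  by rewrite mulrDr.
Qed.

Lemma ucderM a f1 f2 g1 g2 : ucder a f1 g1 -> ucder a f2 g2 ->
  ucder a (fun b t => f1 b t * f2 b t)
    (fun k t => g1 k t * f2 a t + f1 a t * g2 k t).
Proof.
case=> j1 [P1 [P11 P12 P13]] [j2 [P2 [P21 P22 P23]]]; split; first exact: (jcM j1 j2).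
exists (fun k b t => P1 k b t * f2 b t + f1 a t * P2 k b t); split=> [k|k t t01|].
- exact: (jcD (jcM (P11 k) j2) (jcM (jc_fix j1) (P21 k))).
- by rewrite P12// P22.
- apply: filterS2 P13 P23 => b H1 H2 t t01.
  (* The increment is split with [f2] at the moving point and [f1] at the base point, so that each
     half is an increment times a continuous factor. *)
  have -> : f1 b t * f2 b t - f1 a t * f2 a t =
    (f1 b t - f1 a t) * f2 b t + f1 a t * (f2 b t - f2 a t).
    by rewrite mulrBl mulrBr addrA subrK.
  rewrite H1// H2// mulr_suml mulr_sumr -big_split; apply: eq_bigr => k _ /=.
  by rewrite mulrDr !mulrA (mulrC (f1 a t)).
Qed.

Lemma ucderZ a (c : C) f g : ucder a f g ->
  ucder a (fun b t => c * f b t) (fun k t => c * g k t).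
Proof.
move=> H; apply: (ucder_eq _ (ucderM (ucder_cst a c) H)) => k t _.
by rewrite mul0r add0r.
Qed.

Lemma ucderN a f g : ucder a f g ->
  ucder a (fun b t => - f b t) (fun k t => - g k t).
Proof.
move=> /(ucderZ (-1)) H; apply: ucder_eq (ucder_ext _ H) => [k t _|].
  by rewrite mulN1r.
by apply: nearW => b t; rewrite mulN1r.
Qed.

Lemma ucderB a f1 f2 g1 g2 : ucder a f1 g1 -> ucder a f2 g2 ->
  ucder a (fun b t => f1 b t - f2 b t) (fun k t => g1 k t - g2 k t).
Proof. by move=> H1 H2; exact: (ucderD H1 (ucderN H2)). Qed.

Lemma ucder_sum a I (r : seq I) (P : pred I) (f : I -> T -> R -> C)
    (g : I -> 'I_d -> R -> C) :
  (forall i, P i -> ucder a (f i) (g i)) ->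
  ucder a (fun b t => \sum_(i <- r | P i) f i b t)
          (fun k t => \sum_(i <- r | P i) g i k t).
Proof.
move=> H; elim: r => [|i r IH].
  under eq_fun do under eq_fun do rewrite big_nil.
  under [X in ucder _ _ X]eq_fun do under eq_fun do rewrite big_nil.
  exact: ucder_cst.
under eq_fun do under eq_fun do rewrite big_cons.
under [X in ucder _ _ X]eq_fun do under eq_fun do rewrite big_cons.
case: (boolP (P i)) => Pi; [exact: (ucderD (H i Pi) IH)|exact: IH].
Qed.

Lemma ucderX a f g k : ucder a f g ->
  ucder a (fun b t => f b t ^+ k) (fun l t => k%:R * f a t ^+ k.-1 * g l t).
Proof.
move=> H; elim: k => [|k IH].
  under eq_fun do under eq_fun do rewrite expr0.
  by apply: ucder_eq (ucder_cst a 1) => l t _; rewrite !mul0r.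
under eq_fun do under eq_fun do rewrite exprS.
apply: ucder_eq (ucderM H IH) => l t _ /=.
case: k {IH} => [|k]; first by rewrite !expr0 !mul0r mulr0 addr0 !mulr1 mul1r.
rewrite /= -(natr1 k.+1) mulrDl mul1r mulrDl addrC; congr (_ + _); last by rewrite mulrC.
by rewrite exprS !mulrA (mulrC (f a t)).
Qed.

Lemma ucderV a f g : (forall t, 0 <= t <= 1 -> f a t != 0) -> ucder a f g ->
  ucder a (fun b t => (f b t)^-1) (fun k t => - g k t / f a t ^+ 2).
Proof.
move=> f0 [jf [P1 [P11 P12 P13]]]; split; first exact: (jcV jf f0).
have n0 := jc_neq0 jf f0.
exists (fun k b t => - P1 k b t * ((f b t)^-1 * (f a t)^-1)); split=> [k|k t t01|].
- exact: (jcM (jcN (P11 k)) (jcM (jcV jf f0) (jcV (jc_fix jf) f0))).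
- by rewrite P12// expr2 invfM.
- apply: filterS2 P13 n0 => b H n0 t t01.
  have -> : (f b t)^-1 - (f a t)^-1 = - (f b t - f a t) * ((f b t)^-1 * (f a t)^-1).
    rewrite opprB mulrBl mulrA mulrA (mulrC (f a t)) -!mulrA mulfV ?f0// mulr1.
    by rewrite mulrA mulfV ?n0// mul1r.
  rewrite H// -sumrN mulr_suml; apply: eq_bigr => k _.
  by rewrite !mulNr mulrN mulrA.
Qed.

(** Here [g] is the logarithmic derivative of [f], which turns the derivative of a finite product
    into a sum. *)
Definition ulder a f g := (forall t, 0 <= t <= 1 -> f a t != 0) /\
  ucder a f (fun k t => f a t * g k t).

Lemma ulder_of a f g : (forall t, 0 <= t <= 1 -> f a t != 0) -> ucder a f g ->
  ulder a f (fun k t => g k t / f a t).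
Proof.
move=> f0 H; split; [exact: f0|apply: ucder_eq H => k t t01].
by rewrite mulrC divfK ?f0.
Qed.

Lemma ulderM a f1 f2 g1 g2 : ulder a f1 g1 -> ulder a f2 g2 ->
  ulder a (fun b t => f1 b t * f2 b t) (fun k t => g1 k t + g2 k t).
Proof.
case=> n1 H1 [n2 H2]; split=> [t t01|]; first by rewrite mulf_neq0 ?n1 ?n2.
apply: ucder_eq (ucderM H1 H2) => k t t01.
by ring.
Qed.


Lemma ulder_cst a (c : C) : c != 0 -> ulder a (fun _ _ => c) (fun _ _ => 0).
Proof.
by move=> c0; split; [move=> *; exact: c0|apply: ucder_eq (ucder_cst a c) => k t _; rewrite mulr0].
Qed.

Lemma ulder_prod a I (r : seq I) (P : pred I) (f : I -> T -> R -> C)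
    (g : I -> 'I_d -> R -> C) :
  (forall i, P i -> ulder a (f i) (g i)) ->
  ulder a (fun b t => \prod_(i <- r | P i) f i b t)
          (fun k t => \sum_(i <- r | P i) g i k t).
Proof.
move=> H; elim: r => [|i r IH].
  under eq_fun do under eq_fun do rewrite big_nil.
  under [X in ulder _ _ X]eq_fun do under eq_fun do rewrite big_nil.
  by apply: ulder_cst; exact: oner_neq0.
under eq_fun do under eq_fun do rewrite big_cons.
under [X in ulder _ _ X]eq_fun do under eq_fun do rewrite big_cons.
case: (boolP (P i)) => Pi; [exact: (ulderM (H i Pi) IH)|exact: IH].
Qed.

Lemma ulderX a f g k : ulder a f g ->
  ulder a (fun b t => f b t ^+ k) (fun l t => k%:R * g l t).
Proof.
case=> n1 H1; split=> [t t01|]; first by rewrite expf_neq0 ?n1.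
apply: ucder_eq (ucderX k H1) => l t t01; case: k => [|k].
  by rewrite !mul0r mulr0.
by rewrite /= exprS; ring.
Qed.

Definition ucdiff a f := exists g, ucder a f g.

Lemma ucdiff_prod a I (r : seq I) (P : pred I) (f : I -> T -> R -> C) :
  (forall i, P i -> ucdiff a (f i)) -> ucdiff a (fun b t => \prod_(i <- r | P i) f i b t).
Proof.
move=> H; elim: r => [|i r [g IH]].
  under eq_fun do under eq_fun do rewrite big_nil.
  eexists; exact: ucder_cst.
under eq_fun do under eq_fun do rewrite big_cons.
case: (boolP (P i)) => Pi; last by exists g.
by have [g' H'] := H i Pi; eexists; apply: ucderM; [exact: H'|exact: IH].
Qed.

Lemma ucdiff_sum a I (r : seq I) (P : pred I) (f : I -> T -> R -> C) :
  (forall i, P i -> ucdiff a (f i)) -> ucdiff a (fun b t => \sum_(i <- r | P i) f i b t).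
Proof.
move=> H; elim: r => [|i r [g IH]].
  under eq_fun do under eq_fun do rewrite big_nil.
  eexists; exact: ucder_cst.
under eq_fun do under eq_fun do rewrite big_cons.
case: (boolP (P i)) => Pi; last by exists g.
by have [g' H'] := H i Pi; eexists; apply: ucderD; [exact: H'|exact: IH].
Qed.

Lemma ucdiffM a f1 f2 : ucdiff a f1 -> ucdiff a f2 ->
  ucdiff a (fun b t => f1 b t * f2 b t).
Proof. by move=> [g1 H1] [g2 H2]; eexists; exact: ucderM H1 H2. Qed.
Lemma ucdiffV a f : (forall t, 0 <= t <= 1 -> f a t != 0) -> ucdiff a f ->
  ucdiff a (fun b t => (f b t)^-1).
Proof. by move=> f0 [g1 H1]; eexists; exact: ucderV f0 H1. Qed.
Lemma ucdiff_cst a c : ucdiff a (fun _ _ => c).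
Proof. by eexists; exact: ucder_cst. Qed.

Definition cder a (f : T -> C) (g : 'I_d -> C) := ucder a (fun b _ => f b) (fun k _ => g k).

Lemma cderP a (f : T -> C) (g : 'I_d -> C) : cder a f g <-> f b @[b --> a] --> f a /\
  exists Phi : 'I_d -> T -> C, [/\ forall k, Phi k b @[b --> a] --> Phi k a,
    forall k, Phi k a = g k &
    \forall b \near a, f b - f a = \sum_k (x k b - x k a) * Phi k b].
Proof.
have z01 : 0 <= (0 : R) <= 1 by rewrite lexx ler01.
split=> [[/jc_sE jf [Phi [P1 P2 P3]]]|[jf [Phi [P1 P2 P3]]]].
  split; first exact: jf.
  exists (fun k b => Phi k b 0); split=> [k|k|]; last 2 first.
  - by rewrite P2.
  - by apply: filterS P3 => b /(_ 0 z01).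
  have [H _] := P1 k; have {}H := H 0 z01.
  exact: (cvg_comp _ _ (@cvg_slice _ a 0) H).
split; first exact: jc_s.
exists (fun k b _ => Phi k b); split=> [k|k t _|]; last 2 first.
- by rewrite P2.
- by apply: filterS P3 => b H t _.
by apply: jc_s; exact: P1.
Qed.

End Spaces.

(** Slopes compose by substitution: the slopes of [f] at [u b] multiply the slopes of the
    coordinates of [u], and no remainder has to be estimated. *)
Lemma cder_chain (T S : topologicalType) (d e : nat) (x : 'I_d -> T -> C)
    (y : 'I_e -> S -> C) (u : T -> S) (f : S -> C) (a : T) g (gu : 'I_e -> 'I_d -> C) :
  cder y (u a) f g -> u b @[b --> a] --> u a ->
  (forall k, cder x a (fun b => y k (u b)) (gu k)) ->
  cder x a (fun b => f (u b)) (fun l => \sum_k g k * gu k l).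
Proof.
move=> /cderP[f1 [Phi [P1 P2 P3]]] cu H; apply/cderP; split.
  exact: (cvg_comp _ _ cu f1).
have {}H k : exists Psi : 'I_d -> T -> C, [/\ forall l, Psi l b @[b --> a] --> Psi l a,
    forall l, Psi l a = gu k l &
    \forall b \near a, y k (u b) - y k (u a) = \sum_l (x l b - x l a) * Psi l b].
  by have /cderP[_] := H k.
have [Psi HPsi] := choice H.
exists (fun l b => \sum_k Phi k (u b) * Psi k l b); split=> [l|l|].
- apply: cvg_sumc => k _; apply: cvgM.
    exact: (cvg_comp _ _ cu (P1 k)).
  by have [+ _ _] := HPsi k; apply.
- by apply: eq_bigr => k _; have [_ -> _] := HPsi k; rewrite P2.
have P4 : \forall b \near a, forall k,
    y k (u b) - y k (u a) = \sum_l (x l b - x l a) * Psi k l b.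
  by apply: filter_forall => k; have [] := HPsi k.
have P5 := cu _ P3; rewrite /nbhs /= in P5.
apply: filterS2 P5 P4 => b /= -> {}H.
under [RHS]eq_bigr do rewrite mulr_sumr.
rewrite exchange_big; apply: eq_bigr => k _; rewrite H mulr_suml.
by apply: eq_bigr => l _; rewrite [Phi _ _ * _]mulrC mulrA.
Qed.

End Calculus.
#[global] Opaque jc ucder.

(** * Comparison of slopes with the real, complex and Frechet derivatives *)

Section Links.
Local Open Scope complex_scope.
Variable R : realType.
Local Notation C := (cplx R).
Local Notation Re := complex.Re.
Local Notation Im := complex.Im.

(** With one injective coordinate the slope away from [a] can only be the difference quotient, and
    [c] is the value that extends it continuously. *)
Lemma cder1_eps (T : topologicalType) (x : T -> C) (a : T) (f : T -> C) (c : C) :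
  (forall b, x b = x a -> b = a) -> x b @[b --> a] --> x a ->
  cder (fun _ : 'I_1 => x) a f (fun _ => c) <->
  (forall e : R, 0 < e -> \forall b \near a, b != a ->
     nc ((f b - f a) / (x b - x a) - c) < e).
Proof.
move=> xI xc; split=> [/cderP[fa [Phi [P1 P2 P3]]] e e0|H].
  have /cvg_ncP /(_ e e0) := P1 ord0; rewrite P2 => Q.
  apply: filterS2 P3 Q => b; rewrite big_ord1 => -> + ba.
  rewrite mulrAC mulfV ?mul1r// subr_eq0.
  by apply: contra ba => /eqP /xI ->.
pose phi b : C := if b == a then c else (f b - f a) / (x b - x a).
have phic : phi b @[b --> a] --> phi a.
  apply/cvg_ncP => e e0; apply: filterS (H e e0) => b.
  rewrite /phi eqxx; case: eqP => [_ _|_]; last exact.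
  by rewrite subrr nc0.
have E b : f b - f a = (x b - x a) * phi b.
  rewrite /phi; case: eqP => [->|/eqP ba]; first by rewrite !subrr mul0r.
  rewrite mulrC divfK// subr_eq0; apply: contra ba => /eqP /xI -> //.
apply/cderP; split.
  have -> : f = fun b => f a + (x b - x a) * phi b.
    by apply/funext => b; rewrite -E addrC subrK.
  apply: cvgD; first exact: cvg_cst.
  apply: cvgM phic; apply: cvgB xc _; exact: cvg_cst.
exists (fun _ => phi); split=> [_|_|]; first exact: phic.
- by rewrite /phi eqxx.
- by apply: nearW => b; rewrite big_ord1.
Qed.

Definition xR (_ : 'I_1) (t : R) : C := rc t.
Definition xC (_ : 'I_1) (z : C) : C := z.
Definition rder (f : R -> C) (t : R) (c : C) := cder xR t f (fun _ => c).
Definition zder (f : C -> C) (z : C) (c : C) := cder xC z f (fun _ => c).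

Lemma cder1_ex (T : topologicalType) (x : 'I_1 -> T -> C) (a : T) (f : T -> C) :
  ucdiff x a (fun b _ => f b) -> exists c, cder x a f (fun _ => c).
Proof.
case=> g H; exists (g ord0 0); have /cderP[f1 [Phi [P1 P2 P3]]] : cder x a f (fun k => g k 0).
  case: H => j [Phi [P1 P2 P3]]; apply/cderP; split; first exact: jc_sE.
  have z01 : 0 <= (0 : R) <= 1 by rewrite lexx ler01.
  exists (fun k b => Phi k b 0); split=> [k|k|].
  - have [H _] := P1 k; have {}H := H 0 z01.
    exact: (cvg_comp _ _ (@cvg_slice _ _ a 0) H).
  - by rewrite P2.
  - by apply: filterS P3 => b /(_ 0 z01).
apply/cderP; split; first exact: f1.
exists Phi; split; [exact: P1|by move=> k; rewrite ord1 P2|exact: P3].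
Qed.

Lemma zder_eps f z c : zder f z c <->
  (forall e : R, 0 < e -> \forall w \near z, w != z -> nc ((f w - f z) / (w - z) - c) < e).
Proof. by apply: cder1_eps => //; exact: cvg_id. Qed.

Lemma rder_eps f t c : rder f t c <->
  (forall e : R, 0 < e -> \forall s \near t, s != t ->
    nc ((f s - f t) / (rc s - rc t) - c) < e).
Proof. by apply: (cder1_eps (x := rc)) => [b /rcI //|]; exact: rc_cvg. Qed.

Lemma zderP f z c : zder f z c <-> is_derive z 1 f c.
Proof.
have K : zder f z c <-> (h^-1 *: (f (h *: 1 + z) - f z)) @[h --> (0 : C)^'] --> c.
  rewrite zder_eps; split => [H|/cvg_ncP H e e0].
    apply/cvg_ncP => e /H /nbhs_ncP[d d0 Hd].
    apply/nbhs_ncP; exists d => // h; rewrite subr0 => hd h0.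
    have := Hd (h + z); rewrite addrK => /(_ hd).
    rewrite -subr_eq0 addrK => /(_ h0).
    by rewrite /GRing.scale /= mulr1 mulrC.
  have /nbhs_ncP[d d0 Hd] := H e e0.
  apply/nbhs_ncP; exists d => // w wd wz.
  have := Hd (w - z); rewrite subr0 => /(_ wd); rewrite subr_eq0 => /(_ wz).
  by rewrite /GRing.scale /= mulr1 subrK mulrC.
rewrite K; split => [H|[H1 H2]].
  split; last by apply: cvg_lim => //; exact: H.
  by apply/cvg_ex; exists c.
rewrite -H2; exact: H1.
Qed.

Lemma zder_derive1 f z c : zder f z c -> derive1 f z = c.
Proof. by move/zderP => H; rewrite derive1E; exact: derive_val. Qed.

Lemma derivable_zder (f : C -> C) (z : C) : derivable f z 1 -> zder f z (derive1 f z).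
Proof. by move=> H; apply/zderP; rewrite derive1E; exact: derivableP. Qed.

Lemma rder_ReIm f t c : rder f t c <->
  is_derive t 1 (fun s => Re (f s)) (Re c) /\ is_derive t 1 (fun s => Im (f s)) (Im c).
Proof.
have K (u : R -> R) (d : R) : is_derive t 1 u d <->
    (h^-1 *: (u (h *: 1 + t) - u t)) @[h --> (0 : R)^'] --> d.
  split => [[H1 H2]|H]; first by rewrite -H2; exact: H1.
  split; last by apply: cvg_lim => //; exact: H.
  by apply/cvg_ex; exists d.
have L : rder f t c <-> ((f (h + t) - f t) / rc h) @[h --> (0 : R)^'] --> c.
  rewrite rder_eps; split => [H|/cvg_ncP H e e0].
    apply/cvg_ncP => e /H /nbhs_ballP[d /= d0 Hd].
    apply/nbhs_ballP; exists d => //= h hd h0.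
    have hd' : ball t d (h + t).
      by move: hd; rewrite -!ball_normE /ball_ /= opprD addrCA subrr addr0 sub0r.
    have := Hd _ hd'; rewrite -subr_eq0 addrK => /(_ h0).
    by rewrite -rcB addrK.
  have /nbhs_ballP[d /= d0 Hd] := H e e0.
  apply/nbhs_ballP; exists d => //= s hd st.
  have hd' : ball 0 d (s - t).
    by move: hd; rewrite -!ball_normE /ball_ /= sub0r opprB.
  have := Hd _ hd'; rewrite subr_eq0 => /(_ st).
  by rewrite subrK rcB.
rewrite L cvg_ReIm !K.
have eR : (fun h => Re ((f (h + t) - f t) / rc h)) =
    (fun h => h^-1 *: (Re (f (h *: 1 + t)) - Re (f t))).
  by apply/funext => h; rewrite -rcV mulrC ReMr ReB /GRing.scale /= mulr1.
have eI : (fun h => Im ((f (h + t) - f t) / rc h)) =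
    (fun h => h^-1 *: (Im (f (h *: 1 + t)) - Im (f t))).
  by apply/funext => h; rewrite -rcV mulrC ImMr ImB /GRing.scale /= mulr1.
by rewrite eR eI.
Qed.

Lemma rder_rc (u : R -> R) (t d : R) : is_derive t 1 u d -> rder (fun s => rc (u s)) t (rc d).
Proof. by move=> H; apply/rder_ReIm; split => //=; exact: is_derive_cst. Qed.

Lemma rder_cvg (f : R -> C) (t : R) c : rder f t c -> f s @[s --> t] --> f t.
Proof. by case/cderP. Qed.
Lemma zder_cvg (f : C -> C) (z : C) c : zder f z c -> f w @[w --> z] --> f z.
Proof. by case/cderP. Qed.

Lemma zder_id z : zder id z 1.
Proof.
have H : id b @[b --> z] --> (z : C) by exact: cvg_id.
by apply: ucder_eq (ucder_coord (x := xC) (k := ord0) H) => k t _; rewrite ord1.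
Qed.

Lemma rder_id t : rder rc t 1.
Proof.
by apply: ucder_eq (ucder_coord (x := xR) (k := ord0) (@rc_cvg R t)) => k s _; rewrite ord1.
Qed.

Lemma cder_chain_z (T : topologicalType) (d : nat) (x : 'I_d -> T -> C) (u : T -> C)
    (f : C -> C) (a : T) c (g : 'I_d -> C) :
  zder f (u a) c -> cder x a u g -> cder x a (fun b => f (u b)) (fun l => c * g l).
Proof.
move=> H1 H2; have cu : u b @[b --> a] --> u a by case/cderP : H2.
have := cder_chain H1 cu (fun k => H2).
by apply: ucder_eq => k t _; rewrite big_ord1.
Qed.

Lemma zder_horner (p : {poly C}) z : zder (fun w => p.[w]) z p^`().[z].
Proof.
elim/poly_ind : p => [|p c IH].
  have -> : (fun w => (0 : {poly C}).[w]) = fun _ => 0.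
    by apply/funext => w; rewrite horner0.
  by rewrite deriv0 horner0; exact: ucder_cst.
rewrite derivD derivM derivX derivC addr0 mulr1 hornerD hornerMX.
have -> : (fun w => (p * 'X + c%:P).[w]) = fun w => p.[w] * w + c.
  by apply/funext => w; rewrite hornerD hornerMX hornerC.
apply: ucder_eq (ucderD (ucderM IH (zder_id z)) (ucder_cst _ _ c)).
by move=> k t _ /=; rewrite mulr1 addr0.
Qed.

Lemma horner_cvg (p : {poly C}) z : p.[w] @[w --> z] --> p.[z].
Proof. exact: zder_cvg (zder_horner p z). Qed.

Section Rows.
Variable n : nat.
Local Notation pt := 'rV[C]_n.
Implicit Types (a b v : pt) (f : pt -> C) (g : 'I_n -> C).

Definition xV (k : 'I_n) (b : pt) : C := b 0 k.
Definition vder f a g := cder xV a f g.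

Lemma xV_cvg k a : xV k b @[b --> a] --> xV k a.
Proof. exact: (coord_continuous (i := ord0) (j := k)). Qed.

Lemma vder_coord k a : vder (xV k) a (fun l => (l == k)%:R).
Proof. exact: (ucder_coord (x := xV) (@xV_cvg k a)). Qed.

Lemma nbhs_rVP a (A : set pt) :
  nbhs a A <-> exists2 e : R, 0 < e & forall b, (forall k, nc (b 0 k - a 0 k) < e) -> A b.
Proof.
split=> [|[e e0 H]].
  case/nbhs_ballP => e /= e0 H.
  have [e' ee e'0] : exists2 e', e = rc e' & 0 < e'.
    move: e0; case: (e) => e1 e2; rewrite ltcE /= => /andP[/eqP-> ?].
    by exists e1.
  exists e' => // b Hb; apply: H; split=> [|i j]; first by [].
  rewrite ord1.
  rewrite -ball_normE /ball_ /= ee normE ltcR ncB; exact: Hb.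
apply/nbhs_ballP; exists (rc e) => /=; first by rewrite -rc0 ltcR.
move=> b [_ Hb]; apply: H => k; have := Hb ord0 k.
by rewrite -ball_normE /ball_ /= normE ltcR ncB.
Qed.

Lemma vder_Dv f a g v : vder f a g -> derivable f a v /\ 'D_v f a = \sum_k v 0 k * g k.
Proof.
case/cderP => fa [Phi [P1 P2 P3]].
have H : (h^-1 *: (f (h *: v + a) - f a)) @[h --> (0 : C)^'] --> \sum_k v 0 k * g k.
  have lin : (fun h : C => h *: v + a) @ (0 : C)^' --> a.
    move=> A /nbhs_rVP[e e0 eA].
    pose M := \sum_k nc (v 0 k) + 1.
    have M0 : 0 < M by rewrite ltr_wpDl// sumr_ge0// => k _; exact: nc_ge0.
    have d0 : 0 < e / M by rewrite divr_gt0.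
    have N := near_nc (0 : C) d0.
    rewrite /nbhs /= /dnbhs /within /=; apply: filterS N => h hN _; apply: eA => k.
    rewrite !mxE addrK ncM (le_lt_trans (y := nc h * M))//.
      rewrite ler_wpM2l ?nc_ge0// /M (bigD1 k)//= -addrA lerDl.
      by rewrite addr_ge0// sumr_ge0// => l _; exact: nc_ge0.
    by rewrite -ltr_pdivlMr// -[h]subr0.
  have K : (\sum_k v 0 k * Phi k (h *: v + a)) @[h --> (0 : C)^'] --> \sum_k v 0 k * g k.
    apply: cvg_sumc => k _; apply: cvgM; first exact: cvg_cst.
    rewrite -P2; exact: (cvg_comp _ _ lin (P1 k)).
  apply: cvg_trans K; apply: near_eq_cvg.
  have Q := lin _ P3; rewrite /nbhs /= in Q.
  move: Q; rewrite /dnbhs /within /=; apply: filterS => h Hh h0; move: (Hh h0) => /= ->.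
  rewrite /GRing.scale /= mulr_sumr; apply: eq_bigr => k _.
  by rewrite /xV !mxE addrK !mulrA mulVf// mul1r.
split; first by apply/cvg_ex; eexists; exact: H.
by apply: cvg_lim => //; exact: H.
Qed.

Lemma nc_coord_le (h : pt) k : rc (nc (h 0 k)) <= `|h|.
Proof.
rewrite -normE [leRHS]/Num.norm /= mx_normE -[leLHS]nngE num_le.
exact: (le_bigmax _ (fun i : 'I_1 * 'I_n => `|h i.1 i.2|%:nng) (ord0, k)).
Qed.

Definition lform g (h : pt) : C := \sum_k h 0 k * g k.
Lemma lform_linear g : linear (lform g).
Proof.
move=> c u v; rewrite /lform scaler_sumr -big_split; apply: eq_bigr => k _ /=.
by rewrite !mxE mulrDl -mulrA.
Qed.
HB.instance Definition _ g := GRing.isLinear.Build C pt C *:%R (lform g) (lform_linear g).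

Lemma lform_cvg g b : lform g h @[h --> b] --> lform g b.
Proof.
apply: (@cvg_sumc R pt (nbhs b) _ _ _ _ (fun k h => xV k h * g k) (fun k => xV k b * g k)).
move=> k _; exact: (cvgM (@xV_cvg k b) (cvg_cst _)).
Qed.

Lemma vder_differentiable f a g : vder f a g -> differentiable f a.
Proof.
case/cderP => fa [Phi [P1 P2 P3]].
have lc : continuous (lform g).
  by move=> b; exact: lform_cvg.
apply/diffP; apply: (@getPex _ (fun (df : {linear pt -> C}) => continuous df /\
  forall y, f y = f (lim (nbhs a)) + df (y - lim (nbhs a))
                  +o_(y \near a) (y - lim (nbhs a)))).
exists (lform g : {linear pt -> C}); split; first exact: lc.
have L : lim (nbhs a) = a by exact: lim_id.
rewrite L => z.
have E : f = (fun z => f a + lform g (z - a)) +o_a (fun z => z - a).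
  apply/eqaddoP => e e0.
  have [e' ee e'0] : exists2 e', e = rc e' & 0 < e'.
    move: e0; case: (e) => e1 e2; rewrite ltcE /= => /andP[/eqP-> ?].
    by exists e1.
  (* Dividing by n + 1 instead of n keeps the divisor non-zero in dimension 0. *)
  have d0 : 0 < e' / n.+1%:R by rewrite divr_gt0.
  have P4 : \forall b \near a, forall k, nc (Phi k b - g k) < e' / n.+1%:R.
    by apply: (@near_all pt _ a) => k; have /cvg_ncP := P1 k; rewrite P2; exact.
  apply: filterS2 P3 P4 => b H1 H2.
  have -> : (f - (fun z0 => f a + lform g (z0 - a))) b =
     \sum_k (b 0 k - a 0 k) * (Phi k b - g k).
    rewrite !fctE opprD addrA H1 /lform -sumrB; apply: eq_bigr => k _.
    by rewrite /xV !mxE mulrBr.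
  apply: (le_trans (ler_norm_sum _ _ _)).
  have -> : e * `|b - a| = \sum_(k < n.+1) (rc (e' / n.+1%:R) * `|b - a|).
    rewrite sumr_const card_ord -[RHS]mulr_natr mulrAC -rc_nat -rcM divfK//.
    by rewrite ee.
  rewrite big_ord_recr /= -[leLHS]addr0; apply: lerD; last first.
    by rewrite mulr_ge0// -rc0 lecR ltW.
  apply: ler_sum => k _; rewrite normrM mulrC; apply: ler_pM => //.
    by rewrite normE lecR ltW.
  have := nc_coord_le (b - a) k; rewrite -normE !mxE; exact.
by rewrite {1}E.
Qed.

(** The whole remainder is charged to one coordinate that realises the maximum norm of [b - a]. The
    quotient of the remainder by this coordinate has the modulus of the quotient by the norm, hence
    tends to 0. *)
Lemma differentiable_vder f a : differentiable f a ->
  vder f a (fun k => 'D_(delta_mx 0 k) f a).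
Proof.
move=> df; pose g k := 'D_(delta_mx 0 k) f a.
have dE h : 'd f a h = lform g h.
  rewrite {1}(row_sum_delta h) linear_sum; apply: eq_bigr => k _.
  by rewrite linearZ /g deriveE.
pose r b := f b - f a - lform g (b - a).
have rb (e : R) : 0 < e -> \forall b \near a, `|r b| <= rc e * `|b - a|.
  move=> e0; have e0' : (0 : C) < rc e by rewrite -rc0 ltcR.
  case: df => -[_ E]; move/eqaddoP : E => /(_ _ e0').
  have L : lim (nbhs a) = a by exact: lim_id.
  rewrite /= L; apply: filterS => b; rewrite /r -dE opprD addrA; exact.
have r0 b : `|b - a| = 0 -> r b = 0.
  move/eqP; rewrite normr_eq0 => /eqP h; rewrite /r h linear0 subr0.
  by rewrite (subr0_eq h) subrr.
pose K b := [pick k | `|(b - a) 0 k| == `|b - a|].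
pose Phi k b := g k + if K b == Some k then r b / (b - a) 0 k else 0.
apply/cderP; split; first exact: differentiable_continuous.
exists Phi; split=> [k|k|].
- have -> : Phi k a = g k.
    by rewrite /Phi subrr mxE invr0 mulr0 if_same addr0.
  apply: (proj2 (@cvg_ncP R pt (nbhs a) _ (Phi k) (g k))) => e e0; have e2 : 0 < e / 2 by rewrite divr_gt0.
  apply: filterS (rb _ e2) => b rbe.
  have H : nc (Phi k b - g k) <= e / 2; last first.
    by rewrite (le_lt_trans H)// ltr_pdivrMr// ltr_pMr// ltr1n.
  rewrite /Phi addrC addKr; case: ifPn => [|_]; last by rewrite nc0 ltW.
  rewrite /K; case: pickP => // l /eqP nl /eqP [lk]; subst l.
  have [z0|z0] := eqVneq ((b - a) 0 k) 0.
    by rewrite z0 invr0 mulr0 nc0 ltW.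
  rewrite ncM ncV ler_pdivrMr ?nc_gt0// -lecR.
  move: rbe; rewrite -nl !normE -rcM; exact.
- by rewrite /Phi subrr mxE invr0 mulr0 if_same addr0.
apply: (@nearW _ (nbhs a)) => b; rewrite /xV.
transitivity (lform g (b - a) + r b); first by rewrite /r [RHS]addrC subrK.
under [RHS]eq_bigr do rewrite /Phi mulrDr.
rewrite big_split /=; congr (_ + _).
  by apply: eq_bigr => k _; rewrite !mxE.
rewrite /K; case: pickP => [l /eqP nl|N].
  rewrite (bigD1 l)//= eqxx big1 ?addr0; last first.
    by move=> k kl; case: eqP => [[lk]|_]; [rewrite lk eqxx in kl|rewrite mulr0].
  have [z0|z0] := eqVneq ((b - a) 0 l) 0.
    by rewrite r0 ?mul0r ?mulr0// -nl z0 normr0.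
  by rewrite mulrC !mxE divfK//; move: z0; rewrite !mxE.
rewrite big1 => [|k _]; last by rewrite mulr0.
apply: r0; apply/eqP; apply: contraT => /mx_norm_neq0 [[i k]] /=; rewrite (ord1 i) => E.
by have := N k; rewrite -E eqxx.
Qed.

End Rows.
End Links.
#[global] Opaque cder.

Lemma near_comp (T S : topologicalType) (u : T -> S) (a : T) (c : S) (P : S -> Prop) :
  u b @[b --> a] --> c -> (\forall y \near c, P y) -> \forall b \near a, P (u b).
Proof. by move=> H HP; exact: (H P HP). Qed.

(** * The complex exponential, logarithms and the unit circle *)

Section ComplexExp.
Local Open Scope complex_scope.
Variable R : realType.
Local Notation C := (cplx R).
Local Notation Re := complex.Re.
Local Notation Im := complex.Im.
Implicit Types (z w : C) (s t : R).

Lemma cvg_at (T : topologicalType) (a : T) (f : T -> C) (l : C) :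
  (forall e : R, 0 < e -> \forall b \near a, nc (f b - l) < e) -> f b @[b --> a] --> l.
Proof. by move=> H; apply/cvg_ncP. Qed.

Lemma cvg_near_eq (T : topologicalType) (a : T) (f g : T -> C) (l : C) :
  (\forall b \near a, f b = g b) -> f b @[b --> a] --> l -> g b @[b --> a] --> l.
Proof. by move=> H; apply: cvg_trans; exact: near_eq_cvg. Qed.

Lemma zder_comp (f u : C -> C) (a c d : C) :
  zder f (u a) c -> zder u a d -> zder (fun b => f (u b)) a (c * d).
Proof. exact: (@cder_chain_z R C 1 (@xC R) u f a c (fun _ => d)). Qed.

Lemma rder_comp (f : C -> C) (u : R -> C) (a : R) (c d : C) :
  zder f (u a) c -> rder u a d -> rder (fun b => f (u b)) a (c * d).
Proof. exact: (@cder_chain_z R R 1 (@xR R) u f a c (fun _ => d)). Qed.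

Definition cis t : C := cos t +i* sin t.

Lemma cexpE z : cexp z = rc (expR (Re z)) * cis (Im z).
Proof. by apply: cplx_eq; rewrite (ReMr, ImMr). Qed.
Lemma cisD s t : cis (s + t) = cis s * cis t.
Proof.
by apply: cplx_eq; rewrite (ReM, ImM) /= ?cosD// sinD addrC.
Qed.
Lemma cis0 : cis 0 = 1. Proof. by rewrite /cis cos0 sin0. Qed.
Lemma cexpD z w : cexp (z + w) = cexp z * cexp w.
Proof. by rewrite !cexpE ReD ImD expRD rcM cisD; ring. Qed.
Lemma cexp0 : cexp (0 : C) = 1. Proof. by rewrite cexpE expR0 cis0 mul1r. Qed.
Lemma cexp_neq0 z : cexp z != 0.
Proof.
have : cexp z * cexp (- z) != 0 by rewrite -cexpD subrr cexp0 oner_neq0.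
by rewrite mulf_eq0 negb_or => /andP[].
Qed.
Lemma nc_cis t : nc (cis t) = 1.
Proof. by rewrite /nc /= cos2Dsin2 sqrtr1. Qed.

Lemma rder_cis t : rder cis t ('i%C * cis t).
Proof.
apply/rder_ReIm; split; rewrite (ReM, ImM) /= ?mul0r ?mul1r ?sub0r ?add0r.
  exact: is_derive_cos.
exact: is_derive_sin.
Qed.

(** With the slopes [A] of the real exponential and [B] of [cis] one has e^h - 1 - h = Re h (A
    cis(Im h) - 1) + Im h (B - i), and both brackets tend to 0. *)
Lemma zder_cexp0 : zder (@cexp R) (0 : C) 1.
Proof.
apply/zder_eps => e e0.
have h1 : is_derive (0 : R) 1 (expR : R -> R) 1.
  by have := is_derive_expR (0 : R); rewrite expR0.
have /cderP[ce [A [cA A0 dA]]] := rder_rc h1.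
have /cderP[cc [B [cB B0 dB]]] := rder_cis 0.
have Re0c : Re h @[h --> (0 : C)] --> (0 : R).
  by have /cvg_ReIm[] := @cvg_id _ (nbhs (0 : C)).
have Im0c : Im h @[h --> (0 : C)] --> (0 : R).
  by have /cvg_ReIm[_] := @cvg_id _ (nbhs (0 : C)).
have e2 : 0 < e / 2 by rewrite divr_gt0.
have N1 : \forall h \near (0 : C), nc (A ord0 (Re h) * cis (Im h) - 1) < e / 2.
  have H : A ord0 (Re h) * cis (Im h) @[h --> (0 : C)] --> A ord0 0 * cis 0.
    have H1 := cvg_comp _ _ Re0c (cA ord0); have H2 := cvg_comp _ _ Im0c cc.
    exact: (cvgM H1 H2).
  by move/cvg_ncP : H => /(_ _ e2); rewrite A0 cis0 mulr1.
have N2 : \forall h \near (0 : C), nc (B ord0 (Im h) - 'i%C) < e / 2.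
  have H : B ord0 (Im h) @[h --> (0 : C)] --> B ord0 0.
    exact: (cvg_comp _ _ Im0c (cB ord0)).
  by move/cvg_ncP : H => /(_ _ e2); rewrite B0 cis0 mulr1.
have N3 := near_comp Re0c dA; have N4 := near_comp Im0c dB.
apply: filterS2 (filterI N1 N2) (filterI N3 N4) => h [{}N1 {}N2] [/= {}N3 {}N4] h0.
rewrite subr0 cexp0.
have E : cexp h - 1 - h =
    rc (Re h) * (A ord0 (Re h) * cis (Im h) - 1) + rc (Im h) * (B ord0 (Im h) - 'i%C).
  move: N3 N4; rewrite !big_ord1 /xR expR0 cis0 rc1 rc0 !subr0 => N3 N4.
  rewrite cexpE [X in _ - X = _]cplxE.
  have -> : rc (expR (Re h)) = rc (Re h) * A ord0 (Re h) + 1 by rewrite -N3 subrK.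
  have -> : cis (Im h) = rc (Im h) * B ord0 (Im h) + 1 by rewrite -N4 subrK.
  by ring.
have -> : (cexp h - 1) / h - 1 = (cexp h - 1 - h) / h by rewrite [RHS]mulrBl mulfV.
rewrite ncM ncV ltr_pdivrMr ?nc_gt0// E.
apply: (le_lt_trans (ncD _ _)); rewrite !ncM !nc_rc.
have H1 : `|Re h| * nc (A ord0 (Re h) * cis (Im h) - 1) <=
          nc h * nc (A ord0 (Re h) * cis (Im h) - 1).
  by rewrite ler_wpM2r ?nc_ge0 ?Re_le_nc.
have H2 : `|Im h| * nc (B ord0 (Im h) - 'i%C) <= nc h * nc (B ord0 (Im h) - 'i%C).
  by rewrite ler_wpM2r ?nc_ge0 ?Im_le_nc.
apply: (le_lt_trans (lerD H1 H2)); rewrite -mulrDr mulrC ltr_pM2r ?nc_gt0//.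
by rewrite [ltRHS]splitr; exact: ltrD.
Qed.

(** The divided difference of [cexp] at 0, continued by its limit 1. It converts slopes of a
    function into slopes of its logarithm in [ucder_log]. *)
Definition cexp_slope (u : C) : C := if u == 0 then 1 else (cexp u - 1) / u.

Lemma cexp_slopeE u : cexp u - 1 = u * cexp_slope u.
Proof.
rewrite /cexp_slope; case: eqP => [->|/eqP u0]; first by rewrite cexp0 subrr mul0r.
by rewrite mulrC divfK.
Qed.

Lemma zder_cexp z : zder (@cexp R) z (cexp z).
Proof.
have H0 : zder (fun w => w - z) z 1.
  apply: ucder_eq (ucderB (zder_id z) (ucder_cst _ _ z)) => k t _ /=.
  by rewrite subr0.
have H1 := zder_cexp0; rewrite -(subrr z) in H1.
have := ucderZ (cexp z) (zder_comp (u := fun w => w - z) H1 H0).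
have E : (fun (b : C) (t : R) => cexp z * cexp (b - z)) = fun b _ => cexp b.
  by apply/funext => b; apply/funext => t; rewrite -cexpD addrC subrK.
by rewrite E; apply: ucder_eq => k t _; rewrite !mulr1.
Qed.

Lemma cexp_cvg z : cexp w @[w --> z] --> cexp z.
Proof. exact: zder_cvg (zder_cexp z). Qed.

Lemma cexp_slope_cvg (u : C) : cexp_slope w @[w --> u] --> cexp_slope u.
Proof.
have [->|u0] := eqVneq u 0.
  have -> : cexp_slope 0 = 1 by rewrite /cexp_slope eqxx.
  apply: (@cvg_at C) => e e0.
  have /zder_eps /(_ e e0) := zder_cexp0; apply: filterS => h.
  rewrite /cexp_slope; case: eqP => [_ _|_ /(_ isT)]; first by rewrite subrr nc0.
  by rewrite cexp0 subr0.
have H : (cexp w - 1) / w @[w --> u] --> (cexp u - 1) / u.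
  have H1 := ucderB (zder_cexp u) (ucder_cst _ _ 1).
  have H2 := ucderV (fun (t : R) _ => u0) (zder_id u).
  exact: (@jc_sE R C u (fun w => (cexp w - 1) / w) (ucder_jc (ucderM H1 H2))).
have -> : cexp_slope u = (cexp u - 1) / u by rewrite /cexp_slope (negPf u0).
  have N : \forall w \near u, (cexp w - 1) / w = cexp_slope w.
  apply/nbhs_ncP; exists (nc u); first by rewrite nc_gt0.
  move=> w wu; have w0 : w != 0.
    by apply: contraTN wu => /eqP ->; rewrite sub0r ncN ltxx.
  by rewrite /cexp_slope (negPf w0).
exact: (cvg_near_eq N H).
Qed.

Lemma polar (x y : R) : x ^+ 2 + y ^+ 2 = 1 -> exists t, cos t = x /\ sin t = y.
Proof.
move=> H; have x1 : -1 <= x <= 1.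
  rewrite -ler_norml -(@ler_pXn2r _ 2)// ?nnegrE// real_normK ?num_real// expr1n -H.
  by rewrite lerDl sqr_ge0.
have Ey : Num.sqrt (1 - x ^+ 2) = `|y|.
  by rewrite -H addrC addKr sqrtr_sqr.
have [y0|y0] := leP 0 y.
  by exists (acos x); rewrite acosK ?in_itv// sin_acos// Ey ger0_norm.
exists (- acos x); rewrite cosN sinN acosK ?in_itv// sin_acos// Ey ltr0_norm//.
by rewrite opprK.
Qed.

Lemma cexp_surj w : w != 0 -> exists z, cexp z = w.
Proof.
move=> w0; have n0 : 0 < nc w by rewrite nc_gt0.
have [t [ct st]] : exists t, cos t = Re w / nc w /\ sin t = Im w / nc w.
  apply: polar; rewrite !expr_div_n -mulrDl -nc_sqr mulfV// expf_neq0//.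
  by rewrite gt_eqF.
exists (ln (nc w) +i* t); rewrite cexpE /= lnK ?posrE//.
apply: cplx_eq; rewrite (ReMr, ImMr) /= ?ct ?st mulrC divfK// gt_eqF//.
Qed.

(* The principal branch, valid only on the right half-plane. *)
Definition clog w : C := ln (nc w) +i* asin (Im w / nc w).

Lemma clogK w : 0 < Re w -> cexp (clog w) = w.
Proof.
move=> w0; have n0 : 0 < nc w.
  by rewrite (lt_le_trans w0)// (le_trans _ (Re_le_nc _))// ler_norm.
have I1 : -1 <= Im w / nc w <= 1.
  by rewrite -ler_norml normrM normfV (gtr0_norm n0) ler_pdivrMr// mul1r Im_le_nc.
rewrite cexpE /= lnK ?posrE//; apply: cplx_eq; rewrite (ReMr, ImMr) /=; last first.
  by rewrite asinK ?in_itv// mulrC divfK// gt_eqF.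
rewrite cos_asin//.
have -> : 1 - (Im w / nc w) ^+ 2 = (Re w / nc w) ^+ 2.
  rewrite !expr_div_n; apply/eqP; rewrite subr_eq -mulrDl -nc_sqr mulfV//.
  by rewrite expf_neq0// gt_eqF.
rewrite sqrtr_sqr ger0_norm; last by rewrite divr_ge0// ltW.
by rewrite mulrC divfK// gt_eqF.
Qed.

Lemma nc_cvg {T : Type} (F : set_system T) {FF : Filter F} (f : T -> C) (a : C) :
  f @ F --> a -> nc (f t) @[t --> F] --> nc a.
Proof.
move=> /cvg_ncP H; apply/cvgrPdist_lt => e /H; apply: filterS => t.
apply: le_lt_trans; rewrite ler_norml; apply/andP; split.
  rewrite lerNl opprB lerBlDr; apply: le_trans (ncD _ _).
  by rewrite subrK.
rewrite lerBlDr ncB; apply: le_trans (ncD _ _).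
by rewrite subrK.
Qed.

Lemma clog_cvg {T : Type} (F : set_system T) {FF : Filter F} (f : T -> C) w :
  0 < Re w -> f @ F --> w -> clog (f t) @[t --> F] --> clog w.
Proof.
move=> w0 fw; have n0 : 0 < nc w.
  by rewrite (lt_le_trans w0)// (le_trans _ (Re_le_nc _))// ler_norm.
have nv : nc (f t) @[t --> F] --> nc w by exact: nc_cvg fw.
apply/cvg_ReIm; split.
  have K := continuous_ln n0; exact: (cvg_comp _ _ nv K).
have Iv : Im (f t) / nc (f t) @[t --> F] --> Im w / nc w.
  apply: cvgM; first by case/cvg_ReIm : fw.
  by apply: cvgV; [rewrite gt_eqF|exact: nv].
have I1 : -1 < Im w / nc w < 1.
  rewrite -ltr_norml normrM normfV (gtr0_norm n0) ltr_pdivrMr// mul1r.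
  rewrite -(@ltr_pXn2r _ 2)// ?nnegrE ?nc_ge0// real_normK ?num_real// nc_sqr.
  by rewrite ltrDr exprn_gt0.
exact: (cvg_comp _ _ Iv (continuous_asin I1)).
Qed.

Definition ei (s : R) : C := cis (2 * pi * s).

Lemma ei_cexp s : ei s = cexp (two_pi_i R * rc s).
Proof.
by rewrite cexpE ReM ImM /= !mul0r ?mulr0 subr0 ?addr0 ?add0r expR0 mul1r.
Qed.
Lemma ei0 : ei 0 = 1. Proof. by rewrite /ei mulr0 cis0. Qed.
Lemma ei1 : ei 1 = 1. Proof. by rewrite /ei mulr1 /cis mulr_natl cos2pi sin2pi. Qed.
Lemma nc_ei s : nc (ei s) = 1. Proof. exact: nc_cis. Qed.
Lemma ei_neq0 s : ei s != 0. Proof. by rewrite -nc_gt0 nc_ei. Qed.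
Lemma two_pi_i_neq0 : two_pi_i R != 0.
Proof. by apply/eqP => -[] /eqP; rewrite mulf_eq0 pnatr_eq0/= gt_eqF// pi_gt0. Qed.

Lemma rder_ei s : rder ei s (two_pi_i R * ei s).
Proof.
have H : cder (@xR R) s (fun t => two_pi_i R * rc t) (fun _ => two_pi_i R).
  by apply: ucder_eq (ucderZ (two_pi_i R) (rder_id s)) => k t _; rewrite mulr1.
have := rder_comp (u := fun t => two_pi_i R * rc t) (zder_cexp _) H.
have -> : (fun b : R => cexp (two_pi_i R * rc b)) = ei.
  by apply/funext => b; rewrite -ei_cexp.
by apply: ucder_eq => k t _; rewrite -ei_cexp mulrC.
Qed.

Lemma ei_inj s t : 0 <= s < 1 -> 0 <= t < 1 -> ei s = ei t -> s = t.
Proof.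
wlog st : s t / s <= t.
  by move=> W h1 h2 e; have [/W|/ltW/W] := leP s t; [apply|move=> ->].
move=> /andP[s0 s1] /andP[t0 t1] e.
have : ei (t - s) = 1.
  have : ei (t - s) * ei s = ei s.
    by rewrite /ei -cisD -mulrDr subrK -/(ei t) -e.
  move=> H; apply: (mulIf (ei_neq0 s)); rewrite H mul1r//.
(* Real parts give cos(2 pi (t - s)) = 1, hence sin(pi (t - s)) = 0, which is impossible for 0 < t -
   s < 1. *)
rewrite /ei => /(congr1 (@complex.Re R)) /= H; apply/eqP; rewrite eq_le st /= leNgt.
apply/negP => lt; have : 0 < sin (pi * (t - s)).
  apply: sin_gt0_pi; rewrite ?mulr_gt0 ?pi_gt0 ?subr_gt0// gtr_pMr ?pi_gt0//.
  by rewrite ltrBlDr (lt_le_trans t1)// lerDl.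
move: H; rewrite -mulrA mulr_natl cos_mulr2n => H.
have : sin (pi * (t - s)) ^+ 2 = 0 by rewrite sin2cos2; move: H; lra.
by move/eqP; rewrite expf_eq0/= => /eqP ->; rewrite ltxx.
Qed.

End ComplexExp.

(** * Real integrals over segments *)

Section Integrals.
Local Open Scope complex_scope.
Variable R : realType.
Local Notation C := (cplx R).
Local Notation Re := complex.Re.
Local Notation Im := complex.Im.
Local Notation mu := (@lebesgue_measure R).
Implicit Types (u v w t : R) (f g h : R -> R).

Definition cont_on u v f := forall t, u <= t <= v -> f s @[s --> t] --> f t.

Lemma cont_on_within u v f : cont_on u v f -> {within `[u, v], continuous f}.
Proof.
move=> H; apply: continuous_in_subspaceT => t.
by rewrite inE /= in_itv /= => /H.
Qed.

Lemma cont_on_integrable u v f : cont_on u v f -> mu.-integrable `[u, v] (EFin \o f).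
Proof.
move=> H; apply: continuous_compact_integrable; first exact: segment_compact.
exact: cont_on_within.
Qed.

Lemma RFTC u v f F : u < v -> cont_on u v f -> {within `[u, v], continuous F} ->
  (forall t, u < t < v -> is_derive t 1 F (f t)) ->
  \int[mu]_(t in `[u, v]) f t = F v - F u.
Proof.
move=> uv cf cF dF; rewrite /Rintegral (@continuous_FTC2 _ f F)//.
- exact: cont_on_within.
- have [_ H1 H2] := (continuous_within_itvP F uv).1 cF; split => // t.
  by rewrite in_itv => /= /dF [].
- by move=> t; rewrite in_itv /= => /dF [_ <-]; rewrite derive1E.
Qed.

(** A velocity may jump or fail to exist at break points, so integrability rests on measurability
    and boundedness instead of continuity. *)
Definition mbd u v f := measurable_fun `[u, v] f /\
  exists M, forall t, u <= t <= v -> `|f t| <= M.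

Lemma mbd_integrable u v f : mbd u v f -> mu.-integrable `[u, v] (EFin \o f).
Proof.
case=> mf [M HM]; apply: measurable_bounded_integrable => //.
  by rewrite /= lebesgue_measure_itv /=; case: ifP => _; rewrite ltry.
exists M; split; first exact: num_real.
by move=> x Mx t /=; rewrite in_itv /= => /HM /le_trans; apply; exact: ltW.
Qed.

Lemma cont_on_mbd u v f : cont_on u v f -> mbd u v f.
Proof.
move=> cf; split.
  by have /integrableP[/measurable_realfun.measurable_EFinP] := cont_on_integrable cf.
have [uv|vu] := leP u v; last first.
  by exists 0 => t /andP[] /le_trans /[apply]; rewrite leNgt vu.
have cN : {within `[u, v], continuous (fun t => `|f t|)}.
  apply: cont_on_within => t /cf; exact: cvg_norm.
have [c _ Hc] := EVT_max uv cN.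
by exists `|f c| => t tI; apply: Hc; rewrite in_itv.
Qed.

Lemma mbd_open u v f g : cont_on u v g -> (forall t, u < t < v -> f t = g t) -> mbd u v f.
Proof.
move=> /cont_on_mbd[mg [M HM]] fg; split.
  apply: (measurable_realfun.measurable_fun_itv_cc (b0 := false) (b1 := true)).
  apply: (eq_measurable_fun g).
    by move=> t; rewrite inE /= in_itv /= => tI; rewrite fg.
  apply: measurable_funS mg => // t /=; rewrite !in_itv /= => /andP[? ?].
  by rewrite !ltW.
(* Nothing relates [f] to [g] at the two ends, so the end values enter the bound. *)
exists (`|M| + (`|f u| + `|f v|)) => t /andP[ut tv].
have [->|tu] := eqVneq t u.
  by rewrite addrCA lerDl addr_ge0.
have [->|tv'] := eqVneq t v.
  by rewrite addrA lerDr addr_ge0.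
rewrite fg; last by rewrite !lt_neqAle ut tv tv' eq_sym tu.
by rewrite (le_trans (HM t _)) ?ut// (le_trans (ler_norm _))// lerDl addr_ge0.
Qed.

Lemma mbd_glue u v w f : u <= v <= w -> mbd u v f -> mbd v w f -> mbd u w f.
Proof.
move=> /andP[uv vw] [m1 [M1 H1]] [m2 [M2 H2]]; split.
  have -> : `[u, w]%classic = `[u, v]%classic `|` `[v, w]%classic.
    apply/seteqP; split=> t /=; rewrite !in_itv /=.
      by case/andP=> ut tw; have [tv|/ltW vt] := leP t v; [left|right]; rewrite ?ut ?vt.
    by case=> /andP[h1 h2]; rewrite ?h1 ?h2 ?(le_trans h2 vw) ?(le_trans uv h1).
  by apply/measurable_funU.
exists (`|M1| + `|M2|) => t /andP[ut tw]; have [tv|/ltW vt] := leP t v.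
  by rewrite (le_trans (H1 t _)) ?ut// (le_trans (ler_norm _))// lerDl.
by rewrite (le_trans (H2 t _)) ?vt// (le_trans (ler_norm _))// lerDr.
Qed.

Lemma Rintegral_open u v f g : u < v -> cont_on u v g ->
  (forall t, u < t < v -> f t = g t) ->
  \int[mu]_(t in `[u, v]) f t = \int[mu]_(t in `[u, v]) g t.
Proof.
move=> uv cg fg.
have If := mbd_integrable (mbd_open cg fg); have Ig := cont_on_integrable cg.
have S1 (h : R -> R) : mu.-integrable `[u, v] (EFin \o h) ->
    \int[mu]_(t in `[u, v]) h t = \int[mu]_(t in `]u, v[) h t.
  move=> Ih; rewrite -Rintegral_itv_obnd_cbnd; last first.
    by apply: integrableS Ih => // t /=; rewrite !in_itv /= => /andP[/ltW -> ->].
  rewrite -Rintegral_itv_bndo_bndc//.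
  by apply: integrableS Ih => // t /=; rewrite !in_itv /= => /andP[/ltW -> /ltW ->].
rewrite !S1//; apply: eq_Rintegral => t; rewrite inE /= in_itv /= => tI.
exact: fg.
Qed.

Lemma Rintegral_glue u v w f : u <= v <= w -> mbd u v f -> mbd v w f ->
  \int[mu]_(t in `[u, w]) f t =
  \int[mu]_(t in `[u, v]) f t + \int[mu]_(t in `[v, w]) f t.
Proof.
move=> uvw m1 m2; have m := mbd_integrable (mbd_glue uvw m1 m2).
case/andP: (uvw) => uv vw.
have := @Rintegral_itvB R f (BLeft u) (BRight w) v m.
rewrite !bnd_simp => /(_ uv vw).
rewrite Rintegral_itv_obnd_cbnd; last first.
  have := mbd_integrable m2; apply: integrableS => // t /=.
  by rewrite !in_itv /= => /andP[/ltW -> ->].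
by move=> <-; rewrite addrC subrK.
Qed.

End Integrals.

(** * Complex integrals and line integrals as bounded functionals *)

Section Functionals.
Local Open Scope complex_scope.
Variable R : realType.
Local Notation C := (cplx R).
Local Notation Re := complex.Re.
Local Notation Im := complex.Im.
Local Notation mu := (@lebesgue_measure R).
Implicit Types (u v w t : R) (f g h : R -> C).

Definition contC u v f := forall t, u <= t <= v -> f s @[s --> t] --> f t.

Lemma contC_Re u v f : contC u v f -> cont_on u v (fun t => Re (f t)).
Proof. by move=> H t /H /cvg_ReIm[]. Qed.
Lemma contC_Im u v f : contC u v f -> cont_on u v (fun t => Im (f t)).
Proof. by move=> H t /H /cvg_ReIm[]. Qed.
Lemma contCD u v f g : contC u v f -> contC u v g -> contC u v (fun t => f t + g t).
Proof. by move=> F G t tI; exact: (cvgD (F t tI) (G t tI)). Qed.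
Lemma contCM u v f g : contC u v f -> contC u v g -> contC u v (fun t => f t * g t).
Proof. by move=> F G t tI; exact: (cvgM (F t tI) (G t tI)). Qed.
Lemma contC_cst u v (c : C) : contC u v (fun _ => c).
Proof. by move=> t _; exact: cvg_cst. Qed.
Lemma contCN u v f : contC u v f -> contC u v (fun t => - f t).
Proof. by move=> F t tI; exact: (cvgN (F t tI)). Qed.
Lemma contCB u v f g : contC u v f -> contC u v g -> contC u v (fun t => f t - g t).
Proof. by move=> F G; exact: contCD F (contCN G). Qed.
Lemma contCV u v f : contC u v f -> (forall t, u <= t <= v -> f t != 0) ->
  contC u v (fun t => (f t)^-1).
Proof. by move=> F n0 t tI; exact: (cvgV (n0 t tI) (F t tI)). Qed.
Lemma contC_sum u v I (r : seq I) (P : pred I) (F : I -> R -> C) :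
  (forall i, P i -> contC u v (F i)) -> contC u v (fun t => \sum_(i <- r | P i) F i t).
Proof. by move=> H t tI; apply: cvg_sumc => i Pi; exact: H. Qed.
Lemma contCX u v f k : contC u v f -> contC u v (fun t => f t ^+ k).
Proof. by move=> F t tI; apply: cvg_expc; exact: F. Qed.

Definition cint u v f : C :=
  (\int[mu]_(t in `[u, v]) Re (f t)) +i* (\int[mu]_(t in `[u, v]) Im (f t)).

Definition mbdC u v f := mbd u v (fun t => Re (f t)) /\ mbd u v (fun t => Im (f t)).

Lemma contC_mbd u v f : contC u v f -> mbdC u v f.
Proof. by move=> H; split; apply: cont_on_mbd; [exact: contC_Re|exact: contC_Im]. Qed.

Lemma cintD u v f g : mbdC u v f -> mbdC u v g ->
  cint u v (fun t => f t + g t) = cint u v f + cint u v g.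
Proof.
case=> /mbd_integrable f1 /mbd_integrable f2 [/mbd_integrable g1 /mbd_integrable g2].
by apply: cplx_eq; rewrite /= -RintegralD//; apply: eq_Rintegral => t _; rewrite (ReD, ImD).
Qed.

Lemma cint_ext u v f g : (forall t, u <= t <= v -> f t = g t) -> cint u v f = cint u v g.
Proof.
by move=> fg; apply: cplx_eq; apply: eq_Rintegral => t; rewrite inE /= in_itv /= => /fg ->.
Qed.

Lemma cintZ u v c f : mbdC u v f -> cint u v (fun t => c * f t) = c * cint u v f.
Proof.
case=> m1 m2; have i1 := mbd_integrable m1; have i2 := mbd_integrable m2.
have Z (r : R) (k : R -> R) : mu.-integrable `[u, v] (EFin \o k) ->
    mu.-integrable `[u, v] (EFin \o (fun t => r * k t)).
  by move=> ik; exact: (integrableZl _ r ik).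
apply: cplx_eq; rewrite (ReM, ImM) /= -!RintegralZl//.
  rewrite -RintegralB//; [|exact: Z..].
  by apply: eq_Rintegral => t _; rewrite ReM.
rewrite -RintegralD//; [|exact: Z..].
by apply: eq_Rintegral => t _; rewrite ImM.
Qed.

Lemma cint_open u v f g : u < v -> contC u v g ->
  (forall t, u < t < v -> f t = g t) -> mbdC u v f /\ cint u v f = cint u v g.
Proof.
move=> uv cg fg; have cR := contC_Re cg; have cI := contC_Im cg.
have fR t : u < t < v -> Re (f t) = Re (g t) by move/fg ->.
have fI t : u < t < v -> Im (f t) = Im (g t) by move/fg ->.
split; first by split; [exact: mbd_open fR|exact: mbd_open fI].
by apply: cplx_eq; [exact: Rintegral_open fR|exact: Rintegral_open fI].
Qed.

Lemma cint_glue u v w f : u <= v <= w -> mbdC u v f -> mbdC v w f ->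
  mbdC u w f /\ cint u w f = cint u v f + cint v w f.
Proof.
move=> uvw [m1 m2] [m3 m4]; split.
  by split; [exact: mbd_glue m1 m3|exact: mbd_glue m2 m4].
by apply: cplx_eq; rewrite /=; exact: Rintegral_glue.
Qed.

Lemma cint_pieces (k : nat) (p : nat -> R) f (g : nat -> R -> C) :
  (0 < k)%N -> (forall i, (i < k)%N -> p i < p i.+1) ->
  (forall i, (i < k)%N -> contC (p i) (p i.+1) (g i)) ->
  (forall i t, (i < k)%N -> p i < t < p i.+1 -> f t = g i t) ->
  [/\ mbdC (p 0%N) (p k) f, p 0%N <= p k &
     cint (p 0%N) (p k) f = \sum_(i < k) cint (p i) (p i.+1) (g i)].
Proof.
case: k => // k _; elim: k => [|k IH] H1 H2 H3.
  have [m e] := cint_open (H1 0%N isT) (H2 0%N isT) (fun t => H3 0%N t isT).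
  by split; [exact: m|rewrite ltW ?H1|rewrite big_ord1].
have [m1 l1 e1] := IH (fun i ik => H1 i (ltnW ik)) (fun i ik => H2 i (ltnW ik))
  (fun i t ik => H3 i t (ltnW ik)).
have ik : (k.+1 < k.+2)%N by [].
have [m2 e2] := cint_open (H1 _ ik) (H2 _ ik) (fun t => H3 _ t ik).
have l2 := ltW (H1 _ ik).
have [|m e] := cint_glue _ m1 m2; first by rewrite l1.
by split; [exact: m|exact: le_trans l2|rewrite e big_ord_recr /= e1 e2].
Qed.

Lemma Rint_bound u v (f : R -> R) (M : R) : u < v -> cont_on u v f ->
  (forall t, u <= t <= v -> `|f t| <= M) ->
  `|\int[mu]_(t in `[u, v]) f t| <= M * (v - u).
Proof.
move=> uv cf fM; have If := cont_on_integrable cf.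
apply: (le_trans (le_normr_Rintegral _ If)) => //.
have cM : cont_on u v (fun _ => M) by move=> t _; exact: cvg_cst.
have -> : M * (v - u) = \int[mu]_(t in `[u, v]) M.
  rewrite mulrBr; symmetry; apply: (@RFTC R u v (fun _ => M) (fun t => M * t) uv cM).
    apply: cont_on_within => t _; apply: cvgM; [exact: cvg_cst|exact: cvg_id].
  move=> t _; have H : is_derive t 1 (M \*: (@id R)) (M *: 1) by exact: is_deriveZ.
  by apply: is_derive_eq; rewrite /GRing.scale /= mulr1.
apply: le_Rintegral => //.
  by apply: cont_on_integrable => t /cf; exact: cvg_norm.
exact: cont_on_integrable cM.
Qed.

(** The factor 2 comes from estimating the real and the imaginary part separately. *)
Lemma cint_bound u v f M : u < v -> contC u v f ->
  (forall t, u <= t <= v -> nc (f t) <= M) -> nc (cint u v f) <= 2 * (v - u) * M.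
Proof.
move=> uv cf fM; apply: (le_trans (nc_le _)).
rewrite mulrAC -mulrA mulr_natl mulr2n; apply: lerD; apply: Rint_bound => //.
- exact: contC_Re.
- by move=> t tI; rewrite (le_trans (Re_le_nc _))// fM.
- exact: contC_Im.
- by move=> t tI; rewrite (le_trans (Im_le_nc _))// fM.
Qed.

Lemma cFTC u v f (F : R -> C) : u < v -> contC u v f -> contC u v F ->
  (forall t, u < t < v -> rder F t (f t)) -> cint u v f = F v - F u.
Proof.
move=> uv cf cF dF; apply: cplx_eq; rewrite (ReB, ImB) /=.
  apply: (@RFTC R u v (fun t => Re (f t)) (fun t => Re (F t)) uv (contC_Re cf)
    (cont_on_within (contC_Re cF))).
  by move=> t /dF /rder_ReIm[].
apply: (@RFTC R u v (fun t => Im (f t)) (fun t => Im (F t)) uv (contC_Im cf)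
    (cont_on_within (contC_Im cF))).
by move=> t /dF /rder_ReIm[].
Qed.

Lemma contCP u v f : contC u v f <-> forall t, u <= t <= v -> f s @[s --> t] --> f t.
Proof. by []. Qed.

Opaque contC.

(** Linearity and boundedness in the supremum norm are all that differentiation under the integral
    sign uses; the plain integral over [0, 1] and [curve_int] are both instances. *)
Record functional (J : (R -> C) -> C) : Prop := Functional {
  JD : forall f g, contC 0 1 f -> contC 0 1 g -> J (fun t => f t + g t) = J f + J g;
  JZ : forall c f, contC 0 1 f -> J (fun t => c * f t) = c * J f;
  Jbound : exists2 M : R, 0 < M & forall f (e : R), contC 0 1 f ->
    (forall t, 0 <= t <= 1 -> nc (f t) <= e) -> nc (J f) <= M * e }.

Section OneFunctional.
Variables (J : (R -> C) -> C) (HJ : functional J).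

Lemma JB f g : contC 0 1 f -> contC 0 1 g -> J (fun t => f t - g t) = J f - J g.
Proof.
move=> cf cg; have E : (fun t => f t - g t) = (fun t => f t + (-1) * g t).
  by apply/funext => t; rewrite mulN1r.
have cm : contC 0 1 (fun t => -1 * g t) by exact: (contCM (@contC_cst 0 1 (-1)) cg).
by rewrite E (JD HJ cf cm) (JZ HJ (-1) cg) mulN1r.
Qed.

Lemma J_ext f g : contC 0 1 f -> contC 0 1 g ->
  (forall t, 0 <= t <= 1 -> f t = g t) -> J f = J g.
Proof.
move=> cf cg fg; apply/eqP; rewrite -subr_eq0 -(JB cf cg); apply/eqP.
have [M M0 HM] := Jbound HJ; apply: nc_small => e e0.
have H : nc (J (fun t => f t - g t)) <= M * 0.
  by apply: HM => [|t tI]; [exact: (contCB cf cg)|rewrite fg// subrr nc0].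
by rewrite (le_trans H)// mulr0 ltW.
Qed.

Lemma J0 : J (fun _ => 0) = 0.
Proof.
have -> : (fun _ : R => 0 : C) = (fun _ => 0 * 0) by apply/funext => t; rewrite mul0r.
by rewrite (JZ HJ 0 (@contC_cst 0 1 0)) mul0r.
Qed.

Lemma J_sum I (r : seq I) (P : pred I) (f : I -> R -> C) :
  (forall i, P i -> contC 0 1 (f i)) ->
  J (fun t => \sum_(i <- r | P i) f i t) = \sum_(i <- r | P i) J (f i).
Proof.
move=> H; elim: r => [|i r IH].
  under eq_fun do rewrite big_nil.
  by rewrite big_nil J0.
under eq_fun do rewrite big_cons.
rewrite big_cons; case: (boolP (P i)) => Pi; last exact: IH.
by rewrite (JD HJ (H i Pi) (contC_sum H)) IH.
Qed.

Section Param.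
Variables (T : topologicalType) (d : nat) (x : 'I_d -> T -> C) (a : T).

Transparent jc ucder.

Lemma jc_contC (f : T -> R -> C) : jc a f -> \forall b \near a, contC 0 1 (f b).
Proof. by case=> _; apply: filterS => b H; apply/contCP. Qed.

Lemma J_cvg (f : T -> R -> C) : jc a f -> J (f b) @[b --> a] --> J (f a).
Proof.
move=> jf; have cf := jc_contC jf; have ca := nbhs_singleton cf.
have [M M0 HM] := Jbound HJ; apply: cvg_at => e e0.
have d0 : 0 < e / (2 * M) by rewrite divr_gt0 ?mulr_gt0.
have N : \forall b \near a, forall t, 0 <= t <= 1 -> nc (f b t - f a t) < e / (2 * M).
  have j2 := jcB jf (jc_fix jf).
  apply: (jc_near (P := fun z => nc z < e / (2 * M)) j2) => t tI.
  by rewrite subrr; apply: filterS (near_nc 0 d0) => z; rewrite subr0.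
apply: filterS2 cf N => b cb Nb; rewrite -(JB cb ca).
have H : nc (J (fun t => f b t - f a t)) <= M * (e / (2 * M)).
  apply: HM => [|t /Nb /ltW]; [exact: (contCB cb ca)|exact].
have E : M * (e / (2 * M)) = e / 2 by field; rewrite gt_eqF.
by rewrite (le_lt_trans H)// E ltr_pdivrMr// ltr_pMr// ltr1n.
Qed.

(** Applying [J] to the slopes of the integrand gives slopes of the integral, and [J_cvg] makes them
    continuous. *)
Lemma J_cder (f : T -> R -> C) (g : 'I_d -> R -> C) : (forall k, contC 0 1 (g k)) -> ucder x a f g ->
  cder x a (fun b => J (f b)) (fun k => J (g k)).
Proof.
move=> cg [jf [Phi [P1 P2 P3]]]; apply/cderP; split; first exact: (J_cvg jf).
exists (fun k b => J (Phi k b)); split=> [k|k|].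
- exact: (J_cvg (P1 k)).
- exact: (J_ext (nbhs_singleton (jc_contC (P1 k))) (cg k) (P2 k)).
- have cP : \forall b \near a, forall k, contC 0 1 (Phi k b).
    by apply: near_all => k; exact: (jc_contC (P1 k)).
  have cf := jc_contC jf; have ca := nbhs_singleton cf.
  apply: filterS2 (filterI cP cf) P3 => b [{}cP cb] H.
  have cS k : contC 0 1 (fun t => (x k b - x k a) * Phi k b t).
    exact: (contCM (@contC_cst 0 1 _) (cP k)).
  rewrite -(JB cb ca) (J_ext (contCB cb ca) (contC_sum (P := xpredT) (fun k _ => cS k)) H).
  rewrite (J_sum (index_enum _) (P := xpredT) (fun k _ => cS k)).
  by apply: eq_bigr => k _; exact: (JZ HJ _ (cP k)).
Qed.
End Param.
End OneFunctional.

Lemma cint_functional : functional (cintegral01 (R := R)).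
Proof.
split=> [f g cf cg|c f cf|].
- exact: (cintD (contC_mbd cf) (contC_mbd cg)).
- exact: (cintZ c (contC_mbd cf)).
- exists (2 * (1 - 0)); first by rewrite subr0 mulr1.
  move=> f e cf fe; exact: (cint_bound (@ltr01 R) cf fe).
Qed.

Lemma cFTC01 f (F : R -> C) : contC 0 1 f -> contC 0 1 F ->
  (forall t, 0 < t < 1 -> rder F t (f t)) -> cintegral01 f = F 1 - F 0.
Proof. exact: (cFTC (@ltr01 R)). Qed.

Section Curves.
Variable gam : R -> C.

Definition curve_int (G : R -> C) : C := cintegral01 (fun t => G t * velocity gam t).

Hypothesis Hgam : piecewise_C1 gam.

Lemma velocityE t c : rder gam t c -> velocity gam t = c.
Proof.
case/rder_ReIm => H1 H2; apply: cplx_eq; rewrite /= derive1E; exact: derive_val.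
Qed.

(** The [dg i] come from the C^1 extensions of the pieces, so they are continuous up to both ends of
    their interval, where [velocity] itself may be ill-behaved. *)
Lemma curve_pieces : exists (k : nat) (p : nat -> R) (dg : nat -> R -> C),
  [/\ p 0%N = 0, p k = 1, (0 < k)%N,
    forall i, (i < k)%N -> [/\ p i < p i.+1, 0 <= p i, p i.+1 <= 1 &
       contC (p i) (p i.+1) (dg i)] &
    forall i t, (i < k)%N -> p i < t < p i.+1 ->
      velocity gam t = dg i t /\ rder gam t (dg i t)].
Proof.
case: Hgam => k [p [p0 pk H]].
have k0 : (0 < k)%N.
  by case: k pk {H} => // pk; move: p0; rewrite pk => /eqP; rewrite oner_eq0.
have inc i j : (i <= j <= k)%N -> p i <= p j.
  move=> /andP[]; elim: j => [|j IH]; first by rewrite leqn0 => /eqP ->.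
  rewrite leq_eqVlt => /orP[/eqP->//|]; rewrite ltnS => ij jk.
  by have [/ltW h _] := H j jk; rewrite (le_trans (IH ij (ltnW jk))).
have {}H i : exists dg : R -> C, (i < k)%N -> [/\ p i < p i.+1, contC (p i) (p i.+1) dg &
    forall t, p i < t < p i.+1 -> rder gam t (dg t)].
  have [ik|] := ltnP i k; last by exists (fun _ => 0).
  have [h [x [y [dxy cx cy e]]]] := H i ik.
  exists (fun t => derive1 x t +i* derive1 y t) => _; split; first exact: h.
    apply/contCP => t _; apply/cvg_ReIm; split; [exact: cx|exact: cy].
  move=> t tI; have [dx dy] := dxy t.
  have N : \forall s \near t, x s +i* y s = gam s.
    have : t \in `]p i, p i.+1[ by rewrite in_itv.
    move/near_in_itvoo; apply: filterS => s; rewrite in_itv /= => /andP[/ltW h1 /ltW h2].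
    by rewrite e// h1 h2.
  have E : rder (fun s => x s +i* y s) t (derive1 x t +i* derive1 y t).
    by apply/rder_ReIm; split => /=; rewrite derive1E; exact: derivableP.
  apply: ucder_ext E; apply: filterS N => s /= -> _; by [].
have [dg Hdg] := choice H.
exists k, p, dg; split => // i.
  move=> ik; have [h1 h2 _] := Hdg i ik; split => //.
    by rewrite -p0; apply: inc; rewrite leq0n ltnW.
  by rewrite -pk; apply: inc; rewrite ik leqnn.
move=> t ik tI; have [_ _ /(_ t tI) r] := Hdg i ik.
by split; [exact: velocityE|exact: r].
Qed.

Lemma curve_functional : functional curve_int.
Proof.
have [k [p [dg [p0 pk k0 H1 H2]]]] := curve_pieces.
have sub G i : contC 0 1 G -> (i < k)%N -> contC (p i) (p i.+1) (fun t => G t * dg i t).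
  move=> /contCP cG ik; have [_ h1 h2 c] := H1 i ik; refine (contCM _ c).
  apply/contCP => t /andP[h3 h4]; apply: cG.
  by rewrite (le_trans h1 h3) (le_trans h4 h2).
have inc i : (i < k)%N -> p i < p i.+1 by case/H1.
have E G : contC 0 1 G -> mbdC 0 1 (fun t => G t * velocity gam t) /\
    curve_int G = \sum_(i < k) cint (p i) (p i.+1) (fun t => G t * dg i t).
  move=> cG; have := @cint_pieces k p (fun t => G t * velocity gam t)
     (fun i t => G t * dg i t) k0 inc (fun i ik => sub G i cG ik).
  rewrite p0 pk; case=> [i t ik tI|m _ e]; last by split; [exact: m|exact: e].
  by have [-> _] := H2 i t ik tI.
split=> [f g cf cg|c f cf|].
- rewrite /curve_int; under eq_fun do rewrite mulrDl.
  exact: (cintD (proj1 (E f cf)) (proj1 (E g cg))).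
- rewrite /curve_int; under eq_fun do rewrite -mulrA.
  exact: (cintZ c (proj1 (E f cf))).
have B i : exists M : R, (i < k)%N -> 0 <= M /\
    forall t, p i <= t <= p i.+1 -> nc (dg i t) <= M.
  have [ik|] := ltnP i k; last by exists 0.
  have [h _ _ c] := H1 i ik.
  have [_ [M1 HM1]] := cont_on_mbd (contC_Re c).
  have [_ [M2 HM2]] := cont_on_mbd (contC_Im c).
  exists (M1 + M2) => _.
  have HM t : p i <= t <= p i.+1 -> nc (dg i t) <= M1 + M2.
    by move=> tI; rewrite (le_trans (nc_le _))// lerD ?HM1 ?HM2.
  split; last exact: HM.
  by apply: le_trans (HM (p i) _); [exact: nc_ge0|rewrite lexx ltW].
have [M HM] := choice B.
(* The summand 1 makes the bound positive even for a motionless curve. *)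
exists (1 + \sum_(i < k) 2 * (p i.+1 - p i) * M i).
  rewrite ltr_wpDr// sumr_ge0// => i _; have [h _] := HM i (ltn_ord i).
  by rewrite mulr_ge0// mulr_ge0// subr_ge0 ltW// inc.
move=> f e cf fe; have [_ ->] := E f cf.
have e0 : 0 <= e by apply: le_trans (fe 0 _); [exact: nc_ge0|rewrite lexx ler01].
rewrite mulrDl mul1r; apply: (le_trans (nc_sum _ _ _)).
rewrite (le_trans (y := (\sum_(i < k) 2 * (p i.+1 - p i) * M i) * e))//; last by rewrite lerDr.
rewrite mulr_suml; apply: ler_sum => i _; rewrite -mulrA (mulrC (M i)).
apply: cint_bound; [exact: inc|exact: sub|move=> t tI].
have [M0 h] := HM i (ltn_ord i); rewrite ncM; apply: ler_pM; rewrite ?nc_ge0 ?h//.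
have [_ h1 h2 _] := H1 i (ltn_ord i); case/andP: tI => h3 h4.
by apply: fe; rewrite (le_trans h1 h3) (le_trans h4 h2).
Qed.

(** Quantifying over the derivatives [c] of [gam] at [t] imposes nothing where [gam] has none. On
    each piece the fundamental theorem applies, and the boundary values of the continuous [F]
    telescope. *)
Lemma curve_FTC (G F : R -> C) : contC 0 1 G -> contC 0 1 F ->
  (forall t c, 0 < t < 1 -> rder gam t c -> rder F t (G t * c)) ->
  curve_int G = F 1 - F 0.
Proof.
move=> /contCP cG /contCP cF dF.
have [k [p [dg [p0 pk k0 H1 H2]]]] := curve_pieces.
have inc i : (i < k)%N -> p i < p i.+1 by case/H1.
have sub (A : R -> C) i : (forall t, 0 <= t <= 1 -> A s @[s --> t] --> A t) ->
    (i < k)%N -> contC (p i) (p i.+1) A.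
  move=> cA ik; have [_ h1 h2 c] := H1 i ik.
  apply/contCP => t /andP[h3 h4]; apply: cA.
  by rewrite (le_trans h1 h3) (le_trans h4 h2).
have cGd i : (i < k)%N -> contC (p i) (p i.+1) (fun t => G t * dg i t).
  by move=> ik; have [_ _ _ c] := H1 i ik; exact: (contCM (sub G i cG ik) c).
have := @cint_pieces k p (fun t => G t * velocity gam t)
     (fun i t => G t * dg i t) k0 inc cGd.
rewrite p0 pk; case=> [i t ik tI|_ _]; first by have [-> _] := H2 i t ik tI.
move=> e; have -> : curve_int G = cint 0 1 (fun t => G t * velocity gam t) by [].
rewrite e.
have T i : (i < k)%N -> cint (p i) (p i.+1) (fun t => G t * dg i t) = F (p i.+1) - F (p i).
  move=> ik; apply: (cFTC (inc i ik) (cGd i ik) (sub F i cF ik)) => t tI.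
  have [_ r] := H2 i t ik tI; have [_ h1 h2 _] := H1 i ik; case/andP: tI => h3 h4.
  by apply: dF => //; rewrite (le_lt_trans h1 h3) (lt_le_trans h4 h2).
under eq_bigr => i _ do rewrite T//.
rewrite -(big_mkord xpredT (fun i => F (p i.+1) - F (p i))) telescope_sumr//.
by rewrite p0 pk.
Qed.

End Curves.

End Functionals.

(** * Goursat's theorem for parallelograms *)

Section Goursat.
Local Open Scope complex_scope.
Variable R : realType.
Local Notation C := (cplx R).
Local Notation Re := complex.Re.
Local Notation Im := complex.Im.
Local Notation mu := (@lebesgue_measure R).
Implicit Types (s t : R) (p u v z : C).

(** The retraction of the line onto [0, 1]; composing with it extends data on the unit interval to
    continuous data on the whole line. *)
Definition clamp t : R := Num.max 0 (Num.min t 1).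
Lemma clamp_in t : 0 <= clamp t <= 1.
Proof. by rewrite /clamp le_max lexx /= ge_max ler01 ge_min lexx orbT. Qed.
Lemma clampE t : 0 <= t <= 1 -> clamp t = t.
Proof. by case/andP=> t0 t1; rewrite /clamp (min_idPl t1) (max_idPr t0). Qed.
Lemma clamp_cvg t : clamp s @[s --> t] --> clamp t.
Proof.
have c0 : cst (0 : R) s @[s --> t] --> (0 : R) by exact: cvg_cst.
have c1 : cst (1 : R) s @[s --> t] --> (1 : R) by exact: cvg_cst.
have ci : s @[s --> t] --> t by exact: cvg_id.
exact: (continuous_max c0 (continuous_min ci c1)).
Qed.

Lemma is_derive_prim (f : R -> R) : (forall t, f s @[s --> t] --> f t) ->
  exists F : R -> R, forall t, 0 <= t <= 1 -> is_derive t 1 F (f t).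
Proof.
move=> cf; exists (fun x => \int[mu]_(t in `[-1, x]) f t) => t /andP[t0 t1].
have t2 : t < 2 by rewrite (le_lt_trans t1)// ltr1n.
have If : mu.-integrable `[-1, 2] (EFin \o f).
  by apply: (@cont_on_integrable R); move=> x _; exact: cf.
have t1' : -1 < t by lra.
have [D E] := @continuous_FTC1_closed R f (-1) t 2 t2 If t1' (cf t).
by split; [exact: D|rewrite -derive1E].
Qed.

Lemma primitive (f : R -> C) : contC 0 1 f ->
  exists F : R -> C, forall t, 0 <= t <= 1 -> rder F t (f t).
Proof.
move=> /contCP cf; pose f' t := f (clamp t).
have cf' t : f' s @[s --> t] --> f' t.
  exact: (cvg_comp _ _ (@clamp_cvg t) (cf _ (clamp_in t))).
have [F1 H1] : exists F : R -> R, forall t, 0 <= t <= 1 -> is_derive t 1 F (Re (f' t)).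
  by apply: is_derive_prim => t; case/cvg_ReIm : (cf' t).
have [F2 H2] : exists F : R -> R, forall t, 0 <= t <= 1 -> is_derive t 1 F (Im (f' t)).
  by apply: is_derive_prim => t; case/cvg_ReIm : (cf' t).
exists (fun t => F1 t +i* F2 t) => t tI.
have E : f' t = f t by rewrite /f' clampE.
by rewrite -E; apply/rder_ReIm; split; [exact: (H1 t tI)|exact: (H2 t tI)].
Qed.

Lemma rder_affine (a b : C) t : rder (fun s => a + rc s * b) t b.
Proof.
have H := ucderD (ucder_cst (@xR R) t a) (ucderM (rder_id t) (ucder_cst _ _ b)).
by apply: ucder_eq H => k s _ /=; rewrite add0r mul1r mulr0 addr0.
Qed.

Lemma rder_compR (F : R -> C) (w : R -> R) t c d :
  rder F (w t) c -> w s @[s --> t] --> w t -> rder (fun s => rc (w s)) t d ->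
  rder (fun s => F (w s)) t (c * d).
Proof.
move=> H1 cw H2.
have := @cder_chain R R R 1 1 (@xR R) (@xR R) w F t (fun _ => c) (fun _ _ => d) H1 cw
  (fun _ => H2).
by apply: ucder_eq => k s _; rewrite big_ord1.
Qed.

(** A primitive on [0, 1] replaces the change of variables by the fundamental theorem on each
    half. *)
Lemma cint_half (f : R -> C) : contC 0 1 f ->
  cintegral01 f = 2^-1 * (cintegral01 (fun s => f (s / 2)) +
                          cintegral01 (fun s => f ((1 + s) / 2))).
Proof.
move=> cf; have [F HF] := primitive cf.
have two0 : (2 : C) != 0 by rewrite pnatr_eq0.
have cF t : 0 <= t <= 1 -> F s @[s --> t] --> F t by move/HF/rder_cvg.
have H (a : R) : 0 <= a <= 2^-1 -> cintegral01 (fun s => f (a + s / 2)) =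
    2 * (F (a + 2^-1) - F a).
  move=> /andP[a0 a2].
  have I t : 0 <= t <= 1 -> 0 <= a + t / 2 <= 1.
    by move=> /andP[t0 t1]; apply/andP; split; lra.
  have cw t : a + s / 2 @[s --> t] --> a + t / 2.
    by apply: cvgD; [exact: cvg_cst|apply: cvgM; [exact: cvg_id|exact: cvg_cst]].
  have r t : 0 <= t <= 1 -> rder (fun s => 2 * F (a + s / 2)) t (f (a + t / 2)).
    move=> /I tI; have d : rder (fun s => rc (a + s / 2)) t (2^-1).
      have := rder_affine (rc a) 2^-1 t.
      have -> : (fun s => rc a + rc s * 2^-1) = fun s => rc (a + s / 2).
        by apply/funext => s; rewrite rcD rcM rcV rc_nat.
      exact.
    have := ucderZ 2 (rder_compR (w := fun s => a + s / 2) (HF _ tI) (cw t) d).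
    by apply: ucder_eq => k s _; rewrite mulrCA mulfV// mulr1.
  rewrite (@cFTC01 R _ (fun s => 2 * F (a + s / 2))).
  - by rewrite mul0r addr0 mul1r mulrBr.
  - apply/contCP => t /I tI; have /contCP := cf => /(_ _ tI) cft.
    exact: (cvg_comp _ _ (cw t) cft).
  - by apply/contCP => t /r /rder_cvg.
  - by move=> t /andP[/ltW t0 /ltW t1]; apply: r; rewrite t0 t1.
have -> : (fun s => f (s / 2)) = fun s => f (0 + s / 2).
  by apply/funext => s; rewrite add0r.
have -> : (fun s => f ((1 + s) / 2)) = fun s => f (2^-1 + s / 2).
  by apply/funext => s; rewrite mulrDl mul1r.
have H0 : cintegral01 (fun s => f (0 + s / 2)) = 2 * (F (0 + 2^-1) - F 0).
  by apply: H; apply/andP; split; lra.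
have H1 : cintegral01 (fun s => f (2^-1 + s / 2)) = 2 * (F (2^-1 + 2^-1) - F 2^-1).
  by apply: H; apply/andP; split; lra.
rewrite H0 H1.
rewrite (@cFTC01 R f F cf); last 2 first.
- by apply/contCP.
- by move=> t /andP[/ltW t0 /ltW t1]; apply: HF; rewrite t0 t1.
have -> : 2^-1 + 2^-1 = 1 :> R by lra.
by rewrite add0r; field.
Qed.

Lemma dist_itv (a d x y : R) : a <= x <= a + d -> a <= y <= a + d -> `|x - y| <= d.
Proof. by move=> /andP[? ?] /andP[? ?]; rewrite ler_norml; apply/andP; split; lra. Qed.

Lemma itv01_sub (a d x : R) : 0 <= a -> a + d <= 1 -> a <= x <= a + d -> 0 <= x <= 1.
Proof. by move=> ? ? /andP[? ?]; apply/andP; split; lra. Qed.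

Section Bisection.
Variable N : nat -> R * R -> R.

(** The side of a dyadic square of generation [j]. Throughout, [N j (x, y)] measures the square of
    this side with lower left corner (x, y). *)
Definition dy (j : nat) : R := 2^-1 ^+ j.
Definition in_unit (j : nat) (xy : R * R) :=
  [/\ 0 <= xy.1, 0 <= xy.2, xy.1 + dy j <= 1 & xy.2 + dy j <= 1].
Definition child (j : nat) (x x' : R) := x <= x' /\ x' + dy j.+1 <= x + dy j.

Lemma dy_ge0 j : 0 <= dy j. Proof. by rewrite exprn_ge0// invr_ge0. Qed.
Lemma dyS j : dy j = dy j.+1 + dy j.+1. Proof. by rewrite /dy exprS; field. Qed.
Lemma dy0 : dy 0 = 1. Proof. by rewrite /dy expr0. Qed.

Hypothesis HN : forall j x y, in_unit j (x, y) -> N j (x, y) <=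
  N j.+1 (x, y) + N j.+1 (x, y + dy j.+1) + N j.+1 (x + dy j.+1, y) +
  N j.+1 (x + dy j.+1, y + dy j.+1).

(** Pigeonhole: if each of the four quarters had measure below a quarter of the total, [HN] would
    fail. *)
Lemma bisect j xy : in_unit j xy -> exists xy', [/\ in_unit j.+1 xy',
  child j xy.1 xy'.1, child j xy.2 xy'.2 & N j xy <= 4 * N j.+1 xy'].
Proof.
case: xy => x y H; have B := HN H; case: H => /= x0 y0 x1 y1.
have d0 := dy_ge0 j.+1.
move: B x1 y1; rewrite /child /in_unit (dyS j); move: (dy j.+1) d0 => e d0.
move: (N j (x, y)) => q.
have [H1|N1] := leP q (4 * N j.+1 (x, y)).
  by move=> _ x1 y1; exists (x, y) => /=; split=> //; split=> //; lra.
have [H2|N2] := leP q (4 * N j.+1 (x, y + e)).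
  by move=> _ x1 y1; exists (x, y + e) => /=; split=> //; split=> //; lra.
have [H3|N3] := leP q (4 * N j.+1 (x + e, y)).
  by move=> _ x1 y1; exists (x + e, y) => /=; split=> //; split=> //; lra.
move=> B x1 y1; exists (x + e, y + e) => /=; split; last by lra.
- by split => /=; lra.
- by split; lra.
- by split; lra.
Qed.

Lemma nested : exists s : nat -> R * R,
  forall j, [/\ in_unit j (s j), child j (s j).1 (s j.+1).1, child j (s j).2 (s j.+1).2 &
    N 0%N (0, 0) <= 4 ^+ j * N j (s j)].
Proof.
have H (a : nat * (R * R)) : exists xy', in_unit a.1 a.2 -> [/\ in_unit a.1.+1 xy',
  child a.1 a.2.1 xy'.1, child a.1 a.2.2 xy'.2 & N a.1 a.2 <= 4 * N a.1.+1 xy'].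
  have [/bisect[xy' h]|] := pselect (in_unit a.1 a.2); first by exists xy'.
  by exists a.2.
have [g Hg] := choice H.
pose s := fix s j := if j is i.+1 then g (i, s i) else (0, 0).
have K j : in_unit j (s j) /\ N 0%N (0, 0) <= 4 ^+ j * N j (s j).
  elim: j => [|j [IH1 IH2]].
    by rewrite expr0 mul1r; split => //; split => /=; rewrite /dy ?expr0 ?add0r.
  have [h1 h2 h3 h4] := Hg (j, s j) IH1; split; first exact: h1.
  by rewrite (le_trans IH2)// exprSr -mulrA ler_wpM2l ?exprn_ge0.
exists s => j; have [k1 k2] := K j; have [h1 h2 h3 h4] := Hg (j, s j) k1.
by split.
Qed.

Lemma limit_point (x : nat -> R) :
  (forall j, child j (x j) (x j.+1)) ->
  exists X, forall j, x j <= X <= x j + dy j.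
Proof.
move=> H.
have up i j : (i <= j)%N -> x i <= x j.
  elim: j => [|j IH]; first by rewrite leqn0 => /eqP ->.
  rewrite leq_eqVlt => /orP[/eqP->//|]; rewrite ltnS => /IH /le_trans; apply.
  by case: (H j).
have dn i j : (i <= j)%N -> x j + dy j <= x i + dy i.
  elim: j => [|j IH]; first by rewrite leqn0 => /eqP ->.
  rewrite leq_eqVlt => /orP[/eqP->//|]; rewrite ltnS => /IH; apply: le_trans.
  by case: (H j).
have ub j : ubound (range x) (x j + dy j).
  move=> _ [i _ <-]; have [ij|/ltnW ji] := leqP i j.
    by rewrite (le_trans (up _ _ ij))// lerDl dy_ge0.
  by rewrite (le_trans _ (dn _ _ ji))// lerDl dy_ge0.
exists (sup (range x)) => j; apply/andP; split.
  by apply: ub_le_sup; [exists (x 0%N + dy 0); exact: ub|exists j].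
by apply: ge_sup; [exists (x 0%N); exists 0%N|exact: ub].
Qed.


Lemma bisection : exists (s : nat -> R * R) (X Y : R), forall j, [/\ in_unit j (s j),
   (s j).1 <= X <= (s j).1 + dy j, (s j).2 <= Y <= (s j).2 + dy j &
   N 0%N (0, 0) <= 4 ^+ j * N j (s j)].
Proof.
have [s Hs] := nested.
have [X HX] : exists X, forall j, (s j).1 <= X <= (s j).1 + dy j.
  by apply: (limit_point (x := fun j => (s j).1)) => j; case: (Hs j).
have [Y HY] : exists Y, forall j, (s j).2 <= Y <= (s j).2 + dy j.
  by apply: (limit_point (x := fun j => (s j).2)) => j; case: (Hs j).
by exists s, X, Y => j; have [h1 _ _ h2] := Hs j; split.
Qed.

End Bisection.

Section OneFunction.
Variable k : C -> C.

Definition seg p u : C := cintegral01 (fun s => k (p + rc s * u)).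
(** The integral of [k] over the boundary of the parallelogram, run through in the order p, p + u, p
    + u + v, p + v. *)
Definition para p u v : C :=
  u * (seg p u - seg (p + v) u) + v * (seg (p + u) v - seg p v).
Definition in_para p u v (P : C -> Prop) :=
  forall s t, 0 <= s <= 1 -> 0 <= t <= 1 -> P (p + rc s * u + rc t * v).

Lemma para_swap p u v : para p u v = - para p v u.
Proof. by rewrite /para; ring. Qed.

Lemma seg_cont p u : (forall s, 0 <= s <= 1 -> exists c, zder k (p + rc s * u) c) ->
  contC 0 1 (fun s => k (p + rc s * u)).
Proof.
move=> H; apply/contCP => s /H[c /zder_cvg cc].
have ca := rder_cvg (rder_affine p u s).
exact: (cvg_comp _ _ ca cc).
Qed.

Lemma seg_half p u : contC 0 1 (fun s => k (p + rc s * u)) ->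
  seg p u = 2^-1 * (seg p (u / 2) + seg (p + u / 2) (u / 2)).
Proof.
move=> /cint_half E; rewrite {1}/seg E /seg; congr (_ * (_ + _)); congr cintegral01.
  by apply/funext => s; rewrite rcM rcV rc_nat -mulrA (mulrC _ u).
apply/funext => s; congr k.
by rewrite rcM rcV rcD rc_nat rc1; ring.
Qed.

Lemma para_half p u v : in_para p u v (fun z => exists c, zder k z c) ->
  para p u v = para p (u / 2) v + para (p + u / 2) (u / 2) v.
Proof.
move=> H; have two0 : (2 : C) != 0 by rewrite pnatr_eq0.
have z01 : 0 <= (0 : R) <= 1 by apply/andP; split; lra.
have o01 : 0 <= (1 : R) <= 1 by apply/andP; split; lra.
have c1 : contC 0 1 (fun s => k (p + rc s * u)).
  by apply: seg_cont => s sI; have := H s 0 sI z01; rewrite rc0 mul0r addr0.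
have c2 : contC 0 1 (fun s => k (p + v + rc s * u)).
  by apply: seg_cont => s sI; have := H s 1 sI o01; rewrite rc1 mul1r addrAC.
rewrite /para (seg_half c1) (seg_half c2).
have -> : p + u / 2 + v = p + v + u / 2 by rewrite addrAC.
have -> : p + u / 2 + u / 2 = p + u by field.
by field.
Qed.

Lemma in_para_sub p u v (x y d e : R) (P : C -> Prop) :
  0 <= x -> 0 <= y -> 0 <= d -> 0 <= e -> x + d <= 1 -> y + e <= 1 ->
  in_para p u v P -> in_para (p + rc x * u + rc y * v) (rc d * u) (rc e * v) P.
Proof.
move=> x0 y0 d0 e0 x1 y1 H s t /andP[s0 s1] /andP[t0 t1].
have ds : 0 <= d * s <= d by rewrite mulr_ge0//= ler_piMr.
have et : 0 <= e * t <= e by rewrite mulr_ge0//= ler_piMr.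
have := H (x + d * s) (y + e * t); rewrite !rcD !rcM.
have -> : p + (rc x + rc d * rc s) * u + (rc y + rc e * rc t) * v =
  p + rc x * u + rc y * v + rc s * (rc d * u) + rc t * (rc e * v) by ring.
by apply; apply/andP; split; lra.
Qed.

Section Parallelogram.
Variables (p u v : C).
Hypothesis kd : in_para p u v (fun z => exists c, zder k z c).

Definition corner (xy : R * R) : C := p + rc xy.1 * u + rc xy.2 * v.
Definition cell (j : nat) (xy : R * R) :=
  para (corner xy) (rc (dy j) * u) (rc (dy j) * v).

Lemma cell_split j x y : in_unit j (x, y) -> cell j (x, y) =
  cell j.+1 (x, y) + cell j.+1 (x, y + dy j.+1) +
  (cell j.+1 (x + dy j.+1, y) + cell j.+1 (x + dy j.+1, y + dy j.+1)).
Proof.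
case=> /= x0 y0 x1 y1; have d0 := dy_ge0 j; have e0 := dy_ge0 j.+1.
have dS := dyS j.
have eu (w : C) : rc (dy j) * w / 2 = rc (dy j.+1) * w by rewrite dS rcD; field.
have I0 : in_para (corner (x, y)) (rc (dy j) * u) (rc (dy j) * v)
    (fun z => exists c, zder k z c) by exact: in_para_sub.
have pS (x' y' : R) : corner (x' + dy j.+1, y') = corner (x', y') + rc (dy j.+1) * u.
  by rewrite /corner /= rcD; ring.
have pS' (x' y' : R) : corner (x', y' + dy j.+1) = corner (x', y') + rc (dy j.+1) * v.
  by rewrite /corner /= rcD; ring.
have H1 (x' : R) : 0 <= x' -> x' + dy j.+1 <= 1 ->
   para (corner (x', y)) (rc (dy j.+1) * u) (rc (dy j) * v) =
   cell j.+1 (x', y) + cell j.+1 (x', y + dy j.+1).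
  move=> xx1 xx2; rewrite para_swap para_half; last first.
    have := @in_para_sub p u v x' y (dy j.+1) (dy j) _ xx1 y0 e0 d0 xx2 y1 kd.
    by move=> H s t sI tI; rewrite addrAC; exact: H.
  by rewrite eu opprD -!para_swap /cell pS'.
rewrite {1}/cell (para_half I0) eu -pS !H1//; first by rewrite addr_ge0.
  by rewrite -addrA -dS.
by rewrite (le_trans _ x1)// dS lerD2l lerDl.
Qed.

(** The subtracted term is the exact mean over the segment of the affine function k(z0) + (z - z0)
    c, so only the integral of (z - z0)(Phi(z) - c) has to be bounded. *)
Lemma seg_affine z0 (c : C) (Phi : C -> C) (a w : C) (r e : R) :
  (forall s, 0 <= s <= 1 -> exists d, zder k (a + rc s * w) d) ->
  (forall s, 0 <= s <= 1 -> let z := a + rc s * w in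
     [/\ k z = k z0 + (z - z0) * Phi z, nc (z - z0) <= r & nc (Phi z - c) <= e]) ->
  nc (seg a w - (k z0 + (a - z0) * c + w * c / 2)) <= 2 * (r * e).
Proof.
move=> H1 H2; have cf := seg_cont H1.
pose A (s : R) : C := k z0 + (a - z0 + rc s * w) * c.
have cA : contC 0 1 A.
  apply/contCP => s _; apply: cvgD; first exact: cvg_cst.
  apply: cvgM; last exact: cvg_cst.
  exact: (rder_cvg (rder_affine (a - z0) w s)).
have two0 : (2 : C) != 0 by rewrite pnatr_eq0.
have dG (s : R) : rder (fun s => (k z0 + (a - z0) * c) * rc s + rc s ^+ 2 * (w * c / 2)) s (A s).
  have H := ucderD (ucderZ (k z0 + (a - z0) * c) (rder_id s))
    (ucderM (ucderX 2 (rder_id s)) (ucder_cst _ _ (w * c / 2))).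
  by apply: ucder_eq H => i t _ /=; rewrite /A; field.
have EA : cintegral01 A = k z0 + (a - z0) * c + w * c / 2.
  rewrite (@cFTC01 R A (fun s => (k z0 + (a - z0) * c) * rc s + rc s ^+ 2 * (w * c / 2)) cA).
  - by rewrite rc1 rc0; ring.
  - by apply/contCP => s _; exact: rder_cvg (dG s).
  - by move=> s _; exact: dG.
rewrite -EA /seg -(JB (cint_functional R) cf cA).
have -> : 2 * (r * e) = 2 * (1 - 0) * (r * e) by rewrite subr0 mulr1.
apply: (cint_bound (@ltr01 R) (contCB cf cA)) => s sI.
have [-> h1 h2] := H2 s sI; rewrite /A.
have -> : k z0 + (a + rc s * w - z0) * Phi (a + rc s * w) -
    (k z0 + (a - z0 + rc s * w) * c) =
    (a + rc s * w - z0) * (Phi (a + rc s * w) - c) by ring.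
by rewrite ncM ler_pM ?nc_ge0.
Qed.

Lemma goursat : para p u v = 0.
Proof.
have HN j x y : in_unit j (x, y) -> nc (cell j (x, y)) <=
  nc (cell j.+1 (x, y)) + nc (cell j.+1 (x, y + dy j.+1)) + nc (cell j.+1 (x + dy j.+1, y)) +
  nc (cell j.+1 (x + dy j.+1, y + dy j.+1)).
  move/cell_split => ->; apply: (le_trans (ncD _ _)); rewrite -[leRHS]addrA.
  by apply: lerD; exact: ncD.
have [s [X [Y Hs]]] := bisection (N := fun j xy => nc (cell j xy)) HN.
have [XI YI] : 0 <= X <= 1 /\ 0 <= Y <= 1.
  have [[/= a1 a2 a3 a4] /andP[b1 b2] /andP[b3 b4] _] := Hs 0%N.
  move: a3 a4 b2 b4; rewrite dy0 => a3 a4 b2 b4.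
  by split; apply/andP; split; lra.
have [c /cderP[_ [Phi [P1 P2 P3]]]] := kd XI YI.
have [z0 Ez] : exists z0, z0 = p + rc X * u + rc Y * v by eexists.
rewrite -Ez in P1 P2 P3.
pose m := nc u + nc v.
have m0 : 0 <= m by rewrite addr_ge0// nc_ge0.
apply: nc_small => e e0.
(* The final estimate is 4 m^2 e1, which this choice keeps below [e]; the summand 1 covers m = 0. *)
pose e1 := e / (8 * m ^+ 2 + 1).
have M0 : 0 < 8 * m ^+ 2 + 1 by rewrite ltr_wpDl// mulr_ge0// exprn_ge0.
have e10 : 0 < e1 by rewrite divr_gt0.
have /cvg_ncP /(_ _ e10) NP := P1 ord0; rewrite P2 in NP.
have [r1 r10 Hr1] := proj1 (nbhs_ncP _ _) NP.
have [r2 r20 Hr2] := proj1 (nbhs_ncP _ _) P3.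
pose r := Num.min r1 r2.
have r0 : 0 < r by rewrite lt_min r10.
have Hr z : nc (z - z0) < r -> nc (Phi ord0 z - c) < e1 /\
    k z - k z0 = \sum_k (xC k z - xC k z0) * Phi k z.
  by rewrite lt_min => /andP[h1 h2]; split; [exact: Hr1|exact: Hr2].
have [j Hj] : exists j, dy j * m < r.
  have /cvgrPdist_lt H : dy j * m @[j --> \oo] --> 0 * m.
    apply: cvgMl; apply: cvg_expr.
    by rewrite ger0_norm ?invr_ge0// invf_lt1// ltr1n.
  have := H r r0; rewrite mul0r => -[j _ Hj]; exists j.
  have := Hj j (leqnn j); rewrite /= sub0r normrN; apply: le_lt_trans; exact: ler_norm.
have [[/= a1 a2 a3 a4] HX HY HQ] := Hs j.
have E0 : cell 0 (0, 0) = para p u v.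
  by rewrite /cell /corner dy0 rc0 rc1 !mul0r !addr0 !mul1r.
rewrite -E0; apply: (le_trans HQ).
have [d Ed] : exists d, d = dy j by eexists.
have d0 : 0 <= d by rewrite Ed dy_ge0.
have near_z (x y : R) : (s j).1 <= x <= (s j).1 + d -> (s j).2 <= y <= (s j).2 + d ->
    nc (corner (x, y) - z0) <= d * m.
  move=> h1 h2.
  have -> : corner (x, y) - z0 = rc (x - X) * u + rc (y - Y) * v.
    by rewrite /corner Ez /= !rcB; ring.
  apply: (le_trans (ncD _ _)); rewrite !ncM !nc_rc mulrDr.
  move: HX HY; rewrite -Ed => g1 g2.
  apply: lerD; rewrite ler_wpM2r ?nc_ge0//.
    exact: (dist_itv h1 g1).
  exact: (dist_itv h2 g2).
have good (x y : R) : (s j).1 <= x <= (s j).1 + d -> (s j).2 <= y <= (s j).2 + d ->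
    let z := corner (x, y) in
    [/\ k z = k z0 + (z - z0) * Phi ord0 z, nc (z - z0) <= d * m & nc (Phi ord0 z - c) <= e1].
  move=> hx hy z; have h := near_z x y hx hy.
  have dr : d * m < r by rewrite Ed.
  have [h1 h2] := Hr z (le_lt_trans h dr).
  move: h2 => /=; rewrite big_ord1 /xC => h2; split; [|exact: h|exact: ltW].
  by rewrite -h2 addrC subrK.
have diff (x y : R) : (s j).1 <= x <= (s j).1 + d -> (s j).2 <= y <= (s j).2 + d ->
    exists d, zder k (corner (x, y)) d.
  move=> h1 h2; apply: kd; rewrite -Ed in a3 a4.
    exact: (itv01_sub a1 a3 h1).
  exact: (itv01_sub a2 a4 h2).
have lx : (s j).1 <= (s j).1 <= (s j).1 + d by rewrite lexx lerDl.
have ly : (s j).2 <= (s j).2 <= (s j).2 + d by rewrite lexx lerDl.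
have rx : (s j).1 <= (s j).1 + d <= (s j).1 + d by rewrite lexx lerDl d0.
have ry : (s j).2 <= (s j).2 + d <= (s j).2 + d by rewrite lexx lerDl d0.
have mid (t a : R) : 0 <= t <= 1 -> a <= a + d * t <= a + d.
  by move=> /andP[t0 t1]; rewrite lerDl mulr_ge0//= lerD2l ler_piMr.
pose L a w := k z0 + (a - z0) * c + w * c / 2.
have SU (y : R) : (s j).2 <= y <= (s j).2 + d ->
    nc (seg (corner ((s j).1, y)) (rc d * u) - L (corner ((s j).1, y)) (rc d * u)) <=
      2 * (d * m * e1).
  move=> hy; have E (t : R) : corner ((s j).1, y) + rc t * (rc d * u) =
      corner ((s j).1 + d * t, y) by rewrite /corner /= rcD rcM; ring.
  apply: (seg_affine (Phi := Phi ord0)) => t tI; rewrite E.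
    by apply: diff => //; exact: mid.
  by apply: good => //; exact: mid.
have SV (x : R) : (s j).1 <= x <= (s j).1 + d ->
    nc (seg (corner (x, (s j).2)) (rc d * v) - L (corner (x, (s j).2)) (rc d * v)) <=
      2 * (d * m * e1).
  move=> hx; have E (t : R) : corner (x, (s j).2) + rc t * (rc d * v) =
      corner (x, (s j).2 + d * t) by rewrite /corner /= rcD rcM; ring.
  apply: (seg_affine (Phi := Phi ord0)) => t tI; rewrite E.
    by apply: diff => //; exact: mid.
  by apply: good => //; exact: mid.
have cU : corner ((s j).1 + d, (s j).2) = corner (s j) + rc d * u.
  by rewrite /corner /= rcD; ring.
have cV : corner ((s j).1, (s j).2 + d) = corner (s j) + rc d * v.
  by rewrite /corner /= rcD; ring.
have c0 : corner ((s j).1, (s j).2) = corner (s j) by [].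
have q1 := SU _ ly; have q2 := SU _ ry; have q3 := SV _ lx; have q4 := SV _ rx.
rewrite ?cU ?cV ?c0 in q1 q2 q3 q4.
(* The affine approximations [L] contribute nothing around the whole boundary, so they may be
   subtracted on each side. *)
have -> : cell j (s j) =
  rc d * u * ((seg (corner (s j)) (rc d * u) - L (corner (s j)) (rc d * u)) -
    (seg (corner (s j) + rc d * v) (rc d * u) - L (corner (s j) + rc d * v) (rc d * u))) +
  rc d * v * ((seg (corner (s j) + rc d * u) (rc d * v) - L (corner (s j) + rc d * u) (rc d * v)) -
    (seg (corner (s j)) (rc d * v) - L (corner (s j)) (rc d * v))).
  by rewrite /cell /para /L Ed; ring.
have B : nc (rc d * u * ((seg (corner (s j)) (rc d * u) - L (corner (s j)) (rc d * u)) -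
    (seg (corner (s j) + rc d * v) (rc d * u) - L (corner (s j) + rc d * v) (rc d * u))) +
  rc d * v * ((seg (corner (s j) + rc d * u) (rc d * v) - L (corner (s j) + rc d * u) (rc d * v)) -
    (seg (corner (s j)) (rc d * v) - L (corner (s j)) (rc d * v)))) <=
  d * nc u * (4 * (d * m * e1)) + d * nc v * (4 * (d * m * e1)).
  apply: (le_trans (ncD _ _)); rewrite !ncM !nc_rc ger0_norm//.
  have four (a b : C) : nc a <= 2 * (d * m * e1) -> nc b <= 2 * (d * m * e1) ->
      nc (a - b) <= 4 * (d * m * e1).
    by move=> h1 h2; apply: (le_trans (ncDB _ _)); apply: (le_trans (lerD h1 h2)); rewrite -mulrDl -natrD.
  by apply: lerD; rewrite ler_wpM2l ?mulr_ge0 ?nc_ge0//; exact: four.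
apply: (le_trans (ler_wpM2l _ B)); first by rewrite exprn_ge0.
have -> : 4 ^+ j * (d * nc u * (4 * (d * m * e1)) + d * nc v * (4 * (d * m * e1))) =
    (4 ^+ j * (d * d)) * (4 * m ^+ 2 * e1) by rewrite /m; ring.
(* The loss 4^j of the bisection is exactly offset by the area factor d^2 of the small cell. *)
have -> : 4 ^+ j * (d * d) = 1.
  rewrite Ed /dy -exprMn -exprMn.
  have -> : 4 * (2^-1 * 2^-1) = 1 :> R by field.
  by rewrite expr1n.
rewrite mul1r /e1 mulrA ler_pdivrMr// (mulrC _ e) ler_pM2l//.
by rewrite (le_trans (y := 8 * m ^+ 2))// ?lerDl// ler_wpM2r ?exprn_ge0// ler_nat.
Qed.
End Parallelogram.
End OneFunction.
End Goursat.

(** * Cauchy's formula for the derivative on a circle *)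

Section Cauchy.
Local Open Scope complex_scope.
Variable R : realType.
Local Notation C := (cplx R).

Lemma ei_continuous (s : R) : ei t @[t --> s] --> ei s.
Proof. exact: rder_cvg (rder_ei s). Qed.

(** The exponential unrolls the annulus into a rectangle with sides ln r2 - ln r1 and 2 pi i. By
    periodicity the two horizontal sides cancel in [goursat]; the two vertical ones are the two
    means. *)
Lemma circle_mean (h : C -> C) (r1 r2 : R) : 0 < r1 -> r1 <= r2 ->
  (forall w, r1 <= nc w <= r2 -> exists c, zder h w c) ->
  cintegral01 (fun s => h (rc r1 * ei s)) = cintegral01 (fun s => h (rc r2 * ei s)).
Proof.
move=> r10 r12 H; have r20 : 0 < r2 by rewrite (lt_le_trans r10).
pose k (w : C) := h (cexp w).
pose p : C := rc (ln r1); pose u : C := rc (ln r2 - ln r1).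
have Ecexp (s t : R) : cexp (p + rc s * u + rc t * two_pi_i R) =
    rc (expR (ln r1 + s * (ln r2 - ln r1))) * ei t.
  rewrite cexpE; congr (rc (expR _) * cis _).
    by rewrite /p /u !ReD !ReMr /= mulr0 addr0.
  by rewrite /p /u !ImD !ImMr /= mulr0 addr0 add0r mulrC.
have kd : in_para p u (two_pi_i R) (fun z => exists c, zder k z c).
  move=> s t /andP[s0 s1] _; set w := _ + _.
  have [c Hc] : exists c, zder h (cexp w) c.
    apply: H; rewrite /w Ecexp ncM nc_ei mulr1 nc_rc ger0_norm ?expR_ge0//.
    have l12 : 0 <= ln r2 - ln r1 by rewrite subr_ge0 ler_ln ?posrE.
    rewrite -{1}(lnK (x := r1)) ?posrE// -{3}(lnK (x := r2)) ?posrE// !ler_expR.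
    by rewrite lerDl mulr_ge0//= -lerBrDl ler_piMl.
  by exists (c * cexp w); exact: (zder_comp (u := @cexp R) Hc (zder_cexp w)).
have := goursat kd; rewrite /para.
have per (s : R) : k (p + two_pi_i R + rc s * u) = k (p + rc s * u).
  rewrite /k; have := Ecexp s 1; have := Ecexp s 0.
  rewrite rc1 mul1r rc0 mul0r addr0 addrAC => -> ->.
  by rewrite ei0 ei1.
have -> : seg k (p + two_pi_i R) u = seg k p u.
  by congr cintegral01; apply/funext => s; exact: per.
rewrite subrr mulr0 add0r => /eqP; rewrite mulf_eq0 (negPf (@two_pi_i_neq0 R)) /=.
rewrite subr_eq0 => /eqP E.
have E1 (t : R) : k (p + rc t * two_pi_i R) = h (rc r1 * ei t).
  have := Ecexp 0 t; rewrite rc0 mul0r addr0 mul0r addr0 lnK ?posrE// /k => ->.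
  by [].
have E2 (t : R) : k (p + u + rc t * two_pi_i R) = h (rc r2 * ei t).
  have e : ln r1 + (ln r2 - ln r1) = ln r2 by ring.
  have := Ecexp 1 t; rewrite rc1 !mul1r e lnK ?posrE// /k => ->.
  by [].
have F1 : cintegral01 (fun s => h (rc r1 * ei s)) = seg k p (two_pi_i R).
  by congr cintegral01; apply/funext => s; rewrite E1.
have F2 : cintegral01 (fun s => h (rc r2 * ei s)) = seg k (p + u) (two_pi_i R).
  by congr cintegral01; apply/funext => s; rewrite E2.
by rewrite F1 F2 E.
Qed.

(** By [circle_mean] the mean of the difference quotient is the same on all smaller circles, and it
    tends to [c] as the radius shrinks. *)
Lemma cauchy_derivative (g : C -> C) (z0 c : C) (r : R) : 0 < r ->
  (forall w, nc (w - z0) <= r -> exists d, zder g w d) -> zder g z0 c ->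
  cintegral01 (fun s => (g (z0 + rc r * ei s) - g z0) / (rc r * ei s)) = c.
Proof.
move=> r0 H dg; pose h (w : C) := (g (z0 + w) - g z0) / w.
have hd w : 0 < nc w <= r -> exists d, zder h w d.
  move=> /andP[w0 wr]; rewrite nc_gt0 in w0.
  have [|d Hd] := H (z0 + w); first by rewrite addrC addKr.
  have sh : zder (fun w => z0 + w) w 1.
    by apply: ucder_eq (ucderD (ucder_cst _ _ z0) (zder_id w)) => k t _ /=; rewrite add0r.
  have H1 := ucderB (zder_comp (u := fun w => z0 + w) Hd sh) (ucder_cst _ _ (g z0)).
  have H2 := ucderV (fun (t : R) _ => w0) (zder_id w).
  by apply: (cder1_ex (x := @xC R)); eexists; exact: (ucderM H1 H2).
have cont (q : R) : 0 < q <= r -> contC 0 1 (fun s => h (rc q * ei s)).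
  move=> /andP[q0 qr]; apply/contCP => s _.
  have [d /zder_cvg Hd] : exists d, zder h (rc q * ei s) d.
    by apply: hd; rewrite ncM nc_rc nc_ei mulr1 gtr0_norm// q0.
  have ce : rc q * ei t @[t --> s] --> rc q * ei s.
    exact: (cvgM (cvg_cst _) (@ei_continuous s)).
  exact: (cvg_comp _ _ ce Hd).
apply/eqP; rewrite -subr_eq0; apply/eqP; apply: nc_small => e e0.
have e20 : 0 < e / 2 by rewrite divr_gt0.
have /nbhs_ncP[d d0 Hd] := (zder_eps _ _ _).1 dg _ e20.
pose q := Num.min r (d / 2).
have q0 : 0 < q by rewrite lt_min r0 divr_gt0.
have qr : q <= r by rewrite ge_min lexx.
have qd : q < d by rewrite gt_min ltr_pdivrMr// ltr_pMr// ltr1n orbT.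
have -> : cintegral01 (fun s => (g (z0 + rc r * ei s) - g z0) / (rc r * ei s)) =
    cintegral01 (fun s => h (rc q * ei s)).
  symmetry; apply: circle_mean => // w /andP[qw wr]; apply: hd.
  by rewrite (lt_le_trans q0 qw).
have cq : contC 0 1 (fun s => h (rc q * ei s)) by apply: cont; rewrite q0.
have cc : contC 0 1 (fun _ : R => c) by exact: contC_cst.
have Ec : cintegral01 (fun _ : R => c) = c.
  have dF (t : R) : rder (fun s => rc s * c) t c.
    have := rder_affine 0 c t; have -> : (fun s : R => 0 + rc s * c) = fun s => rc s * c.
      by apply/funext => s; rewrite add0r.
    exact.
  rewrite (@cFTC01 R (fun _ => c) (fun s => rc s * c) cc).
  - by rewrite rc1 rc0 mul1r mul0r subr0.
  - by apply/contCP => t _; exact: rder_cvg (dF t).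
  - by move=> t _; exact: dF.
rewrite -{1}Ec -(JB (cint_functional R) cq cc).
have -> : e = 2 * (1 - 0) * (e / 2) by rewrite subr0 mulr1 mulrC divfK.
apply: (cint_bound (@ltr01 R) (contCB cq cc)) => s _; apply: ltW.
have nq : nc (rc q * ei s) = q by rewrite ncM nc_rc nc_ei mulr1 gtr0_norm.
have := Hd (z0 + rc q * ei s); rewrite /h addrC addKr nq; apply => //.
by rewrite -subr_eq0 addrC addKr -nc_gt0 nq.
Qed.

End Cauchy.

Lemma cvg_const (T S : topologicalType) (a : T) (c : S) : (fun _ : T => c) b @[b --> a] --> c.
Proof. exact: cvg_cst. Qed.
Lemma cvg_ident (T : topologicalType) (a : T) : id b @[b --> a] --> a.
Proof. exact: cvg_id. Qed.

(** * Second partial derivatives of differentiable functions of several variables *)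

Section Partials.
Local Open Scope complex_scope.
Variable R : realType.
Variable n : nat.
Local Notation C := (cplx R).
Local Notation pt := 'rV[C]_n.
Implicit Types (a b : pt) (f : pt -> C) (U : set pt).
Local Notation e_ i := (delta_mx 0 i : pt).

Lemma cvg_shift (T : topologicalType) (u : T -> pt) (v : T -> C) (a : T) i :
  u b @[b --> a] --> u a -> v b @[b --> a] --> v a ->
  u b + v b *: e_ i @[b --> a] --> u a + v a *: e_ i.
Proof.
move=> cu cv A /nbhs_rVP[e e0 He].
have e20 : 0 < e / 2 by rewrite divr_gt0.
have N1 : \forall b \near a, forall k, nc (u b 0 k - u a 0 k) < e / 2.
  have M : nbhs (u a) (fun w : pt => forall k, nc (w 0 k - u a 0 k) < e / 2).
    by apply/nbhs_rVP; exists (e / 2).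
  exact: cu M.
have /cvg_ncP /(_ _ e20) N2 := cv.
apply: filterS2 N1 N2 => b H1 H2; apply: He => k; rewrite !mxE.
have -> : u b 0 k + v b * ((0 == 0 :> 'I_1) && (k == i))%:R -
    (u a 0 k + v a * ((0 == 0 :> 'I_1) && (k == i))%:R) =
    (u b 0 k - u a 0 k) + (v b - v a) * (k == i)%:R by rewrite eqxx /=; ring.
apply: (le_lt_trans (ncD _ _)); rewrite [ltRHS]splitr ltr_leD//.
by case: (k == i); rewrite ?mulr1 ?mulr0 ?nc0; apply: ltW.
Qed.

Lemma vder_line f a (b : C) i (g : 'I_n -> C) : vder f (a + b *: e_ i) g ->
  zder (fun z => f (a + z *: e_ i)) b (g i).
Proof.
move=> H.
have cu : a + z *: e_ i @[z --> b] --> a + b *: e_ i.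
  exact: (@cvg_shift C (fun _ => a) id b i (@cvg_const C pt b a) (@cvg_ident C b)).
have Hk (k : 'I_n) : cder (@xC R) b (fun z : C => xV k (a + z *: e_ i)) (fun _ => (k == i)%:R).
  have E : (fun z : C => xV k (a + z *: e_ i)) = fun z => a 0 k + z * (k == i)%:R.
    by apply/funext => z; rewrite /xV !mxE eqxx.
  rewrite E.
  have D := ucderD (ucder_cst (@xC R) b (a 0 k)) (ucderM (zder_id b) (ucder_cst _ _ (k == i)%:R)).
  by apply: ucder_eq D => l t _ /=; rewrite add0r mul1r mulr0 addr0.
have := cder_chain (u := fun z : C => a + z *: e_ i) H cu Hk.
apply: ucder_eq => k t _; rewrite (bigD1 i)//= eqxx mulr1 big1 ?addr0// => j ji.
by rewrite (negPf ji) mulr0.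
Qed.


Transparent jc.
Lemma jc_joint (T : topologicalType) (a : T) (f : T -> R -> C) :
  (\forall b \near a, forall t : R, 0 <= t <= 1 -> f p.1 p.2 @[p --> (b, t)] --> f b t) ->
  jc a f.
Proof.
move=> H; split; first exact: (nbhs_singleton H).
apply: filterS H => b H t tI; have cs : (fun s => (b, s)) @ t --> (b, t).
  move=> Z [[A B] /= [aA tB] AB]; rewrite /nbhs /=; apply: filterS tB => s Bs.
  by apply: AB; split => //=; exact: nbhs_singleton aA.
exact: (cvg_comp _ _ cs (H t tI)).
Qed.
Opaque jc.

Definition box a (r : R) : set pt := [set b | forall k, nc (b 0 k - a 0 k) < r].

Lemma box_nbhs a r : 0 < r -> nbhs a (box a r).
Proof. by move=> r0; apply/nbhs_rVP; exists r. Qed.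

Lemma open_box U a : open U -> U a -> exists2 r : R, 0 < r & box a r `<=` U.
Proof. by move=> oU Ua; have /nbhs_rVP[r r0 H] := open_nbhs_nbhs (conj oU Ua); exists r. Qed.

Lemma box_open a r : 0 < r -> forall b, box a r b -> nbhs b (box a r).
Proof.
move=> r0 b Hb.
apply: (@near_all pt _ b) => k.
have /cvg_ncP H := @xV_cvg R n k b.
have e0 : 0 < r - nc (b 0 k - a 0 k) by rewrite subr_gt0.
apply: filterS (H _ e0) => c; rewrite /xV ltrBrDr => /(le_lt_trans _); apply.
by apply: le_trans (ncD _ _); rewrite addrA subrK.
Qed.

Lemma rV_cvg (T : topologicalType) (u : T -> pt) (a : T) :
  (forall k, u b 0 k @[b --> a] --> u a 0 k) -> u b @[b --> a] --> u a.
Proof.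
move=> H A /nbhs_rVP[e e0 He]; rewrite /nbhs /=.
have N : \forall b \near a, forall k, nc (u b 0 k - u a 0 k) < e.
  by apply: near_all => k; have /cvg_ncP := H k; apply.
by apply: filterS N => b /He.
Qed.

Lemma rV_coord_cvg (T : topologicalType) (u : T -> pt) (a : T) (c : pt) :
  u b @[b --> a] --> c -> forall k, u b 0 k @[b --> a] --> c 0 k.
Proof. by move=> H k; exact: (cvg_comp _ _ H (@xV_cvg R n k c)). Qed.

Lemma cvg_scale_add (T : topologicalType) (u h : T -> pt) (w : T -> C) (a : T) :
  u b @[b --> a] --> u a -> h b @[b --> a] --> h a -> w b @[b --> a] --> w a ->
  u b + w b *: h b @[b --> a] --> u a + w a *: h a.
Proof.
move=> cu ch cw; refine (@rV_cvg T (fun q => u q + w q *: h q) a _) => k.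
have E q : (u q + w q *: h q) 0 k = u q 0 k + w q * h q 0 k by rewrite !mxE.
rewrite E; under eq_fun do rewrite E.
have h1 := @rV_coord_cvg T u a (u a) cu k; have h2 := @rV_coord_cvg T h a (h a) ch k.
exact: (cvgD h1 (cvgM cw h2)).
Qed.

Section Smooth.
Variables (f : pt -> C) (U : set pt).
Hypothesis oU : open U.
Hypothesis df : forall b, U b -> differentiable f b.

Definition pd i b : C := 'D_(e_ i) f b.

Lemma pd_vder b : U b -> vder f b (pd^~ b).
Proof. by move=> Ub; exact: differentiable_vder (df Ub). Qed.

Lemma diff_cvg b : U b -> f c @[c --> b] --> f b.
Proof. by move/df/differentiable_continuous. Qed.

Lemma cauchy_pd i (r : R) b (g : pt -> C) (dg : 'I_n -> C) : 0 < r ->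
  (forall w, nc w <= r -> differentiable g (b + w *: e_ i)) -> vder g b dg ->
  cintegral01 (fun s => (g (b + (rc r * ei s) *: e_ i) - g b) / (rc r * ei s)) = dg i.
Proof.
move=> r0 H Hb.
have dc : zder (fun z => g (b + z *: e_ i)) 0 (dg i).
  by apply: vder_line; rewrite scale0r addr0.
have Hw (w : C) : nc (w - 0) <= r -> exists d, zder (fun z => g (b + z *: e_ i)) w d.
  rewrite subr0 => /H /differentiable_vder Hd; eexists; exact: (vder_line Hd).
rewrite -(cauchy_derivative r0 Hw dc); congr cintegral01; apply/funext => s.
by rewrite add0r scale0r addr0.
Qed.

Section AtPoint.
Variables (a : pt) (r : R).
Hypotheses (r0 : 0 < r) (HU : box a (4 * r) `<=` U).

(** The point is at distance less than 4 r from [a] in every coordinate: at most r from [b], r from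
    [c] and r from [w]. Hence the radius 4 r in [HU]. *)
Lemma box_shift b c (w : C) i (t : R) : box a r b -> box a r c -> nc w <= r ->
  0 <= t <= 1 -> U (b + rc t *: (c - b) + w *: e_ i).
Proof.
move=> Hb Hc wr /andP[t0 t1]; apply: HU => k; rewrite !mxE.
have -> : b 0 k + rc t * (c 0 k - b 0 k) + w * ((0 == 0 :> 'I_1) && (k == i))%:R - a 0 k =
  rc (1 - t) * (b 0 k - a 0 k) + rc t * (c 0 k - a 0 k) + w * (k == i)%:R.
  by rewrite eqxx rcB rc1 /=; ring.
apply: (le_lt_trans (ncD _ _)); apply: (le_lt_trans (y := (r + r) + r)).
  apply: lerD; last by case: (k == i); rewrite ?mulr1 ?mulr0 ?nc0// ltW.
  apply: (le_trans (ncD _ _)); rewrite !ncM !nc_rc !ger0_norm ?subr_ge0//.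
  apply: lerD; last by rewrite -[leRHS]mul1r ler_pM ?nc_ge0// ltW.
  by rewrite -[leRHS]mul1r ler_pM ?nc_ge0 ?subr_ge0 ?gerBl// ltW.
by move: (r) r0 => q q0; lra.
Qed.

Let z01 : 0 <= (0 : R) <= 1. Proof. by apply/andP; split; lra. Qed.

Lemma box_U b : box a r b -> U b.
Proof.
move=> Hb; have [i|n0] := pickP (@predT 'I_n).
  have := @box_shift b b 0 i 0 Hb Hb _ z01; rewrite nc0 => /(_ (ltW r0)).
  by rewrite rc0 !scale0r !addr0.
by apply: HU => k; have := n0 k.
Qed.

Lemma circle_U b i (s : R) : box a r b -> U (b + (rc r * ei s) *: e_ i).
Proof.
move=> Hb; have := @box_shift b b (rc r * ei s) i 0 Hb Hb _ z01.
rewrite rc0 scale0r addr0; apply.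
by rewrite ncM nc_rc nc_ei mulr1 gtr0_norm.
Qed.

Definition dq (b : pt) i (s : R) : C :=
  (f (b + (rc r * ei s) *: e_ i) - f b) / (rc r * ei s).

Lemma pdE b i : box a r b -> pd i b = cintegral01 (dq b i).
Proof.
move=> Hb; rewrite /dq (cauchy_pd (dg := pd^~ b) r0)//; last exact: pd_vder (box_U Hb).
move=> w wr; apply: df; have := @box_shift b b w i 0 Hb Hb wr z01.
by rewrite rc0 scale0r addr0.
Qed.

Lemma rei_neq0 (s : R) : rc r * ei s != 0.
Proof. by rewrite mulf_neq0 ?ei_neq0// rc_eq0 gt_eqF. Qed.

Lemma rei_cvg (T : topologicalType) (b : T) (t : R) :
  rc r * ei p.2 @[p --> (b, t)] --> rc r * ei t.
Proof.
have c2 : p.2 @[p --> (b, t)] --> t by exact: cvg_snd.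
exact: (cvgM (cvg_cst _) (cvg_comp _ _ c2 (@ei_continuous R t))).
Qed.

Lemma dq_jc i b0 : box a r b0 -> jc b0 (fun b s => dq b i s).
Proof.
move=> Hb0; apply: jc_joint; apply: filterS (box_open r0 Hb0) => b Hb t tI.
have c1 : p.1 @[p --> (b, t)] --> b by exact: cvg_fst.
have ce := @rei_cvg pt b t.
have cs := cvg_shift (i := i) (u := fun p : pt * R => p.1)
  (v := fun p : pt * R => rc r * ei p.2) (a := (b, t)) c1 ce.
have cf := diff_cvg (@circle_U b i t Hb).
have cf2 := diff_cvg (box_U Hb).
have h1 := cvg_comp _ _ cs cf; have h2 := cvg_comp _ _ c1 cf2.
exact: (cvgM (cvgB h1 h2) (cvgV (rei_neq0 t) ce)).
Qed.

(** By [pdE] the partial derivative is a circle mean of values of [f], and [f] is continuous. *)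
Lemma pd_cvg_at i : pd i b @[b --> a] --> pd i a.
Proof.
have Ha : box a r a by move=> k; rewrite subrr nc0.
have j := dq_jc i Ha.
have H := J_cvg (cint_functional R) j; rewrite -(pdE _ Ha) in H.
by apply: cvg_near_eq H; apply: filterS (box_nbhs a r0) => b Hb; rewrite pdE.
Qed.
End AtPoint.

Lemma small_box a : U a -> exists2 r, 0 < r & box a (4 * r) `<=` U.
Proof.
move=> /(open_box oU)[r r0 H]; exists (r / 4); first by rewrite divr_gt0.
by rewrite mulrC divfK.
Qed.

Lemma pd_cvg i a : U a -> pd i b @[b --> a] --> pd i a.
Proof. by move=> /small_box[r r0 H]; exact: (pd_cvg_at r0 H). Qed.

(** Hadamard's lemma. The means of the partial derivatives along the segment are slopes, and they
    are continuous by [pd_cvg]. *)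
Lemma mvt_integral b h : (forall t : R, 0 <= t <= 1 -> U (b + rc t *: h)) ->
  f (b + h) - f b = \sum_k h 0 k * cintegral01 (fun t => pd k (b + rc t *: h)).
Proof.
move=> HU; pose u (t : R) : pt := b + rc t *: h.
have cu t : u s @[s --> t] --> u t.
  exact: (@cvg_scale_add R (fun _ => b) (fun _ => h) rc t (@cvg_const R pt t b)
    (@cvg_const R pt t h) (@rc_cvg R t)).
have du k t : rder (fun s => xV k (u s)) t (h 0 k).
  have E : (fun s => xV k (u s)) = fun s => b 0 k + rc s * h 0 k.
    by apply/funext => s; rewrite /xV /u !mxE.
  by rewrite E; exact: rder_affine.
have dF t : 0 <= t <= 1 -> rder (fun s => f (u s)) t (\sum_k pd k (u t) * h 0 k).
  by move=> /HU Ut; exact: (@cder_chain R R pt 1 n (@xR R) (@xV R n) u f t (pd^~ (u t))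
    (fun k _ => h 0 k) (pd_vder Ut) (cu t) (fun k => du k t)).
have cpd k : contC 0 1 (fun t => pd k (u t)).
  by apply/contCP => t /HU Ut; exact: (cvg_comp _ _ (cu t) (@pd_cvg k _ Ut)).
have cS k : contC 0 1 (fun t => pd k (u t) * h 0 k).
  exact: (contCM (cpd k) (@contC_cst R 0 1 _)).
have := cFTC01 (contC_sum (P := xpredT) (r := index_enum 'I_n) (fun k _ => cS k))
  (F := fun s => f (u s)).
rewrite /u rc1 rc0 scale1r scale0r addr0 -/u => <-.
- rewrite (J_sum (cint_functional R) (index_enum 'I_n) (P := xpredT) (fun k _ => cS k)).
  apply: eq_bigr => k _; rewrite -(JZ (cint_functional R) (h 0 k) (cpd k)).
  by congr cintegral01; apply/funext => t; rewrite mulrC.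
- by apply/contCP => t /dF /rder_cvg.
- by move=> t /andP[/ltW t0 /ltW t1]; apply: dF; rewrite t0 t1.
Qed.

Lemma cint_const (c : C) : cintegral01 (fun _ : R => c) = c.
Proof.
have dF (t : R) : rder (fun s => 0 + rc s * c) t c by exact: rder_affine.
rewrite (@cFTC01 R (fun _ => c) (fun s => 0 + rc s * c) (@contC_cst R 0 1 c)).
- by rewrite rc1 rc0 mul1r mul0r !add0r subr0.
- by apply/contCP => t _; exact: rder_cvg (dF t).
- by move=> t _; exact: dF.
Qed.

Section Second.
Variables (a : pt) (r : R) (i : 'I_n).
Hypotheses (r0 : 0 < r) (HU : box a (4 * r) `<=` U).

Let Ha : box a r a. Proof. by move=> k; rewrite subrr nc0. Qed.
Let w (s : R) : C := rc r * ei s.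
Definition ddq k (s : R) : C := (pd k (a + w s *: e_ i) - pd k a) / w s.
(** The Hadamard slope of b |-> f(b + q(s) e_i) at [a] in direction [k]. *)
Definition Psi (q : R -> C) k (b : pt) (s : R) : C :=
  cintegral01 (fun t => pd k (a + q s *: e_ i + rc t *: (b - a))).

Lemma Psi_jc (q : R -> C) k : (forall s : R, q t @[t --> s] --> q s) -> (forall s, nc (q s) <= r) ->
  jc a (Psi q k).
Proof.
move=> cq qr; apply: jc_joint; apply: filterS (box_nbhs a r0) => b Hb s sI.
have HUt (c : pt) (u t : R) : box a r c -> 0 <= t <= 1 -> U (a + q u *: e_ i + rc t *: (c - a)).
  move=> Hc tI; have := box_shift r0 HU i Ha Hc (qr u) tI.
  by rewrite addrAC.
have j : jc (b, s) (fun (p : pt * R) t => pd k (a + q p.2 *: e_ i + rc t *: (p.1 - a))).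
  apply: jc_joint; exists (box a r, setT) => /=.
    by split; [exact: box_open|exact: filterT].
  move=> [c u] [/= Hc _] t tI.
  have c1 : p.1.1 @[p --> ((c, u), t)] --> c.
    exact: (cvg_comp _ _ cvg_fst cvg_fst).
  have c2 : p.1.2 @[p --> ((c, u), t)] --> u.
    exact: (cvg_comp _ _ cvg_fst cvg_snd).
  have c3 : p.2 @[p --> ((c, u), t)] --> t by exact: cvg_snd.
  have cA := @cvg_shift (pt * R * R)%type (fun _ => a)
     (fun p => q p.1.2) ((c, u), t) i (@cvg_const (pt * R * R)%type pt ((c, u), t) a) (cvg_comp _ _ c2 (cq u)).
  have cB : p.1.1 - a @[p --> ((c, u), t)] --> c - a.
    have := @cvg_scale_add (pt * R * R)%type (fun p => p.1.1)
      (fun _ => a) (fun _ => -1 : C) ((c, u), t) c1 (@cvg_const (pt * R * R)%type pt ((c, u), t) a)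
      (@cvg_const (pt * R * R)%type C ((c, u), t) (-1 : C)).
    by rewrite scaleN1r; exact.
  have cC := @cvg_scale_add (pt * R * R)%type
     (fun p => a + q p.1.2 *: e_ i) (fun p => p.1.1 - a) (fun p => rc p.2)
     ((c, u), t) cA cB (cvg_comp _ _ c3 (@rc_cvg R t)).
  exact: (cvg_comp _ _ cC (@pd_cvg k _ (HUt c u t Hc tI))).
exact: (J_cvg (cint_functional R) j).
Qed.

Lemma w_cvg (s : R) : w t @[t --> s] --> w s.
Proof. exact: (cvgM (cvg_cst _) (@ei_continuous R s)). Qed.
Lemma nc_w s : nc (w s) <= r.
Proof. by rewrite ncM nc_rc nc_ei mulr1 gtr0_norm. Qed.
Lemma w_neq0 s : w s != 0. Proof. exact: rei_neq0. Qed.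

Lemma Psi_a q k s : Psi q k a s = pd k (a + q s *: e_ i).
Proof.
transitivity (cintegral01 (fun _ : R => pd k (a + q s *: e_ i))); last exact: cint_const.
apply: (congr1 (@cintegral01 R)); apply: functional_extensionality_dep => t.
by rewrite (subrr a) scaler0 addr0.
Qed.

Transparent ucder.
Lemma dq_ucder : ucder (@xV R n) a (fun b s => dq r b i s) ddq.
Proof.
split; first exact: (dq_jc r0 HU i Ha).
exists (fun k b s => (Psi w k b s - Psi (fun _ => 0) k b s) / w s); split=> [k|k s sI|].
- have j0 : jc a (Psi (fun _ => 0) k).
    apply: Psi_jc => s; first exact: cvg_cst.
    by rewrite nc0 ltW.
  have jw : jc a (Psi w k) by apply: Psi_jc => s; [exact: w_cvg|exact: nc_w].
  have ji : jc a (fun _ s => (w s)^-1).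
    by apply: jc_t => s _; exact: (cvgV (w_neq0 s) (@w_cvg s)).
  exact: (jcM (jcB jw j0) ji).
- by rewrite !Psi_a /ddq scale0r addr0.
apply: filterS (box_nbhs a r0) => b Hb s sI.
have M q : nc q <= r -> f (b + q *: e_ i) - f (a + q *: e_ i) =
    \sum_k (b 0 k - a 0 k) * Psi (fun _ => q) k b s.
  move=> qr; have -> : b + q *: e_ i = a + q *: e_ i + (b - a).
    by rewrite addrAC [a + (b - a)]addrC subrK.
  rewrite mvt_integral => [|t tI]; last first.
    by have := box_shift r0 HU i Ha Hb qr tI; rewrite addrAC.
  by apply: eq_bigr => k _; rewrite !mxE.
have M0 := M 0; rewrite nc0 !scale0r !addr0 in M0.
have Mw := M (w s) (nc_w s).
rewrite /dq -/(w s) -mulrBl.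
have -> : f (b + w s *: e_ i) - f b - (f (a + w s *: e_ i) - f a) =
   (f (b + w s *: e_ i) - f (a + w s *: e_ i)) - (f b - f a) by ring.
rewrite Mw (M0 (ltW r0)) -sumrB mulr_suml; apply: eq_bigr => k _.
by rewrite /xV mulrA mulrBr.
Qed.

(** Formula [pdE] is differentiated under the integral sign; a second derivative is thus a circle
    mean of difference quotients of first derivatives. *)
Lemma pd_vder_int : vder (pd i) a (fun k => cintegral01 (ddq k)).
Proof.
have cg k : contC 0 1 (ddq k).
  apply/contCP => s _.
  have cA : a + w t *: e_ i @[t --> s] --> a + w s *: e_ i.
    exact: (@cvg_shift R (fun _ => a) w s i (@cvg_const R pt s a) (@w_cvg s)).
  have cp := cvg_comp _ _ cA (@pd_cvg k _ (circle_U r0 HU i s Ha)).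
  exact: (cvgM (cvgB cp (cvg_cst _)) (cvgV (w_neq0 s) (@w_cvg s))).
have := J_cder (cint_functional R) cg dq_ucder.
apply: ucder_ext; apply: filterS (box_nbhs a r0) => b Hb t.
by rewrite (pdE r0 HU).
Qed.
End Second.

Lemma pd_differentiable i a : U a -> differentiable (pd i) a.
Proof. by move=> /small_box[r r0 H]; exact: vder_differentiable (pd_vder_int i r0 H). Qed.

End Smooth.

(** Both sides equal the circle mean of [ddq] in directions [i] and [k]: one by Cauchy's formula
    applied to [pd f k] along [i], the other by [pd_vder_int]. *)
Theorem partial_sym f U a i k : open U -> (forall b, U b -> differentiable f b) -> U a ->
  'D_(e_ i) (pd f k) a = 'D_(e_ k) (pd f i) a.
Proof.
move=> oU df Ua; have [r r0 HU] := small_box oU Ua.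
have H := pd_vder_int oU df i r0 HU.
have [_ E] := vder_Dv (e_ k) H; apply: (eq_trans _ (esym E)).
have -> : \sum_k0 (e_ k) 0 k0 * cintegral01 (ddq f a r i k0) = cintegral01 (ddq f a r i k).
  rewrite (bigD1 k)//= mxE !eqxx mul1r big1 ?addr0 => [|l lk]; first by [].
  by rewrite mxE (negPf lk) andbF mul0r.
have Ha : box a r a by move=> j; rewrite subrr nc0.
have Hd := differentiable_vder (pd_differentiable oU df k Ua).
apply: (eq_trans (esym (cauchy_pd (g := pd f k) (dg := fun j => 'D_(e_ j) (pd f k) a) (i := i) r0 _ Hd))).
  move=> w wr; apply: (pd_differentiable oU df).
  have := @box_shift U a r r0 HU a a w i 0 Ha Ha wr; rewrite rc0 scale0r addr0.
  by apply; apply/andP; split; lra.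
by apply: (congr1 (@cintegral01 R)); apply: functional_extensionality_dep => t.
Qed.
End Partials.

(** * Lagrange interpolation and top coefficients of remainders *)

Lemma coefM_top (F : fieldType) (p q : {poly F}) k l : (size p <= k.+1)%N ->
  (size q <= l.+1)%N -> (p * q)`_(k + l) = p`_k * q`_l.
Proof.
move=> sp sq; rewrite coefM.
have kl : (k < (k + l).+1)%N by rewrite ltnS leq_addr.
rewrite (bigD1 (Ordinal kl))//= addKn big1 ?addr0// => i /eqP ik.
have [lt|ge] := ltnP i k.
  by rewrite (nth_default 0 (leq_trans sq _)) ?mulr0//; lia.
rewrite (nth_default 0 (leq_trans sp _)) ?mul0r//.
rewrite ltn_neqAle ge andbT; apply/eqP => kE; apply: ik; exact/val_inj.
Qed.

Section Lagrange.
Variables (F : fieldType) (I : finType) (X : I -> F).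
Hypothesis Xinj : injective X.

Definition nodal : {poly F} := \prod_r ('X - (X r)%:P).
Definition conodal r : {poly F} := \prod_(s | s != r) ('X - (X s)%:P).

Lemma nodalE r : nodal = ('X - (X r)%:P) * conodal r.
Proof. by rewrite /nodal (bigD1 r). Qed.

Lemma conodal_monic r : conodal r \is monic.
Proof. by apply: monic_prod => s _; apply: monicXsubC. Qed.

Lemma size_conodal r : size (conodal r) = #|I|.
Proof.
have : size nodal = #|I|.+1 by rewrite size_prod_XsubC /index_enum -enumT -cardE.
rewrite (nodalE r) size_monicM ?monicXsubC ?monic_neq0 ?conodal_monic// size_XsubC.
by move=> [].
Qed.

Lemma conodal_neq r s : s != r -> (conodal r).[X s] = 0.
Proof. by move=> sr; rewrite horner_prod (bigD1 s)//= !hornerE subrr mul0r. Qed.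

Lemma conodal_eq r : (conodal r).[X r] != 0.
Proof.
rewrite horner_prod; apply/prodf_neq0 => s sr; rewrite !hornerE subr_eq0.
by apply: contraNneq sr => /Xinj ->.
Qed.

Lemma poly_eq_at (f g : {poly F}) : (size f <= #|I|)%N -> (size g <= #|I|)%N ->
  (forall r, f.[X r] = g.[X r]) -> f = g.
Proof.
move=> sf sg H; apply/eqP; rewrite -subr_eq0; apply/eqP.
apply: (@roots_geq_poly_eq0 _ _ [seq X r | r in I]).
- by apply/allP => _ /mapP[r _ ->]; rewrite /root !hornerE H subrr.
- by rewrite /image_mem map_inj_uniq ?enum_uniq.
by rewrite size_image (leq_trans (size_polyD _ _))// size_polyN geq_max sf.
Qed.

Lemma lagrange (f : {poly F}) : (size f <= #|I|)%N ->
  f = \sum_r (f.[X r] / (conodal r).[X r]) *: conodal r.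
Proof.
move=> sf; apply: poly_eq_at => // [|s].
  apply: (leq_trans (size_sum _ _ _)); apply/bigmax_leqP => r _.
  by rewrite (leq_trans (size_scale_leq _ _))// size_conodal.
rewrite horner_sum (bigD1 s)//= hornerZ divfK ?conodal_eq// big1 ?addr0// => r rs.
by rewrite eq_sym in rs; rewrite hornerZ (conodal_neq rs) mulr0.
Qed.

(** Each [conodal r] is monic of degree #|I| - 1, so this compares top coefficients in
    [lagrange]. *)
Lemma lagrange_top (f : {poly F}) : (size f <= #|I|)%N ->
  f`_(#|I|.-1) = \sum_r f.[X r] / (conodal r).[X r].
Proof.
move=> sf; rewrite {1}(lagrange sf) coef_sum; apply: eq_bigr => r _.
have /monicP := conodal_monic r.
by rewrite coefZ /lead_coef size_conodal => ->; rewrite mulr1.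
Qed.

Lemma lagrange_frac (f : {poly F}) z : (size f <= #|I|)%N -> (forall r, z != X r) ->
  f.[z] / nodal.[z] = \sum_r f.[X r] / (conodal r).[X r] / (z - X r).
Proof.
move=> sf Hz; rewrite {1}(lagrange sf) horner_sum mulr_suml; apply: eq_bigr => r _.
have z0 s : z - X s != 0 by rewrite subr_eq0.
have c0 : (conodal r).[z] != 0.
  by rewrite horner_prod; apply/prodf_neq0 => s _; rewrite !hornerE.
rewrite (nodalE r) hornerM hornerZ !hornerE; move: (f.[X r] / (conodal r).[X r]) (z0 r) c0 => q.
by move: (z - X r) (conodal r).[z] => u v u0 v0; field; rewrite u0.
Qed.

(** Since deg f < 2 N, the terms of degree 2 N on the right cancel: c r_(N-1) against s_N. At the
    nodes only s P survives. Together they tie a top coefficient to values at the nodes. *)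
Lemma top_coef_bezout (f r s P : {poly F}) (c : F) N : #|I| = N.+1 -> P \is monic ->
  size P = N.+1 -> (size f <= N.*2)%N -> (size r <= N)%N ->
  f = r * (c *: nodal) + s * P -> c != 0 ->
  [/\ (size s <= N.+1)%N, c * r`_N.-1 + s`_N = 0 \/ N = 0%N & (forall i, f.[X i] = s.[X i] * P.[X i])].
Proof.
move=> cI Pm sP sf sr E c0.
have sn : size nodal = N.+2 by rewrite size_prod_XsubC /index_enum -enumT -cardE cI.
have ss : (size s <= N.+1)%N.
  have [->|s0] := eqVneq s 0; first by rewrite size_poly0.
  have : (size (s * P)%R <= N.*2.+1)%N.
    have -> : s * P = f - r * (c *: nodal) by rewrite E addrAC subrr add0r.
    apply: (leq_trans (size_polyD _ _)); rewrite geq_max (leq_trans sf)//= size_polyN.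
    apply: (leq_trans (size_polyMleq _ _)); rewrite size_scale// sn.
    move: (size _) sr => k; lia.
  rewrite size_Mmonic// sP; lia.
split=> //.
  case: N cI sP sf sr sn ss => [|N] cI sP sf sr sn ss; [by right|left].
  have : f`_(N.*2.+2) = 0 by apply: nth_default.
  have e1 : N.*2.+2 = (N + N.+2)%N by lia.
  have e2 : N.*2.+2 = (N.+1 + N.+1)%N by lia.
  rewrite E coefD {1}e1 {1}e2 coefM_top ?size_scale ?sn// coefM_top ?sP//.
  have lcn : nodal`_N.+2 = 1.
    have /monicP : nodal \is monic by apply: monic_prod => i _; apply: monicXsubC.
    by rewrite /lead_coef sn.
  have lcP : P`_N.+1 = 1 by have /monicP := Pm; rewrite /lead_coef sP.
  by rewrite coefZ lcn lcP !mulr1 mulrC.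
move=> i; rewrite E hornerD !hornerM hornerZ.
by rewrite [in nodal.[_]](nodalE i) hornerM hornerXsubC subrr mul0r !mulr0 add0r.
Qed.

End Lagrange.

Section TopCoefficient.
Variables (F : fieldType) (P : {poly F}) (N : nat).
Hypotheses (Pm : P \is monic) (sP : size P = N.+1).
Implicit Types G H : {poly F}.

(** For monic [P] of degree [N] this is the sum of the residues of G / P over all roots of [P]. *)
Definition rho G : F := (G %% P)`_N.-1.

Lemma rhoD G H : rho (G + H) = rho G + rho H.
Proof. by rewrite /rho modpD coefD. Qed.

Lemma rhoZ c G : rho (c *: G) = c * rho G.
Proof. by rewrite /rho modpZl coefZ. Qed.

Lemma rho0 : rho 0 = 0. Proof. by rewrite /rho mod0p coef0. Qed.

Lemma rho_modE G H : G %% P = H %% P -> rho G = rho H.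
Proof. by rewrite /rho => ->. Qed.

(** Multiplying a non-zero remainder by a suitable power of X moves its leading coefficient to
    degree N - 1, where [rho] sees it. *)
Lemma rho_nondeg G : (forall H, (size H <= N)%N -> rho (G * H) = 0) -> G %% P = 0.
Proof.
move=> HG; apply/eqP; apply: contraT => G0.
have P0 : P != 0 by rewrite monic_neq0.
have sG : (size (G %% P)%R <= N)%N by rewrite -ltnS -sP ltn_modp.
have s1 : (0 < size (G %% P)%R)%N by rewrite size_poly_gt0.
have := HG 'X^(N - size (G %% P)); rewrite size_polyXn /rho mulrC -modp_mul mulrC.
have sM : size (G %% P * 'X^(N - size (G %% P))) = N by rewrite size_mulXn// subnK.
have lN : (N - size (G %% P)%R < N)%N by move: s1 sG; move: (size _) => k; lia.
rewrite (@modp_small _ (G %% P * _)) ?sM ?sP// => /(_ lN) E.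
have /eqP : lead_coef (G %% P * 'X^(N - size (G %% P))) = 0 by rewrite lead_coefE sM.
by rewrite lead_coef_eq0 -size_poly_eq0 sM; move: sG s1; move: (size _) => k; lia.
Qed.

End TopCoefficient.

(** * Residues of rational functions *)

Section Residues.
Local Open Scope complex_scope.
Variable R : realType.
Local Notation C := (cplx R).
Implicit Types (f g h : C -> C) (z r : C).

Lemma zder_derivable f z c : zder f z c -> derivable f z 1.
Proof. by move=> /zderP H; exact: ex_derive. Qed.

Lemma holomorphicP h z0 :
  holomorphic_at h z0 <-> \forall z \near z0, exists c, zder h z c.
Proof.
split; apply: filterS => z; first by move=> /derivable_zder H; exists (derive1 h z).
by case=> c; exact: zder_derivable.
Qed.

Lemma zder_rat (p q : {poly C}) z : q.[z] != 0 ->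
  zder (fun w => p.[w] / q.[w]) z ((p^`().[z] * q.[z] - p.[z] * q^`().[z]) / q.[z] ^+ 2).
Proof.
move=> q0; have H := ucderM (zder_horner p z) (ucderV (fun (t : R) _ => q0) (zder_horner q z)).
apply: ucder_eq H => k t _; rewrite /=; move: q0; move: (q.[z]) => u u0.
by field.
Qed.

Lemma holomorphic_rat (p q : {poly C}) z0 : q.[z0] != 0 ->
  holomorphic_at (fun w => p.[w] / q.[w]) z0.
Proof.
move=> q0; apply/holomorphicP.
have N : \forall z \near z0, q.[z] != 0 by exact: (cvg_neq0 (@horner_cvg R q z0) q0).
by apply: filterS N => z /(zder_rat p) H; eexists; exact: H.
Qed.

Lemma holomorphic_cvg h z0 : holomorphic_at h z0 -> h z @[z --> z0] --> h z0.
Proof. by move=> /holomorphicP /nbhs_singleton[c] /zder_cvg. Qed.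

Lemma holomorphicD f g z0 : holomorphic_at f z0 -> holomorphic_at g z0 ->
  holomorphic_at (fun z => f z + g z) z0.
Proof.
move=> /holomorphicP H1 /holomorphicP H2; apply/holomorphicP.
apply: filterS2 H1 H2 => z [c c1] [d d1]; exists (c + d); exact: (ucderD c1 d1).
Qed.

Lemma holomorphicZ c f z0 : holomorphic_at f z0 -> holomorphic_at (fun z => c * f z) z0.
Proof.
move=> /holomorphicP H1; apply/holomorphicP.
apply: filterS H1 => z [d d1]; exists (c * d); exact: (ucderZ c d1).
Qed.

Lemma holomorphic_cst c z0 : holomorphic_at (fun _ => c) z0.
Proof.
apply/holomorphicP; apply: (@nearW _ (nbhs z0)) => z; exists 0; exact: ucder_cst. Qed.

Lemma dnbhs_nc z0 (P : C -> Prop) : (\forall z \near z0^', P z) <->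
  exists2 e : R, 0 < e & forall z, z != z0 -> nc (z - z0) < e -> P z.
Proof.
split.
  rewrite /dnbhs /within /= => H.
  have /nbhs_ncP[e e0 He] : nbhs z0 (fun z => z != z0 -> P z) by exact: H.
  by exists e => // z z1 ze; exact: He.
case=> e e0 H; rewrite /dnbhs /within /=; apply/nbhs_ncP; exists e => // z ze z1.
exact: H.
Qed.

Lemma punctured_eq f g z0 : f z @[z --> z0] --> f z0 -> g z @[z --> z0] --> g z0 ->
  (\forall z \near z0^', f z = g z) -> f z0 = g z0.
Proof.
move=> /cvg_ncP cf /cvg_ncP cg /dnbhs_nc[d d0 H].
apply/eqP; rewrite -subr_eq0; apply/eqP; apply: nc_small => e e0.
have e20 : 0 < e / 2 by rewrite divr_gt0.
have /nbhs_ncP[d1 d10 H1] := cf _ e20; have /nbhs_ncP[d2 d20 H2] := cg _ e20.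
pose q := Num.min d (Num.min d1 d2) / 2.
have q0 : 0 < q by rewrite divr_gt0// !lt_min d0 d10.
have qm : q < Num.min d (Num.min d1 d2).
  by rewrite ltr_pdivrMr// ltr_pMr ?ltr1n// !lt_min d0 d10.
move: qm; rewrite !lt_min => /and3P[q1 q2 q3].
have nq : nc (z0 + rc q - z0) = q by rewrite addrC addKr nc_rc gtr0_norm.
have zq : z0 + rc q != z0 by rewrite -subr_eq0 addrC addKr rc_eq0 gt_eqF.
have E := H _ zq; have E1 := H1 (z0 + rc q); have E2 := H2 (z0 + rc q).
rewrite nq in E E1 E2.
have -> : f z0 - g z0 = - (f (z0 + rc q) - f z0) + (g (z0 + rc q) - g z0).
  by rewrite (E q1); ring.
apply: (le_trans (ncD _ _)); rewrite ncN [leRHS]splitr lerD// ltW//.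
  exact: E1.
exact: E2.
Qed.

(** Multiplying by the highest power of z - z0 and letting z tend to z0 kills the deepest
    coefficient; the others follow by induction. *)
Lemma principal_part0 (K : nat) (d : nat -> C) g z0 : g z @[z --> z0] --> g z0 ->
  (\forall z \near z0^', \sum_(k < K) d k / (z - z0) ^+ k.+1 = g z) ->
  forall k, (k < K)%N -> d k = 0.
Proof.
move=> cg; elim: K => [//|K IH] H.
have cw : (z - z0) @[z --> z0] --> z0 - z0 by exact: (cvgB cvg_id (cvg_cst z0)).
pose p : {poly C} := \sum_(k < K.+1) d k *: ('X - z0%:P) ^+ (K - k).
have dK : d K = 0.
  have E : p.[z0] = (z0 - z0) ^+ K.+1 * g z0.
    apply: (@punctured_eq (horner p) (fun z => (z - z0) ^+ K.+1 * g z) z0).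
    - exact: horner_cvg.
    - have cx : (z - z0) ^+ K.+1 @[z --> z0] --> (z0 - z0) ^+ K.+1.
        exact: (@cvg_expc R C (nbhs z0) _ (fun z => z - z0) _ K.+1 cw).
      exact: (cvgM cx cg).
    move/dnbhs_nc: H => [e e0 He]; apply/dnbhs_nc; exists e => // z z1 ze.
    have w0 : z - z0 != 0 by rewrite subr_eq0.
    rewrite -(He z z1 ze) /p horner_sum mulr_sumr; apply: eq_bigr => k _.
    rewrite !hornerE; move: (z - z0) w0 => w w0.
    have kK : (k <= K)%N by rewrite -ltnS.
    have -> : w ^+ K.+1 = w ^+ (K - k) * w ^+ k.+1 by rewrite -exprD addnS subnK.
    have := expf_neq0 k.+1 w0; move: (w ^+ k.+1) (w ^+ (K - k)) => u v u0.
    change (d k * v = v * u * d k / u); by field.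
  move: E; rewrite subrr expr0n mul0r /p horner_sum big_ord_recr /= subnn.
  rewrite big1 ?add0r => [|k _]; first by rewrite expr0 !hornerE.
  by rewrite !hornerE subrr expr0n subn_eq0 leqNgt ltn_ord mulr0.
move=> k; rewrite ltnS leq_eqVlt => /predU1P[->//|]; apply: IH.
move/dnbhs_nc: H => [e e0 He]; apply/dnbhs_nc; exists e => // z z1 ze.
by rewrite -(He z z1 ze) big_ord_recr /= dK mul0r addr0.
Qed.

Lemma sum_pad (N K : nat) (c : nat -> C) (w : C) : (N <= K)%N ->
  \sum_(k < K) (if (k < N)%N then c k else 0) / w ^+ k.+1 = \sum_(k < N) c k / w ^+ k.+1.
Proof.
move=> NK; rewrite (big_ord_widen _ (fun k => c k / w ^+ k.+1) NK) [RHS]big_mkcond.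
by apply: eq_bigr => k _; case: ifP => //; rewrite mul0r.
Qed.

Lemma is_residueD f g z0 r s : is_residue f z0 r -> is_residue g z0 s ->
  is_residue (fun z => f z + g z) z0 (r + s).
Proof.
move=> [N [c [h [hh <- H]]]] [N' [c' [h' [hh' <- H']]]].
pose K := maxn N N'.
exists K, (fun k => (if (k < N.+1)%N then c k else 0) + (if (k < N'.+1)%N then c' k else 0)),
  (fun z => h z + h' z); split; [exact: (holomorphicD hh hh')|by []|].
apply: filterS2 H H' => z -> ->.
have -> : forall u v w t : C, u + v + (w + t) = (u + w) + (v + t) by move=> *; ring.
rewrite -(@sum_pad N.+1 K.+1) ?ltnS ?leq_maxl// -(@sum_pad N'.+1 K.+1) ?ltnS ?leq_maxr//.
by rewrite -big_split; congr (_ + _); apply: eq_bigr => k _; rewrite mulrDl.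
Qed.

Lemma is_residueZ a f z0 r : is_residue f z0 r -> is_residue (fun z => a * f z) z0 (a * r).
Proof.
move=> [N [c [h [hh <- H]]]]; exists N, (fun k => a * c k), (fun z => a * h z); split; [exact: (holomorphicZ a hh)|by []|].
apply: filterS H => z ->; rewrite mulrDr mulr_sumr; congr (_ + _).
by apply: eq_bigr => k _; rewrite mulrA.
Qed.

Lemma is_residue_ext f g z0 r : (\forall z \near z0^', f z = g z) ->
  is_residue f z0 r -> is_residue g z0 r.
Proof.
move=> fg [N [c [h [hh <- H]]]]; exists N, c, h; split; [exact: hh|by []|].
by apply: filterS2 fg H => z ->.
Qed.

Lemma is_residue_holomorphic h z0 : holomorphic_at h z0 -> is_residue h z0 0.
Proof.
move=> hh; exists 0%N, (fun _ => 0), h; split; [exact: hh|by []|]; apply: (@nearW _ (z0^')) => z.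
by rewrite big1 ?add0r// => k _; rewrite mul0r.
Qed.

Lemma is_residue_pole z0 k : is_residue (fun z => ((z - z0) ^+ k.+1)^-1) z0 (k == 0)%:R.
Proof.
exists k, (fun j => (j == k)%:R), (fun _ => 0); split; [exact: holomorphic_cst|by rewrite eq_sym|].
apply: (@nearW _ (z0^')) => z; rewrite addr0 big_ord_recr /= eqxx mul1r big1 ?add0r// => j _.
by rewrite (ltn_eqF (ltn_ord j)) mul0r.
Qed.

Lemma is_residue_uniq f z0 r s : is_residue f z0 r -> is_residue f z0 s -> r = s.
Proof.
move=> Hr /(is_residueZ (-1)) Hs.
have := is_residueD Hr Hs => -[N [c [h [hh E H]]]].
have cN : (fun z => - h z) z @[z --> z0] --> - h z0 by exact: (cvgN (holomorphic_cvg hh)).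
have c0 : c 0%N = 0.
  apply: (principal_part0 (K := N.+1) (g := fun z => - h z) cN) => //.
  move/dnbhs_nc: H => [e e0 He]; apply/dnbhs_nc; exists e => // z z1 ze.
  by apply/eqP; rewrite -addr_eq0 -(He z z1 ze) mulN1r subrr.
by move: E; rewrite c0 mulN1r => /esym/eqP; rewrite subr_eq0 => /eqP.
Qed.

Lemma residueE f z0 r : is_residue f z0 r -> residue f z0 = r.
Proof. by move=> H; apply: is_residue_uniq (H); apply: (xgetPex 0); exists r. Qed.

(* [pfrac u h r]: off [u], the function [h] is a combination of powers
   (z - x)^-(k+1) with [x] in [u], and [r] is the sum of the coefficients of
   the terms with k = 0. *)
Inductive pfrac (u : seq C) : (C -> C) -> C -> Prop :=
| pfrac_term x k : x \in u -> pfrac u (fun z => ((z - x) ^+ k.+1)^-1) (k == 0)%:R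
| pfrac_add h r h' r' : pfrac u h r -> pfrac u h' r' ->
    pfrac u (fun z => h z + h' z) (r + r')
| pfrac_scale c h r : pfrac u h r -> pfrac u (fun z => c * h z) (c * r)
| pfrac_ext h h' r : (forall z, z \notin u -> h z = h' z) -> pfrac u h r -> pfrac u h' r.

(** Dividing by z - x makes the function O(z^-2) at infinity, so the simple terms sum to 0.
    Concretely, 1 / ((z - x)(z - y)) is (x - y)^-1 times a difference of simple terms, and higher
    orders reduce to this one. *)
Lemma pfrac_div u h r x : x \in u -> pfrac u h r -> pfrac u (fun z => h z / (z - x)) 0.
Proof.
move=> xu; elim=> {h r} [y k yu|h r h' r' _ IH _ IH'|c h r _ IH|h h' r hh _ IH].
- have [<-|xy] := eqVneq x y.
    apply: pfrac_ext (pfrac_term k.+1 xu) => z _.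
    by rewrite -invfM -exprSr.
  have xy0 : x - y != 0 by rewrite subr_eq0.
  elim: k => [|k IH].
    have H := pfrac_scale (x - y)^-1 (pfrac_add (pfrac_term 0 xu)
      (pfrac_scale (-1) (pfrac_term 0 yu))).
    move: H; rewrite /= mulN1r subrr mulr0; apply: pfrac_ext => z zu.
    have zx : z - x != 0 by rewrite subr_eq0; apply: contraNneq zu => ->.
    have zy : z - y != 0 by rewrite subr_eq0; apply: contraNneq zu => ->.
    by rewrite !expr1; field; rewrite zx zy.
  have H := pfrac_scale (x - y)^-1 (pfrac_add IH
      (pfrac_scale (-1) (pfrac_term k.+1 yu))).
  move: H; rewrite /= mulr0 add0r mulr0; apply: pfrac_ext => z zu.
  have zx : z - x != 0 by rewrite subr_eq0; apply: contraNneq zu => ->.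
  have zy : z - y != 0 by rewrite subr_eq0; apply: contraNneq zu => ->.
  rewrite [(z - y) ^+ k.+2]exprS; have := expf_neq0 k.+1 zy; move: (_ ^+ k.+1) => w w0.
  by field; rewrite zx zy w0.
- by have := pfrac_add IH IH'; rewrite addr0; apply: pfrac_ext => z _; rewrite mulrDl.
- by have := pfrac_scale c IH; rewrite mulr0; apply: pfrac_ext => z _; rewrite mulrA.
- by apply: pfrac_ext IH => z zu; rewrite hh.
Qed.

Lemma pfrac0 u x : x \in u -> pfrac u (fun _ => 0) 0.
Proof.
move=> xu; have := pfrac_scale 0 (pfrac_term 0 xu); rewrite mul0r.
by apply: pfrac_ext => z _; rewrite mul0r.
Qed.

(** One root is peeled off at a time. With q the product of the remaining factors and c the top
    coefficient of G, G / ((z - x) q) = ((G - c q) / q) / (z - x) + c / (z - x); by [pfrac_div] only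
    the last term contributes to the sum. *)
Lemma pfrac_rat (s u : seq C) (G : {poly C}) x0 : x0 \in u -> {subset s <= u} ->
  (size G <= size s)%N ->
  pfrac u (fun z => G.[z] / (\prod_(x <- s) ('X - x%:P)).[z]) G`_(size s).-1.
Proof.
move=> x0u; elim: s G => [|x s IH] G su sG.
  have -> : G = 0 by apply/eqP; rewrite -size_poly_leq0.
  by rewrite coef0; apply: pfrac_ext (pfrac0 x0u) => z _; rewrite horner0 mul0r.
have xu : x \in u by apply: su; rewrite mem_head.
pose q : {poly C} := \prod_(y <- s) ('X - y%:P); pose c := G`_(size s).
have qm : q \is monic by apply: monic_prod => i _; apply: monicXsubC.
have sq : size q = (size s).+1 by rewrite size_prod_XsubC.
have sG' : (size (G - c *: q)%R <= size s)%N.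
  apply/leq_sizeP => j; rewrite leq_eqVlt => /predU1P[<-|ij].
    have /monicP := qm; rewrite /lead_coef sq /= => qs.
    by rewrite coefB coefZ qs mulr1 subrr.
  rewrite coefB coefZ (nth_default 0 (leq_trans sG _))//.
  by rewrite (nth_default 0 (leq_trans _ ij)) ?sq// mulr0 subrr.
have su' : {subset s <= u} by move=> y ys; apply: su; rewrite inE ys orbT.
have H1 := pfrac_div xu (IH _ su' sG').
have H2 := pfrac_scale c (pfrac_term 0 xu).
have := pfrac_add H1 H2; rewrite /= mulr1 add0r; apply: pfrac_ext => z zu.
have zx : z - x != 0 by rewrite subr_eq0; apply: contraNneq zu => ->.
have qz : q.[z] != 0.
  rewrite horner_prod prodf_seq_neq0; apply/allP => y ys; rewrite !hornerE subr_eq0 /=.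
  by apply: contraNneq zu => ->; exact: su'.
rewrite big_cons hornerM hornerXsubC -/q hornerD hornerN hornerZ expr1.
by field; rewrite zx qz.
Qed.

(** A generator of [pfrac] has non-zero residue only at its own point and only for a simple pole;
    everything else is additive. *)
Lemma pfrac_residue u h r : pfrac u h r -> uniq u ->
  exists2 rr : C -> C, (forall x, x \in u -> is_residue h x (rr x)) & \sum_(x <- u) rr x = r.
Proof.
move=> H uu; elim: H => {h r} [y k yu|h r h' r' _ [rr H E] _ [rr' H' E']|c h r _ [rr H E]|h h' r hh _ [rr H E]].
- exists (fun x => ((x == y) && (k == 0))%:R) => [x xu|].
    have [->|xy] := eqVneq x y; first exact: is_residue_pole.
    apply: is_residue_holomorphic.
    have q0 : (('X - y%:P) ^+ k.+1).[x] != 0 by rewrite !hornerE expf_neq0// subr_eq0.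
    have -> : (fun z => ((z - y) ^+ k.+1)^-1) =
        fun z => (1 : {poly C}).[z] / (('X - y%:P) ^+ k.+1).[z].
      by apply: functional_extensionality_dep => z; rewrite !hornerE ?mul1r.
    exact: (holomorphic_rat 1 q0).
  rewrite (bigD1_seq y)//= eqxx big1 ?addr0// => x xy.
  by rewrite (negPf xy).
- exists (fun x => rr x + rr' x) => [x xu|]; first exact: is_residueD (H x xu) (H' x xu).
  by rewrite big_split E E'.
- exists (fun x => c * rr x) => [x xu|]; first exact: is_residueZ (H x xu).
  by rewrite -mulr_sumr E.
exists rr => // x xu; apply: is_residue_ext (H x xu).
pose q : {poly C} := \prod_(y <- rem x u) ('X - y%:P).
have q0 : q.[x] != 0.
  rewrite horner_prod prodf_seq_neq0; apply/allP => y; rewrite mem_rem_uniq// inE => /andP[yx _].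
  by rewrite !hornerE subr_eq0 eq_sym.
have N : \forall z \near x, q.[z] != 0 by exact: (cvg_neq0 (@horner_cvg R q x) q0).
rewrite /dnbhs /within /=; apply: filterS N => z qz zx; apply: hh.
apply: contra qz => zu; rewrite horner_prod prodf_seq_eq0; apply/hasP; exists z.
  by rewrite mem_rem_uniq// inE zx.
by rewrite !hornerE subrr.
Qed.

End Residues.

(** * The polynomials attached to lambda and to its tangent vectors *)

Section CKP.
Local Open Scope complex_scope.
Variables (R : realType) (m : nat) (n : 'I_m.+1 -> nat).
Hypothesis n_gt0 : forall i, (0 < n i)%N.
Local Notation C := (cplx R).
Local Notation N := (ckp_dim n).
Local Notation pt := 'rV[C]_N.
Local Notation l0 := (lift ord0).
Local Notation e_ k := (delta_mx 0 k : pt).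
Local Notation n0 := (n ord0).
Implicit Types (a b u v : pt) (z w : C) (j : 'I_m).

Lemma sum_lift (V : nmodType) (F : 'I_m.+1 -> V) :
  \sum_(i < m.+1 | i != ord0) F i = \sum_(j < m) F (l0 j).
Proof. by rewrite big_mkcond big_ord_recl /= add0r. Qed.

Definition nn j : nat := n (l0 j).
Definition pole a j : C := coeff a (l0 j) 0.

Lemma width0 : ckp_width n ord0 = n0.-1. Proof. by []. Qed.
Lemma width_lift j : ckp_width n (l0 j) = (nn j).+1. Proof. by []. Qed.

Lemma ckp_dimE : N = (n0.-1 + \sum_j (nn j).+1)%N.
Proof.
rewrite /ckp_dim card_tagged sumnE big_map big_enum /= big_ord_recl card_ord width0.
by congr (_ + _)%N; apply: eq_bigr => j _; rewrite card_ord width_lift.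
Qed.

Lemma ckp_dim1 : N.+1 = (n0 + \sum_j (nn j) + m)%N.
Proof.
rewrite ckp_dimE; under eq_bigr do rewrite -addn1; rewrite big_split /= sum1_card card_ord.
by have := n_gt0 ord0; lia.
Qed.

Lemma coeff_lin (c : C) u v i k : coeff (c *: u + v) i k = c * coeff u i k + coeff v i k.
Proof. by rewrite /coeff; case: insub => [l|]; rewrite ?mxE// mulr0 addr0. Qed.


Lemma coeff_eq0 v : (forall i k, (k < ckp_width n i)%N -> coeff v i k = 0) -> v = 0.
Proof.
move=> H; apply/rowP => k; rewrite mxE.
rewrite -(enum_valK k); case: (enum_val k) => i l.
by have := H i l (ltn_ord l); rewrite /coeff valK.
Qed.


Lemma coeff_ucder a i k :
  ucder (@xV R N) a (fun b _ => coeff b i k) (fun l _ => coeff (e_ l) i k).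
Proof.
rewrite /coeff; case: insub => [l|]; last exact: ucder_cst.
apply: ucder_eq (ucder_coord (x := @xV R N) (@xV_cvg R N (enum_rank (existT _ i l)) a)).
by move=> p t _; rewrite mxE eqxx eq_sym.
Qed.

Lemma lamE a z : lam a z = n0%:R^-1 * z ^+ n0 + \sum_(k < n0.-1) coeff a ord0 k * z ^+ k +
  \sum_j \sum_(k < nn j) coeff a (l0 j) k.+1 / (z - pole a j) ^+ k.+1.
Proof.
rewrite /lam sum_lift; congr (_ + _); apply: eq_bigr => j _.
by rewrite big_add1 big_mkord.
Qed.

(** The closed form of [dlam] off the poles; the last summand is due to the motion of the pole. *)
Definition dl a v z : C := \sum_(k < n0.-1) coeff v ord0 k * z ^+ k +
  \sum_j \sum_(k < nn j) (coeff v (l0 j) k.+1 / (z - pole a j) ^+ k.+1 +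
    k.+1%:R * coeff a (l0 j) k.+1 * pole v j / (z - pole a j) ^+ k.+2).

Lemma dl_lin a (c : C) u v z : dl a (c *: u + v) z = c * dl a u z + dl a v z.
Proof.
have E (A B p q : C) : c * (A + B) + (p + q) = (c * A + p) + (c * B + q) by ring.
rewrite /dl E; congr (_ + _).
  rewrite mulr_sumr -big_split; apply: eq_bigr => k _.
  by rewrite coeff_lin mulrDl mulrA.
rewrite mulr_sumr -big_split; apply: eq_bigr => j _ /=.
rewrite mulr_sumr -big_split; apply: eq_bigr => k _ /=.
rewrite /pole !coeff_lin; move: (_ ^+ k.+1) (_ ^+ k.+2) => x y.
by rewrite mulrDl; ring.
Qed.

Lemma dl0 a z : dl a 0 z = 0.
Proof. by have := dl_lin a (-1) 0 0 z; rewrite scaler0 addr0 mulN1r addNr. Qed.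

Lemma dl_sum a v z : dl a v z = \sum_k v 0 k * dl a (e_ k) z.
Proof.
rewrite {1}(row_sum_delta v); elim/big_rec2 : _ => [|k x y _ <-]; first by rewrite dl0.
by rewrite dl_lin.
Qed.

Lemma is_poleP a z : ~ is_pole a z <-> forall j, z != pole a j.
Proof.
split=> [H j|H [i i0 E]].
  by apply/eqP => E; apply: H; exists (l0 j).
have [j E'|E'] := unliftP ord0 i; last by rewrite E' eqxx in i0.
by have := H j; rewrite E E' eqxx.
Qed.

Lemma lam_ucder a (gam : R -> C) : (forall t : R, 0 <= t <= 1 -> gam s @[s --> t] --> gam t) ->
  (forall t : R, 0 <= t <= 1 -> forall j, gam t != pole a j) ->
  ucder (@xV R N) a (fun b t => lam b (gam t)) (fun k t => dl a (e_ k) (gam t)).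
Proof.
move=> cg pg; have Hg := ucder_t (@xV R N) a cg.
have H1 : ucder (@xV R N) a (fun b t => n0%:R^-1 * gam t ^+ n0 + \sum_(k < n0.-1) coeff b ord0 k * gam t ^+ k)
    (fun l t => \sum_(k < n0.-1) coeff (e_ l) ord0 k * gam t ^+ k).
  have D := ucderD (ucderZ (n0%:R^-1) (ucderX n0 Hg))
    (ucder_sum (index_enum 'I_n0.-1) (P := xpredT)
     (fun (k : 'I_n0.-1) _ => ucderM (@coeff_ucder a ord0 k) (ucderX k Hg))).
  apply: ucder_eq D => l t _ /=; rewrite !mulr0 add0r; apply: eq_bigr => k _.
  by rewrite !mulr0 addr0.
have H2 j : ucder (@xV R N) a (fun b t => gam t - pole b j) (fun l t => - pole (e_ l) j).
  by apply: ucder_eq (ucderB Hg (@coeff_ucder a (l0 j) 0)) => l t _; rewrite sub0r.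
have H3 j (k : 'I_(nn j)) : ucder (@xV R N) a
    (fun b t => coeff b (l0 j) k.+1 / (gam t - pole b j) ^+ k.+1)
    (fun l t => coeff (e_ l) (l0 j) k.+1 / (gam t - pole a j) ^+ k.+1 +
      k.+1%:R * coeff a (l0 j) k.+1 * pole (e_ l) j / (gam t - pole a j) ^+ k.+2).
  have n0' (t : R) : 0 <= t <= 1 -> (gam t - pole a j) ^+ k.+1 != 0.
    by move=> /pg /(_ j) h; rewrite expf_neq0// subr_eq0.
  apply: ucder_eq (ucderM (@coeff_ucder a (l0 j) k.+1) (ucderV n0' (ucderX k.+1 (H2 j)))) => l t tI /=.
  have : gam t - pole a j != 0 by rewrite subr_eq0 pg.
  move: (gam t - pole a j) => w w0; rewrite [w ^+ k.+2]exprS [w ^+ k.+1]exprS.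
  by have := expf_neq0 k w0; move: (w ^+ k) => q q0; field; rewrite q0 w0.
have H := ucderD H1 (ucder_sum (index_enum 'I_m) (P := xpredT) (fun j _ =>
   ucder_sum (index_enum 'I_(nn j)) (P := xpredT) (fun k _ => H3 j k))).
apply: ucder_ext H; apply: (@nearW _ (nbhs a)) => b t.
by rewrite lamE.
Qed.

Lemma dlamE a v z : ~ is_pole a z -> dlam a v z = dl a v z.
Proof.
move=> /is_poleP hz.
have cz (t : R) : 0 <= t <= 1 -> (fun _ : R => z) s @[s --> t] --> z by move=> _; exact: cvg_cst.
have H := lam_ucder cz (fun t _ => hz).
have [_ E] := @vder_Dv R N (fun b => lam b z) a (fun k => dl a (e_ k) z) v H.
by rewrite /dlam E -dl_sum.
Qed.

Definition polprod a (e : 'I_m -> nat) : {poly C} := \prod_j ('X - (pole a j)%:P) ^+ e j.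
Definition copol a (e : 'I_m -> nat) j : {poly C} :=
  \prod_(i | i != j) ('X - (pole a i)%:P) ^+ e i.

Lemma polprodE a e j : polprod a e = ('X - (pole a j)%:P) ^+ e j * copol a e j.
Proof. by rewrite /polprod (bigD1 j). Qed.

Lemma polprod_monic a e : polprod a e \is monic.
Proof. by apply: monic_prod => j _; apply: monic_exp; apply: monicXsubC. Qed.
Lemma copol_monic a e j : copol a e j \is monic.
Proof. by apply: monic_prod => i _; apply: monic_exp; apply: monicXsubC. Qed.

Lemma size_polprod a e : size (polprod a e) = (\sum_j e j).+1.
Proof.
rewrite size_prod => [|j _]; last by rewrite expf_neq0// polyXsubC_eq0.
under eq_bigr do rewrite size_exp_XsubC -addn1; rewrite big_split /= sum1_card.
by rewrite subSn ?leq_addl// addnK.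
Qed.

Lemma size_copol a e j : (size (copol a e j) + e j)%N = (\sum_j e j).+1.
Proof.
rewrite -(size_polprod a) (polprodE a e j) size_monicM ?monic_exp ?monicXsubC ?monic_neq0 ?copol_monic//.
by rewrite size_exp_XsubC addnC.
Qed.

Lemma polprod_neq0 a e z : (forall j, z != pole a j) -> (polprod a e).[z] != 0.
Proof.
move=> H; rewrite horner_prod; apply/prodf_neq0 => j _.
by rewrite !hornerE expf_neq0// subr_eq0.
Qed.

Lemma polprod_exp1 a (e f : 'I_m -> nat) : (polprod a e * polprod a f) = polprod a (fun j => e j + f j)%N.
Proof. by rewrite -big_split; apply: eq_bigr => j _; rewrite exprD. Qed.

Local Notation one := (fun _ : 'I_m => 1%N).
Local Notation nn1 := (fun j : 'I_m => (nn j).+1).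

Definition polypart a : {poly C} := \sum_(k < n0.-1) coeff a ord0 k *: 'X^k.

(** The numerator of lambda over the denominator prod_j (z - p_j)^(n_j). *)
Definition Vpol a : {poly C} := polprod a nn * (n0%:R^-1 *: 'X^n0 + polypart a) +
  \sum_j copol a nn j *
    \sum_(k < nn j) coeff a (l0 j) k.+1 *: ('X - (pole a j)%:P) ^+ (nn j - k.+1).

(** The logarithmic derivative of prod_j (z - p_j)^(n_j), cleared of its denominator prod_j (z -
    p_j). *)
Definition Spol a : {poly C} := \sum_j (nn j)%:R *: copol a one j.

(* With D = (z - a_1)^(n_1+1) ... (z - a_m)^(n_m+1): P = D lambda' and W = D lambda. *)
Definition Ppol a : {poly C} := polprod a one * (Vpol a)^`() - Spol a * Vpol a.
Definition Wpol a : {poly C} := polprod a one * Vpol a.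

(* D times the derivative of lambda along v. *)
Definition fpol a v : {poly C} := polprod a nn1 * polypart v +
  \sum_j copol a nn1 j *
    \sum_(k < nn j) (coeff v (l0 j) k.+1 *: ('X - (pole a j)%:P) ^+ (nn j - k) +
      (k.+1%:R * coeff a (l0 j) k.+1 * pole v j) *: ('X - (pole a j)%:P) ^+ (nn j - k.+1)).

Lemma horner_polypart a z : (polypart a).[z] = \sum_(k < n0.-1) coeff a ord0 k * z ^+ k.
Proof. by rewrite horner_sum; apply: eq_bigr => k _; rewrite !hornerE. Qed.

Lemma expr_frac (w : C) (k l : nat) : (k <= l)%N -> w != 0 -> w ^+ (l - k) = w ^+ l / w ^+ k.
Proof.
move=> kl w0; have -> : w ^+ l = w ^+ (l - k) * w ^+ k by rewrite -exprD subnK.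
by rewrite mulfK ?expf_neq0.
Qed.

Lemma copolE a e j z : z != pole a j -> (copol a e j).[z] = (polprod a e).[z] / (z - pole a j) ^+ e j.
Proof.
move=> h; rewrite (polprodE a e j) hornerM horner_exp hornerXsubC mulrC mulKf//.
by rewrite expf_neq0// subr_eq0.
Qed.

Lemma Vpol_lam a z : (forall j, z != pole a j) -> (Vpol a).[z] = (polprod a nn).[z] * lam a z.
Proof.
move=> hz; rewrite lamE mulrDr /Vpol hornerD hornerM hornerD hornerZ hornerXn horner_polypart.
congr (_ + _); rewrite horner_sum mulr_sumr; apply: eq_bigr => j _.
rewrite hornerM copolE// horner_sum -mulrA; congr (_ * _); rewrite mulr_sumr.
apply: eq_bigr => k _ /=; rewrite !hornerE expr_frac ?subr_eq0//.
have := expf_neq0 (nn j) (_ : z - pole a j != 0); rewrite subr_eq0 hz => /(_ isT).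
move: ((z - pole a j) ^+ nn j) ((z - pole a j) ^- k.+1) => w q w0 /=.
by rewrite [LHS]mulrACA (mulVf w0) mul1r.
Qed.

Lemma fpol_dl a v z : (forall j, z != pole a j) -> (fpol a v).[z] = (polprod a nn1).[z] * dl a v z.
Proof.
move=> hz; rewrite /dl mulrDr /fpol hornerD hornerM horner_polypart.
congr (_ + _); rewrite horner_sum mulr_sumr; apply: eq_bigr => j _.
rewrite hornerM copolE// horner_sum -mulrA; congr (_ * _); rewrite mulr_sumr.
have w0 : z - pole a j != 0 by rewrite subr_eq0.
apply: eq_bigr => k _ /=; rewrite !hornerE.
have lk := ltn_ord k.
have -> : (z - pole a j) ^+ (nn j - k) = (z - pole a j) ^+ (nn j).+1 * (z - pole a j) ^- k.+1.
  by rewrite -subSS expr_frac// ltnW.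
have -> : (z - pole a j) ^+ (nn j - k.+1) = (z - pole a j) ^+ (nn j).+1 * (z - pole a j) ^- k.+2.
  by rewrite -subSS expr_frac.
have := expf_neq0 (nn j).+1 w0.
move: ((z - pole a j) ^+ (nn j).+1) ((z - pole a j) ^- k.+1) ((z - pole a j) ^- k.+2) => x p q x0 /=.
by field.
Qed.

Lemma sum_size (I : Type) (r : seq I) (P : pred I) (F : I -> {poly C}) (k : nat) :
  (forall i, P i -> (size (F i) <= k)%N) -> (size (\sum_(i <- r | P i) F i)%R <= k)%N.
Proof.
move=> H; elim/big_rec : _ => [|i x Pi Hx]; first by rewrite size_poly0.
by rewrite (leq_trans (size_polyD _ _))// geq_max H.
Qed.

Definition Mdeg : nat := (n0 + \sum_j nn j)%N.

Lemma Vpol_size_coef a : (size (Vpol a) <= Mdeg.+1)%N /\ (Vpol a)`_Mdeg = n0%:R^-1.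
Proof.
have nz : (n0%:R : C) != 0 by rewrite pnatr_eq0 -lt0n.
have sp : (size (polypart a) <= n0)%N.
  apply: sum_size => k _; rewrite (leq_trans (size_scale_leq _ _))// size_polyXn.
  by have := ltn_ord k; lia.
pose q : {poly C} := n0%:R^-1 *: 'X^n0 + polypart a.
have sq : (size q <= n0.+1)%N.
  rewrite (leq_trans (size_polyD _ _))// geq_max (leq_trans sp)// andbT.
  by rewrite (leq_trans (size_scale_leq _ _))// size_polyXn.
have qc : q`_n0 = n0%:R^-1.
  by rewrite coefD coefZ coefXn eqxx mulr1 nth_default ?addr0.
have sQ : size (polprod a nn) = (\sum_j nn j).+1 := size_polprod a nn.
have lQ : (polprod a nn)`_(\sum_j nn j) = 1.
  by have /monicP := polprod_monic a nn; rewrite /lead_coef sQ.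
have rest : (size (\sum_j copol a nn j *
    \sum_(k < nn j) coeff a (l0 j) k.+1 *: ('X - (pole a j)%:P) ^+ (nn j - k.+1))%R <= Mdeg)%N.
  apply: sum_size => j _; apply: (leq_trans (size_polyMleq _ _)).
  have sj : (size (\sum_(k < nn j) coeff a (l0 j) k.+1 *:
      ('X - (pole a j)%:P) ^+ (nn j - k.+1))%R <= nn j)%N.
    apply: sum_size => k _; rewrite (leq_trans (size_scale_leq _ _))// size_exp_XsubC.
    by have := ltn_ord k; lia.
  have := size_copol a nn j; move: sj; rewrite /Mdeg; have := n_gt0 ord0.
  move: (size _) (size _) => x y; lia.
rewrite /Vpol -/q; split.
  rewrite (leq_trans (size_polyD _ _))// geq_max (leq_trans rest)// andbT.
  apply: (leq_trans (size_polyMleq _ _)); rewrite sQ /Mdeg.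
  by move: sq; move: (size _) => x; lia.
rewrite coefD (nth_default 0 rest) addr0 /Mdeg addnC coefM_top ?sQ// lQ mul1r.
by [].
Qed.

Lemma size_Vpol a : size (Vpol a) = Mdeg.+1.
Proof.
have [s c] := Vpol_size_coef a; apply/eqP; rewrite eqn_leq s ltnNge; apply/negP => h.
move: c; rewrite nth_default// => /eqP; rewrite eq_sym invr_eq0 pnatr_eq0 => /eqP E.
by have := n_gt0 ord0; rewrite E.
Qed.

Lemma lead_Vpol a : lead_coef (Vpol a) = n0%:R^-1.
Proof. by rewrite /lead_coef size_Vpol (Vpol_size_coef a).2. Qed.

Lemma sum_one : (\sum_(j < m) 1)%N = m. Proof. by rewrite sum1_card card_ord. Qed.

(** The top coefficient is (Mdeg - sum_j n_j) / n_0 = 1: the normalisation z^(n_0) / n_0 of lambda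
    is what makes [Ppol] monic. *)
Lemma Ppol_size_coef a : (size (Ppol a) <= N.+1)%N /\ (Ppol a)`_N = 1.
Proof.
have nz : (n0%:R : C) != 0 by rewrite pnatr_eq0 -lt0n.
have sV := size_Vpol a; have NE : N = (m + Mdeg.-1)%N.
  by have := ckp_dim1; rewrite /Mdeg; have := n_gt0 ord0; lia.
have M0 : (0 < Mdeg)%N by rewrite /Mdeg addn_gt0 n_gt0.
have s1 : size (polprod a one) = m.+1 by rewrite size_polprod sum_one.
have l1 : (polprod a one)`_m = 1.
  by have /monicP := polprod_monic a one; rewrite /lead_coef s1.
have sd : (size (Vpol a)^`() <= Mdeg.-1.+1)%N.
  rewrite prednK//; have [->|V0] := eqVneq (Vpol a) 0; first by rewrite deriv0 size_poly0.
  by rewrite -ltnS -sV lt_size_deriv.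
have cd : (Vpol a)^`()`_Mdeg.-1 = n0%:R^-1 *+ Mdeg.
  by rewrite coef_deriv prednK// (Vpol_size_coef a).2.
have scj j : size (copol a one j) = m.-1.+1.
  have := size_copol a one j; rewrite sum_one; have := ltn_ord j.
  by move: (size _) => x; lia.
have lcj j : (copol a one j)`_m.-1 = 1.
  by have /monicP := copol_monic a one j; rewrite /lead_coef scj.
have NEj j : N = (m.-1 + Mdeg)%N by have := ltn_ord j; lia.
split.
  rewrite (leq_trans (size_polyD _ _))// size_polyN geq_max; apply/andP; split.
    apply: (leq_trans (size_polyMleq _ _)); rewrite s1 NE.
    by move: sd; move: (size _) => x; lia.
  rewrite mulr_suml; apply: sum_size => j _; apply: (leq_trans (size_polyMleq _ _)).
  have := size_scale_leq (nn j)%:R (copol a one j); rewrite scj sV (NEj j).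
  by move: (size _) => x; lia.
rewrite coefB {1}NE coefM_top ?s1// l1 mul1r cd mulr_suml coef_sum.
have -> : \sum_j ((nn j)%:R *: copol a one j * Vpol a)`_N = (\sum_j nn j)%:R * n0%:R^-1.
  rewrite natr_sum mulr_suml; apply: eq_bigr => j _.
  rewrite -scalerAl coefZ {1}(NEj j) coefM_top ?scj ?sV// lcj mul1r (Vpol_size_coef a).2.
  by [].
by rewrite -[_ *+ Mdeg]mulr_natl /Mdeg natrD mulrDl addrK mulfV.
Qed.

Lemma size_Ppol a : size (Ppol a) = N.+1.
Proof.
have [s c] := Ppol_size_coef a; apply/eqP; rewrite eqn_leq s ltnNge; apply/negP => h.
by move: c; rewrite nth_default// => /eqP; rewrite eq_sym oner_eq0.
Qed.

Lemma Ppol_monic a : Ppol a \is monic.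
Proof. by apply/monicP; rewrite /lead_coef size_Ppol (Ppol_size_coef a).2. Qed.

Lemma near_nonpole a z : (forall j, z != pole a j) -> \forall w \near z, forall j, w != pole a j.
Proof.
move=> hz; have H : \forall w \near z, (polprod a one).[w] != 0.
  exact: (cvg_neq0 (@horner_cvg R (polprod a one) z) (polprod_neq0 one hz)).
apply: filterS H => w w0 j; apply: contra_neq w0 => ->.
by rewrite (polprodE a one j) hornerM expr1 hornerXsubC subrr mul0r.
Qed.

Lemma zder_lam a z : (forall j, z != pole a j) ->
  zder (lam a) z ((Ppol a).[z] / (polprod a nn1).[z]).
Proof.
move=> hz; have Q0 := polprod_neq0 nn hz; have p0 := polprod_neq0 one hz.
have z0 j : z - pole a j != 0 by rewrite subr_eq0.
have HQ : ulder (@xC R) z (fun w (_ : R) => \prod_j (w - pole a j) ^+ nn j)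
    (fun _ _ => \sum_j (nn j)%:R / (z - pole a j)).
  apply: (ulder_prod (index_enum 'I_m) (P := xpredT)
     (f := fun j w _ => (w - pole a j) ^+ nn j) (g := fun j _ _ => (nn j)%:R / (z - pole a j))).
  move=> j _; apply: ulderX.
  have := ulder_of (fun (t : R) _ => z0 j) (ucderB (zder_id z) (ucder_cst _ _ (pole a j))).
  by case=> h1 h2; split=> //; apply: ucder_eq h2 => k t _; rewrite subr0 mul1r.
have EQ w : \prod_j (w - pole a j) ^+ nn j = (polprod a nn).[w].
  by rewrite horner_prod; apply: eq_bigr => j _; rewrite !hornerE.
have HQ2 : ucder (@xC R) z (fun w _ => (polprod a nn).[w])
   (fun _ _ => (polprod a nn).[z] * \sum_j (nn j)%:R / (z - pole a j)).
  case: HQ => _; rewrite EQ; apply: ucder_ext.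
  by apply: (@nearW _ (nbhs z)) => w _; rewrite EQ.
have H := ucderM (zder_horner (Vpol a) z) (ucderV (fun (t : R) _ => Q0) HQ2).
have H2 : zder (fun w => (Vpol a).[w] / (polprod a nn).[w]) z ((Ppol a).[z] / (polprod a nn1).[z]).
  apply: ucder_eq H => k t _ /=.
  have -> : polprod a nn1 = polprod a nn * polprod a one.
    by rewrite polprod_exp1; congr polprod; apply: functional_extensionality_dep => j; rewrite addn1.
  have -> : (Ppol a).[z] = (polprod a one).[z] * (Vpol a)^`().[z] -
      ((polprod a one).[z] * \sum_j (nn j)%:R / (z - pole a j)) * (Vpol a).[z].
    rewrite /Ppol !hornerE; congr (_ - _ * _); rewrite horner_sum mulr_sumr.
    apply: eq_bigr => j _; rewrite hornerZ (copolE one (hz j)) expr1.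
    by rewrite mulrCA mulrA.
  rewrite hornerM; move: Q0 p0; move: (polprod a nn).[z] (polprod a one).[z] => q p q0 p0.
  by move: (\sum_j _) => s; field; rewrite q0 p0.
apply: ucder_ext H2; apply: filterS (near_nonpole hz) => w hw t.
by rewrite (Vpol_lam hw) mulrC mulKf// polprod_neq0.
Qed.

Lemma zero_expr k : (0 : C) ^+ k = (k == 0)%:R. Proof. exact: expr0n. Qed.

Lemma copol_pole a e i j : i != j -> (0 < e i)%N -> (copol a e j).[pole a i] = 0.
Proof.
move=> ij ei; rewrite /copol horner_prod (bigD1 i)//= !hornerE subrr zero_expr.
by rewrite (gtn_eqF ei) mul0r.
Qed.

Lemma Vpol_pole a i : (Vpol a).[pole a i] = (copol a nn i).[pole a i] * coeff a (l0 i) (nn i).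
Proof.
rewrite /Vpol hornerD hornerM (polprodE a nn i) hornerM horner_exp hornerXsubC subrr zero_expr.
rewrite (gtn_eqF (n_gt0 _)) !mul0r add0r horner_sum (bigD1 i)//= [X in _ + X]big1 ?addr0; last first.
  by move=> j ji; rewrite hornerM copol_pole ?mul0r// 1?eq_sym//; exact: n_gt0.
rewrite hornerM; congr (_ * _); rewrite horner_sum.
have lt : ((nn i).-1 < nn i)%N by rewrite prednK// n_gt0.
rewrite (bigD1 (Ordinal lt))//= [X in _ + X]big1 ?addr0 => [|k ki].
  by rewrite prednK ?n_gt0// subnn expr0 hornerZ hornerC mulr1.
rewrite !hornerE subrr zero_expr subn_eq0 leqNgt; have := ltn_ord k.
rewrite leq_eqVlt => /predU1P[E|->]; last by rewrite mulr0.
by case/eqP: ki; apply: val_inj => /=; exact: (congr1 predn E).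
Qed.

Lemma Ppol_pole a i : (Ppol a).[pole a i] =
  - ((nn i)%:R * (copol a one i).[pole a i] * (Vpol a).[pole a i]).
Proof.
rewrite /Ppol !hornerE (polprodE a one i) hornerM expr1 hornerXsubC subrr !mul0r sub0r.
congr (- (_ * _)); rewrite horner_sum (bigD1 i)//= hornerZ big1 ?addr0// => j ji.
by rewrite hornerZ copol_pole ?mulr0// 1?eq_sym.
Qed.

(** At a pole only the coefficient of highest order survives on both sides. The quotient - f_v / P,
    which at a zero of lambda is the velocity of that zero, is thus also the velocity of the
    pole. *)
Lemma fpol_pole a v i : (fpol a v).[pole a i] = - pole v i * (Ppol a).[pole a i].
Proof.
rewrite Ppol_pole Vpol_pole /fpol hornerD hornerM (polprodE a nn1 i) hornerM horner_exp.
rewrite hornerXsubC subrr zero_expr /= !mul0r add0r horner_sum (bigD1 i)//=.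
rewrite [X in _ + X]big1 ?addr0; last first.
  by move=> j ji; rewrite hornerM copol_pole ?mul0r// 1?eq_sym.
have -> : copol a nn1 i = copol a nn i * copol a one i.
  by rewrite -big_split; apply: eq_bigr => j _ /=; rewrite -exprD addn1.
rewrite !hornerM horner_sum.
have lt : ((nn i).-1 < nn i)%N by rewrite prednK// n_gt0.
rewrite (bigD1 (Ordinal lt))//= [X in _ + X]big1 ?addr0 => [|k ki].
  rewrite prednK ?n_gt0// subnn expr0 !hornerE subrr zero_expr.
  have -> : (nn i - (nn i).-1 == 0)%N = false by have := n_gt0 (l0 i); rewrite /nn; lia.
  by rewrite mulr0 add0r /=; ring.
rewrite !hornerE subrr !zero_expr.
have -> : (nn i - k == 0)%N = false by have := ltn_ord k; lia.
have -> : (nn i - k.+1 == 0)%N = false.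
  apply/negP => /eqP h; case/eqP: ki; apply: val_inj => /=; have := ltn_ord k.
  by move: h; move: (nat_of_ord k) => x; lia.
by rewrite !mulr0 addr0.
Qed.

Lemma MCKP_pole a i j : MCKP a -> i != j -> pole a i != pole a j.
Proof. by move=> [_ H] ij; apply: H; rewrite ?(inj_eq lift_inj)// eq_sym neq_lift. Qed.

Lemma MCKP_top a (i : 'I_m) : MCKP a -> coeff a (l0 i) (nn i) != 0.
Proof. by move=> [H _]; apply: H; rewrite eq_sym neq_lift. Qed.

Lemma copol_neq0 a e i : MCKP a -> (copol a e i).[pole a i] != 0.
Proof.
move=> Ma; rewrite horner_prod; apply/prodf_neq0 => j ji.
by rewrite !hornerE expf_neq0// subr_eq0 (MCKP_pole Ma)// eq_sym.
Qed.

Lemma Vpol_pole_neq0 a i : MCKP a -> (Vpol a).[pole a i] != 0.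
Proof. by move=> Ma; rewrite Vpol_pole mulf_neq0 ?copol_neq0 ?MCKP_top. Qed.

Lemma Ppol_pole_neq0 a i : MCKP a -> (Ppol a).[pole a i] != 0.
Proof.
move=> Ma; rewrite Ppol_pole oppr_eq0 !mulf_neq0 ?copol_neq0 ?Vpol_pole_neq0//.
by rewrite pnatr_eq0 -lt0n n_gt0.
Qed.

Lemma size_fpol a v : (size (fpol a v) <= N)%N.
Proof.
have NE := ckp_dimE; rewrite (leq_trans (size_polyD _ _))// geq_max; apply/andP; split.
  have sp : (size (polypart v) <= n0.-1)%N.
    apply: sum_size => k _; rewrite (leq_trans (size_scale_leq _ _))// size_polyXn.
    exact: ltn_ord.
  apply: (leq_trans (size_polyMleq _ _)); rewrite size_polprod NE.
  by move: sp; move: (size _) => x; lia.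
apply: sum_size => j _; apply: (leq_trans (size_polyMleq _ _)).
set G := (X in size X%R).
have sG : (size (\sum_(k < nn j) (coeff v (l0 j) k.+1 *: ('X - (pole a j)%:P) ^+ (nn j - k) +
      (k.+1%:R * coeff a (l0 j) k.+1 * pole v j) *: ('X - (pole a j)%:P) ^+ (nn j - k.+1)))%R <= (nn j).+1)%N.
  apply: sum_size => k _; rewrite (leq_trans (size_polyD _ _))// geq_max.
  by rewrite !(leq_trans (size_scale_leq _ _))// size_exp_XsubC ltnS leq_subr.
have := size_copol a nn1 j; move: sG; rewrite NE.
move: (size _) (size _) => x y; lia.
Qed.

Lemma polypart_lin (c : C) u v : polypart (c *: u + v) = c *: polypart u + polypart v.
Proof.
rewrite /polypart scaler_sumr -big_split; apply: eq_bigr => k _.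
by rewrite coeff_lin scalerDl scalerA.
Qed.

Lemma fpol_lin a (c : C) u v : fpol a (c *: u + v) = c *: fpol a u + fpol a v.
Proof.
rewrite /fpol polypart_lin scalerDr addrACA mulrDr scalerAr; congr (_ + _).
rewrite scaler_sumr -big_split; apply: eq_bigr => j _ /=.
rewrite scalerAr -mulrDr; congr (_ * _); rewrite scaler_sumr -big_split; apply: eq_bigr => k _ /=.
rewrite /pole !coeff_lin scalerDr !scalerA !scalerDl.
have -> : k.+1%:R * coeff a (l0 j) k.+1 * (c * coeff u (l0 j) 0 + coeff v (l0 j) 0) =
  c * (k.+1%:R * coeff a (l0 j) k.+1 * coeff u (l0 j) 0) +
  k.+1%:R * coeff a (l0 j) k.+1 * coeff v (l0 j) 0 by ring.
by rewrite scalerDl addrACA.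
Qed.

(** The other summands are divisible by (z - p_j)^(n_j+1) and the cofactor of the block [G j] is
    prime to it, so it divides [G j], whose degree is at most n_j. All blocks vanish, then the
    polynomial part. *)
Lemma fpol_eq0 a v : MCKP a -> fpol a v = 0 -> v = 0.
Proof.
move=> Ma f0.
pose G j := \sum_(k < nn j) (coeff v (l0 j) k.+1 *: ('X - (pole a j)%:P) ^+ (nn j - k) +
      (k.+1%:R * coeff a (l0 j) k.+1 * pole v j) *: ('X - (pole a j)%:P) ^+ (nn j - k.+1)).
have G0 j : G j = 0.
  have sG : (size (G j) <= (nn j).+1)%N.
    apply: sum_size => k _; rewrite (leq_trans (size_polyD _ _))// geq_max.
    by rewrite !(leq_trans (size_scale_leq _ _))// size_exp_XsubC ltnS leq_subr.
  have dv : ('X - (pole a j)%:P) ^+ (nn j).+1 %| copol a nn1 j * G j.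
    have : copol a nn1 j * G j = - (polprod a nn1 * polypart v +
        \sum_(i | i != j) copol a nn1 i * G i).
      apply/eqP; rewrite eq_sym eqr_oppLR -addr_eq0 -addrA -[X in _ == X]f0 /fpol (bigD1 j (P := xpredT))//=.
      by rewrite [X in _ + X]addrC.
    move->; rewrite dvdpNr dvdp_add//; first by rewrite (polprodE a nn1 j) -mulrA dvdp_mulr.
    apply: (big_ind (fun p => _ %| p)); [exact: dvdp0|by move=> *; exact: dvdp_add|move=> i ij].
    by rewrite dvdp_mulr// /copol (bigD1 j) 1?eq_sym//= dvdp_mulr.
  have cp : coprimep (('X - (pole a j)%:P) ^+ (nn j).+1) (copol a nn1 j).
    by rewrite coprimep_expl// coprimep_sym coprimep_XsubC /root copol_neq0.
  move: dv; rewrite Gauss_dvdpr// => /dvdpP[q E]; apply/eqP; apply: contraT => G0.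
  have q0 : q != 0 by apply: contra_neq G0 => q0; rewrite E q0 mul0r.
  move: sG; rewrite E size_Mmonic ?monic_exp ?monicXsubC// size_exp_XsubC.
  have : (0 < size q)%N by rewrite size_poly_gt0.
  by move: (size q) => x; lia.
(* Translating the pole to 0 turns the block into a polynomial in powers of X, whose coefficients
   can be read off. *)
have Xc j k : ('X - (pole a j)%:P) ^+ k \Po ('X + (pole a j)%:P) = 'X^k.
  by rewrite rmorphXn /= rmorphB /= comp_polyX comp_polyC addrK.
have Gc j l : \sum_(k < nn j) (coeff v (l0 j) k.+1 * (l == nn j - k)%N%:R +
   (k.+1%:R * coeff a (l0 j) k.+1 * pole v j) * (l == nn j - k.+1)%N%:R) = 0.
  have : (G j \Po ('X + (pole a j)%:P))`_l = 0 by rewrite G0 comp_poly0 coef0.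
  rewrite raddf_sum coef_sum => E; rewrite -[RHS]E; apply: eq_bigr => k _.
  by rewrite raddfD /= !linearZ /= !Xc coefD !coefZ !coefXn.
have p0 j : pole v j = 0.
  have lt : ((nn j).-1 < nn j)%N by rewrite prednK// n_gt0.
  have := Gc j 0; rewrite (bigD1 (Ordinal lt))//= [X in _ + X]big1 ?addr0 => [|k ki]; last first.
    have -> : (0 == nn j - k)%N = false by have := ltn_ord k; move: (nat_of_ord k) => x; lia.
    have -> : (0 == nn j - k.+1)%N = false.
      apply/negP => /eqP h; case/eqP: ki; apply: val_inj => /=; have := ltn_ord k.
      by move: h; move: (nat_of_ord k) => x; lia.
    by rewrite !mulr0 addr0.
  rewrite prednK ?n_gt0// subnn eqxx mulr1.
  have -> : (0 == nn j - (nn j).-1)%N = false by have := n_gt0 (l0 j); rewrite /nn; lia.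
  rewrite mulr0 add0r => /eqP; rewrite !mulf_eq0 (negPf (MCKP_top j Ma)) pnatr_eq0.
  by rewrite (gtn_eqF (n_gt0 _)) => /eqP.
have c0 j k : (k < nn j)%N -> coeff v (l0 j) k.+1 = 0.
  move=> kn; have := Gc j (nn j - k)%N; rewrite (bigD1 (Ordinal kn))//= p0 eqxx !mulr0 mul0r addr0 mulr1.
  rewrite big1 ?addr0// => l lk; rewrite mulr0 mul0r addr0.
  have -> : (nn j - k == nn j - l)%N = false; last by rewrite mulr0.
  apply/negP => /eqP h; case/eqP: lk; apply: val_inj => /=; have := ltn_ord l.
  by move: h; move: (nat_of_ord l) => x; lia.
have q0 : polypart v = 0.
  move: f0; rewrite /fpol big1 ?addr0 => [|j _]; last by rewrite -/(G j) G0 mulr0.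
  by move/eqP; rewrite mulf_eq0 (negPf (monic_neq0 (polprod_monic _ _))) => /eqP.
apply: coeff_eq0 => i k; have [j ->|->] := unliftP ord0 i.
  by rewrite width_lift; case: k => [_|k]; [exact: p0|exact: c0].
rewrite width0 => kn; have : (polypart v)`_k = 0 by rewrite q0 coef0.
rewrite coef_sum (bigD1 (Ordinal kn))//= coefZ coefXn eqxx mulr1 big1 ?addr0// => l lk.
rewrite coefZ coefXn; have -> : (k == l)%N = false; last by rewrite mulr0.
by apply/negP => /eqP h; case/eqP: lk; apply: val_inj.
Qed.

End CKP.

(** Congruences modulo [P] are proved by writing the difference as an explicit combination in which
    every term has a factor known to be divisible by [P]; this tactic checks the last point. *)
Ltac dvdp_auto := solve [assumption | apply dvdpp
  | apply: dvdp_add; dvdp_auto | rewrite dvdpNr; dvdp_auto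
  | apply: dvdp_mulr; dvdp_auto | apply: dvdp_mull; dvdp_auto].

(** * Bilinear forms and their matrices *)

Section Forms.
Variables (F : fieldType) (N : nat).
Implicit Types (B : 'rV[F]_N -> 'rV[F]_N -> F) (M : 'M[F]_N).

Definition bilin B := (forall c u v w, B (c *: u + v) w = c * B u w + B v w) /\
  (forall c u v w, B w (c *: u + v) = c * B w u + B w v).

Definition form_mx B : 'M[F]_N := \matrix_(k, l) B (delta_mx 0 k) (delta_mx 0 l).

Lemma form_mul B u v : bilin B -> (u *m form_mx B *m v^T) 0 0 = B u v.
Proof.
move=> [Bl Br].
have l0 w : B 0 w = 0 by have := Bl (-1) 0 0 w; rewrite scaler0 addr0 mulN1r addNr.
have r0 w : B w 0 = 0 by have := Br (-1) 0 0 w; rewrite scaler0 addr0 mulN1r addNr.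
have El w : B u w = \sum_k u 0 k * B (delta_mx 0 k) w.
  by rewrite {1}(row_sum_delta u); elim/big_rec2 : _ => [|k x y _ <-]; rewrite ?Bl.
have Er k : B (delta_mx 0 k) v = \sum_l v 0 l * B (delta_mx 0 k) (delta_mx 0 l).
  by rewrite {1}(row_sum_delta v); elim/big_rec2 : _ => [|l x y _ <-]; rewrite ?Br.
rewrite El mxE; under eq_bigr do rewrite mxE mulr_suml.
rewrite exchange_big; apply: eq_bigr => k _; rewrite Er mulr_sumr.
by apply: eq_bigr => l _; rewrite !mxE -mulrA [_ * v 0 l]mulrC.
Qed.

Lemma form_row B u l : bilin B -> (u *m form_mx B) 0 l = B u (delta_mx 0 l).
Proof.
move=> H; have -> : (u *m form_mx B) 0 l = (col l (u *m form_mx B)) 0 0 by rewrite [RHS]mxE.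
by rewrite colE -form_mul// trmx_delta.
Qed.

Lemma unitmx_inj M : (forall u : 'rV_N, u *m M = 0 -> u = 0) -> M \in unitmx.
Proof. by move=> H; rewrite -row_free_unit inj_row_free. Qed.

End Forms.

(** Here [i], [w] and [s] stand for the numerators of E^-1, of u o v and of the star product, with
    [x] and [y] those of u and v. The hypotheses say E^-1 o E = e, s = E^-1 o w and w = u o v;
    eliminating [i] and [w] costs a factor D^2, which is invertible modulo [P]. *)
Lemma dvdp_star_aux (F : fieldType) (P D W s i w x y : {poly F}) :
  P %| (i * W - D ^+ 2) -> P %| (s * D - i * w) -> P %| (w * D - x * y) ->
  P %| ((s * W - x * y) * D * D).
Proof.
move=> H1 H2 H3.
have -> : (s * W - x * y) * D * D = (s * D - i * w) * (W * D) + (i * W - D ^+ 2) * (w * D) +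
  D ^+ 2 * (w * D - x * y) by ring.
dvdp_auto.
Qed.

Lemma poly_nonroot (F : numDomainType) (p : {poly F}) : p != 0 -> exists k : nat, p.[k%:R] != 0.
Proof.
move=> p0; have [//|H] := pselect (exists k : nat, p.[k%:R] != 0).
case/eqP: p0; apply: (@roots_geq_poly_eq0 _ _ [seq k%:R | k <- iota 0 (size p)]).
- apply/allP => _ /mapP[k _ ->]; apply/rootP/eqP; apply: contraT => k0.
  by case: H; exists k.
- by rewrite map_inj_uniq ?iota_uniq// => x y /eqP; rewrite eqr_nat => /eqP.
by rewrite size_map size_iota.
Qed.

Lemma horner_Wpol (R : realType) (m : nat) (n : 'I_m.+1 -> nat) (a : 'rV[cplx R]_(ckp_dim n)) z :
  (Wpol a).[z] = (polprod a (fun _ => 1%N)).[z] * (Vpol a).[z].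
Proof. exact: hornerM. Qed.

#[global] Opaque Ppol Vpol fpol Wpol.

(** * The Euler field *)

Section Euler.
Local Open Scope complex_scope.
Variables (R : realType) (m : nat) (n : 'I_m.+1 -> nat).
Hypothesis n_gt0 : forall i, (0 < n i)%N.
Local Notation C := (cplx R).
Local Notation N := (ckp_dim n).
Local Notation pt := 'rV[C]_N.
Local Notation n0 := (n ord0).
Local Notation l0 := (lift ord0).
Implicit Types (a : pt) (z : C).

Definition mkpt (F : 'I_m.+1 -> nat -> C) : pt :=
  \row_k (fun x : {i : 'I_m.+1 & 'I_(ckp_width n i)} => F (tag x) (tagged x)) (enum_val k).

Lemma coeff_mk F i k : (k < ckp_width n i)%N -> coeff (mkpt F) i k = F i k.
Proof. by move=> h; rewrite /coeff (insubT (fun k => k < _)%N h) mxE enum_rankK. Qed.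

(** Quasi-homogeneity: giving z the weight 1 / n_0 and lambda the weight 1, each coordinate is
    multiplied by its own weight. *)
Definition euler_vec a := mkpt (fun i k =>
  if unlift ord0 i is Some j then
    if k is 0%N then pole a j / n0%:R else (1 + k%:R / n0%:R) * coeff a i k
  else (1 - k%:R / n0%:R) * coeff a i k).

Definition dlamz a z : C := z ^+ n0.-1 + \sum_(k < n0.-1) coeff a ord0 k * (k%:R * z ^+ k.-1) -
  \sum_j \sum_(k < nn n j) k.+1%:R * coeff a (l0 j) k.+1 / (z - pole a j) ^+ k.+2.

Lemma zder_lam_explicit a z : (forall j, z != pole a j) -> zder (lam a) z (dlamz a z).
Proof.
move=> hz; have nz : (n0%:R : C) != 0 by rewrite pnatr_eq0 -lt0n n_gt0.
have HX k : zder (fun w => w ^+ k) z (k%:R * z ^+ k.-1).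
  by apply: ucder_eq (ucderX k (zder_id z)) => l t _ /=; rewrite mulr1.
have HT j (k : 'I_(nn n j)) : zder (fun w => coeff a (l0 j) k.+1 / (w - pole a j) ^+ k.+1) z
    (- (k.+1%:R * coeff a (l0 j) k.+1 / (z - pole a j) ^+ k.+2)).
  have z0 : z - pole a j != 0 by rewrite subr_eq0.
  have H1 := ucderX k.+1 (ucderB (zder_id z) (ucder_cst _ _ (pole a j))).
  have H2 := ucderZ (coeff a (l0 j) k.+1) (ucderV (fun (t : R) _ => expf_neq0 k.+1 z0) H1).
  apply: ucder_eq H2 => l t _ /=; rewrite subr0 mulr1.
  move: z0; move: (z - pole a j) => w w0; rewrite [w ^+ k.+2]exprS [w ^+ k.+1]exprS.
  by have := expf_neq0 k w0; move: (w ^+ k) => q q0; field; rewrite q0 w0.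
have H := ucderD (ucderD (ucderZ n0%:R^-1 (HX n0))
   (ucder_sum (index_enum 'I_n0.-1) (P := xpredT) (fun (k : 'I_n0.-1) _ => ucderZ (coeff a ord0 k) (HX k))))
  (ucder_sum (index_enum 'I_m) (P := xpredT) (fun j _ =>
   ucder_sum (index_enum 'I_(nn n j)) (P := xpredT) (fun k _ => HT j k))).
have H' : zder (lam a) z (n0%:R^-1 * (n0%:R * z ^+ n0.-1) + \sum_(k < n0.-1) coeff a ord0 k * (k%:R * z ^+ k.-1) +
   \sum_j \sum_(k < nn n j) - (k.+1%:R * coeff a (l0 j) k.+1 / (z - pole a j) ^+ k.+2)).
  by apply: ucder_ext H; apply: (@nearW _ (nbhs z)) => b t; rewrite lamE.
apply: ucder_eq H' => _ t _; rewrite mulKf// /dlamz; congr (_ + _).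
by rewrite -sumrN; apply: eq_bigr => j _; rewrite sumrN.
Qed.

Lemma dl_euler a z : (forall j, z != pole a j) ->
  dl a (euler_vec a) z = lam a z - z / n0%:R * derive1 (lam a) z.
Proof.
move=> hz; rewrite (zder_derive1 (zder_lam_explicit hz)).
have nz : (n0%:R : C) != 0 by rewrite pnatr_eq0 -lt0n n_gt0.
have En : z / n0%:R * z ^+ n0.-1 = n0%:R^-1 * z ^+ n0.
  by rewrite mulrAC mulrC -exprS prednK ?n_gt0.
have shape (x A B x' A' B' : C) : x = x' -> A - A' + (B + B') = x + A + B - (x' + A' - B').
  by move=> ->; ring.
rewrite lamE /dlamz /dl mulrDr mulrN mulrDr -(shape _ _ _ _ _ _ (esym En)); congr (_ + _).
  rewrite mulr_sumr -sumrB; apply: eq_bigr => k _.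
  rewrite /euler_vec coeff_mk ?width0// unlift_none.
  case: k => -[|k] hk /=; first by rewrite !mul0r mulr0 mulr0 !subr0 mul1r.
  by rewrite exprS; field.
rewrite mulr_sumr -big_split; apply: eq_bigr => j _; rewrite mulr_sumr -big_split; apply: eq_bigr => k _.
have -> : pole (euler_vec a) j = pole a j / n0%:R.
  by rewrite /pole /euler_vec coeff_mk ?width_lift// liftK.
rewrite /euler_vec coeff_mk ?width_lift ?ltnS// liftK.
have : z - pole a j != 0 by rewrite subr_eq0.
have -> : z / n0%:R * (k.+1%:R * coeff a (l0 j) k.+1 / (z - pole a j) ^+ k.+2) =
  ((z - pole a j) + pole a j) / n0%:R * (k.+1%:R * coeff a (l0 j) k.+1 / (z - pole a j) ^+ k.+2).
  by rewrite subrK.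
move: (z - pole a j) => w w0; rewrite [w ^+ k.+2]exprS.
have := expf_neq0 k.+1 w0; move: (w ^+ k.+1) => q q0 /=.
by field; rewrite q0 w0.
Qed.

Lemma euler_fieldE a z : (forall j, z != pole a j) ->
  dl a (euler_field a) z = lam a z - z / n0%:R * derive1 (lam a) z.
Proof.
move=> hz; have H : forall z, ~ is_pole a z ->
    dlam a (euler_field a) z = lam a z - z / n0%:R * derive1 (lam a) z.
  apply: (xgetPex (P := [set v | forall z, ~ is_pole a z ->
    dlam a v z = lam a z - z / n0%:R * derive1 (lam a) z]) 0).
  by exists (euler_vec a) => w hw; rewrite dlamE// dl_euler//; exact/is_poleP.
have np : ~ is_pole a z by exact/is_poleP.
by rewrite -(dlamE _ np); exact: H.
Qed.

Lemma poly_eq_nonpole a (p q : {poly C}) :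
  (forall z, (forall j, z != pole a j) -> p.[z] = q.[z]) -> p = q.
Proof.
move=> H; apply/eqP; rewrite -subr_eq0; apply: contraT => d0.
have d1 : (p - q) * polprod a (fun _ => 1%N) != 0 by exact: mulf_neq0 d0 (monic_neq0 (polprod_monic _ _)).
have [k] := poly_nonroot d1; rewrite hornerM mulf_eq0 negb_or => /andP[h1 h2].
have hk j : (k%:R : C) != pole a j.
  apply: contra_neq h2 => ->.
  by rewrite (polprodE a _ j) hornerM expr1 hornerXsubC subrr mul0r.
by move: h1; rewrite hornerD hornerN H// subrr eqxx.
Qed.

(** The correction is a multiple of [Ppol], so modulo [Ppol] the Euler field is [Wpol]. *)
Lemma fpol_euler a : fpol a (euler_field a) = Wpol a - n0%:R^-1 *: ('X * Ppol a).
Proof.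
apply: (@poly_eq_nonpole a) => z hz; rewrite fpol_dl// euler_fieldE//.
have -> : (Wpol a - n0%:R^-1 *: ('X * Ppol a)).[z] = (Wpol a).[z] - n0%:R^-1 * (z * (Ppol a).[z]).
  by move: (Wpol a) (Ppol a) => w p; rewrite hornerD hornerN hornerZ hornerM hornerX.
rewrite (zder_derive1 (zder_lam hz)) horner_Wpol Vpol_lam//.
have -> : polprod a (fun j => (nn n j).+1) = polprod a (nn n) * polprod a (fun _ => 1%N).
  by rewrite polprod_exp1; congr polprod; apply: functional_extensionality_dep => j; rewrite addn1.
rewrite hornerM; have := polprod_neq0 (nn n) hz; have := polprod_neq0 (fun _ => 1%N) hz.
move: (polprod a _).[z] (polprod a (nn n)).[z] => p q p0 q0.
have nz : (n0%:R : C) != 0 by rewrite pnatr_eq0 -lt0n n_gt0.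
by field; rewrite ?p0 ?q0 ?nz.
Qed.

End Euler.

(** * Metric, products and cometric as congruences modulo [P] *)

Section Frobenius.
Local Open Scope complex_scope.
Variables (R : realType) (m : nat) (n : 'I_m.+1 -> nat).
Hypothesis n_gt0 : forall i, (0 < n i)%N.
Local Notation C := (cplx R).
Local Notation N := (ckp_dim n).
Local Notation pt := 'rV[C]_N.
Local Notation e_ k := (delta_mx 0 k : pt).
Local Notation n0 := (n ord0).
Implicit Types (u v w : pt) (z : C).

Section AtPoint.
Variable a : pt.
Hypothesis Ma : MCKP a.
Local Notation P := (Ppol a).
Local Notation W := (Wpol a).
Local Notation f := (fpol a).
Definition Dpol (b : pt) : {poly C} := polprod b (fun j => (nn n j).+1).
Local Notation D := (Dpol a).
Local Notation rhoP G := (rho (Ppol a) N G).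

Lemma coprime_PD : coprimep P D.
Proof.
apply: (big_ind (fun q => coprimep P q)) => [|x y hx hy|j _]; first exact: coprimep1.
  by rewrite coprimepMr hx.
by rewrite coprimep_expr// coprimep_XsubC /root Ppol_pole_neq0.
Qed.

Lemma rho_dvd G H : P %| (G - H) -> rhoP G = rhoP H.
Proof.
move=> d; apply: rho_modE; apply/eqP; rewrite -subr_eq0 -modpN -modpD.
by rewrite -/(P %| _).
Qed.

Lemma P_neq0 : P != 0. Proof. by rewrite monic_neq0 ?Ppol_monic. Qed.

Lemma modP_dvd G : P %| (G %% P - G).
Proof. by rewrite {2}(divp_eq G P) opprD addrCA subrr addr0 dvdpNr dvdp_mull. Qed.

Lemma crit_nonpole z : P.[z] = 0 -> forall j, z != pole a j.
Proof. by move=> Pz j; apply: contra_eq_neq Pz => ->; exact: Ppol_pole_neq0. Qed.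

Lemma criticalE : critical a = [set z | P.[z] = 0].
Proof.
apply/seteqP; split=> z /=; rewrite /critical /=.
  case=> /is_poleP hz; rewrite (zder_derive1 (zder_lam hz)) => /eqP.
  by rewrite mulf_eq0 invr_eq0 (negPf (polprod_neq0 _ hz)) orbF => /eqP.
move=> Pz; have hz := crit_nonpole Pz; split; first exact/is_poleP.
by rewrite (zder_derive1 (zder_lam hz)) Pz mul0r.
Qed.

(** As [B] is invertible modulo [P], H / (B P) differs from r / P, with r the remainder of H Bi, by
    a function holomorphic at the roots of [P]. The residues of r / P add up to the top coefficient
    of r. *)
Lemma sum_residues (F : C -> C) (B Bi U H : {poly C}) : U * P + Bi * B = 1 ->
  (forall z, P.[z] = 0 -> \forall w \near z, F w = H.[w] / (B.[w] * P.[w])) ->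
  \sum_(z \in critical a) residue F z = rhoP (H * Bi).
Proof.
move=> E HF; have Bz z : P.[z] = 0 -> B.[z] != 0.
  move=> Pz; apply/eqP => Bz; have := congr1 (horner^~ z) E.
  by rewrite hornerD !hornerM Pz Bz !mulr0 addr0 hornerC => /esym/eqP; rewrite oner_eq0.
have [rs Prs] := closed_field_poly_normal P.
rewrite (monicP (Ppol_monic n_gt0 a)) scale1r in Prs.
have rootP z : (P.[z] = 0) <-> z \in rs.
  by rewrite -root_prod_XsubC -Prs; split=> /rootP.
pose r := (H * Bi) %% P; pose q := (H * Bi) %/ P.
have sr : (size r <= size rs)%N.
  have : size P = (size rs).+1 by rewrite Prs size_prod_XsubC.
  by move=> sP; rewrite -ltnS -sP ltn_modp P_neq0.
have srs : size rs = N.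
  by have := size_Ppol n_gt0 a; rewrite Prs size_prod_XsubC => -[].
have -> : critical a = [set` undup rs].
  by rewrite criticalE; apply/seteqP; split=> z /=; rewrite mem_undup => /rootP.
rewrite -fsbig_seq ?undup_uniq//.
(* Without roots, [P] is 1 and both sides are 0; [pfrac_rat] requires at least one point. *)
have [rs0|] := posnP (size rs).
  have rsn : rs = [::] by apply: size0nil.
  rewrite rsn big_nil /rho; move: sr; rewrite rs0 leqn0 size_poly_eq0 => /eqP.
  by rewrite /r => ->; rewrite coef0.
rewrite -has_predT => /hasP[x0 x0rs _].
have x0u : x0 \in undup rs by rewrite mem_undup.
have su : {subset rs <= undup rs} by move=> x; rewrite mem_undup.
have [rr Hrr Er] := pfrac_residue (pfrac_rat x0u su sr) (undup_uniq rs).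
rewrite -Prs srs in Er Hrr.
have -> : rhoP (H * Bi) = r`_N.-1 by [].
rewrite -Er; apply: eq_big_seq => x xu; apply: residueE.
have Px : P.[x] = 0 by apply/rootP; rewrite -mem_undup.
have H2 : is_residue (fun z => (H * U + B * q).[z] / B.[z]) x 0.
  by apply: is_residue_holomorphic; apply: holomorphic_rat; exact: Bz.
have := is_residueD (Hrr x xu) H2; rewrite addr0; apply: is_residue_ext.
have BN : \forall z \near x, B.[z] != 0 by exact: (cvg_neq0 (@horner_cvg R B x) (Bz x Px)).
have [e1 e10 HB] := (nbhs_ncP _ _).1 BN; have [e2 e20 HFx] := (nbhs_ncP _ _).1 (HF x Px).
pose T : {poly C} := \prod_(y <- rem x (undup rs)) ('X - y%:P).
have T0 : T.[x] != 0.
  rewrite horner_prod prodf_seq_neq0; apply/allP => y; rewrite mem_rem_uniq ?undup_uniq// inE => /andP[yx _].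
  by rewrite !hornerE subr_eq0 eq_sym.
have TN : \forall z \near x, T.[z] != 0 by exact: (cvg_neq0 (@horner_cvg R T x) T0).
have [e3 e30 HT] := (nbhs_ncP _ _).1 TN.
apply/dnbhs_nc; exists (Num.min e1 (Num.min e2 e3)); first by rewrite !lt_min e10 e20.
move=> z zx; rewrite !lt_min => /and3P[z1 z2 z3].
rewrite (HFx z z2); have := HB z z1; have : P.[z] != 0.
  apply: contraNneq (HT z z3) => Pz; rewrite /T horner_prod prodf_seq_eq0.
  apply/hasP; exists z; last by rewrite !hornerE subrr.
  by rewrite mem_rem_uniq ?undup_uniq// inE zx mem_undup; apply/rootP.
have EH : H = H * U * P + B * (q * P + r).
  by rewrite -divp_eq mulrCA [B * Bi]mulrC -mulrA -mulrDr E mulr1.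
rewrite [in RHS]EH !(hornerD, hornerM); move: P.[z] B.[z] => p b p0 b0.
by field; rewrite p0 b0.
Qed.


Lemma near_dlam (z : C) : P.[z] = 0 -> \forall w \near z,
  [/\ D.[w] != 0, derive1 (lam a) w = P.[w] / D.[w] & forall v, dlam a v w = (f v).[w] / D.[w]].
Proof.
move=> Pz; apply: filterS (near_nonpole (crit_nonpole Pz)) => w hw.
have D0 : D.[w] != 0 by exact: polprod_neq0.
split=> [//||v]; first exact: (zder_derive1 (zder_lam hw)).
by rewrite (dlamE v ((is_poleP a w).2 hw)) (fpol_dl v hw) mulrC mulKf.
Qed.

Variables (U Di : {poly C}).
Hypothesis E : U * P + Di * D = 1.

(** Since v(lambda) = f v / D and lambda' = P / D, the integrand is f u f v / (D P), and [Di]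
    inverts D modulo [P]. *)
Lemma etaE u v : eta a u v = rhoP (f u * f v * Di).
Proof.
rewrite /eta (sum_residues (H := f u * f v) E)// => z Pz.
apply: filterS (near_dlam Pz) => w [D0 -> H]; rewrite !H hornerM invfM invrK.
by move: D0; move: D.[w] P.[w] => d p d0; rewrite invfM; move: p^-1 => q; field.
Qed.

Lemma eta3E u v w : eta3 a u v w = rhoP (f u * f v * f w * Di ^+ 2).
Proof.
have E2 : (2 * U - U ^+ 2 * P) * P + Di ^+ 2 * D ^+ 2 = 1.
  have -> : Di ^+ 2 * D ^+ 2 = (1 - U * P) ^+ 2 by rewrite -E addrC addKr exprMn.
  by ring.
rewrite /eta3 (sum_residues (H := f u * f v * f w) E2)// => z Pz.
apply: filterS (near_dlam Pz) => x [D0 -> H]; rewrite !H; move: D0.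
move: D P (f u) (f v) (f w) => d p x1 x2 x3 d0; rewrite expr2 !hornerM !invfM invrK.
by move: (p.[x])^-1 d.[x] d0 => q y y0; field.
Qed.

Lemma rho_mulr_lin (p q x y : {poly C}) c :
  rhoP (p * (c *: x + y) * q) = c * rhoP (p * x * q) + rhoP (p * y * q).
Proof.
have -> : p * (c *: x + y) * q = c *: (p * x * q) + p * y * q.
  by rewrite mulrDr mulrDl -scalerAr -!scalerAl.
by rewrite rhoD rhoZ.
Qed.

Definition rform (G : {poly C}) u v : C := rhoP (f u * f v * G).

Lemma rho_bilin (G : {poly C}) : bilin (rform G).
Proof.
rewrite /rform; split=> c u v w; rewrite fpol_lin; move: (f u) (f v) (f w) => x y z.
  have -> : (c *: x + y) * z * G = c *: (x * z * G) + y * z * G by rewrite !mulrDl -!scalerAl.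
  by rewrite rhoD rhoZ.
exact: rho_mulr_lin.
Qed.

(** By [fpol_eq0] the map is injective, and its source and target both have dimension N. *)
Lemma fpol_surj (H : {poly C}) : (size H <= N)%N -> exists v, f v = H.
Proof.
move=> sH; pose K : 'M[C]_N := \matrix_k poly_rV (f (e_ k)).
have fE v : poly_rV (f v) = v *m K.
  rewrite {1}(row_sum_delta v) mulmx_sum_row.
  have -> : f (\sum_j v 0 j *: e_ j) = \sum_j v 0 j *: f (e_ j).
    elim/big_rec2 : _ => [|k x y _ <-]; last by rewrite fpol_lin.
    by have := fpol_lin a (-1) 0 0; rewrite scaler0 addr0 scaleN1r addNr.
  by rewrite linear_sum; apply: eq_bigr => k _; rewrite linearZ /= rowK.
have Ku : K \in unitmx.
  apply: unitmx_inj => u; rewrite -fE => E0; apply: (fpol_eq0 n_gt0 Ma).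
  by rewrite -(poly_rV_K (size_fpol a u)) E0 linear0.
exists (poly_rV H *m invmx K).
rewrite -(poly_rV_K (size_fpol a _)) fE mulmxKV//.
exact: poly_rV_K.
Qed.

Lemma fpol_surj_mod (H : {poly C}) : exists v, P %| (f v - H).
Proof.
have [|v Hv] := @fpol_surj (H %% P); last by exists v; rewrite Hv modP_dvd.
by rewrite -ltnS -(size_Ppol n_gt0 a) ltn_modp P_neq0.
Qed.

Lemma fpol_inj_mod u v : P %| (f u - f v) -> u = v.
Proof.
move=> d; apply/eqP; rewrite -subr_eq0; apply/eqP; apply: (fpol_eq0 n_gt0 Ma).
have -> : u - v = -1 *: v + u by rewrite scaleN1r addrC.
rewrite fpol_lin scaleN1r addrC; apply/eqP; apply: contraLR d => d0.
apply/negP => /(dvdp_leq d0); rewrite (size_Ppol n_gt0) leqNgt ltnS.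
by rewrite (leq_trans (size_polyD _ _))// size_polyN geq_max !size_fpol.
Qed.

Lemma coprime_of (A B Bi : {poly C}) : A * P + Bi * B = 1 -> coprimep P B /\ coprimep P Bi.
Proof.
move=> H; split; apply/Bezout_eq1_coprimepP; first by exists (A, Bi).
by exists (A, B); rewrite /= [B * Bi]mulrC.
Qed.

Lemma rho_eq0 (G : {poly C}) : (forall v, rhoP (f v * G) = 0) -> P %| G.
Proof.
move=> H; rewrite /dvdp; apply/eqP; apply: (rho_nondeg (Ppol_monic n_gt0 a) (size_Ppol n_gt0 a)).
by move=> Q sQ; have [v <-] := fpol_surj sQ; rewrite mulrC.
Qed.

Lemma eta_mxE : eta_mx a = form_mx (rform Di).
Proof. by apply/matrixP => k l; rewrite !mxE etaE. Qed.

Lemma eta_unit : eta_mx a \in unitmx.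
Proof.
apply: unitmx_inj => u Hu; apply: fpol_inj_mod; have [_ cD] := coprime_of E.
have f0 : f 0 = 0 by have := fpol_lin a (-1) 0 0; rewrite scaler0 addr0 scaleN1r addNr.
rewrite f0 subr0 -(Gauss_dvdpl _ cD); apply: rho_eq0 => v.
have := form_mul u v (rho_bilin Di); rewrite -eta_mxE Hu mul0mx mxE => /esym.
by rewrite /rform mulrA [f v * _]mulrC.
Qed.

(** The product is defined through its pairings with all vectors; non-degeneracy of [rho] turns
    these equalities into one congruence, from which the powers of [Di] are then cleared. *)
Lemma frob_mulP u v : P %| (f (frob_mul a u v) * D - f u * f v).
Proof.
set w := frob_mul a u v; have [_ cD] := coprime_of E.
have Hw : w *m eta_mx a = \row_k eta3 a u v (e_ k) by rewrite /w /frob_mul mulmxKV ?eta_unit.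
have H : P %| (f w * Di - f u * f v * Di ^+ 2).
  apply: rho_eq0 => x.
  have El k : rhoP (f w * f (e_ k) * Di) = rhoP (f u * f v * f (e_ k) * Di ^+ 2).
    rewrite -eta3E; have := form_row w k (rho_bilin Di).
    by rewrite -eta_mxE Hw mxE => ->.
  have Ex : rhoP (f w * f x * Di) = rhoP (f u * f v * f x * Di ^+ 2).
    have [_ Br] := rho_bilin Di.
    rewrite (row_sum_delta x); elim/big_rec : _ => [|k y _ IH].
      have -> : f 0 = 0 by have := fpol_lin a (-1) 0 0; rewrite scaler0 addr0 scaleN1r addNr.
      by rewrite !mulr0 !mul0r.
    by rewrite fpol_lin !rho_mulr_lin El IH.
  have -> : f x * (f w * Di - f u * f v * Di ^+ 2) =
     f w * f x * Di + (-1) *: (f u * f v * f x * Di ^+ 2) by rewrite scaleN1r; ring.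
  by rewrite rhoD rhoZ Ex mulN1r subrr.
have -> : f w * D - f u * f v = (f w * Di - f u * f v * Di ^+ 2) * D ^+ 2
     + (U * (f w * D) + (U ^+ 2 * P - 2 * U) * (f u * f v)) * P.
  have -> : (f w * Di - f u * f v * Di ^+ 2) * D ^+ 2 =
    f w * D * (Di * D) - f u * f v * (Di * D) ^+ 2 by ring.
  have -> : Di * D = 1 - U * P by rewrite -E addrC addKr.
  by ring.
dvdp_auto.
Qed.

Lemma frob_mul_eq u v w : P %| (f w * D - f u * f v) -> frob_mul a u v = w.
Proof.
move=> H; apply: fpol_inj_mod; have [cD _] := coprime_of E.
rewrite -(Gauss_dvdpl _ cD).
have -> : (f (frob_mul a u v) - f w) * D = (f (frob_mul a u v) * D - f u * f v)
   - (f w * D - f u * f v) by ring.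
by have H2 := frob_mulP u v; dvdp_auto.
Qed.

(** The function 1 has numerator D. For n_0 = 1 this has degree N and is no tangent vector, but its
    class modulo [P] always is one. *)
Lemma unit_fieldP : P %| (f (unit_field a) - D).
Proof.
have [e0 He0] := fpol_surj_mod D.
have He v : frob_mul a e0 v = v.
  apply: frob_mul_eq; have -> : f v * D - f e0 * f v = - ((f e0 - D) * f v) by ring.
  dvdp_auto.
have Hu : forall v, frob_mul a (unit_field a) v = v.
  by apply: (xgetPex (P := [set e | forall v, frob_mul a e v = v]) 0); exists e0.
have := frob_mulP (unit_field a) e0; rewrite Hu => H; have [cD _] := coprime_of E.
rewrite -(Gauss_dvdpl _ cD).
have -> : (f (unit_field a) - D) * D = - (f e0 * D - f (unit_field a) * f e0)
   + (D - f (unit_field a)) * (f e0 - D) by ring.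
dvdp_auto.
Qed.

Lemma eulerP : P %| (f (euler_field a) - W).
Proof. by rewrite (fpol_euler n_gt0) addrAC subrr add0r dvdpNr scalerAl dvdp_mull. Qed.

(** The sum of the residues of u(lambda) v(lambda) lambda / lambda': the intersection form carried
    to vectors by eta. *)
Definition Tform u v : C := rform (W * Di ^+ 2) u v.

Lemma eta_row u : flat a u = u *m form_mx (rform Di).
Proof. by rewrite /flat eta_mxE. Qed.

Lemma cometric_form om1 om2 : cometric a om1 om2 = Tform (sharp a om1) (sharp a om2).
Proof.
rewrite /cometric /comul eta_row form_mul; last exact: rho_bilin.
rewrite /Tform /rform.
set w := frob_mul _ _ _; apply: rho_dvd; have H1 := frob_mulP (sharp a om1) (sharp a om2).
rewrite -/w in H1; move: H1 eulerP.
move: (f w) (f (sharp a om1)) (f (sharp a om2)) (f (euler_field a)) => x y y' e H1 H2.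
have -> : x * e * Di - y * y' * (W * Di ^+ 2) = (e - W) * (x * Di) + W * Di ^+ 2 * (x * D - y * y')
   + W * x * Di * (1 - Di * D) by ring.
have -> : 1 - Di * D = U * P by rewrite -E addrK.
dvdp_auto.
Qed.

Lemma sharp_lin c om1 om2 : sharp a (c *: om1 + om2) = c *: sharp a om1 + sharp a om2.
Proof. by rewrite /sharp mulmxDl scalemxAl. Qed.

Lemma cometric_bilin : bilin (cometric a).
Proof.
have [Bl Br] := rho_bilin (W * Di ^+ 2).
split=> c u v w; rewrite !cometric_form sharp_lin; first exact: Bl.
exact: Br.
Qed.

Lemma cometric_mxE : cometric_mx a = form_mx (cometric a). Proof. by []. Qed.

Lemma sharpK v : sharp a (v *m eta_mx a) = v.
Proof. by rewrite /sharp mulmxK ?eta_unit. Qed.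

(** If [P] and [W] share a root c, then P / (z - c) is the numerator of a vector on which [Tform]
    vanishes identically, so the cometric is degenerate. *)
Lemma Mhat_coprime : \det (cometric_mx a) != 0 -> coprimep P W.
Proof.
rewrite -unitfE -/(_ \in unitmx) => cu; apply/negPn/negP => ncop.
have gs : size (gcdp P W) != 1 by [].
have [c] : exists c, root (gcdp P W) c by apply/closed_rootP.
rewrite root_gcd => /andP[/factor_theorem[g Pg] /factor_theorem[W1 EW]].
have g0 : g != 0 by apply: contraTneq (P_neq0) => g0; rewrite Pg g0 mul0r eqxx.
have [v fv] : exists v, f v = g.
  apply: fpol_surj; have := size_Ppol n_gt0 a.
  by rewrite Pg size_Mmonic ?monicXsubC// size_XsubC addn2 /= => -[->].
have om0 : (v *m eta_mx a) *m cometric_mx a = 0.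
  apply/rowP => l; rewrite cometric_mxE (form_row _ l cometric_bilin) cometric_form sharpK mxE.
  rewrite /Tform /rform -(rho0 (Ppol a) N); apply: rho_dvd; rewrite subr0 fv EW.
  have -> : g * f (sharp a (e_ l)) * (W1 * ('X - c%:P) * Di ^+ 2) =
    (g * ('X - c%:P)) * (f (sharp a (e_ l)) * W1 * Di ^+ 2) by ring.
  by rewrite -Pg; dvdp_auto.
have v0 : v = 0.
  have : v *m eta_mx a = 0 by rewrite -(mulmxK cu (v *m _)) om0 mul0mx.
  by move=> e; rewrite -(mulmxK eta_unit v) e mul0mx.
move: g0; rewrite -fv v0.
by have := fpol_lin a (-1) 0 0; rewrite scaler0 addr0 scaleN1r addNr => ->; rewrite eqxx.
Qed.

Section Coprime.
Variables (U' Wi : {poly C}).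
Hypothesis EW : U' * P + Wi * W = 1.

(** The sum of the residues of u(lambda) v(lambda) / (lambda lambda') at the critical points: the
    covariant metric of the almost duality. *)
Definition gdn u v : C := rform Wi u v.

Lemma gdn_cometric : form_mx gdn *m cometric_mx a = 1%:M.
Proof.
apply/row_matrixP => k; rewrite row_mul rowE row1.
set v := e_ k; have [vh Hvh] := fpol_surj_mod (D * f v * Wi).
have Ev : v *m form_mx gdn = vh *m eta_mx a.
  have bg : bilin gdn by exact: rho_bilin.
  apply/rowP => l; rewrite eta_mxE (form_row v l bg) (form_row vh l (rho_bilin Di)); rewrite /gdn /rform; apply: rho_dvd.
  move: Hvh; move: (f vh) (f v) (f (e_ l)) => x y y' H.
  have -> : y * y' * Wi - x * y' * Di = - ((x - D * y * Wi) * (y' * Di)) + y * y' * Wi * (1 - Di * D) by ring.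
  have -> : 1 - Di * D = U * P by rewrite -E addrK.
  dvdp_auto.
apply/rowP => l; rewrite Ev cometric_mxE (form_row _ l cometric_bilin) cometric_form sharpK.
have -> : v 0 l = (v *m (1%:M : 'M[C]_N)) 0 l by rewrite mulmx1.
have Es : e_ l = sharp a (e_ l) *m eta_mx a by rewrite /sharp mulmxKV ?eta_unit.
have -> : (v *m (1%:M : 'M[C]_N)) 0 l = rhoP (f (sharp a (e_ l)) * f v * Di).
  have := form_row (sharp a (e_ l)) k (rho_bilin Di); rewrite /rform => <-.
  by rewrite -eta_mxE -Es mulmx1 !mxE eqxx /= eq_sym.
rewrite /Tform /rform; apply: rho_dvd; move: Hvh; move: (f vh) (f v) (f (sharp a _)) => x y s H.
have -> : x * s * (W * Di ^+ 2) - s * y * Di = (x - D * y * Wi) * (s * W * Di ^+ 2) +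
   s * y * Di * ((Di * D) * (Wi * W) - 1) by ring.
have -> : (Di * D) * (Wi * W) - 1 = (U * U' * P - U - U') * P.
  have -> : Di * D = 1 - U * P by rewrite -E addrC addKr.
  have -> : Wi * W = 1 - U' * P by rewrite -EW addrC addKr.
  by ring.
dvdp_auto.
Qed.

(** Modulo [P] the Euler field is [W] and the unit is D, so E^-1 has numerator D^2 / W and the star
    product has numerator f u f v / W. *)
Lemma starP u v : P %| (f (star a u v) * W - f u * f v).
Proof.
have [cW _] := coprime_of EW; have [cD _] := coprime_of E.
have HE : P %| (f (euler_inv a) * W - D ^+ 2).
  have [vi Hvi] := fpol_surj_mod (D ^+ 2 * Wi).
  have Hi : frob_mul a (euler_field a) vi = unit_field a.
    apply: frob_mul_eq; move: Hvi eulerP unit_fieldP.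
    move: (f vi) (f (euler_field a)) (f (unit_field a)) => x e u1 H1 H2 H3.
    have -> : u1 * D - e * x = (u1 - D) * D - (e - W) * x - W * (x - D ^+ 2 * Wi) +
      D ^+ 2 * (1 - Wi * W) by ring.
    have -> : 1 - Wi * W = U' * P by rewrite -EW addrK.
    dvdp_auto.
  have He : frob_mul a (euler_field a) (euler_inv a) = unit_field a.
    apply: (xgetPex (P := [set v | frob_mul a (euler_field a) v = unit_field a]) 0).
    by exists vi.
  have := frob_mulP (euler_field a) (euler_inv a); rewrite He; move: eulerP unit_fieldP.
  move: (f (euler_inv a)) (f (euler_field a)) (f (unit_field a)) => x e u1 H1 H2 H3.
  have -> : x * W - D ^+ 2 = - (u1 * D - e * x) + (u1 - D) * D - (e - W) * x by ring.
  dvdp_auto.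
have H1 := frob_mulP (euler_inv a) (frob_mul a u v); have H2 := frob_mulP u v.
rewrite -/(star a u v) in H1.
rewrite -(Gauss_dvdpl _ cD) -(Gauss_dvdpl _ cD).
exact: dvdp_star_aux HE H1 H2.
Qed.

End Coprime.
End AtPoint.
End Frobenius.

(** * Metric and star product in terms of zeros and poles *)

Section RootData.
Local Open Scope complex_scope.
Variables (R : realType) (m : nat) (n : 'I_m.+1 -> nat).
Hypothesis n_gt0 : forall i, (0 < n i)%N.
Local Notation C := (cplx R).
Local Notation N := (ckp_dim n).
Local Notation M := (Mdeg n).
Local Notation pt := 'rV[C]_N.
Local Notation n0 := (n ord0).
Local Notation one := (fun _ : 'I_m => 1%N).
Local Notation nn1 := (fun j : 'I_m => (nn n j).+1).
Implicit Types (u v : pt) (z : C).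

Local Notation idx := ('I_M + 'I_m)%type.

Definition eps (r : idx) : C := match r with inl _ => 1 | inr j => - (nn n j)%:R end.

(* The zeros [Z] and the poles of lambda, with the multiplicities [eps]. *)
Definition rpt (Z : 'I_M -> C) (a : pt) (r : idx) : C :=
  match r with inl k => Z k | inr j => pole a j end.

Definition is_zeros (a : pt) (Z : 'I_M -> C) :=
  Vpol a = n0%:R^-1 *: \prod_k ('X - (Z k)%:P).

Lemma card_idx : #|{: idx}| = N.+1.
Proof. by rewrite card_sum !card_ord (ckp_dim1 n_gt0) /Mdeg. Qed.

Lemma eps_neq0 r : eps r != 0.
Proof. by case: r => [k|j] /=; rewrite ?oner_neq0// oppr_eq0 pnatr_eq0 -lt0n n_gt0. Qed.

Lemma n0_neq0 : (n0%:R : C) != 0.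
Proof. by rewrite pnatr_eq0 -lt0n n_gt0. Qed.

Section AtPoint.
Variables (a : pt) (Z : 'I_M -> C).
Hypotheses (Ma : MCKP a) (HZ : is_zeros a Z).
Local Notation X := (rpt Z a).
Local Notation zpol := (\prod_k ('X - (Z k)%:P) : {poly C}).
Local Notation P := (Ppol a).
Local Notation W := (Wpol a).
Local Notation f := (fpol a).
Local Notation w := (nodal (rpt Z a)).
Local Notation c r := (conodal (rpt Z a) r).

Lemma nodal_rpt : w = zpol * polprod a one.
Proof.
by rewrite /nodal big_sumType.
Qed.

Lemma Wpol_nodal : W = n0%:R^-1 *: w.
Proof.
transitivity (polprod a one * Vpol a); first by [].
by rewrite HZ nodal_rpt -scalerAr mulrC.
Qed.

Lemma XsubC_neq0 (x : C) : 'X - x%:P != 0. Proof. by rewrite polyXsubC_eq0. Qed.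

Lemma conodal_zero k : c (inl k) = (\prod_(l | l != k) ('X - (Z l)%:P)) * polprod a one.
Proof.
apply: (mulfI (XsubC_neq0 (Z k))); have := nodalE X (inl k); rewrite /= => <-.
by rewrite nodal_rpt (bigD1 k)//= mulrA.
Qed.

Lemma conodal_pole j : c (inr j) = zpol * copol a one j.
Proof.
apply: (mulfI (XsubC_neq0 (pole a j))); have := nodalE X (inr j); rewrite /= => <-.
by rewrite nodal_rpt (polprodE a one j) expr1 mulrCA.
Qed.

Lemma PpolE z : P.[z] = (polprod a one).[z] * (Vpol a)^`().[z] - (Spol a).[z] * (Vpol a).[z].
Proof.
transitivity ((polprod a one * (Vpol a)^`() - Spol a * Vpol a).[z]); first by [].
by move: (polprod a one) (Vpol a) (Spol a) => p q s; rewrite hornerD hornerN !hornerM.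
Qed.

Lemma Vpol_zero z : (Vpol a).[z] = n0%:R^-1 * zpol.[z].
Proof. by rewrite HZ hornerZ. Qed.

Lemma Vpol_at_zero k : (Vpol a).[Z k] = 0.
Proof.
by rewrite Vpol_zero horner_prod (bigD1 k)//= hornerXsubC subrr mul0r mulr0.
Qed.

(** P = W lambda' / lambda, where W is the nodal polynomial over n_0 and lambda' / lambda has
    residue [eps r] at X_r; the value of [conodal r] there is the derivative of the nodal
    polynomial. *)
Lemma Ppol_rpt r : P.[X r] = eps r * n0%:R^-1 * (c r).[X r].
Proof.
case: r => [k|j] /=.
  rewrite mul1r conodal_zero hornerM PpolE Vpol_zero HZ derivZ hornerZ.
  rewrite !(bigD1 k (P := xpredT))//=; move: (\prod_(l | l != k) _) => q.
  rewrite derivM derivXsubC mul1r hornerD !hornerM hornerXsubC subrr !mul0r addr0 !mulr0 subr0.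
  by rewrite mulrCA [X in _ * X]mulrC.
rewrite Ppol_pole Vpol_zero conodal_pole hornerM -/(nn n j).
by move: (copol a one j).[_] zpol.[_] => x y; ring.
Qed.

Section Simple.
Hypothesis Xinj : injective X.

Lemma Ppol_rpt_neq0 r : P.[X r] != 0.
Proof. by rewrite Ppol_rpt !mulf_neq0 ?eps_neq0 ?invr_eq0 ?n0_neq0 ?conodal_eq. Qed.

Lemma conodalV r : ((c r).[X r])^-1 = eps r * n0%:R^-1 / P.[X r].
Proof.
have := Ppol_rpt_neq0 r; rewrite Ppol_rpt.
have := conodal_eq Xinj r; have := n0_neq0; have := eps_neq0 r.
move: (c r).[X r] (eps r) n0%:R => x e y e0 y0 x0 _.
by field; rewrite ?e0 ?y0 ?x0.
Qed.

Lemma coprime_PW : exists U Wi : {poly C}, U * P + Wi * W = 1.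
Proof.
have : coprimep P W.
  rewrite Wpol_nodal coprimepZr ?invr_eq0 ?n0_neq0//.
  apply: (big_ind (fun q => coprimep P q)) => [|x y hx hy|r _]; first exact: coprimep1.
    by rewrite coprimepMr hx.
  by rewrite coprimep_XsubC /root Ppol_rpt_neq0.
by move=> /Bezout_eq1_coprimepP[[U Wi] /=] H; exists U, Wi.
Qed.

Lemma coprime_PDex : exists U Di : {poly C}, U * P + Di * Dpol a = 1.
Proof.
by have /Bezout_eq1_coprimepP[[U Di] /= H] := coprime_PD n_gt0 Ma; exists U, Di.
Qed.

(** Implicit differentiation of lambda(X_r) = 0 gives v(X_r) = - v(lambda) / lambda'; at the poles
    the same expression is v(p_j) by [fpol_pole]. That it is the derivative of X_r is part of
    [local_roots]. *)
Definition uX v r : C := - ((f v).[X r] / P.[X r]).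

Lemma uX_pole v j : uX v (inr j) = pole v j.
Proof.
have := Ppol_rpt_neq0 (inr j); rewrite /uX /= (fpol_pole n_gt0).
by move: P.[_] => x x0; rewrite !mulNr opprK mulfK.
Qed.

Lemma frac_rpt (g : {poly C}) z : (size g <= N.+1)%N -> (forall r, z != X r) ->
  g.[z] / W.[z] = \sum_r eps r * (g.[X r] / P.[X r]) / (z - X r).
Proof.
move=> sg hz; rewrite Wpol_nodal hornerZ invfM invrK mulrCA lagrange_frac ?card_idx//.
rewrite mulr_sumr; apply: eq_bigr => r _; rewrite conodalV.
have := n0_neq0; move: (n0%:R : C) (z - X r)^-1 P.[X r]^-1 => y q p y0.
by field.
Qed.

Lemma top_rpt (g : {poly C}) : (size g <= N.+1)%N ->
  g`_N = n0%:R^-1 * \sum_r eps r * (g.[X r] / P.[X r]).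
Proof.
move=> sg; have := @lagrange_top _ _ X Xinj g; rewrite card_idx => -> //.
rewrite mulr_sumr; apply: eq_bigr => r _; rewrite conodalV.
by ring.
Qed.

Lemma sum_eps : \sum_r eps r = n0%:R.
Proof.
have := top_rpt (eq_leq (size_Ppol n_gt0 a)).
have -> : P`_N = 1.
  by have /monicP := Ppol_monic n_gt0 a; rewrite /lead_coef (size_Ppol n_gt0).
move=> E; have : n0%:R = n0%:R * (n0%:R^-1 * \sum_r eps r * (P.[X r] / P.[X r])) :> C by rewrite -E mulr1.
rewrite mulVKf ?n0_neq0// => ->; apply: eq_bigr => r _.
by rewrite mulfV ?mulr1 ?Ppol_rpt_neq0.
Qed.

(** The numerator [f v] has degree below N. Equivalently, sum_r eps_r X_r is constant, because
    lambda has no term of degree n_0 - 1. *)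
Lemma sum_eps_uX v : \sum_r eps r * uX v r = 0.
Proof.
have := top_rpt (leqW (size_fpol a v)); rewrite nth_default ?size_fpol//.
move=> /esym/eqP; rewrite mulf_eq0 invr_eq0 (negPf n0_neq0) /= => /eqP E.
by rewrite -[RHS]oppr0 -[in RHS]E -sumrN; apply: eq_bigr => r _; rewrite mulrN.
Qed.

Lemma rpt_not_pole z : (forall r, z != X r) -> forall j, z != pole a j.
Proof. by move=> hz j; exact: (hz (inr j)). Qed.

Lemma lam_W z : (forall r, z != X r) -> [/\ W.[z] != 0, lam a z = W.[z] / (polprod a nn1).[z] &
  (polprod a nn1).[z] != 0].
Proof.
move=> hz; have hp := rpt_not_pole hz; split; last exact: polprod_neq0.
  rewrite Wpol_nodal hornerZ mulf_neq0 ?invr_eq0 ?n0_neq0// /nodal horner_prod.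
  by apply/prodf_neq0 => r _; rewrite hornerXsubC subr_eq0.
rewrite horner_Wpol Vpol_lam//.
have -> : polprod a nn1 = polprod a (nn n) * polprod a one.
  by rewrite polprod_exp1; congr polprod; apply: functional_extensionality_dep => j; rewrite addn1.
rewrite hornerM; have := polprod_neq0 (nn n) hp; have := polprod_neq0 one hp.
move: (polprod a _).[z] (polprod a _).[z] => x y x0 y0.
by field; rewrite ?x0 ?y0.
Qed.

Lemma lam_neq0 z : (forall r, z != X r) -> lam a z != 0.
Proof. by move=> /lam_W[w0 -> d0]; rewrite mulf_neq0 ?invr_eq0. Qed.

Lemma dlog_v v z : (forall r, z != X r) -> dl a v z / lam a z = - \sum_r eps r * uX v r / (z - X r).
Proof.
move=> hz; have [w0 -> d0] := lam_W hz; have := fpol_dl v (rpt_not_pole hz) => E.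
have -> : dl a v z = (f v).[z] / (polprod a nn1).[z] by rewrite E mulrC mulKf.
rewrite invfM invrK mulrACA mulVf// mulr1 frac_rpt ?(leqW (size_fpol a v))//.
by rewrite -sumrN; apply: eq_bigr => r _; rewrite /uX mulrN mulNr opprK.
Qed.

Lemma dlog_z z : (forall r, z != X r) -> derive1 (lam a) z / lam a z = \sum_r eps r / (z - X r).
Proof.
move=> hz; have [w0 -> d0] := lam_W hz.
rewrite (zder_derive1 (zder_lam (rpt_not_pole hz))).
rewrite invfM invrK mulrACA mulVf// mulr1 frac_rpt ?(size_Ppol n_gt0)//.
by apply: eq_bigr => r _; rewrite mulfV ?mulr1 ?Ppol_rpt_neq0.
Qed.

(* Lagrange interpolation: the polynomials of degree at most N separate the N + 1 points [X r]. *)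
Lemma uX_separates (y : idx -> C) : \sum_r eps r * y r = 0 ->
  (forall v, \sum_r eps r * y r * uX v r = 0) -> forall r, y r = 0.
Proof.
move=> y0 Hy s; pose g := c s.
have sg : size g = N.+1 by rewrite size_conodal card_idx.
(* The polynomial [g] itself has degree N and is no numerator of a vector; subtracting the monic [P]
   repairs this, and the hypothesis [y0] removes the contribution of [P]. *)
have sh : (size (g - P)%R <= N)%N.
  apply/leq_sizeP => j; rewrite leq_eqVlt => /predU1P[<-|Nj].
    have /monicP := conodal_monic X s; rewrite -/g /lead_coef sg /= coefB => ->.
    have /monicP := Ppol_monic n_gt0 a; rewrite /lead_coef (size_Ppol n_gt0) /= => ->.
    by rewrite subrr.
  by rewrite coefB !nth_default ?subrr// ?sg ?(size_Ppol n_gt0).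
have [v fv] := fpol_surj n_gt0 Ma sh.
have := Hy v; have -> : \sum_r eps r * y r * uX v r = - (eps s * y s * (g.[X s] / P.[X s])).
  have E r : eps r * y r * uX v r = eps r * y r - eps r * y r * (g.[X r] / P.[X r]).
    rewrite /uX fv hornerD hornerN mulrBl mulfV ?Ppol_rpt_neq0//.
    by ring.
  under eq_bigr do rewrite E.
  rewrite sumrB y0 sub0r (bigD1 s)//= [X in _ + X]big1 ?addr0// => r rs.
  by rewrite /g conodal_neq// mul0r mulr0.
move=> /eqP; rewrite oppr_eq0 !mulf_eq0 invr_eq0 (negPf (eps_neq0 s)) (negPf (Ppol_rpt_neq0 s)).
by rewrite (negPf (conodal_eq Xinj s)) !orbF => /eqP.
Qed.

Lemma fpol0 : f 0 = 0.
Proof. by have := fpol_lin a (-1) 0 0; rewrite scaler0 addr0 scaleN1r addNr. Qed.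

Definition rmetric u v : C := - \sum_r eps r * uX u r * uX v r.

(** At X_r the relation gives s / P = uX u r uX v r, whence the partial fractions of s / W.
    Comparing coefficients of degree 2 N then expresses the top coefficient of [g] by the sum of the
    same numbers. *)
Lemma rho_frac u v (g s : {poly C}) : (size g <= N)%N -> f u * f v = g * W + s * P ->
  g`_N.-1 = rmetric u v /\
  forall z, (forall r, z != X r) -> s.[z] / W.[z] = \sum_r eps r * uX u r * uX v r / (z - X r).
Proof.
move=> sg E; have sf : (size (f u * f v)%R <= N.*2)%N.
  apply: (leq_trans (size_polyMleq _ _)); have := size_fpol a u; have := size_fpol a v.
  by rewrite -addnn; move: (size _) (size _) => x y; lia.
rewrite Wpol_nodal in E.
have c0 : n0%:R^-1 != 0 :> C by rewrite invr_eq0 n0_neq0.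
have [ss top sX] := top_coef_bezout card_idx (Ppol_monic n_gt0 a) (size_Ppol n_gt0 a) sf sg E c0.
have sE r : s.[X r] / P.[X r] = uX u r * uX v r.
  have := sX r; rewrite hornerM /uX mulrNN; have := Ppol_rpt_neq0 r.
  move: (f u).[_] (f v).[_] P.[_] s.[_] => x y p q p0 e.
  have -> : q = x * y / p by rewrite e mulfK.
  by field.
split; last first.
  move=> z hz; rewrite frac_rpt//; apply: eq_bigr => r _.
  by rewrite sE mulrA.
case: top => [top|N0].
  have := top_rpt ss => e; rewrite e -mulrDr in top.
  move/eqP: top; rewrite mulf_eq0 (negPf c0) /= addr_eq0 => /eqP ->.
  by rewrite /rmetric; congr (- _); apply: eq_bigr => r _; rewrite sE mulrA.
(* In dimension 0 there is only the zero vector and both sides vanish. *)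
have g0 : g = 0 by apply/eqP; rewrite -size_poly_leq0 -[X in (_ <= X)%N]N0.
have u0 : u = 0 by apply/rowP => k; have := ltn_ord k; rewrite [X in (_ < X)%N]N0.
rewrite g0 coef0 /rmetric big1 ?oppr0// => r _.
by rewrite u0 /uX fpol0 horner0 mul0r oppr0 mulr0 mul0r.
Qed.

Lemma rmetric_bilin : bilin rmetric.
Proof.
have L k u v r : uX (k *: u + v) r = k * uX u r + uX v r.
  by rewrite /uX fpol_lin hornerD hornerZ; ring.
split=> k u v x; rewrite /rmetric mulrN -opprD; congr (- _); rewrite mulr_sumr -big_split;
  by apply: eq_bigr => r _; rewrite L /=; ring.
Qed.

(** The inverse [gdn] of the cometric is [rho] of f u f v Wi. The remainder of this product modulo
    [P] is the [g] of [rho_frac], so [gdn] is [rmetric]. *)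
Lemma metric_cometric : form_mx rmetric *m cometric_mx a = 1%:M.
Proof.
have [U [Di E]] := coprime_PDex; have [U' [Wi EW]] := coprime_PW.
rewrite -(gdn_cometric n_gt0 Ma E EW); congr (_ *m _); apply/matrixP => k l.
rewrite !mxE /gdn /rform /rho; move: (delta_mx 0 k) (delta_mx 0 l) => u v.
set G := f u * f v * Wi.
have sg : (size (G %% P)%R <= N)%N by rewrite -ltnS -(size_Ppol n_gt0 a) ltn_modp P_neq0.
have Ef : f u * f v = G %% P * W + (f u * f v * U' + G %/ P * W) * P.
  have {1}-> : f u * f v = f u * f v * (U' * P + Wi * W) by rewrite EW mulr1.
  have -> : f u * f v * (U' * P + Wi * W) = f u * f v * U' * P + G * W by rewrite /G; ring.
  by rewrite {1}(divp_eq G P); ring.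
by have [<- _] := rho_frac sg Ef.
Qed.

Lemma rpt_Mhat : Mhat R n a.
Proof.
split; first exact: Ma.
have : cometric_mx a \in unitmx by have [] := mulmx1_unit metric_cometric.
by rewrite unitmxE unitfE.
Qed.

(** By [starP], f u f v = f (star a u v) W + s P. Dividing by W^2 gives the two terms, since P / W
    is the logarithmic derivative of lambda and [rho_frac] expands s / W. *)
Lemma star_rpt u v z : (forall r, z != X r) ->
  (dl a u z / lam a z) * (dl a v z / lam a z) = dl a (star a u v) z / lam a z +
  derive1 (lam a) z / lam a z * \sum_r eps r * uX u r * uX v r / (z - X r).
Proof.
move=> hz; have [U [Di E]] := coprime_PDex; have [U' [Wi EW]] := coprime_PW.
have /dvdpP[q Eq] := starP n_gt0 Ma E EW u v.
have Ef : f u * f v = f (star a u v) * W + (- q) * P.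
  by rewrite mulNr -Eq opprB addrC subrK.
have [_ /(_ z hz) <-] := rho_frac (size_fpol a _) Ef.
have [w0 -> d0] := lam_W hz; have hp := rpt_not_pole hz.
have dE x : dl a x z = (f x).[z] / (polprod a nn1).[z] by rewrite (fpol_dl x hp) mulrC mulKf.
rewrite (zder_derive1 (zder_lam hp)) !dE.
have := congr1 (horner^~ z) Ef; move: w0 d0.
move: (f u) (f v) (f (star a u v)) W P => fu fv fs w p; rewrite /= hornerD !hornerM.
move: fu.[z] fv.[z] fs.[z] w.[z] p.[z] (- q).[z] (polprod a nn1).[z] => x y s W' p' q' d w0 d0 e.
have -> : x / d / (W' / d) * (y / d / (W' / d)) = x * y / W' ^+ 2 by field; rewrite ?w0 ?d0.
by rewrite e; field; rewrite ?w0 ?d0.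
Qed.

End Simple.

(** A multiple zero of lambda would be a common root of [P] and [W], against [Mhat_coprime]; zeros
    never meet poles. *)
Lemma Mhat_rpt_inj : Mhat R n a -> injective X.
Proof.
case=> _ /(Mhat_coprime n_gt0 Ma _) H.
have [U [Di E]] := coprime_PDex.
have /Bezout_eq1_coprimepP[[U' Wi] /= EW] := H _ _ E.
have nr z : W.[z] = 0 -> P.[z] = 0 -> False.
  move=> W0 P0; have := congr1 (horner^~ z) EW; move: W P W0 P0 => w p W0 P0.
  rewrite /= hornerD !hornerM W0 P0 !mulr0 addr0 hornerC => /esym/eqP.
  by rewrite oner_eq0.
have zp k j : Z k <> pole a j.
  move=> e; have := Vpol_pole_neq0 n_gt0 j Ma.
  by rewrite -e Vpol_at_zero eqxx.
move=> [k|i] [l|j] /= e; [|by case: (zp k j)|by case: (zp l i)|].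
  congr inl; apply/eqP; apply/negPn/negP => kl; apply: (nr (Z k)).
    by rewrite horner_Wpol Vpol_at_zero mulr0.
  have := Ppol_rpt (inl k); rewrite /= => ->; rewrite conodal_zero hornerM horner_prod.
  by rewrite (bigD1 l) 1?eq_sym//= e hornerXsubC subrr !mul0r mulr0.
by congr inr; apply/eqP; apply/negPn/negP => /(MCKP_pole Ma); rewrite e eqxx.
Qed.

End AtPoint.

Lemma zeros_exist (a : pt) : exists Z, is_zeros a Z.
Proof.
have [rs E] := closed_field_poly_normal (Vpol a).
have sr : size rs = M.
  have := size_Vpol n_gt0 a; rewrite E size_scale ?(lead_Vpol n_gt0) ?invr_eq0 ?n0_neq0//.
  by rewrite size_prod_XsubC => -[].
exists (fun k => nth 0 rs k); rewrite /is_zeros {1}E (lead_Vpol n_gt0); congr (_ *: _).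
by rewrite (big_nth 0) sr big_mkord.
Qed.

End RootData.

(** The harmonic choice of [e] also covers an empty [I]. *)
Lemma fin_min (R : realType) (I : finType) (F : I -> R) : (forall i, 0 < F i) ->
  exists2 e, 0 < e & forall i, e <= F i.
Proof.
move=> F0; have S0 : 0 <= \sum_i (F i)^-1 by apply: sumr_ge0 => i _; rewrite invr_ge0 ltW.
exists (1 + \sum_i (F i)^-1)^-1; first by rewrite invr_gt0 ltr_wpDr.
move=> i; rewrite -[leRHS]invrK lef_pV2 ?posrE ?invr_gt0 ?ltr_wpDr//.
rewrite (bigD1 i)//= addrCA lerDl addr_ge0 ?ler01//.
by apply: sumr_ge0 => j _; rewrite invr_ge0 ltW.
Qed.

(** * Zeros of lambda as differentiable functions of the point *)

Section Roots.
Local Open Scope complex_scope.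
Variables (R : realType) (m : nat) (n : 'I_m.+1 -> nat).
Hypothesis n_gt0 : forall i, (0 < n i)%N.
Local Notation C := (cplx R).
Local Notation N := (ckp_dim n).
Local Notation M := (Mdeg n).
Local Notation pt := 'rV[C]_N.
Local Notation n0 := (n ord0).
Local Notation l0 := (lift ord0).
Local Notation e_ k := (delta_mx 0 k : pt).
Implicit Types (a b : pt) (z : C).

Lemma coeff_cvg a i k : coeff b i k @[b --> a] --> coeff a i k.
Proof. exact: jc_sE (ucder_jc (@coeff_ucder R m n a i k)). Qed.

Lemma MCKP_open a : MCKP a -> \forall b \near a, MCKP b.
Proof.
move=> Ma; have H1 : \forall b \near a, forall j, coeff b (l0 j) (nn n j) != 0.
  by apply: (@near_all pt _ a) => j; exact: (cvg_neq0 (@coeff_cvg a _ _) (MCKP_top j Ma)).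
have H2 : \forall b \near a, forall p : 'I_m * 'I_m, p.1 != p.2 -> pole b p.1 != pole b p.2.
  apply: (@near_all pt _ a) => -[i j]; rewrite /=; have [->|ij] := eqVneq i j.
    by apply: (@nearW _ (nbhs a)) => b.
  have H : pole b i - pole b j @[b --> a] --> pole a i - pole a j.
    exact: (cvgB (@coeff_cvg a (l0 i) 0) (@coeff_cvg a (l0 j) 0)).
  have h0 : pole a i - pole a j != 0 by rewrite subr_eq0 (MCKP_pole Ma ij).
  by apply: filterS (cvg_neq0 H h0) => b; rewrite subr_eq0.
apply: filterS2 H1 H2 => b h1 h2; split=> [i|i j]; first by have [k ->|->] := unliftP ord0 i; rewrite ?eqxx.
have [k ->|->] := unliftP ord0 i; rewrite ?eqxx//; have [l ->|->] := unliftP ord0 j; rewrite ?eqxx//.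
by move=> _ _ kl; apply: (h2 (k, l)); apply: contraNneq kl => /= ->.
Qed.

Lemma nonpole_near a z : (forall j, z != pole a j) -> \forall b \near a, forall j, z != pole b j.
Proof.
move=> hz; apply: (@near_all pt _ a) => j.
have H : z - pole b j @[b --> a] --> z - pole a j.
  exact: (cvgB (@cvg_const pt C a z) (@coeff_cvg a (l0 j) 0)).
have h0 : z - pole a j != 0 by rewrite subr_eq0.
by apply: filterS (cvg_neq0 H h0) => b; rewrite subr_eq0.
Qed.

Lemma polprod_cvg a e z : (polprod b e).[z] @[b --> a] --> (polprod a e).[z].
Proof.
have E b : (polprod b e).[z] = \prod_j (z - pole b j) ^+ e j.
  by rewrite horner_prod; apply: eq_bigr => j _; rewrite !hornerE.
rewrite E; under eq_fun do rewrite E.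
apply: (@cvg_prodc R pt (nbhs a) _ _ _ _ (fun j b => (z - pole b j) ^+ e j) (fun j => (z - pole a j) ^+ e j)).
move=> j _; apply: (@cvg_expc R pt (nbhs a) _ (fun b => z - pole b j)).
exact: (cvgB (@cvg_const pt C a z) (@coeff_cvg a (l0 j) 0)).
Qed.

Lemma lam_cder a z : (forall j, z != pole a j) ->
  cder (@xV R N) a (fun b => lam b z) (fun k => dl a (e_ k) z).
Proof.
move=> hz; apply: (@lam_ucder R m n a (fun _ => z)) => [t _|t _ j]; last exact: hz.
exact: (@cvg_const R C t z).
Qed.

Lemma lam_cvg a z : (forall j, z != pole a j) -> lam b z @[b --> a] --> lam a z.
Proof. by move=> hz; exact: jc_sE (ucder_jc (lam_cder hz)). Qed.

Lemma Vpol_cvg a z : (forall j, z != pole a j) -> (Vpol b).[z] @[b --> a] --> (Vpol a).[z].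
Proof.
move=> hz; rewrite (Vpol_lam hz).
have H : (polprod b (nn n)).[z] * lam b z @[b --> a] --> (polprod a (nn n)).[z] * lam a z.
  exact: (cvgM (@polprod_cvg a (nn n) z) (lam_cvg hz)).
by apply: cvg_near_eq H; apply: filterS (nonpole_near hz) => b hb; rewrite Vpol_lam.
Qed.

Lemma zero_not_pole a Z k : MCKP a -> is_zeros a Z -> forall j, Z k != pole a j.
Proof.
move=> Ma HZ j; apply/eqP => e; have := Vpol_pole_neq0 n_gt0 j Ma.
by rewrite -e (Vpol_at_zero HZ) eqxx.
Qed.

Lemma rpt_inj a Z : MCKP a -> is_zeros a Z -> injective Z -> injective (rpt Z a).
Proof.
move=> Ma HZ Zi [k|i] [l|j] /= e.
- by rewrite (Zi _ _ e).
- by have := zero_not_pole k Ma HZ j; rewrite e eqxx.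
- by have := zero_not_pole l Ma HZ i; rewrite e eqxx.
by congr inr; apply/eqP; apply/negPn/negP => /(MCKP_pole Ma); rewrite e eqxx.
Qed.

(** If all zeros of lambda_b were at distance at least e from Z_k, the numerator at Z_k would have
    modulus at least e^M / n_0, whereas it tends to 0 as b tends to a. *)
Lemma root_near a Z (e : R) : MCKP a -> is_zeros a Z -> 0 < e ->
  \forall b \near a, forall k, exists2 w, (Vpol b).[w] = 0 & nc (w - Z k) < e.
Proof.
move=> Ma HZ e0; apply: (@near_all pt _ a) => k; have hz := zero_not_pole k Ma HZ.
have c0 : 0 < nc (n0%:R^-1 : C) * e ^+ M.
  by rewrite mulr_gt0 ?exprn_gt0// nc_gt0 invr_eq0 n0_neq0.
have /cvg_ncP /(_ _ c0) := Vpol_cvg hz; apply: filterS => b.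
rewrite (Vpol_at_zero HZ) subr0 => Hb; have [Zb HZb] := zeros_exist n_gt0 b.
have [//|H] := pselect (exists2 w, (Vpol b).[w] = 0 & nc (w - Z k) < e).
move: Hb; rewrite (Vpol_zero HZb) ncM horner_prod nc_prod ltr_pM2l ?nc_gt0 ?invr_eq0 ?n0_neq0//.
rewrite ltNge => /negP[].
have -> : e ^+ M = \prod_(l < M) e by rewrite big_const_ord iter_mulr_1.
apply: ler_prod => l _; rewrite ltW//= hornerXsubC leNgt; apply/negP => hl; apply: H.
by exists (Zb l); [exact: (Vpol_at_zero HZb)|rewrite -ncN opprB].
Qed.

(** When the first factor vanishes at [a], the product rule only requires continuity of the
    second. *)
Lemma cder_mul0 (T : topologicalType) d (x : 'I_d -> T -> C) (a : T) (f h : T -> C) g :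
  cder x a f g -> f a = 0 -> h c @[c --> a] --> h a ->
  cder x a (fun c => f c * h c) (fun k => g k * h a).
Proof.
move=> /cderP[cf [Phi [P1 P2 P3]]] f0 ch; apply/cderP; split; first exact: (cvgM cf ch).
exists (fun k c => Phi k c * h c); split=> [k|k|]; first exact: (cvgM (P1 k) ch).
  by rewrite P2.
apply: filterS P3 => b; rewrite f0 subr0 mul0r subr0 => ->.
by rewrite mulr_suml; apply: eq_bigr => k _; rewrite mulrA.
Qed.

Section Local.
Variables (a : pt).
Hypothesis Ha : Mhat R n a.

(** The zeros at [a] are simple, so each continues to the unique nearby zero. Solving the
    factorisation of the numerator for one linear factor gives an explicit formula for that zero,
    differentiable by [cder_mul0]. *)
Lemma local_roots : exists (Z : 'I_M -> pt -> C) (r : R), 0 < r /\ forall b, box a r b ->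
  [/\ MCKP b, is_zeros b (Z^~ b), injective (rpt (Z^~ b) b) &
     forall s, vder (fun c => rpt (Z^~ c) c s) b (fun k => uX b (Z^~ b) (e_ k) s)].
Proof.
have Ma := Ha.1; have [Z0 HZ0] := zeros_exist n_gt0 a.
have Xi := Mhat_rpt_inj n_gt0 Ma HZ0 Ha.
have Z0i : injective Z0 by move=> k l e; have /Xi[] : rpt Z0 a (inl k) = rpt Z0 a (inl l).
(* Half distances make the discs around distinct zeros disjoint; the value 1 on the diagonal is a
   dummy. *)
pose dist (p : 'I_M * 'I_M) : R := if p.1 == p.2 then 1 else nc (Z0 p.1 - Z0 p.2) / 2.
have dist0 p : 0 < dist p.
  rewrite /dist; have [//|h] := eqVneq p.1 p.2.
  by rewrite divr_gt0// nc_gt0 subr_eq0 (inj_eq Z0i).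
have [d d0 Hd] := fin_min dist0.
have sep k l w : nc (w - Z0 k) < d -> nc (w - Z0 l) < d -> k = l.
  move=> h1 h2; apply/eqP; apply: contraT => kl; have := Hd (k, l); rewrite /dist /= (negPf kl).
  rewrite ler_pdivlMr// leNgt => /negP[].
  have -> : Z0 k - Z0 l = - (w - Z0 k) + (w - Z0 l) by ring.
  apply: (le_lt_trans (ncD _ _)); rewrite ncN.
  by rewrite mulr_natr mulr2n ltrD.
pose Z k b : C := xget 0 [set w | (Vpol b).[w] = 0 /\ nc (w - Z0 k) < d].
pose good b := MCKP b /\ forall k, exists2 w, (Vpol b).[w] = 0 & nc (w - Z0 k) < d.
have ng : nbhs a good by apply: filterS2 (MCKP_open Ma) (root_near Ma HZ0 d0).
have ZP b k : good b -> (Vpol b).[Z k b] = 0 /\ nc (Z k b - Z0 k) < d.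
  case=> _ /(_ k)[w w1 w2].
  by apply: (xgetPex (P := [set w | (Vpol b).[w] = 0 /\ nc (w - Z0 k) < d]) 0); exists w.
have Zi b : good b -> injective (Z^~ b).
  move=> gb k l e; have [_ h1] := ZP b k gb; have [_ h2] := ZP b l gb.
  by apply: (sep k l (Z k b)); rewrite // e.
have Zz b : good b -> is_zeros b (Z^~ b).
  move=> gb; rewrite /is_zeros -(lead_Vpol n_gt0 b).
  have := @all_roots_prod_XsubC _ (Vpol b) [seq Z k b | k <- enum 'I_M].
  rewrite size_map size_enum_ord (size_Vpol n_gt0) big_map big_enum; apply=> //.
    by apply/allP => _ /mapP[k _ ->]; apply/rootP; case: (ZP b k gb).
  by rewrite uniq_rootsE map_inj_uniq ?enum_uniq//; exact: Zi.
have Zu b k w : good b -> (Vpol b).[w] = 0 -> nc (w - Z0 k) < d -> w = Z k b.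
  move=> gb; rewrite (Vpol_zero (Zz b gb)) => /eqP; rewrite mulf_eq0 invr_eq0 (negPf (n0_neq0 _ n_gt0)) /=.
  rewrite horner_prod prodf_seq_eq0 => /hasP[l _]; rewrite hornerXsubC subr_eq0 => /eqP -> h.
  by have [_ h2] := ZP b l gb; rewrite (sep l k _ h2 h).
have /nbhs_rVP[r r0 Hr] := ng; exists Z, r; split=> // b Hb.
have gb : good b by exact: Hr.
have ngb : nbhs b good by apply: filterS (box_open r0 Hb) => c Hc; exact: Hr.
have Mb := gb.1; have HZ := Zz b gb; have Xb := rpt_inj Mb HZ (Zi b gb).
have Zc k : Z k c @[c --> b] --> Z k b.
  apply: cvg_at => e e0; have [_ hk] := ZP b k gb.
  pose e' := Num.min e (d - nc (Z k b - Z0 k)).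
  have e'0 : 0 < e' by rewrite lt_min e0 subr_gt0.
  apply: filterS2 ngb (root_near Mb HZ e'0) => c gc /(_ k)[w w1].
  rewrite lt_min => /andP[w2 w3]; rewrite -(Zu c k w gc w1)//.
  have -> : w - Z0 k = (w - Z k b) + (Z k b - Z0 k) by ring.
  by apply: (le_lt_trans (ncD _ _)); rewrite -ltrBrDr.
split=> // -[k|j]; last first.
  apply: ucder_eq (@coeff_ucder R m n b (l0 j) 0) => i t _.
  by rewrite uX_pole.
pose z0 := Z k b; have hz : forall j, z0 != pole b j := zero_not_pole k Mb HZ.
pose q (c : pt) : C := \prod_(l | l != k) (z0 - Z l c).
(* From lambda_c(z0) prod_j (z0 - p_j)^(n_j) = n_0^-1 prod_l (z0 - Z_l(c)) one gets Z_k(c) = z0 +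
   lambda_c(z0) h(c), and lambda_b(z0) = 0. *)
pose h (c : pt) : C := - (n0%:R * (polprod c (nn n)).[z0] / q c).
have qc : q c @[c --> b] --> q b.
  apply: (@cvg_prodc R pt (nbhs b) _ _ _ _ (fun l c => z0 - Z l c) (fun l => z0 - Z l b)) => l _.
  exact: (cvgB (@cvg_const pt C b z0) (Zc l)).
have q0 : q b != 0.
  by apply/prodf_neq0 => l lk; rewrite subr_eq0; apply: contraNneq lk => /(Zi b gb) ->.
have hc : h c @[c --> b] --> h b.
  exact: (cvgN (cvgM (cvgM (@cvg_const pt C b n0%:R) (@polprod_cvg b (nn n) z0)) (cvgV q0 qc))).
have V0 : lam b z0 = 0.
  have := Vpol_lam hz; rewrite (Vpol_at_zero HZ) => /esym/eqP.
  by rewrite mulf_eq0 (negPf (polprod_neq0 _ hz)) => /eqP.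
have H := ucderD (ucder_cst (@xV R N) b z0) (cder_mul0 (lam_cder hz) V0 hc).
have H2 : vder (fun c => Z k c) b (fun i => dl b (e_ i) z0 * h b).
  apply: ucder_eq (ucder_ext _ H) => [i t _|]; first by rewrite add0r.
  have Nq : \forall c \near b, q c != 0 by exact: (cvg_neq0 qc q0).
  apply: filterS3 ngb Nq (nonpole_near hz) => c gc qc0 hzc t.
  have := Vpol_lam hzc; rewrite (Vpol_zero (Zz c gc)) horner_prod (bigD1 k)//= hornerXsubC.
  have -> : \prod_(l | l != k) ('X - (Z l c)%:P).[z0] = q c.
    by apply: eq_bigr => l _; rewrite hornerXsubC.
  have := n0_neq0 R n_gt0; have := polprod_neq0 (nn n) hzc; rewrite /h; move: qc0.
  move: (q c) (polprod c _).[z0] (lam c z0) (n0%:R : C) => x y L w x0 y0 w0 e.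
  have -> : L = w^-1 * ((z0 - Z k c) * x) / y by rewrite e mulrC mulKf.
  by field; rewrite ?x0 ?y0 ?w0.
apply: ucder_eq H2 => i t _; rewrite /uX /h (Ppol_rpt HZ (inl k)) conodal_zero hornerM mul1r.
change (rpt (Z^~ b) b (inl k)) with z0.
have -> : (\prod_(l | l != k) ('X - (Z l b)%:P)).[z0] = q b.
  by rewrite horner_prod; apply: eq_bigr => l _; rewrite hornerXsubC.
rewrite (fpol_dl _ hz).
have -> : polprod b (fun j => (nn n j).+1) = polprod b (nn n) * polprod b (fun _ => 1%N).
  by rewrite polprod_exp1; congr polprod; apply: functional_extensionality_dep => j; rewrite addn1.
rewrite hornerM; have := polprod_neq0 (fun _ => 1%N) hz; have := n0_neq0 R n_gt0.
move: (polprod b _).[z0] (polprod b _).[z0] (q b) q0 (n0%:R : C) (dl _ _ _) => x y p p0 w L w0 y0.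
by field; rewrite ?p0 ?w0 ?y0.
Qed.

End Local.
End Roots.

Lemma connected_const (T : topologicalType) (S : Type) (A : set T) (f : T -> S) :
  connected A -> (forall x, A x -> \forall y \near x, f y = f x) ->
  forall x y, A x -> A y -> f y = f x.
Proof.
move=> cA H x y Ax Ay; pose B := A `&` [set z | f z = f x].
have BA : B = A.
  apply: cA; first by exists x.
    exists (interior [set z | f z = f x]); first exact: open_interior.
    apply/seteqP; split=> z [Az Hz]; split=> //.
      by apply: filterS (H z Az) => w; rewrite /= => ->.
    exact: nbhs_singleton Hz.
  exists (~` interior [set z | f z <> f x]).
    by apply: open_closedC; exact: open_interior.
  apply/seteqP; split=> z [Az Hz]; split=> //.
    by move=> /nbhs_singleton /=; apply.
  apply: contrapT => ne; apply: Hz; apply: filterS (H z Az) => w /= ->.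
  exact: ne.
by have [] : B y by rewrite BA.
Qed.

(** * Winding numbers and logarithms along a curve *)

Section Winding.
Local Open Scope complex_scope.
Variable R : realType.
Local Notation C := (cplx R).
Implicit Types (z w : C).

(* The curve only matters on [0, 1]; precomposing with [clamp] makes it
   continuous on R. *)
Definition ext (T : Type) (g : R -> T) (t : R) : T := g (clamp t).

Lemma extE (T : Type) (g : R -> T) t : 0 <= t <= 1 -> ext g t = g t.
Proof. by rewrite /ext => /clampE ->. Qed.

Lemma itv01 : (0 <= (0 : R) <= 1) * (0 <= (1 : R) <= 1).
Proof. by rewrite !lexx !ler01. Qed.

Lemma ext_cvg (g : R -> C) : {within `[0, 1], continuous g} ->
  forall t, ext g s @[s --> t] --> ext g t.
Proof.
move=> /subspace_continuousP H t; have tI : `[0 : R, 1]%classic (clamp t).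
  by rewrite /= in_itv /= clamp_in.
have := H _ tI; apply: cvg_comp => Q HQ.
have h : nbhs t (fun s => `[0 : R, 1]%classic (clamp s) -> Q (clamp s)) by exact: (@clamp_cvg R t _ HQ).
apply: (@filterS _ (nbhs t) _ _ _ _ h) => s; apply.
by rewrite /= in_itv /= clamp_in.
Qed.

Lemma ext_rder (g : R -> C) t c : 0 < t < 1 -> rder g t c -> rder (ext g) t c.
Proof.
move=> tI; apply: ucder_ext.
have : t \in `]0, 1[ by rewrite in_itv.
move/near_in_itvoo; apply: filterS => s; rewrite in_itv /= => /andP[/ltW h1 /ltW h2] _.
by rewrite extE// h1 h2.
Qed.

Lemma curve_int_pieces (gam : R -> C) (f G : R -> C) : piecewise_C1 gam -> contC 0 1 G ->
  (forall t c, 0 < t < 1 -> rder gam t c -> f t = G t * c) ->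
  cintegral01 f = curve_int gam G.
Proof.
move=> Hg /contCP cG H; have [k [p [dg [p0 pk k0 H1 H2]]]] := curve_pieces Hg.
have inc i : (i < k)%N -> p i < p i.+1 by case/H1.
have sub i t : (i < k)%N -> p i <= t <= p i.+1 -> 0 <= t <= 1.
  by move=> /H1[_ h1 h2 _] /andP[h3 h4]; rewrite (le_trans h1 h3) (le_trans h4 h2).
have sub2 i t : (i < k)%N -> p i < t < p i.+1 -> 0 < t < 1.
  by move=> /H1[_ h1 h2 _] /andP[h3 h4]; rewrite (le_lt_trans h1 h3) (lt_le_trans h4 h2).
have cg i : (i < k)%N -> contC (p i) (p i.+1) (fun t => G t * dg i t).
  move=> ik; have [_ _ _ c] := H1 i ik; apply: contCM c.
  by apply/contCP => t tI; apply: cG; exact: sub tI.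
have [_ _ e1] := @cint_pieces R k p f (fun i t => G t * dg i t) k0 inc cg
  (fun i t ik tI => H t _ (sub2 i t ik tI) (H2 i t ik tI).2).
have e2' i t : (i < k)%N -> p i < t < p i.+1 -> G t * velocity gam t = G t * dg i t.
  by move=> ik tI; rewrite (H2 i t ik tI).1.
have [_ _ e2] := @cint_pieces R k p (fun t => G t * velocity gam t) (fun i t => G t * dg i t) k0 inc cg e2'.
by rewrite p0 pk in e1 e2; transitivity (\sum_(i < k) cint (p i) (p i.+1) (fun t => G t * dg i t)).
Qed.

Section OneCurve.
Variable gam : R -> C.
Hypotheses (cg : {within `[0, 1], continuous gam}) (Hg : piecewise_C1 gam) (closed_gam : gam 0 = gam 1).

Local Notation g := (ext gam).
Local Notation J := (curve_int gam).

Lemma ext01 : g 0 = g 1.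
Proof. by rewrite !extE// ?itv01. Qed.

Lemma image_neq w : ~ curve_image gam w -> forall t : R, 0 <= t <= 1 -> g t - w != 0.
Proof.
move=> nw t tI; rewrite subr_eq0; apply/eqP => e; apply: nw.
by exists t; [rewrite /= in_itv|rewrite -e extE].
Qed.

Lemma neq_image w : (forall t : R, 0 <= t <= 1 -> g t - w != 0) -> ~ curve_image gam w.
Proof.
move=> H [t]; rewrite /= in_itv /= => tI e; have := H t tI.
by rewrite extE// e subrr eqxx.
Qed.

Lemma curve_int_ext (f G : R -> C) :
  (forall t, 0 <= t <= 1 -> f t = G t) ->
  cintegral01 (fun t => f t * velocity gam t) = J G.
Proof. by move=> H; apply: cint_ext => t tI; rewrite H. Qed.

Lemma winding_J w : winding_number gam w = (two_pi_i R)^-1 * J (fun t => (g t - w)^-1).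
Proof.
rewrite /winding_number; congr (_ * _); rewrite -(@curve_int_ext (fun t => (gam t - w)^-1)).
  by congr cintegral01; apply: functional_extensionality_dep => t; rewrite mulrC.
by move=> t tI; rewrite extE.
Qed.

Lemma gsub_jc w0 : jc w0 (fun w t => g t - w).
Proof.
have jt : jc w0 (fun (_ : C) => g) by apply: jc_t => t _; exact: ext_cvg.
exact: (jcB jt (jc_s (@cvg_ident C w0))).
Qed.

Lemma image_open w0 : ~ curve_image gam w0 -> \forall w \near w0, ~ curve_image gam w.
Proof.
move=> /image_neq /(jc_neq0 (@gsub_jc w0)); apply: filterS => w; exact: neq_image.
Qed.

Lemma ginv_cont w : ~ curve_image gam w -> contC 0 1 (fun t => (g t - w)^-1).
Proof.
move=> /image_neq H; apply: contCV H; apply: contCB (@contC_cst R 0 1 w).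
by apply/contCP => t _; exact: ext_cvg.
Qed.

Lemma rder_gsub t c w : 0 < t < 1 -> rder gam t c -> rder (fun s => g s - w) t c.
Proof.
move=> tI H; have D := ucderB (ext_rder tI H) (ucder_cst (@xR R) t w).
by apply: ucder_eq D => k s _; rewrite subr0.
Qed.

Lemma J_inv2 w : ~ curve_image gam w -> J (fun t => (g t - w) ^- 2) = 0.
Proof.
move=> nw; have H := image_neq nw.
have c1 := ginv_cont nw.
have c2 : contC 0 1 (fun t => (g t - w) ^- 2).
  have -> : (fun t => (g t - w) ^- 2) = fun t => (g t - w)^-1 * (g t - w)^-1.
    by apply: functional_extensionality_dep => t; rewrite expr2 invfM.
  exact: (contCM c1 c1).
rewrite (curve_FTC Hg c2 (contCN c1)); first by rewrite ext01 subrr.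
move=> t c tI Ht; have tI' : 0 <= t <= 1 by case/andP: tI => h1 h2; rewrite !ltW.
have D := ucderN (ucderV (fun (_ : R) _ => H t tI') (rder_gsub w tI Ht)).
apply: ucder_eq D => k s _ /=; have := H t tI'; move: (g t - w) => x x0.
by field.
Qed.

(** Differentiating in [w] produces the integral of (g - w)^-2, which has the single-valued
    primitive - (g - w)^-1. Local constancy thus follows from a vanishing derivative. *)
Lemma winding_zder w0 : ~ curve_image gam w0 -> zder (winding_number gam) w0 0.
Proof.
move=> nw; have H := image_neq nw.
have jt : ucder (@xC R) w0 (fun (_ : C) => g) (fun _ _ => 0).
  by apply: ucder_t => t _; exact: ext_cvg.
have D := ucderV H (ucderB jt (@zder_id R w0)).
have c1 := ginv_cont nw.
have c2 : contC 0 1 (fun t => (g t - w0) ^- 2).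
  have -> : (fun t => (g t - w0) ^- 2) = fun t => (g t - w0)^-1 * (g t - w0)^-1.
    by apply: functional_extensionality_dep => t; rewrite expr2 invfM.
  exact: (contCM c1 c1).
have D2 : ucder (@xC R) w0 (fun w t => (g t - w)^-1) (fun _ t => (g t - w0) ^- 2).
  by apply: ucder_eq D => k t _; rewrite sub0r opprK mul1r.
have D3 := ucderZ (two_pi_i R)^-1 (J_cder (curve_functional Hg) (fun _ => c2) D2).
have D4 : zder (fun w => (two_pi_i R)^-1 * J (fun t => (g t - w)^-1)) w0 0.
  by apply: ucder_eq D3 => k t _; rewrite (J_inv2 nw) mulr0.
by apply: ucder_ext D4; apply: (@nearW _ (nbhs w0)) => w _; rewrite winding_J.
Qed.

Lemma winding_segment w0 (h : C) : (forall s : R, 0 <= s <= 1 -> ~ curve_image gam (w0 + rc s * h)) ->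
  winding_number gam (w0 + h) = winding_number gam w0.
Proof.
move=> H; have D (s : R) : 0 <= s <= 1 -> rder (fun s => winding_number gam (w0 + rc s * h)) s 0.
  move=> /H /winding_zder D0; have := rder_comp (u := fun s => w0 + rc s * h) D0 (rder_affine w0 h s).
  by apply: ucder_eq => k t _; rewrite mul0r.
have := @cFTC01 R (fun _ => 0) (fun s => winding_number gam (w0 + rc s * h)) (@contC_cst R 0 1 0).
rewrite rc1 mul1r rc0 mul0r addr0 (J0 (cint_functional R)) => E.
apply/eqP; rewrite -subr_eq0 -E ?eqxx//.
  by apply/contCP => s /D /rder_cvg.
by move=> s /andP[s0 s1]; apply: D; rewrite !ltW.
Qed.

Lemma winding_locally w0 : ~ curve_image gam w0 ->
  \forall w \near w0, winding_number gam w = winding_number gam w0.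
Proof.
move=> /image_open /nbhs_ncP[e e0 He]; apply/nbhs_ncP; exists e => // w we.
have -> : w = w0 + (w - w0) by ring.
apply: winding_segment => s /andP[s0 s1]; apply: He.
rewrite addrC addKr ncM nc_rc ger0_norm//; apply: le_lt_trans we.
by rewrite -[leRHS]mul1r ler_wpM2r ?nc_ge0.
Qed.

Lemma g_bounded : exists B : R, forall t : R, 0 <= t <= 1 -> nc (g t) <= B.
Proof.
have H : forall t, ext gam s @[s --> t] --> ext gam t by exact: ext_cvg.
have cn (t : R) : (fun s => nc (g s)) s @[s --> t] --> nc (g t) by exact: nc_cvg (H t).
have /(@EVT_max R (fun s => nc (g s)) 0 1 ler01) [c _ Hc] : {within `[0, 1], continuous (fun s => nc (g s))}.
  exact: cont_on_within (fun t _ => cn t).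
by exists (nc (g c)) => t tI; apply: Hc; rewrite in_itv.
Qed.

Lemma winding_small : exists M B : R, 0 < M /\ forall w (e : R), 0 < e -> B + e^-1 <= nc w ->
  nc (winding_number gam w) <= M * e.
Proof.
have [M M0 HM] := Jbound (curve_functional Hg); have [B HB] := g_bounded.
exists (nc (two_pi_i R)^-1 * M), B; split.
  by rewrite mulr_gt0// nc_gt0 invr_eq0 two_pi_i_neq0.
move=> w e e0 we; have ge (t : R) : 0 <= t <= 1 -> e^-1 <= nc (g t - w).
  move=> /HB hB; rewrite -ncN opprB.
  have : nc w <= nc (w - g t) + nc (g t) by apply: le_trans (ncD _ _); rewrite subrK.
  by move: we hB; move: (nc w) (nc (g t)) (nc (w - g t)) e^-1 => x y z u; lra.
have ei0 : 0 < e^-1 by rewrite invr_gt0.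
have nw : ~ curve_image gam w.
  by apply: neq_image => t /ge h; rewrite -nc_gt0 (lt_le_trans ei0).
rewrite winding_J ncM -mulrA ler_pM2l ?nc_gt0 ?invr_eq0 ?two_pi_i_neq0//.
apply: HM => [|t /ge h]; first exact: ginv_cont.
have -> : nc (g t - w)^-1 = (nc (g t - w))^-1.
  have g0 : g t - w != 0 by rewrite -nc_gt0 (lt_le_trans ei0).
  apply: (mulfI (x := nc (g t - w))); first by rewrite nc_eq0.
  by rewrite -ncM mulfV// mulfV ?nc_eq0//; have := nc_rc (1 : R); rewrite rc1 normr1.
by rewrite -[leRHS]invrK lef_pV2 ?posrE// (lt_le_trans ei0).
Qed.

Lemma not_bounded (A : set C) : ~ bounded_set A <-> forall B : R, exists2 w, A w & B < nc w.
Proof.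
split=> [nb B|H].
  have [//|H] := pselect (exists2 w, A w & B < nc w); case: nb.
  exists (rc B); split; first by rewrite realE -rc0 !lecR le_total.
  move=> x Bx w Aw /=; rewrite normE; apply: le_trans (ltW Bx); rewrite lecR leNgt.
  by apply/negP => h; apply: H; exists w.
case=> x [xr Hx]; have [w Aw] := H (complex.Re x + 1).
have xE : x = rc (complex.Re x) by move: xr; rewrite realE; case: (x) => p q /orP[]; rewrite lecE /= => /andP[/eqP h _]; apply: cplx_eq; rewrite //= h.
have : x < rc (complex.Re x + 1) by rewrite {1}xE ltcR ltrDl.
by move=> /Hx /(_ w Aw) /=; rewrite normE lecR leNgt => /negP.
Qed.

(** The winding number is constant on the unbounded component and arbitrarily small far away by
    [winding_small]. *)
Lemma winding_outside w : ~ curve_image gam w -> ~ enclosed gam w -> winding_number gam w = 0.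
Proof.
move=> nw ne; have nb : ~ bounded_set (connected_component (~` curve_image gam) w).
  by move=> b; apply: ne.
have const z : connected_component (~` curve_image gam) w z ->
    winding_number gam z = winding_number gam w.
  apply: (connected_const (@component_connected _ _ _)); last exact: connected_component_refl.
  by move=> x /connected_component_sub; exact: winding_locally.
have [M [B [M0 HM]]] := winding_small; apply: nc_small => e e0.
have d0 : 0 < e / M by rewrite divr_gt0.
have [z /const <- Bz] := (not_bounded _).1 nb (B + (e / M)^-1).
by apply: le_trans (HM z _ d0 (ltW Bz)) _; rewrite mulrC divfK ?gt_eqF.
Qed.

End OneCurve.

Section Logarithm.
Transparent ucder.
(** The increment of [f] is that of [L] times [D], by the divided difference of the exponential. [D]
    is jointly continuous and non-zero at [a], so slopes of [f] divided by [D] are slopes of [L]. *)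
Lemma ucder_log (T : topologicalType) (d : nat) (x : 'I_d -> T -> C) (a : T) (f L : T -> R -> C) g :
  jc a L -> (\forall b \near a, forall t, 0 <= t <= 1 -> cexp (L b t) = f b t) ->
  ucder x a f g -> ucder x a L (fun k t => g k t / f a t).
Proof.
move=> jL HL [jf [Phi [P1 P2 P3]]]; split; first exact: jL.
have Ha := nbhs_singleton HL.
pose D (b : T) t : C := f a t * cexp_slope (L b t - L a t).
have jD : jc a D.
  apply: jcM (jc_fix jf) _.
  exact: (@jc_comp R T a (fun b t => L b t - L a t) _ (jcB jL (jc_fix jL)) (@cexp_slope_cvg R)).
have Da t : D a t = f a t by rewrite /D subrr /cexp_slope eqxx mulr1.
have D0 t : 0 <= t <= 1 -> D a t != 0 by move=> tI; rewrite Da -Ha// cexp_neq0.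
exists (fun k b t => Phi k b t / D b t); split=> [k|k t tI|]; first exact: (jcM (P1 k) (jcV jD D0)).
  by rewrite P2// Da.
have ND := jc_neq0 jD D0.
near=> b; move=> t tI.
have e1 : cexp (L b t) = f b t by move: t tI; near: b.
have e2 : D b t != 0 by move: t tI {e1}; near: b.
have e3 : f b t - f a t = \sum_k (x k b - x k a) * Phi k b t by move: t tI {e1 e2}; near: b.
have -> : L b t - L a t = (f b t - f a t) / D b t.
  apply: (mulIf e2); rewrite divfK// -e1 -(Ha t tI) /D -(Ha t tI).
  have -> : cexp (L b t) = cexp (L a t) * cexp (L b t - L a t) by rewrite -cexpD addrC subrK.
  have -> : cexp (L b t - L a t) = 1 + (L b t - L a t) * cexp_slope (L b t - L a t).
    by rewrite -cexp_slopeE; ring.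
  by ring.
by rewrite e3 mulr_suml; apply: eq_bigr => k _; rewrite mulrA.
Unshelve. all: by end_near.
Qed.
End Logarithm.

Lemma log_rder (F l : R -> C) (t : R) c : 0 < t < 1 -> {within `[0, 1], continuous l} ->
  (forall t, 0 <= t <= 1 -> cexp (l t) = F t) -> rder F t c -> rder (ext l) t (c / F t).
Proof.
move=> tI cl Hl HF; have jl : jc t (fun s (_ : R) => ext l s) by apply: jc_s; exact: ext_cvg.
have N : \forall s \near t, forall u : R, 0 <= u <= 1 -> cexp (ext l s) = F s.
  have : t \in `]0, 1[ by rewrite in_itv.
  move/near_in_itvoo; apply: filterS => s; rewrite in_itv /= => /andP[/ltW h1 /ltW h2] _ _.
  by rewrite extE ?h1// Hl// h1 h2.
exact: (ucder_log jl N HF).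
Qed.

End Winding.

(** * The argument principle and the density of level 0 *)

Section DensityZero.
Local Open Scope complex_scope.
Variables (R : realType) (m : nat) (n : 'I_m.+1 -> nat).
Hypothesis n_gt0 : forall i, (0 < n i)%N.
Local Notation C := (cplx R).
Local Notation N := (ckp_dim n).
Local Notation M := (Mdeg n).
Local Notation pt := 'rV[C]_N.
Local Notation idx := ('I_M + 'I_m)%type.
Implicit Types (a b : pt).

Variables (a : pt) (Z : 'I_M -> C) (gam : R -> C).
Hypotheses (Ma : MCKP a) (HZ : is_zeros a Z) (Xi : injective (rpt Z a)).
Hypotheses (cg : {within `[0, 1], continuous gam}) (Hg : piecewise_C1 gam) (closed_gam : gam 0 = gam 1).
Hypothesis avoid : forall s, 0 <= s <= 1 -> ~ is_pole a (gam s) /\ lam a (gam s) != 0.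
Local Notation X := (rpt Z a).
Local Notation g := (ext gam).
Local Notation J := (curve_int gam).
Local Notation wn := (winding_number gam).

Lemma rpt_off r : ~ curve_image gam (X r).
Proof.
case=> t; rewrite /= in_itv /= => tI e; have [np l0] := avoid tI.
case: r e => [k|j] /= e; last by apply: np; exists (lift ord0 j); [rewrite eq_sym neq_lift|].
have hz : forall j, gam t != pole a j by exact/is_poleP.
have := Vpol_lam hz; rewrite {1}e (Vpol_at_zero HZ) => /esym/eqP.
by rewrite mulf_eq0 (negPf (polprod_neq0 _ hz)) (negPf l0).
Qed.

Lemma g_off t : 0 <= t <= 1 -> forall r, g t != X r.
Proof. by move=> tI r; have := image_neq (@rpt_off r) tI; rewrite subr_eq0. Qed.

Lemma dlog_cont : contC 0 1 (fun t => \sum_r eps R r / (g t - X r)).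
Proof.
apply: contC_sum => r _; apply: contCM (@contC_cst R 0 1 _) _.
exact: (ginv_cont cg (@rpt_off r)).
Qed.

Lemma lam_rder t c : 0 < t < 1 -> rder gam t c ->
  rder (fun s => lam a (gam s)) t (lam a (gam t) * ((\sum_r eps R r / (g t - X r)) * c)).
Proof.
move=> tI Ht; have tI' : 0 <= t <= 1 by case/andP: tI => h1 h2; rewrite !ltW.
have hg := g_off tI'; rewrite extE// in hg.
have D := rder_comp (zder_lam (rpt_not_pole hg)) Ht; apply: ucder_eq D => k s _.
rewrite extE// -(dlog_z n_gt0 HZ Xi hg) (zder_derive1 (zder_lam (rpt_not_pole hg))).
by have := lam_neq0 n_gt0 HZ hg; move: (lam a _) (_ / _) => x y x0; field.
Qed.

(** Argument principle: the logarithmic derivative of lambda is sum_r eps_r / (z - X_r), integrated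
    term by term. *)
Lemma winding_lam : winding_number (lam a \o gam) 0 = \sum_r eps R r * wn (X r).
Proof.
rewrite /winding_number (@curve_int_pieces R gam _ (fun t => \sum_r eps R r / (g t - X r)) Hg dlog_cont).
  rewrite (J_sum (curve_functional Hg)) => [|r _]; last first.
    by apply: contCM (@contC_cst R 0 1 _) _; exact: (ginv_cont cg (@rpt_off r)).
  rewrite mulr_sumr; apply: eq_bigr => r _; rewrite (JZ (curve_functional Hg)); last first.
    exact: (ginv_cont cg (@rpt_off r)).
  by rewrite mulrCA -/(winding_number gam (X r)) -winding_J.
move=> t c tI Ht; rewrite subr0 (velocityE (lam_rder tI Ht)) /=.
have tI' : 0 <= t <= 1 by case/andP: tI => h1 h2; rewrite !ltW.
have hg := g_off tI'; rewrite extE// in hg.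
by have := lam_neq0 n_gt0 HZ hg; move: (lam a _) => x x0; rewrite mulrAC mulfV// mul1r.
Qed.

Section Log.
Variable l : R -> C.
Hypothesis Hl : log_along gam (lam a) l.

Lemma logl_rder t c : 0 < t < 1 -> rder gam t c -> rder (ext l) t ((\sum_r eps R r / (g t - X r)) * c).
Proof.
move=> tI Ht; have [cl El] := Hl; have D := log_rder tI cl El (lam_rder tI Ht).
have tI' : 0 <= t <= 1 by case/andP: tI => h1 h2; rewrite !ltW.
have hg := g_off tI'; rewrite extE// in hg.
apply: ucder_eq D => k s _.
by have := lam_neq0 n_gt0 HZ hg; move: (lam a _) => x x0; rewrite mulrAC mulfV// mul1r.
Qed.

Lemma ext_contC (h : R -> C) : {within `[0, 1], continuous h} -> contC 0 1 (ext h).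
Proof. by move=> ch; apply/contCP => t _; exact: ext_cvg. Qed.

Lemma log_ends : winding_number (lam a \o gam) 0 = (two_pi_i R)^-1 * (l 1 - l 0).
Proof.
have [cl El] := Hl.
rewrite /winding_number (@curve_int_pieces R gam _ (fun t => \sum_r eps R r / (g t - X r)) Hg dlog_cont).
  rewrite (curve_FTC Hg dlog_cont (ext_contC cl)); first by rewrite !extE ?itv01.
  exact: logl_rder.
move=> t c tI Ht; rewrite subr0 (velocityE (lam_rder tI Ht)) /=.
have tI' : 0 <= t <= 1 by case/andP: tI => h1 h2; rewrite !ltW.
have hg := g_off tI'; rewrite extE// in hg.
by have := lam_neq0 n_gt0 HZ hg; move: (lam a _) => x x0; rewrite mulrAC mulfV// mul1r.
Qed.

Lemma log_closed : winding_number (lam a \o gam) 0 = 0 -> l 1 = l 0.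
Proof.
rewrite log_ends => /eqP; rewrite mulf_eq0 invr_eq0 (negPf (@two_pi_i_neq0 R)) /=.
by rewrite subr_eq0 => /eqP.
Qed.

(** The function z log lambda returns to its value because the logarithm does. What remains is the
    integral of z lambda' / lambda, where z / (z - X_r) = 1 + X_r / (z - X_r) and the constant 1
    integrates to 0. *)
Lemma density0E : winding_number (lam a \o gam) 0 = 0 ->
  log_density gam l 0 = - \sum_r eps R r * X r * wn (X r).
Proof.
move=> /log_closed l10; have [cl El] := Hl; have cl' := ext_contC cl; have cg' := ext_contC cg.
have HJ := curve_functional Hg; have c1 : contC 0 1 (fun _ : R => 1 : C) by exact: contC_cst.
have -> : log_density gam l 0 = (two_pi_i R)^-1 * J (ext l).
  rewrite /log_density; congr (_ * _); apply: (@curve_int_ext R gam) => t tI.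
  by rewrite extE// expr1 divr1.
have ci r := ginv_cont cg (@rpt_off r).
have cG : contC 0 1 (fun t => (\sum_r eps R r / (g t - X r)) * g t) by exact: contCM dlog_cont cg'.
have JJ : J (ext l) + J (fun t => (\sum_r eps R r / (g t - X r)) * g t) = 0.
  rewrite -(JD HJ cl' cG) (curve_FTC Hg (contCD cl' cG) (contCM cl' cg')).
    by rewrite !extE ?itv01// l10 closed_gam subrr.
  move=> t c tI Ht; have D := ucderM (logl_rder tI Ht) (ext_rder tI Ht).
  by apply: ucder_eq D => k s _; ring.
have J1 : J (fun _ => 1) = 0.
  have H1 (t : R) (c : C) : 0 < t < 1 -> rder gam t c -> rder g t (1 * c).
    by move=> tI Ht; apply: ucder_eq (ext_rder tI Ht) => k s _; rewrite mul1r.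
  by have := curve_FTC Hg c1 cg' H1; rewrite (ext01 closed_gam) subrr.
have E : J (fun t => (\sum_r eps R r / (g t - X r)) * g t) = \sum_r eps R r * X r * (two_pi_i R * wn (X r)).
  have cr r : contC 0 1 (fun t => 1 + X r * (g t - X r)^-1).
    exact: contCD c1 (contCM (@contC_cst R 0 1 _) (ci r)).
  transitivity (J (fun t => \sum_r eps R r * (1 + X r * (g t - X r)^-1))).
    apply: (J_ext HJ cG) => [|t tI].
      by apply: contC_sum => r _; exact: contCM (@contC_cst R 0 1 _) (cr r).
    rewrite mulr_suml; apply: eq_bigr => r _; have := g_off tI r; rewrite -subr_eq0.
    by move: (X r) (eps R r) (g t) => x e y h; field.
  rewrite (J_sum HJ) => [|r _]; last exact: contCM (@contC_cst R 0 1 _) (cr r).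
  apply: eq_bigr => r _; rewrite (JZ HJ _ (cr r)) (JD HJ c1 (contCM (@contC_cst R 0 1 _) (ci r))).
  rewrite (JZ HJ _ (ci r)) J1 add0r winding_J mulrA; congr (_ * _).
  by rewrite mulVKf ?two_pi_i_neq0.
have /eqP := JJ; rewrite addr_eq0 => /eqP ->; rewrite E mulrN mulr_sumr; congr (- _).
apply: eq_bigr => r _; rewrite mulrCA; congr (_ * _).
by rewrite mulKf ?two_pi_i_neq0.
Qed.

End Log.
End DensityZero.

(** * Differentiability of inverse matrices *)

Section Determinants.
Transparent jc ucder.
Lemma ucdiff_cder (R : realType) (T : topologicalType) (d : nat) (x : 'I_d -> T -> cplx R) (a : T)
  (f : T -> cplx R) : ucdiff x a (fun b _ => f b) -> exists g, cder x a f g.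
Proof.
case=> g [j [Phi [P1 P2 P3]]]; exists (g^~ 0); apply/cderP; split; first exact: jc_sE.
have z01 : 0 <= (0 : R) <= 1 by rewrite lexx ler01.
exists (fun k b => Phi k b 0); split=> [k|k|].
- have [H _] := P1 k; have {}H := H 0 z01.
  exact: (cvg_comp _ _ (@cvg_slice _ _ a 0) H).
- by rewrite P2.
- by apply: filterS P3 => b /(_ 0 z01).
Qed.
Opaque jc ucder.

Variables (R : realType) (T : topologicalType) (d : nat) (x : 'I_d -> T -> cplx R) (a : T).

Lemma ucdiff_det k (A : T -> 'M[cplx R]_k) :
  (forall i j, ucdiff x a (fun b _ => A b i j)) -> ucdiff x a (fun b _ => \det (A b)).
Proof.
move=> H; rewrite /determinant; apply: ucdiff_sum => s _.
by apply: ucdiffM; [exact: ucdiff_cst|apply: ucdiff_prod => i _; exact: H].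
Qed.

(** Cramer's rule expresses the entries by determinants, which are polynomial in the entries of
    [A]. *)
Lemma ucdiff_inv k (A : T -> 'M[cplx R]_k) : (\forall b \near a, A b \in unitmx) ->
  (forall i j, ucdiff x a (fun b _ => A b i j)) ->
  forall i j, ucdiff x a (fun b _ => invmx (A b) i j).
Proof.
move=> Au HA i j; have ua := nbhs_singleton Au.
have H : ucdiff x a (fun b _ => (\det (A b))^-1 * ((-1) ^+ (j + i) * \det (row' j (col' i (A b))))).
  apply: ucdiffM.
    apply: ucdiffV => [t _|]; last exact: ucdiff_det.
    by rewrite -unitfE -unitmxE.
  apply: ucdiffM; first exact: ucdiff_cst.
  apply: ucdiff_det => p q; have [g Hg] := HA (lift j p) (lift i q).
  by exists g; apply: ucder_ext Hg; apply: (@nearW _ (nbhs a)) => b t; rewrite !mxE.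
case: H => g Hg; exists g; apply: ucder_ext Hg; apply: filterS Au => b ub t.
by rewrite /invmx ub !mxE.
Qed.
End Determinants.

Lemma eq_add_cancel (V : zmodType) (p q x y : V) : p + x = q + y -> p = q -> x = y.
Proof. by move=> e1 e2; move: e1; rewrite e2 => /addrI. Qed.

Section Jacobian.
Variables (R : realType) (N : nat).
Local Notation C := (cplx R).
Local Notation pt := 'rV[C]_N.
Local Notation e_ k := (delta_mx 0 k : pt).
Implicit Types (a b v : pt) (t : pt -> pt).

Definition crd t (al : 'I_N) b : C := t b 0 al.

Lemma Dv_coord t b v al : differentiable t b ->
  differentiable (crd t al) b /\ 'D_v (crd t al) b = (v *m 'J t b) 0 al.
Proof.
move=> dt; have H := @vder_coord R N al (t b).
have dx := vder_differentiable H; have dc : differentiable (crd t al) b.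
  exact: (@differentiable_comp _ _ _ _ t (@xV R N al) b dt dx).
split=> //; rewrite deriveE//.
have -> : 'd (crd t al) b = 'd (@xV R N al) (t b) \o 'd t b :> (pt -> C).
  exact: (@diff_comp _ _ _ _ t (@xV R N al) b dt dx).
rewrite /= -(deriveE _ dx); have [_ ->] := vder_Dv ('d t b v) H.
rewrite (bigD1 al)//= eqxx mulr1 big1 ?addr0 => [|k kal]; last by rewrite (negPf kal) mulr0.
by rewrite /jacobian mul_rV_lin1.
Qed.

Lemma pd_coord t b k al : differentiable t b -> pd (crd t al) k b = 'J t b k al.
Proof. by move=> dt; rewrite /pd (Dv_coord _ _ dt).2 -rowE mxE. Qed.

End Jacobian.

(** * The Koszul argument: second derivatives of the X_r in flat coordinates *)

Section FlatRoots.
Local Open Scope complex_scope.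
Variables (R : realType) (m : nat) (n : 'I_m.+1 -> nat).
Hypothesis n_gt0 : forall i, (0 < n i)%N.
Local Notation C := (cplx R).
Local Notation N := (ckp_dim n).
Local Notation M := (Mdeg n).
Local Notation pt := 'rV[C]_N.
Local Notation idx := ('I_M + 'I_m)%type.
Local Notation e_ k := (delta_mx 0 k : pt).
Implicit Types (a b u v : pt).

Lemma uX_lin a Z c u v r : uX a Z (c *: u + v) r = c * uX a Z u r + uX a Z v r.
Proof. by rewrite /uX fpol_lin hornerD hornerZ; ring. Qed.

Lemma uX_sum a Z v r : uX a Z v r = \sum_k v 0 k * uX a Z (e_ k) r.
Proof.
rewrite {1}(row_sum_delta v); elim/big_rec2 : _ => [|k x y _ <-]; last by rewrite uX_lin.
by have := uX_lin a Z (-1) 0 0 r; rewrite scaler0 addr0 mulN1r addNr.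
Qed.

Lemma cometric_bilinear a : MCKP a -> bilin (cometric a).
Proof.
by move=> Ma; have [U [Di E]] := coprime_PDex n_gt0 Ma; exact: (cometric_bilin n_gt0 Ma E).
Qed.

Variables (U : set pt) (t : pt -> pt).
Hypothesis HU : flat_coordinates U t.

Lemma U_open : open U. Proof. by case: HU => _ []. Qed.
Lemma U_Mhat b : U b -> Mhat R n b. Proof. by case: HU => H _ _; exact: H. Qed.
Lemma t_diff b : U b -> differentiable t b. Proof. by case: HU => _ [_ H _] _ /H[]. Qed.
Lemma J_unit b : U b -> 'J t b \in unitmx. Proof. by case: HU => _ [_ H _] _ /H[]. Qed.

Lemma gupE b : MCKP b -> gup t b = ('J t b)^T *m cometric_mx b *m 'J t b.
Proof.
move=> Mb; apply/matrixP => al be; rewrite mxE.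
have := form_mul (dcoord t b al) (dcoord t b be) (cometric_bilinear Mb).
rewrite -cometric_mxE => <-; rewrite /dcoord trmxK tr_col !colE rowE -!mulmxA.
by rewrite -rowE mxE !mulmxA -colE mxE.
Qed.

Section Near.
Variables (a : pt) (Z : 'I_M -> pt -> C) (r0 : R).
Hypotheses (Ua : U a) (r0_gt0 : 0 < r0) (BU : box a r0 `<=` U).
Hypothesis HB : forall b, box a r0 b -> [/\ MCKP b, is_zeros b (Z^~ b), injective (rpt (Z^~ b) b) &
     forall s, vder (fun c => rpt (Z^~ c) c s) b (fun k => uX b (Z^~ b) (e_ k) s)].

Local Notation X s := (fun c : pt => rpt (Z^~ c) c s).
Let V : set pt := interior (box a r0).
Let oV : open V. Proof. exact: open_interior. Qed.
Let VB b : V b -> box a r0 b. Proof. exact: nbhs_singleton. Qed.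
Let Va : V a. Proof. exact: box_nbhs. Qed.

Definition xr s ga (b : pt) : C := uX b (Z^~ b) (coord_field t b ga) s.

Lemma X_diff s b : V b -> differentiable (X s) b.
Proof. by move=> /VB/HB[_ _ _ /(_ s)]; exact: vder_differentiable. Qed.

Lemma pd_X s b k : V b -> pd (X s) k b = uX b (Z^~ b) (e_ k) s.
Proof.
move=> /VB/HB[_ _ _ /(_ s) H]; rewrite /pd; have [_ ->] := vder_Dv (e_ k) H.
by rewrite -uX_sum.
Qed.

Lemma crd_diff al b : V b -> differentiable (crd t al) b.
Proof. by move=> /VB/BU/t_diff dt; have [] := @Dv_coord R N t b 0 al dt. Qed.

Lemma J_pd k al b : V b -> 'J t b k al = pd (crd t al) k b.
Proof. by move=> /VB/BU/t_diff/pd_coord ->. Qed.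

Lemma near_V : \forall b \near a, V b.
Proof. exact: (open_nbhs_nbhs (conj oV Va)). Qed.

(** The X_s and the coordinates of [t] are differentiable on an open set, so [pd_differentiable]
    makes their partial derivatives, and then the inverse Jacobian, differentiable. *)
Lemma xr_vder s ga : exists xi : 'I_N -> C, vder (xr s ga) a xi.
Proof.
have H1 k : ucdiff (@xV R N) a (fun b _ => invmx ('J t b) ga k).
  apply: ucdiff_inv => [|i j]; first by apply: filterS near_V => b /VB/BU/J_unit.
  have dp := pd_differentiable oV (fun b Vb => @crd_diff j b Vb) i Va.
  eexists; apply: ucder_ext (differentiable_vder dp).
  by apply: filterS near_V => b Vb _; rewrite J_pd.
have H2 k : ucdiff (@xV R N) a (fun b _ => pd (X s) k b).
  have dp := pd_differentiable oV (fun b Vb => @X_diff s b Vb) k Va.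
  by eexists; exact: (differentiable_vder dp).
have [xi Hxi] := ucdiff_cder (ucdiff_sum (index_enum 'I_N) (P := xpredT) (fun k _ => ucdiffM (H1 k) (H2 k))).
exists xi; apply: ucder_ext Hxi; apply: filterS near_V => b Vb _.
rewrite /xr uX_sum; apply: eq_bigr => k _.
by rewrite (pd_X _ _ Vb) /coord_field mxE.
Qed.

Lemma pd_xr s b l : V b -> pd (X s) l b = \sum_be 'J t b l be * xr s be b.
Proof.
move=> Vb; have Ju := J_unit (BU (VB Vb)); rewrite (pd_X _ _ Vb).
transitivity (uX b (Z^~ b) (\sum_be 'J t b l be *: coord_field t b be) s).
  congr uX; apply/rowP => k; rewrite summxE.
  have -> : \sum_i ('J t b l i *: coord_field t b i) 0 k = ('J t b *m invmx ('J t b)) l k.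
    by rewrite mxE; apply: eq_bigr => i _; rewrite !mxE.
  by rewrite mulmxV// !mxE eqxx eq_sym.
elim/big_rec2 : _ => [|k x y _ <-]; last by rewrite uX_lin.
by have := uX_lin b (Z^~ b) (-1) 0 0 s; rewrite scaler0 addr0 mulN1r addNr.
Qed.

(** The frame [coord_field] is dual to [dcoord], so the covariant metric in it is the inverse of
    [gup], which flatness keeps constant. *)
Lemma metric_xr b : V b -> \matrix_(be, ga) rmetric b (Z^~ b) (coord_field t b be) (coord_field t b ga) =
  invmx (gup t b).
Proof.
move=> Vb; have Ju := J_unit (BU (VB Vb)); have [Mb HZ Xi _] := HB (VB Vb).
set G := \matrix_(_, _) _.
have EG : G = invmx ('J t b) *m form_mx (rmetric b (Z^~ b)) *m (invmx ('J t b))^T.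
  apply/matrixP => be ga; rewrite mxE.
  have := form_mul (coord_field t b be) (coord_field t b ga) (rmetric_bilin b (Z^~ b)) => <-.
  by rewrite /coord_field tr_row !rowE colE -!mulmxA -rowE mxE !mulmxA -colE mxE.
have E1 : G *m gup t b = 1%:M.
  rewrite EG gupE// -!mulmxA.
  have -> : (invmx ('J t b))^T *m (('J t b)^T *m (cometric_mx b *m 'J t b)) = cometric_mx b *m 'J t b.
    by rewrite mulmxA -trmx_mul mulmxV// trmx1 mul1mx.
  rewrite (mulmxA (form_mx _)) (metric_cometric n_gt0 Mb HZ Xi) mul1mx.
  by rewrite mulVmx.
have [_ gu] := mulmx1_unit E1.
by rewrite -[LHS](mulmxK gu) E1 mul1mx.
Qed.

Variable xi : idx -> 'I_N -> 'I_N -> C.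
Hypothesis Hxi : forall s ga, vder (xr s ga) a (xi s ga).

Lemma vder_uniq (f : pt -> C) g g' : vder f a g -> vder f a g' -> g =1 g'.
Proof.
move=> H1 H2 k; have [_ E1] := vder_Dv (e_ k) H1; have [_ E2] := vder_Dv (e_ k) H2.
have S (h : 'I_N -> C) : \sum_l (e_ k) 0 l * h l = h k.
  rewrite (bigD1 k)//= mxE !eqxx mul1r big1 ?addr0// => l lk.
  by rewrite mxE (negPf lk) andbF mul0r.
by rewrite -(S g) -(S g') -E1 -E2.
Qed.

Lemma xi_sum_eps ga k : \sum_s eps R s * xi s ga k = 0.
Proof.
have H := ucder_sum (index_enum (idx : finType)) (P := xpredT) (fun s _ => ucderZ (eps R s) (Hxi s ga)).
have H0 : vder (fun b => \sum_s eps R s * xr s ga b) a (fun _ => 0).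
  apply: ucder_ext (ucder_cst (@xV R N) a 0); apply: filterS near_V => b Vb _.
  by have [Mb HZ Xi _] := HB (VB Vb); rewrite /xr (sum_eps_uX n_gt0 HZ Xi).
by have := vder_uniq H0 H k.
Qed.

(** This differentiates the constant metric coefficients of [metric_xr]. *)
Lemma xi_metric be ga k : \sum_s eps R s * (xi s be k * xr s ga a + xr s be a * xi s ga k) = 0.
Proof.
have H := ucder_sum (index_enum (idx : finType)) (P := xpredT)
  (fun s _ => ucderZ (eps R s) (ucderM (Hxi s be) (Hxi s ga))).
have H0 : vder (fun b => \sum_s eps R s * (xr s be b * xr s ga b)) a (fun _ => 0).
  apply: ucder_ext (ucder_cst (@xV R N) a (- (invmx (gup t a) be ga))).
  apply: filterS near_V => b Vb _; case: HU => _ _ HG.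
  rewrite (HG a b Ua (BU (VB Vb))) -(metric_xr Vb) mxE /rmetric opprK.
  by apply: eq_bigr => s _; rewrite mulrA.
by have := vder_uniq H0 H k.
Qed.

(** Differentiating dX_s = sum_be x_be dt^be gives mixed second derivatives of X_s and of t; both
    are symmetric by [partial_sym], and so is what is left. *)
Lemma xi_sym s k l : \sum_be 'J t a l be * xi s be k = \sum_be 'J t a k be * xi s be l.
Proof.
have dX b : V b -> differentiable (X s) b by exact: X_diff.
have dc be b : V b -> differentiable (crd t be) b by exact: crd_diff.
have main i j : pd (pd (X s) i) j a = \sum_be pd (pd (crd t be) i) j a * xr s be a +
    \sum_be 'J t a i be * xi s be j.
  have dp be := differentiable_vder (pd_differentiable oV (dc be) i Va).
  have H := ucder_sum (index_enum 'I_N) (P := xpredT) (fun be _ => ucderM (dp be) (Hxi s be)).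
  have H2 : vder (pd (X s) i) a (fun j => \sum_be (pd (pd (crd t be) i) j a * xr s be a +
      pd (crd t be) i a * xi s be j)).
    apply: ucder_ext H; apply: filterS near_V => b Vb _.
    by rewrite (pd_xr _ _ Vb); apply: eq_bigr => be _; rewrite J_pd.
  have := vder_uniq (differentiable_vder (pd_differentiable oV dX i Va)) H2 j.
  move=> E; apply: (eq_trans E); rewrite big_split; congr (_ + _); apply: eq_bigr => be _.
  by rewrite J_pd.
have e1 := main l k; have e2 := main k l.
have ps : pd (pd (X s) l) k a = pd (pd (X s) k) l a := partial_sym k l oV dX Va.
have pc be : pd (pd (crd t be) l) k a = pd (pd (crd t be) k) l a := partial_sym k l oV (dc be) Va.
have e3 := eq_trans (esym e1) (eq_trans ps e2).
have sm : \sum_be pd (pd (crd t be) l) k a * xr s be a = \sum_be pd (pd (crd t be) k) l a * xr s be a.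
  by apply: eq_bigr => be _; exact: (congr1 (fun z => z * xr s be a) (pc be)).
exact: (eq_add_cancel e3 sm).
Qed.

Let K : 'M[C]_N := invmx ('J t a).
(** The second derivative of X_s in the coordinates [t], obtained from [xi] with the inverse
    Jacobian [K]. *)
Definition Dxr s al be : C := \sum_k K al k * xi s be k.

Lemma Dxr_sym s al be : Dxr s al be = Dxr s be al.
Proof.
have Ju := J_unit Ua.
pose S : 'M[C]_N := \matrix_(k, l) \sum_ga 'J t a l ga * xi s ga k.
pose Xi : 'M[C]_N := \matrix_(k, ga) xi s ga k.
have ES : S = Xi *m ('J t a)^T.
  by apply/matrixP => k l; rewrite !mxE; apply: eq_bigr => ga _; rewrite !mxE mulrC.
have EX : Xi = S *m K^T by rewrite ES -mulmxA -trmx_mul mulVmx// trmx1 mulmx1.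
have SS : S^T = S by apply/matrixP => k l; rewrite !mxE xi_sym.
have ED x y : Dxr s x y = (K *m S *m K^T) x y.
  by rewrite -mulmxA -EX !mxE; apply: eq_bigr => k _; rewrite !mxE.
rewrite !ED -[in RHS](trmxK (K *m S *m K^T)) [in RHS]mxE !trmx_mul trmxK SS mulmxA.
by [].
Qed.

Lemma Dxr_metric al be ga : \sum_s eps R s * Dxr s al be * xr s ga a +
  \sum_s eps R s * Dxr s al ga * xr s be a = 0.
Proof.
have E : \sum_k K al k * (\sum_s eps R s * (xi s be k * xr s ga a + xr s be a * xi s ga k)) = 0.
  by rewrite big1// => k _; rewrite xi_metric mulr0.
rewrite -[RHS]E; under [in RHS]eq_bigr do rewrite mulr_sumr.
rewrite exchange_big -big_split; apply: eq_bigr => s _ /=.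
rewrite /Dxr !mulr_sumr !mulr_suml -big_split; apply: eq_bigr => k _ /=.
by ring.
Qed.

(** Pairing the second derivatives with the first through eps gives a three-index quantity [B],
    symmetric in its first two indices and antisymmetric in the last two, hence zero. With
    [xi_sum_eps], [uX_separates] then kills each second derivative. *)
Lemma Dxr_eq0 s al be : Dxr s al be = 0.
Proof.
have [Mb HZ Xi _] := HB (VB Va).
pose B x y z : C := \sum_s eps R s * Dxr s x y * xr s z a.
have Bs x y z : B x y z = B y x z by apply: eq_bigr => r _; rewrite Dxr_sym.
have Ba x y z : B x y z = - B x z y by apply/eqP; rewrite -addr_eq0; apply/eqP; exact: Dxr_metric.
have B0 x y z : B x y z = 0.
  have : B x y z = - B x y z.
    (* Alternating the two symmetries six times returns to the initial indices after three sign
       changes. *)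
    have e1 := Ba x y z; have e2 := Bs x z y; have e3 := Ba z x y; have e4 := Bs z y x.
    have e5 := Ba y z x; have e6 := Bs y x z.
    by rewrite {1}e1 e2 e3 opprK e4 e5 e6.
  by move/eqP; rewrite -addr_eq0 -mulr2n mulrn_eq0 /= => /eqP.
apply: (uX_separates n_gt0 Mb HZ Xi (y := fun r => Dxr r al be)).
  rewrite /Dxr; under eq_bigr do rewrite mulr_sumr; rewrite exchange_big big1// => k _.
  have -> : \sum_r eps R r * (K al k * xi r be k) = K al k * \sum_r eps R r * xi r be k.
    by rewrite mulr_sumr; apply: eq_bigr => r _; rewrite mulrCA.
  by rewrite xi_sum_eps mulr0.
move=> v; pose c := v *m 'J t a.
have Ev : v = \sum_ga c 0 ga *: coord_field t a ga.
  have : v = c *m invmx ('J t a) by rewrite /c mulmxK ?J_unit.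
  by move=> {1}->; rewrite mulmx_sum_row.
have Eu r : uX a (Z^~ a) v r = \sum_ga c 0 ga * xr r ga a.
  rewrite Ev; elim/big_rec2 : _ => [|ga x y _ <-]; last by rewrite uX_lin.
  by have := uX_lin a (Z^~ a) (-1) 0 0 r; rewrite scaler0 addr0 mulN1r addNr.
under eq_bigr do rewrite Eu mulr_sumr; rewrite exchange_big big1// => ga _.
have -> : \sum_r eps R r * Dxr r al be * (c 0 ga * xr r ga a) = c 0 ga * B al be ga.
  by rewrite mulr_sumr; apply: eq_bigr => r _; ring.
by rewrite B0 mulr0.
Qed.

Lemma xi_eq0 s be k : xi s be k = 0.
Proof.
have -> : xi s be k = \sum_al 'J t a k al * Dxr s al be.
  pose Xi : 'cV[C]_N := \col_k xi s be k.
  have : Xi = 'J t a *m (K *m Xi) by rewrite mulmxA mulmxV ?mul1mx ?J_unit.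
  move/matrixP/(_ k 0); rewrite !mxE => ->; apply: eq_bigr => al _; congr (_ * _).
  by rewrite mxE; apply: eq_bigr => l _; rewrite mxE.
by rewrite big1// => al _; rewrite Dxr_eq0 mulr0.
Qed.

End Near.

(* In flat coordinates the zeros and poles of lambda are affine functions. *)
Lemma roots_affine a : U a -> exists (Z : 'I_M -> pt -> C) (r0 : R), [/\ 0 < r0, box a r0 `<=` U,
  (forall b, box a r0 b -> [/\ MCKP b, is_zeros b (Z^~ b), injective (rpt (Z^~ b) b) &
     forall s, vder (fun c => rpt (Z^~ c) c s) b (fun k => uX b (Z^~ b) (e_ k) s)]) &
  forall s ga, vder (fun b => uX b (Z^~ b) (coord_field t b ga) s) a (fun _ => 0)].
Proof.
move=> Ua; have [Z [r1 [r10 H1]]] := local_roots n_gt0 (U_Mhat Ua).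
have [r2 r20 H2] := open_box U_open Ua; pose r0 := Num.min r1 r2.
have r00 : 0 < r0 by rewrite lt_min r10.
have HU0 : box a r0 `<=` U.
  by move=> b Hb; apply: H2 => k; apply: lt_le_trans (Hb k) _; rewrite ge_min lexx orbT.
have HB0 : forall b, box a r0 b -> [/\ MCKP b, is_zeros b (Z^~ b), injective (rpt (Z^~ b) b) &
     forall s, vder (fun c => rpt (Z^~ c) c s) b (fun k => uX b (Z^~ b) (e_ k) s)].
  by move=> b Hb; apply: H1 => k; apply: lt_le_trans (Hb k) _; rewrite ge_min lexx.
exists Z, r0; split=> // s ga.
have Hx p : exists xi : 'I_N -> C, vder (xr Z p.1 p.2) a xi.
  exact: (xr_vder r00 HU0 HB0).
have [xi Hxi] := choice Hx.
apply: ucder_eq (Hxi (s, ga)) => k u _.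
exact: (xi_eq0 Ua r00 HU0 HB0 (xi := fun s ga => xi (s, ga)) (fun s ga => Hxi (s, ga))).
Qed.

End FlatRoots.

(** * Functions with vanishing partial derivatives *)

Section ZeroDerivative.
Local Open Scope complex_scope.
Variables (R : realType) (N : nat).
Local Notation C := (cplx R).
Local Notation pt := 'rV[C]_N.

Lemma pd0_box (f : pt -> C) a (r : R) : 0 < r -> (forall b, box a r b -> differentiable f b) ->
  (forall b k, box a r b -> pd f k b = 0) -> forall b, box a r b -> f b = f a.
Proof.
move=> r0 df H b Hb; have oU : open (box a r).
  by rewrite openE => c; exact: (@box_open R N a r r0 c).
have HU (t : R) : 0 <= t <= 1 -> box a r (a + rc t *: (b - a)).
  move=> /andP[t0 t1] k; rewrite !mxE addrAC subrr add0r ncM nc_rc ger0_norm//.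
  apply: le_lt_trans (Hb k); rewrite -[leRHS]mul1r ler_wpM2r ?nc_ge0//.
have := mvt_integral oU df HU; rewrite big1 => [/eqP|k _].
  by rewrite subr_eq0 addrC subrK => /eqP.
have -> : cintegral01 (fun t => pd f k (a + rc t *: (b - a))) = cintegral01 (fun _ => 0).
  by apply: cint_ext => t tI; rewrite H//; exact: HU.
by rewrite (J0 (cint_functional R)) mulr0.
Qed.

Lemma pd0_locally (f : pt -> C) (U : set pt) : open U -> (forall b, U b -> differentiable f b) ->
  (forall b k, U b -> pd f k b = 0) -> forall a, U a -> \forall b \near a, f b = f a.
Proof.
move=> oU df H a Ua; have [r r0 Hr] := open_box oU Ua; apply: filterS (box_nbhs a r0) => b.
by apply: (pd0_box r0) => [c /Hr/df|c k /Hr Uc]; last exact: H.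
Qed.
End ZeroDerivative.

(** * The recursion of the densities *)

Section PartOne.
Local Open Scope complex_scope.
Variables (R : realType) (m : nat) (n : 'I_m.+1 -> nat).
Hypothesis n_gt0 : forall i, (0 < n i)%N.
Local Notation C := (cplx R).
Local Notation N := (ckp_dim n).
Local Notation M := (Mdeg n).
Local Notation pt := 'rV[C]_N.
Local Notation idx := ('I_M + 'I_m)%type.
Local Notation e_ k := (delta_mx 0 k : pt).
Implicit Types (a b u v : pt).

Variables (U : set pt) (gam : R -> C) (L : pt -> R -> C).
Hypotheses (oU : open U) (cg : {within `[0, 1], continuous gam}) (Hg : piecewise_C1 gam)
  (closed_gam : gam 0 = gam 1) (HW : forall a, U a -> zero_winding a gam) (HL : log_branch U gam L).

Local Notation g := (ext gam).
Local Notation J := (curve_int gam).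
Local Notation HJ := (curve_functional Hg).
Local Notation Lc b := (ext (L b)).

Lemma Lc_jc a : U a -> jc a (fun b => Lc b).
Proof.
move=> Ua; apply: jc_joint; have NU : \forall b \near a, U b by exact: (open_nbhs_nbhs (conj oU Ua)).
apply: filterS NU => b Ub t tI.
have [_ /subspace_continuousP HC] := HL.
have tI' : `[0 : R, 1]%classic (clamp t) by rewrite /= in_itv /= clamp_in.
move=> Q HQ.
have h0 : within (U `*` `[0 : R, 1]%classic) (nbhs (b, clamp t)) (fun y => Q (L y.1 y.2)).
  exact: (HC (b, clamp t) (conj Ub tI') Q HQ).
have c1 : p.1 @[p --> (b, t)] --> b by exact: cvg_fst.
have c2 : clamp p.2 @[p --> (b, t)] --> clamp t.
  have c2 : p.2 @[p --> (b, t)] --> t by exact: cvg_snd.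
  exact: (cvg_comp _ _ c2 (@clamp_cvg R t)).
have h : nbhs (b, t) (fun p : pt * R => (U `*` `[0 : R, 1]%classic) (p.1, clamp p.2) -> Q (L p.1 (clamp p.2))).
  exact: (cvg_pair c1 c2 h0).
have h2 : nbhs (b, t) (fun p : pt * R => U p.1) by exact: c1 (open_nbhs_nbhs (conj oU Ub)).
apply: (@filterS2 _ (nbhs (b, t)) _ _ _ _ _ h h2) => p hp Up; apply: hp; split=> //=.
by rewrite in_itv /= clamp_in.
Qed.

Lemma Lc_cont b : U b -> contC 0 1 (Lc b).
Proof. by move=> Ub; have [H _] := HL; have [c _] := H b Ub; exact: ext_contC. Qed.

Section AtPoint.
Variables (a : pt) (Z : 'I_M -> C).
Hypotheses (Ua : U a) (Ma : MCKP a) (HZ : is_zeros a Z) (Xi : injective (rpt Z a)).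
Local Notation X := (rpt Z a).

(** The derivative of log lambda along [v] at the point of the curve, in the form provided by
    [dlog_v]. *)
Definition dlg v (t : R) : C := - \sum_r eps R r * uX a Z v r * (g t - X r)^-1.
Definition Lp (p : nat) (t : R) : C := (p`!%:R)^-1 * Lc a t ^+ p.

Let avoid := (HW Ua).1.
Let g_off t : 0 <= t <= 1 -> forall r, g t != X r.
Proof. by move=> tI r; exact: (g_off HZ avoid tI). Qed.
Let ci r : contC 0 1 (fun t => (g t - X r)^-1).
Proof. exact: (ginv_cont cg (rpt_off HZ avoid (r := r))). Qed.

Lemma dlg_cont v : contC 0 1 (dlg v).
Proof.
rewrite /dlg; apply: contCN; apply: contC_sum => r _; exact: (contCM (@contC_cst R 0 1 _) (@ci r)).
Qed.

Lemma Lp_cont p : contC 0 1 (Lp p).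
Proof. 
have c0 := @contC_cst R 0 1 (p`!%:R)^-1; have c1 := @contCX R 0 1 _ p (Lc_cont Ua).
exact: contCM c0 c1. Qed.

Lemma dlg_dl v t : 0 <= t <= 1 -> dl a v (g t) / lam a (g t) = dlg v t.
Proof. by move=> tI; rewrite (dlog_v n_gt0 HZ Xi v (g_off tI)). Qed.

Lemma dlg_sum v t : dlg v t = \sum_k v 0 k * dlg (e_ k) t.
Proof.
rewrite /dlg; under [RHS]eq_bigr do rewrite mulrN mulr_sumr.
rewrite sumrN; congr (- _); rewrite exchange_big; apply: eq_bigr => r _ /=.
rewrite uX_sum mulr_sumr mulr_suml; apply: eq_bigr => k _.
by ring.
Qed.

Lemma Lc_ucder : ucder (@xV R N) a (fun b => Lc b) (fun k => dlg (e_ k)).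
Proof.
have hg (t : R) : 0 <= t <= 1 -> forall j, g t != pole a j.
  by move=> tI j; exact: (rpt_not_pole (g_off tI)).
have cgt (t : R) : 0 <= t <= 1 -> g s @[s --> t] --> g t by move=> _; exact: ext_cvg.
have D := lam_ucder cgt hg.
have NL : \forall b \near a, forall t : R, 0 <= t <= 1 -> cexp (Lc b t) = lam b (g t).
  apply: filterS (open_nbhs_nbhs (conj oU Ua)) => b Ub t tI.
  have [H _] := HL; have [_ Hl] := H b Ub.
  by rewrite !extE// Hl.
by apply: ucder_eq (ucder_log (Lc_jc Ua) NL D) => k t tI; exact: dlg_dl.
Qed.

Lemma F_J p b : U b -> F_density gam L p b =
  (two_pi_i R)^-1 * J (fun t => (p.+1`!%:R)^-1 * Lc b t ^+ p.+1).
Proof.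
move=> Ub; rewrite /F_density /log_density; congr (_ * _).
by apply: (@curve_int_ext R gam) => t tI; rewrite extE// mulrC.
Qed.

Lemma factS (p : nat) : (p.+1`!%:R)^-1 * p.+1%:R = (p`!%:R)^-1 :> C.
Proof.
by rewrite factS natrM invfM mulrAC mulVf ?mul1r// pnatr_eq0.
Qed.

Lemma F_vder p : vder (F_density gam L p) a
  (fun k => (two_pi_i R)^-1 * J (fun t => Lp p t * dlg (e_ k) t)).
Proof.
have D := ucderZ (p.+1`!%:R)^-1 (ucderX p.+1 Lc_ucder).
have D2 : ucder (@xV R N) a (fun b t => (p.+1`!%:R)^-1 * Lc b t ^+ p.+1)
   (fun k t => Lp p t * dlg (e_ k) t).
  apply: ucder_eq D => k t _ /=; rewrite /Lp -(factS p).
  by ring.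
have D3 := ucderZ (two_pi_i R)^-1 (J_cder HJ (fun k => contCM (@Lp_cont p) (@dlg_cont (e_ k))) D2).
apply: ucder_ext D3; apply: filterS (open_nbhs_nbhs (conj oU Ua)) => b Ub _.
by rewrite F_J.
Qed.

Lemma J_comb (v : pt) (A : 'I_N -> R -> C) (B : R -> C) : (forall k, contC 0 1 (A k)) -> contC 0 1 B ->
  (forall t, 0 <= t <= 1 -> B t = \sum_k v 0 k * A k t) ->
  \sum_k v 0 k * ((two_pi_i R)^-1 * J (A k)) = (two_pi_i R)^-1 * J B.
Proof.
move=> cA cB E; have cS : contC 0 1 (fun t => \sum_k v 0 k * A k t).
  by apply: contC_sum => k _; exact: (contCM (@contC_cst R 0 1 _) (cA k)).
rewrite (J_ext HJ cB cS E) (J_sum HJ) => [|k _]; last exact: (contCM (@contC_cst R 0 1 _) (cA k)).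
by rewrite mulr_sumr; apply: eq_bigr => k _; rewrite (JZ HJ _ (cA k)); ring.
Qed.

Lemma F_Dv p v : 'D_v (F_density gam L p) a = (two_pi_i R)^-1 * J (fun t => Lp p t * dlg v t).
Proof.
have [_ ->] := vder_Dv v (F_vder p).
apply: J_comb => [k||t _]; first exact: (contCM (@Lp_cont p) (@dlg_cont _)).
  exact: (contCM (@Lp_cont p) (@dlg_cont _)).
by rewrite dlg_sum mulr_sumr; apply: eq_bigr => k _; rewrite mulrCA.
Qed.

Definition KK (u v : pt) (t : R) : C := \sum_r eps R r * uX a Z u r * uX a Z v r * (g t - X r)^-1.
(** This sum arises twice: as minus the z-derivative of [KK], and as minus the change of [dlg] when
    the X_r move. The coincidence makes the recursion close up. *)
Definition K2 (u v : pt) (t : R) : C := \sum_r eps R r * uX a Z u r * uX a Z v r * (g t - X r) ^- 2.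

Lemma ci2 r : contC 0 1 (fun t => (g t - X r) ^- 2).
Proof.
have -> : (fun t => (g t - X r) ^- 2) = fun t => (g t - X r)^-1 * (g t - X r)^-1.
  by apply: functional_extensionality_dep => t; rewrite expr2 invfM.
exact: (contCM (@ci r) (@ci r)).
Qed.

Lemma KK_cont u v : contC 0 1 (KK u v).
Proof. by rewrite /KK; apply: contC_sum => r _; exact: (contCM (@contC_cst R 0 1 _) (@ci r)). Qed.
Lemma K2_cont u v : contC 0 1 (K2 u v).
Proof. by rewrite /K2; apply: contC_sum => r _; exact: (contCM (@contC_cst R 0 1 _) (@ci2 r)). Qed.

Lemma J_K2 u v : J (K2 u v) = 0.
Proof.
rewrite /K2 (J_sum HJ) => [|r _]; last exact: (contCM (@contC_cst R 0 1 _) (@ci2 r)).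
rewrite big1// => r _; rewrite (JZ HJ _ (@ci2 r)).
by rewrite (J_inv2 cg Hg closed_gam (rpt_off HZ avoid (r := r))) mulr0.
Qed.

Local Notation dz := (fun t => \sum_r eps R r / (g t - X r)).

Lemma dlg_star u v t : 0 <= t <= 1 -> dlg u t * dlg v t = dlg (star a u v) t + dz t * KK u v t.
Proof.
move=> tI; rewrite -!(dlg_dl _ tI) (star_rpt n_gt0 Ma HZ Xi u v (g_off tI)).
by rewrite (dlog_z n_gt0 HZ Xi (g_off tI)).
Qed.

Lemma KK_rder u v t c : 0 < t < 1 -> rder gam t c -> rder (KK u v) t (- K2 u v t * c).
Proof.
move=> tI Ht; have tI' : 0 <= t <= 1 by case/andP: tI => h1 h2; rewrite !ltW.
have g0 r : g t - X r != 0 by rewrite subr_eq0; exact: g_off.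
have D := ucder_sum (index_enum (idx : finType)) (P := xpredT) (fun r _ =>
  ucderZ (eps R r * uX a Z u r * uX a Z v r) (ucderV (fun (_ : R) _ => g0 r) (rder_gsub (X r) tI Ht))).
apply: ucder_eq D => k s _; rewrite /K2 -sumrN mulr_suml; apply: eq_bigr => r _.
by ring.
Qed.

(** The integrand is the derivative of [Lp p.+1] times [KK], which is single-valued along the curve
    because the logarithm closes up. *)
Lemma parts p u v :
  J (fun t => Lp p t * (dz t * KK u v t) - Lp p.+1 t * K2 u v t) = 0.
Proof.
have cz := dlog_cont HZ cg avoid.
have c1 : contC 0 1 (fun t => Lp p t * (dz t * KK u v t) - Lp p.+1 t * K2 u v t).
  exact: contCB (contCM (@Lp_cont p) (contCM cz (@KK_cont u v))) (contCM (@Lp_cont p.+1) (@K2_cont u v)).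
have c2 := contCM (@Lp_cont p.+1) (@KK_cont u v).
have [H _] := HL; have Hl := H a Ua.
have l10 := log_closed n_gt0 HZ Xi cg Hg avoid Hl (HW Ua).2.
rewrite (curve_FTC Hg c1 c2).
  by rewrite /Lp /KK !extE ?itv01// l10 closed_gam subrr.
move=> t c tI Ht.
have D := ucderM (ucderZ (p.+1`!%:R)^-1 (ucderX p.+1 (logl_rder n_gt0 HZ Xi avoid Hl tI Ht))) (KK_rder u v tI Ht).
apply: ucder_eq D => k s _; rewrite /Lp -(factS p) /=.
by ring.
Qed.

Lemma second_derivative p u v : J (fun t => Lp p t * (dlg u t * dlg v t) - Lp p.+1 t * K2 u v t) =
  J (fun t => Lp p t * dlg (star a u v) t).
Proof.
have cz := dlog_cont HZ cg avoid.
have c1 : contC 0 1 (fun t => Lp p t * (dz t * KK u v t) - Lp p.+1 t * K2 u v t).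
  exact: contCB (contCM (@Lp_cont p) (contCM cz (@KK_cont u v))) (contCM (@Lp_cont p.+1) (@K2_cont u v)).
have c2 := contCM (@Lp_cont p) (@dlg_cont (star a u v)).
rewrite -[RHS]addr0 -(parts p u v) -(JD HJ c2 c1); apply: (J_ext HJ).
- exact: contCB (contCM (@Lp_cont p) (contCM (@dlg_cont u) (@dlg_cont v))) (contCM (@Lp_cont p.+1) (@K2_cont u v)).
- exact: (contCD c2 c1).
by move=> t tI; rewrite dlg_star//; ring.
Qed.

End AtPoint.

Variable t : pt -> pt.
Hypothesis HU : flat_coordinates U t.

Section Second.
Variables (a : pt) (Z : 'I_M -> pt -> C) (r0 : R).
Hypotheses (Ua : U a) (r0_gt0 : 0 < r0) (BU : box a r0 `<=` U)
  (HB : forall b, box a r0 b -> [/\ MCKP b, is_zeros b (Z^~ b), injective (rpt (Z^~ b) b) &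
     forall s, vder (fun c => rpt (Z^~ c) c s) b (fun k => uX b (Z^~ b) (e_ k) s)])
  (HX : forall s ga, vder (fun b => uX b (Z^~ b) (coord_field t b ga) s) a (fun _ => 0)).

Let Ba : box a r0 a. Proof. by move=> k; rewrite subrr nc0. Qed.
Local Notation Za := (Z^~ a).

Let cL q : contC 0 1 (Lp a q).
Proof. 
have c0 := @contC_cst R 0 1 (q`!%:R)^-1; have c1 := @contCX R 0 1 _ q (Lc_cont Ua).
exact: contCM c0 c1. Qed.
Let cDl v : contC 0 1 (dlg a Za v).
Proof. have [Ma HZ Xi _] := HB Ba; apply dlg_cont; assumption. Qed.
Let cK2 x y : contC 0 1 (K2 a Za x y).
Proof. have [Ma HZ Xi _] := HB Ba; apply K2_cont with (1 := Ua); assumption. Qed.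

(** By [HX] the coefficients along a coordinate field have zero derivative at [a], so only the
    points X_r move. This is where flatness enters. *)
Lemma dlg_ucder ga : ucder (@xV R N) a (fun b => dlg b (Z^~ b) (coord_field t b ga))
  (fun k s => - K2 a Za (e_ k) (coord_field t a ga) s).
Proof.
have [Ma HZ Xi HV] := HB Ba.
have jt : ucder (@xV R N) a (fun _ => g) (fun _ _ => 0) by apply: ucder_t => s _; exact: ext_cvg.
have g0 r (s : R) : 0 <= s <= 1 -> g s - rpt Za a r != 0.
  by move=> sI; rewrite subr_eq0; exact: (g_off HZ (HW Ua).1 sI).
have D := ucderN (ucder_sum (index_enum (idx : finType)) (P := xpredT) (fun r _ =>
  ucderM (ucderZ (eps R r) (HX r ga)) (ucderV (g0 r) (ucderB jt (HV r))))).
apply: ucder_eq D => k s sI; rewrite /K2 -!sumrN; apply: eq_bigr => r _ /=.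
by ring.
Qed.

Lemma second_vder p ga : vder (pderiv t ga (F_density gam L p)) a (fun k => (two_pi_i R)^-1 *
  J (fun s => (if p is q.+1 then Lp a q s * (dlg a Za (e_ k) s * dlg a Za (coord_field t a ga) s) else 0)
     - Lp a p s * K2 a Za (e_ k) (coord_field t a ga) s)).
Proof.
have [Ma HZ Xi HV] := HB Ba.
have D := ucderM (ucderZ (p`!%:R)^-1 (ucderX p (Lc_ucder Ua HZ Xi))) (dlg_ucder ga).
have D2 : ucder (@xV R N) a (fun b s => Lp b p s * dlg b (Z^~ b) (coord_field t b ga) s)
  (fun k s => (if p is q.+1 then Lp a q s * (dlg a Za (e_ k) s * dlg a Za (coord_field t a ga) s) else 0)
     - Lp a p s * K2 a Za (e_ k) (coord_field t a ga) s).
  apply: ucder_eq D => k s _ /=; rewrite /Lp.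
  case: p => [|q]; first by rewrite mulr0n; ring.
  by rewrite -[(q`!%:R)^-1]factS /=; ring.
have c1 k : contC 0 1 (fun s => (if p is q.+1 then Lp a q s * (dlg a Za (e_ k) s * dlg a Za (coord_field t a ga) s) else 0)
     - Lp a p s * K2 a Za (e_ k) (coord_field t a ga) s).
  apply: contCB; last exact: (contCM (@cL p) (@cK2 _ _)).
  case: p {D D2} => [|q]; first exact: contC_cst.
  exact: (contCM (@cL q) (contCM (@cDl _) (@cDl _))).
have D3 := ucderZ (two_pi_i R)^-1 (J_cder HJ (fun k => @c1 k) D2).
apply: ucder_ext D3; apply: filterS (box_nbhs a r0_gt0) => b Hb _.
have [Mb HZb Xib _] := HB Hb.
by rewrite /pderiv (F_Dv (BU Hb) HZb Xib).
Qed.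

(** For [p] = 0 only the integral of [K2] is left, and it vanishes by [J_K2]; for higher [p],
    [second_derivative] replaces the product of logarithmic derivatives by the one along the star
    product. *)
Lemma second_Dv p ga v : 'D_v (pderiv t ga (F_density gam L p)) a =
  if p is q.+1 then 'D_(star a v (coord_field t a ga)) (F_density gam L q) a else 0.
Proof.
have [Ma HZ Xi HV] := HB Ba.
have [_ ->] := vder_Dv v (second_vder p ga).
set w := coord_field t a ga.
have cB q : contC 0 1 (fun s => Lp a q s * K2 a Za v w s) by exact: (contCM (@cL q) (@cK2 _ _)).
have cK q k : contC 0 1 (fun s => Lp a q s * K2 a Za (e_ k) w s).
  by exact: (contCM (@cL q) (@cK2 _ _)).
have cD q x : contC 0 1 (fun s => Lp a q s * (dlg a Za x s * dlg a Za w s)).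
  exact: (contCM (@cL q) (contCM (@cDl _) (@cDl _))).
have K2s s : K2 a Za v w s = \sum_k v 0 k * K2 a Za (e_ k) w s.
  rewrite /K2; under [RHS]eq_bigr do rewrite mulr_sumr.
  rewrite exchange_big; apply: eq_bigr => r _ /=.
  rewrite uX_sum mulr_sumr !mulr_suml; apply: eq_bigr => k _.
  by ring.
case: p => [|q].
  rewrite (@J_comb v _ (fun s => 0 - Lp a 0 s * K2 a Za v w s)) => [|k||s _].
  - have E : (fun s => 0 - Lp a 0 s * K2 a Za v w s) = (fun s => (-1) * K2 a Za v w s).
      by apply: functional_extensionality_dep => s; rewrite /Lp fact0 invr1 mul1r expr0; ring.
    by rewrite E (JZ HJ _ (@cK2 _ _)) (J_K2 Ua HZ) !mulr0.
  - exact: (contCB (@contC_cst R 0 1 0) (@cK 0%N k)).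
  - exact: (contCB (@contC_cst R 0 1 0) (@cB 0%N)).
  - by rewrite K2s mulr_sumr sub0r -sumrN; apply: eq_bigr => k _; ring.
rewrite (@J_comb v _ (fun s => Lp a q s * (dlg a Za v s * dlg a Za w s) - Lp a q.+1 s * K2 a Za v w s)) => [|k||s _].
- by rewrite (second_derivative Ua Ma HZ Xi) (F_Dv Ua HZ Xi).
- exact: contCB (@cD q _) (@cK q.+1 k).
- exact: contCB (@cD q _) (@cB q.+1).
rewrite K2s (dlg_sum _ _ v) !mulr_sumr !mulr_suml mulr_sumr -sumrB.
by apply: eq_bigr => k _; ring.
Qed.

End Second.

Lemma F_differentiable p a : U a -> differentiable (F_density gam L p) a.
Proof.
move=> Ua; have [Z [r0 [r00 BU HB HX]]] := roots_affine n_gt0 HU Ua.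
have [|Ma HZ Xi _] := HB a; first by move=> k; rewrite subrr nc0.
exact: vder_differentiable (F_vder Ua HZ Xi p).
Qed.

Lemma field_sum a v : U a -> v = \sum_ga (v *m 'J t a) 0 ga *: coord_field t a ga.
Proof.
move=> Ua; have : v = v *m 'J t a *m invmx ('J t a) by rewrite mulmxK ?(J_unit HU Ua).
by move=> {1}->; rewrite mulmx_sum_row.
Qed.

Lemma Dv_sum (f : pt -> C) a v : U a -> differentiable f a ->
  'D_v f a = \sum_ga (v *m 'J t a) 0 ga * pderiv t ga f a.
Proof.
move=> Ua df; have H w : 'D_w f a = 'd f a w by rewrite deriveE.
rewrite H {1}(field_sum v Ua) linear_sum; apply: eq_bigr => ga _.
by rewrite linearZ /pderiv H.
Qed.

Lemma density_chainP : density_chain U t (F_density gam L).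
Proof.
split=> [p a|p be ga a Ua]; first exact: F_differentiable.
have [Z [r0 [r00 BU HB HX]]] := roots_affine n_gt0 HU Ua.
rewrite {1}/pderiv (second_Dv Ua r00 BU HB HX) (Dv_sum _ Ua (F_differentiable p Ua)).
by [].
Qed.

Lemma F0_second a be ga : U a -> pderiv t be (pderiv t ga (F_density gam L 0)) a = 0 /\
  differentiable (pderiv t ga (F_density gam L 0)) a.
Proof.
move=> Ua; have [Z [r0 [r00 BU HB HX]]] := roots_affine n_gt0 HU Ua.
split; first by rewrite {1}/pderiv (second_Dv Ua r00 BU HB HX).
exact: vder_differentiable (second_vder Ua r00 BU HB HX 0 ga).
Qed.

Lemma gup_unit b : U b -> gup t b \in unitmx.
Proof.
move=> Ub; have Mb := U_Mhat HU Ub; rewrite (gupE n_gt0 t Mb.1).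
rewrite !unitmx_mul unitmx_tr (J_unit HU Ub) andbT /=.
by rewrite unitmxE unitfE; case: Mb.
Qed.

(** At level 0 all second derivatives vanish, so on a connected [U] the first derivatives are
    constants [d ga] and the density is affine in [t]. *)
Theorem densities_chain : connected U -> hamiltonian_density_chain U t (F_density gam L).
Proof.
move=> cU; split; first exact: density_chainP.
have [[a Ua]|nU] := pselect (U !=set0); last first.
  by exists (fun _ => 0), 0 => b Ub; case: nU; exists b.
pose F := F_density gam L 0; pose G ga := pderiv t ga F.
have Gd ga b : U b -> differentiable (G ga) b by move=> Ub; have [] := F0_second ga ga Ub.
have G0 ga b k : U b -> pd (G ga) k b = 0.
  move=> Ub; rewrite /pd (Dv_sum _ Ub (Gd ga b Ub)) big1// => be _.
  by have [-> _] := F0_second be ga Ub; rewrite mulr0.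
pose d ga := G ga a.
have Gc ga b : U b -> G ga b = d ga.
  move=> Ub; apply: (connected_const cU (f := G ga)) => // c Uc.
  exact: (pd0_locally oU (Gd ga) (fun c k => @G0 ga c k) Uc).
pose H (b : pt) : C := F b - \sum_ga d ga * crd t ga b.
have Hv b : U b -> vder H b (fun k => pd F k b - \sum_ga d ga * 'J t b k ga).
  move=> Ub; have dt := t_diff HU Ub.
  have D ga : vder (crd t ga) b (fun k => 'J t b k ga).
    have [dc _] := @Dv_coord R N t b 0 ga dt.
    by apply: ucder_eq (differentiable_vder dc) => k s _; rewrite -(pd_coord _ _ dt).
  have DF := differentiable_vder (F_differentiable 0 Ub).
  exact: (ucderB DF (ucder_sum (index_enum 'I_N) (P := xpredT) (fun ga _ => ucderZ (d ga) (D ga)))).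
have Hd b : U b -> differentiable H b by move=> /Hv; exact: vder_differentiable.
have H0 b k : U b -> pd H k b = 0.
  move=> Ub; have [_ E] := vder_Dv (e_ k) (Hv b Ub).
  have S (h : 'I_N -> C) : \sum_l (e_ k) 0 l * h l = h k.
    rewrite (bigD1 k)//= mxE !eqxx mul1r big1 ?addr0 => [//|l lk].
    by rewrite mxE (negPf lk) andbF mul0r.
  rewrite /pd E S.
  rewrite /pd (Dv_sum _ Ub (F_differentiable 0 Ub)); apply/eqP; rewrite subr_eq0; apply/eqP.
  apply: eq_bigr => ga _; rewrite -(Gc ga b Ub) -rowE mxE mulrC.
  by [].
have Hc b : U b -> H b = H a.
  move=> Ub; apply: (connected_const cU (f := H)) => // c Uc.
  exact: (pd0_locally oU Hd (fun c k => @H0 c k) Uc).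
(* As [theta0] lowers the index of [t], the coefficients [d] are raised by the constant matrix
   [gup t a]. *)
exists (fun al => \sum_ga d ga * gup t a ga al), (H a) => b Ub.
rewrite -(Hc b Ub).
have -> : \sum_al (\sum_ga d ga * gup t a ga al) * theta0 t al b = \sum_ga d ga * crd t ga b.
  pose dv : pt := \row_ga d ga; pose tv : 'cV[C]_N := (t b)^T.
  have E1 : \sum_ga d ga * crd t ga b = (dv *m tv) 0 0.
    by rewrite mxE; apply: eq_bigr => ga _; rewrite !mxE.
  have E2 : \sum_al (\sum_ga d ga * gup t a ga al) * theta0 t al b =
      ((dv *m gup t a) *m (gdown t b *m tv)) 0 0.
    rewrite mxE; apply: eq_bigr => al _; rewrite !mxE; congr (_ * _).
      by apply: eq_bigr => ga _; congr (_ * _); rewrite mxE.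
    by apply: eq_bigr => be _; congr (_ * _); rewrite mxE.
  rewrite E2 E1 -mulmxA (mulmxA (gup t a)); case: HU => _ _ HG.
  by rewrite /gdown -(HG a b Ua Ub) mulmxV ?mul1mx ?gup_unit.
by rewrite /H addrC subrK.
Qed.

End PartOne.

(** * Star-shaped curves around a centre *)

Section StarCurve.
Local Open Scope complex_scope.
Variable R : realType.
Local Notation C := (cplx R).
Local Notation Re := complex.Re.
Local Notation Im := complex.Im.
Variables (p : {poly C}) (c : C).

(** The radius in direction [e]. The exponential makes it positive, and the polynomial [p] allows
    its values in finitely many directions to be prescribed by interpolation. *)
Definition star_radius (e : C) : R := expR (Re p.[e]).
Definition star_log (t : R) : C := rc (Re p.[ei t]) + two_pi_i R * rc t.
Definition star_curve (t : R) : C := c + cexp (star_log t).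
Definition star_dlog (t : R) : C := rc (Re (p^`().[ei t] * (two_pi_i R * ei t))) + two_pi_i R.

Lemma star_curveE t : star_curve t = c + rc (star_radius (ei t)) * ei t.
Proof. by rewrite /star_curve /star_log cexpD -ei_cexp cexpE /= cis0 mulr1. Qed.

Lemma star_radius_gt0 e : 0 < star_radius e. Proof. exact: expR_gt0. Qed.

(** A ray from the centre meets the curve only at the radius of its direction; simplicity and the
    location of points relative to the curve both follow from this. *)
Lemma star_ray t (s : R) e : 0 <= s -> nc e = 1 -> star_curve t = c + rc s * e ->
  ei t = e /\ s = star_radius e.
Proof.
move=> s0 e1; rewrite star_curveE => /addrI E; have := congr1 (@nc R) E.
rewrite !ncM !nc_rc nc_ei e1 !mulr1 !ger0_norm ?(ltW (star_radius_gt0 _))// => rs.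
have n0 : rc s != 0 by rewrite rc_eq0 -rs gt_eqF ?star_radius_gt0.
by move: E; rewrite rs => /(mulfI n0) ei_e; split=> //; rewrite -rs ei_e.
Qed.

Lemma rder_star_log t : rder star_log t (star_dlog t).
Proof.
have D := rder_comp (zder_horner p (ei t)) (rder_ei t).
have [D1 _] := (rder_ReIm _ _ _).1 D.
have D2 := ucderD (rder_rc D1) (ucderZ (two_pi_i R) (rder_id t)).
by apply: ucder_eq D2 => k s _; rewrite mulr1.
Qed.

Lemma rder_star t : rder star_curve t (cexp (star_log t) * star_dlog t).
Proof.
have D := ucderD (ucder_cst (@xR R) t c) (rder_comp (zder_cexp (star_log t)) (rder_star_log t)).
by apply: ucder_eq D => k s _; rewrite add0r.
Qed.

Lemma star_dlog_cvg t : star_dlog s @[s --> t] --> star_dlog t.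
Proof.
have c0 := @rder_cvg R _ t _ (rder_ei t).
have ct : cst (two_pi_i R) s @[s --> t] --> two_pi_i R by exact: cvg_cst.
have c1 : (fun s => p^`().[ei s] * (two_pi_i R * ei s)) s @[s --> t] --> p^`().[ei t] * (two_pi_i R * ei t).
  have c2 : (fun s => p^`().[ei s]) s @[s --> t] --> p^`().[ei t].
    exact: (cvg_comp _ _ c0 (@horner_cvg R p^`() (ei t))).
  exact: (cvgM c2 (cvgM ct c0)).
have [c3 _] := (cvg_ReIm _ _).1 c1.
exact: (cvgD (cvg_rc c3) ct).
Qed.

Lemma star_continuous t : star_curve s @[s --> t] --> star_curve t.
Proof. exact: (rder_cvg (rder_star t)). Qed.

Lemma star_dcvg t : (fun s => cexp (star_log s) * star_dlog s) s @[s --> t] --> cexp (star_log t) * star_dlog t.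
Proof.
have c0 : cexp (star_log s) @[s --> t] --> cexp (star_log t).
  exact: (cvg_comp _ _ (rder_cvg (rder_star_log t)) (@cexp_cvg R (star_log t))).
exact: (cvgM c0 (@star_dlog_cvg t)).
Qed.

Lemma star_piecewise : piecewise_C1 star_curve.
Proof.
pose D t := cexp (star_log t) * star_dlog t.
have dx (t : R) : is_derive t 1 (fun s => Re (star_curve s)) (Re (D t)).
  by have [] := (rder_ReIm _ _ _).1 (rder_star t).
have dy (t : R) : is_derive t 1 (fun s => Im (star_curve s)) (Im (D t)).
  by have [] := (rder_ReIm _ _ _).1 (rder_star t).
exists 1%N, (fun i => i%:R); split=> // i; rewrite ltnS leqn0 => /eqP ->; split; first exact: ltr01.
exists (fun s => Re (star_curve s)), (fun s => Im (star_curve s)); split.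
- by move=> t; split; [have := dx t; case|have := dy t; case].
- have -> : derive1 (fun s => Re (star_curve s)) = fun t => Re (D t).
    by apply: functional_extensionality_dep => t; rewrite derive1E; have := dx t; case.
  by move=> t; have [] := (cvg_ReIm _ _).1 (@star_dcvg t).
- have -> : derive1 (fun s => Im (star_curve s)) = fun t => Im (D t).
    by apply: functional_extensionality_dep => t; rewrite derive1E; have := dy t; case.
  by move=> t; have [] := (cvg_ReIm _ _).1 (@star_dcvg t).
by move=> t _; exact: cplx_eq.
Qed.

Lemma star_closed : star_curve 0 = star_curve 1.
Proof. by rewrite !star_curveE ei0 ei1. Qed.

Lemma star_within : {within `[0, 1], continuous star_curve}.
Proof. by apply: continuous_subspaceT => t; exact: star_continuous. Qed.

Lemma star_simple : simple_closed_curve star_curve.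
Proof.
split; [exact: star_within|exact: star_piecewise|exact: star_closed|].
move=> s t sI tI; rewrite [RHS]star_curveE => E.
have [E1 _] := star_ray (ltW (star_radius_gt0 _)) (nc_ei t) E.
exact: ei_inj.
Qed.

Lemma star_off (s : R) e : 0 <= s -> nc e = 1 -> s != star_radius e ->
  ~ curve_image star_curve (c + rc s * e).
Proof. by move=> s0 e1 /eqP sr [t _ E]; apply: sr; have [] := star_ray s0 e1 E. Qed.

(** By construction [star_log] is a logarithm of the curve seen from [c], and it increases by 2 pi i
    over one turn. *)
Lemma star_winding_center : winding_number star_curve c = 1.
Proof.
have nw : ~ curve_image star_curve c.
  have := @star_off 0 1 (lexx _) (@nc1 R); rewrite rc0 mul0r addr0; apply.
  by rewrite lt_eqF ?star_radius_gt0.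
have cg := star_within.
have cl : contC 0 1 star_log by move=> t _; exact: (rder_cvg (rder_star_log t)).
rewrite winding_J (curve_FTC star_piecewise (ginv_cont cg nw) cl).
  rewrite /star_log ei0 ei1 rc0 rc1 mulr0 mulr1 addr0 addrAC subrr add0r mulVf//.
  exact: two_pi_i_neq0.
move=> t d tI Hd; have tI' : 0 <= t <= 1 by case/andP: tI => h1 h2; rewrite !ltW.
have -> : d = cexp (star_log t) * star_dlog t.
  by rewrite -(velocityE Hd) (velocityE (rder_star t)).
have -> : (ext star_curve t - c)^-1 * (cexp (star_log t) * star_dlog t) = star_dlog t.
  rewrite (extE _ tI') /star_curve addrAC subrr add0r mulrA mulVf ?mul1r//.
  exact: cexp_neq0.
exact: rder_star_log.
Qed.

Lemma star_winding_inside (s : R) e : 0 <= s -> nc e = 1 -> s < star_radius e ->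
  winding_number star_curve (c + rc s * e) = 1.
Proof.
move=> s0 e1 sr; rewrite (winding_segment star_within star_piecewise star_closed) ?star_winding_center//.
move=> x /andP[x0 x1]; rewrite mulrA -rcM; apply: star_off => //; first exact: mulr_ge0.
by rewrite lt_eqF// (le_lt_trans _ sr)// ler_piMl.
Qed.

(** The outward ray avoids the curve, so the component of the point contains it and is unbounded. *)
Lemma star_outside (s : R) e : 0 <= s -> nc e = 1 -> star_radius e < s ->
  ~ enclosed star_curve (c + rc s * e).
Proof.
move=> s0 e1 rs [_]; pose ray (x : R) : C := c + rc x * e.
have cray (x : R) : ray y @[y --> x] --> ray x.
  have D : rder (fun y => c + rc y * e) x e by exact: rder_affine.
  exact: (rder_cvg D).
have conn : connected (ray @` `[s, +oo[).
  apply: connected_continuous_connected.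
    by apply/connected_intervalP; exact: interval_is_interval.
  by apply: continuous_subspaceT => x; exact: cray.
have sub : ray @` `[s, +oo[ `<=` ~` curve_image star_curve.
  move=> _ [x + <-]; rewrite /= in_itv /= andbT => sx.
  apply: star_off => //; first exact: le_trans sx.
  by rewrite gt_eqF// (lt_le_trans rs).
have H : ray @` `[s, +oo[ `<=` connected_component (~` curve_image star_curve) (c + rc s * e).
  apply: connected_component_max => //.
  by exists s => //; rewrite /= in_itv /= lexx.
apply/not_bounded => B; pose x : R := s + `|B| + nc c + 1.
have sx : s <= x by rewrite /x -!addrA lerDl !addr_ge0 ?nc_ge0.
exists (ray x); first by apply: H; exists x => //; rewrite /= in_itv /= andbT.
have := ncDB (ray x) c; rewrite /ray addrAC subrr add0r ncM e1 mulr1 nc_rc.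
rewrite ger0_norm; last exact: le_trans sx.
have := ler_norm B; rewrite /x; lra.
Qed.

Lemma polar_form (w : C) : exists2 e : C, nc e = 1 & w = c + rc (nc (w - c)) * e.
Proof.
have [->|wc] := eqVneq w c; first by exists 1; rewrite ?nc1// subrr nc0 rc0 mul0r addr0.
have n0 : nc (w - c) != 0 by rewrite nc_eq0 subr_eq0.
exists ((w - c) / rc (nc (w - c))).
  by rewrite ncM ncV nc_rc ger0_norm ?nc_ge0// mulfV.
by rewrite mulrCA mulfV ?rc_eq0// mulr1 addrC subrK.
Qed.

Lemma star_positive : positively_oriented star_curve.
Proof.
move=> w Hw; have [e e1 E] := polar_form w; move: Hw; rewrite E => Hw.
have s0 := nc_ge0 (w - c).
have [sr|rs|sr] := ltgtP (nc (w - c)) (star_radius e); first exact: star_winding_inside.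
  by case: (star_outside s0 e1 rs).
(* The remaining case is a point off the curve whose distance from [c] is the radius in its
   direction. A small shift towards the centre keeps the winding number and reaches the inside,
   where it is 1. *)
case: Hw => nw _; have s1 : 0 < nc (w - c) by rewrite sr star_radius_gt0.
have [d d0 Hd] := (nbhs_ncP _ _).1 (winding_locally star_within star_piecewise star_closed nw).
pose x := nc (w - c) - Num.min (nc (w - c)) d / 2.
have m0 : 0 < Num.min (nc (w - c)) d / 2 by rewrite divr_gt0// lt_min s1.
have md : Num.min (nc (w - c)) d / 2 < d.
  have : Num.min (nc (w - c)) d <= d by rewrite ge_min lexx orbT.
  by lra.
have ms : Num.min (nc (w - c)) d / 2 < nc (w - c).
  have : Num.min (nc (w - c)) d <= nc (w - c) by rewrite ge_min lexx.
  by lra.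
rewrite -(Hd (c + rc x * e)).
  by apply: star_winding_inside => //; [rewrite subr_ge0 ltW|rewrite -sr ltrBlDr ltrDl].
rewrite opprD addrACA subrr add0r -mulrBl -rcB ncM e1 mulr1 nc_rc /x.
by rewrite addrAC subrr add0r normrN gtr0_norm.
Qed.

End StarCurve.

(** * A curve separating a given set of points from the others *)

Section CurveAround.
Local Open Scope complex_scope.
Variable R : realType.
Local Notation C := (cplx R).
Local Notation Re := complex.Re.
Local Notation Im := complex.Im.
Variables (I : finType) (X : I -> C).
Hypothesis Xinj : injective X.

(* No two of the points lie on a common line through [c]. *)
Lemma generic_center : exists c : C, (forall r, X r != c) /\
  forall r s, r != s -> Im (X r - c) * Re (X s - c) - Re (X r - c) * Im (X s - c) != 0.
Proof.
(* The centre is sought on the parabola s + i s^2. As a parabola contains no line, each forbidden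
   position is a root of a non-zero polynomial in s. *)
pose P1 r : {poly R} := 'X - (Re (X r))%:P.
pose P2 (q : I * I) : {poly R} := (Im (X q.1) * Re (X q.2) - Re (X q.1) * Im (X q.2))%:P
  + (Im (X q.2) - Im (X q.1)) *: 'X + (Re (X q.1) - Re (X q.2)) *: 'X^2.
have P20 q : q.1 != q.2 -> P2 q != 0.
  move=> q12; apply: contra q12 => /eqP E; apply/eqP/Xinj/cplx_eq.
    have := congr1 (fun f : {poly R} => f`_2) E; rewrite !coefD !coefZ coefC coefX coefXn coef0 /=.
    by rewrite mulr0 mulr1 !add0r => /eqP; rewrite subr_eq0 => /eqP.
  have := congr1 (fun f : {poly R} => f`_1) E; rewrite !coefD !coefZ coefC coefX coefXn coef0 /=.
  by rewrite mulr0 mulr1 add0r addr0 => /eqP; rewrite subr_eq0 => /eqP.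
have : (\prod_r P1 r) * (\prod_(q | q.1 != q.2) P2 q) != 0.
  rewrite mulf_neq0//; first by apply/prodf_neq0 => r _; rewrite polyXsubC_eq0.
  by apply/prodf_neq0 => q; exact: P20.
case/poly_nonroot => k; rewrite /root hornerM !horner_prod mulf_eq0 negb_or.
set s : R := k%:R => /andP[/prodf_neq0 H1 /prodf_neq0 H2].
exists (s +i* (s ^+ 2)); split=> [r|r t rt].
  apply/eqP => E; have := H1 r isT; rewrite /P1 hornerXsubC E /= subrr eqxx.
  by [].
have := H2 (r, t) rt; rewrite /P2 /= !hornerE; apply: contra => /eqP E; apply/eqP; rewrite -[RHS]E.
by rewrite !ReB !ImB /=; ring.
Qed.

(** From a generic centre the points lie in distinct directions, so one interpolating polynomial
    lets the curve pass beyond the points of [S] and short of the others. The continuous derivative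
    on the whole line serves to integrate d log lambda in [log_lift]. *)
Theorem curve_around (S : pred I) : exists gam : R -> C,
  [/\ simple_closed_curve gam, positively_oriented gam, forall r, ~ curve_image gam (X r),
      forall r, winding_number gam (X r) = (S r)%:R &
      exists2 d : R -> C, contC 0 1 d & forall t, rder gam t (d t)].
Proof.
have [c [Xc Xd]] := generic_center.
pose rho r := nc (X r - c); pose e r : C := (X r - c) / rc (rho r).
have rho0 r : 0 < rho r by rewrite nc_gt0 subr_eq0.
have rhon r : rc (rho r) != 0 by rewrite rc_eq0 gt_eqF.
have eE r : X r - c = rc (rho r) * e r by rewrite /e mulrCA mulfV ?mulr1.
have e1 r : nc (e r) = 1 by rewrite /e ncM ncV nc_rc (gtr0_norm (rho0 r)) mulfV// gt_eqF ?rho0.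
have einj : injective e.
  move=> r s E; apply/eqP; apply: contraT => /Xd; rewrite !eE E !ReMr !ImMr => /eqP; case.
  by ring.
(* The radius in the direction of X_r becomes its distance times e or 1 / e. *)
pose v r : C := rc (ln (rho r) + if S r then 1 else -1).
pose p := \sum_r (v r / (conodal e r).[e r]) *: conodal e r.
have pe r : p.[e r] = v r.
  rewrite /p horner_sum (bigD1 r)//= big1 ?addr0 => [|s sr].
    by rewrite hornerZ mulfVK// (conodal_eq einj).
  have rs : r != s by rewrite eq_sym.
    by rewrite hornerZ (conodal_neq e rs) mulr0.
have rad r : star_radius p (e r) = rho r * expR (if S r then 1 else -1).
  by rewrite /star_radius pe /= expRD lnK ?posrE.
have XE r : X r = c + rc (rho r) * e r by rewrite -eE addrC subrK.
have si r : S r -> rho r < star_radius p (e r).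
  by move=> Sr; rewrite rad Sr ltr_pMr// expR_gt1 ltr01.
have so r : ~~ S r -> star_radius p (e r) < rho r.
  by move=> Sr; rewrite rad (negPf Sr) gtr_pMr// expR_lt1 ltrN10.
have ne r : rho r != star_radius p (e r).
  by have [/si Sr|/so Sr] := boolP (S r); rewrite ?(lt_eqF Sr) ?(gt_eqF Sr).
exists (star_curve p c); split; [exact: star_simple|exact: star_positive| | |].
- by move=> r; rewrite XE; apply: star_off => //; exact: ltW.
- move=> r; rewrite XE; case: (boolP (S r)) => Sr.
    by apply: star_winding_inside => //; [exact: ltW|exact: si].
  apply: (winding_outside (@star_within R p c) (@star_piecewise R p c) (@star_closed R p c)).
    by apply: star_off => //; exact: ltW.
  by apply: star_outside => //; [exact: ltW|exact: so].
exists (fun t => cexp (star_log p t) * star_dlog p t) => [t _|t]; [exact: star_dcvg|exact: rder_star].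
Qed.

End CurveAround.

Lemma subset_of_card (T : finType) (A : {set T}) k : (k <= #|A|)%N ->
  exists2 B : {set T}, B \subset A & #|B| = k.
Proof.
move=> kA; have : (0 < #|[set B : {set T} | B \subset A & #|B| == k]|)%N by rewrite cards_draws bin_gt0.
by case/card_gt0P => B; rewrite inE => /andP[BA /eqP Bk]; exists B.
Qed.

(** * Sets of zeros and poles whose eps_r sum to 0 *)

Section BalancedSets.
Variables (R : realType) (m : nat) (n : 'I_m.+1 -> nat).
Hypothesis n_gt0 : forall i, (0 < n i)%N.
Hypothesis m_gt0 : (0 < m)%N.
Local Notation C := (cplx R).
Local Notation N := (ckp_dim n).
Local Notation M := (Mdeg n).
Local Notation idx := ('I_M + 'I_m)%type.
Implicit Types (S : {set idx}) (y : idx -> C).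

Lemma nn_lt_Mdeg j : (nn n j < M)%N.
Proof. by rewrite /Mdeg (bigD1 j)//= addnCA -[ltnLHS]addn0 ltn_add2l addn_gt0 n_gt0. Qed.

Definition pole_with j (K : {set 'I_M}) : {set idx} := inr j |: (inl @: K).

Lemma pole_with_sum j K y : \sum_(r in pole_with j K) y r = y (inr j) + \sum_(k in K) y (inl k).
Proof.
rewrite /pole_with big_setU1 /=; last by apply/imsetP => -[].
by rewrite big_imset // => k l _ _ [].
Qed.

Lemma pole_with_balanced j (K : {set 'I_M}) : #|K| = nn n j -> \sum_(r in pole_with j K) eps R r = 0.
Proof. by move=> cK; rewrite pole_with_sum /= sumr_const cK addNr. Qed.

(** Since n_j < Mdeg, one zero can be exchanged for another in a balanced set, so [y] is constant on
    the zeros; a pole p_j with n_j zeros then gives its value at p_j. *)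
Lemma balanced_kernel y : (forall S, \sum_(r in S) eps R r = 0 -> \sum_(r in S) y r = 0) ->
  exists k, forall r, y r = k * eps R r.
Proof.
move=> H; pose j0 : 'I_m := Ordinal m_gt0; have M0 : (0 < M)%N by exact: leq_ltn_trans (nn_lt_Mdeg j0).
have nn0 j : (0 < nn n j)%N by exact: n_gt0.
have swap k l : y (inl k) = y (inl l).
  have [->//|kl] := eqVneq k l.
  have [|B /fintype.subsetP BS cB] := @subset_of_card _ (~: [set k; l])%SET (nn n j0).-1.
    by rewrite cardsCs finset.setCK cards2 kl card_ord; have := nn_lt_Mdeg j0; have := nn0 j0; lia.
  have nk : k \notin B by apply/negP => /BS; rewrite !inE eqxx.
  have nl : l \notin B by apply/negP => /BS; rewrite !inE eqxx orbT.
  have E x : x \notin B -> y (inr j0) + (y (inl x) + \sum_(i in B) y (inl i)) = 0.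
    move=> xB; have cx : #|x |: B| = nn n j0 by rewrite cardsU1 xB cB add1n prednK.
    by have := H _ (pole_with_balanced cx); rewrite pole_with_sum big_setU1.
  apply: (addIr (\sum_(i in B) y (inl i))); apply: (addrI (y (inr j0))).
  by rewrite (E k nk) (E l nl).
pose k0 : 'I_M := Ordinal M0; exists (y (inl k0)) => -[k|j]; first by rewrite mulr1 (swap k k0).
have [|B _ cB] := @subset_of_card _ [set: 'I_M]%SET (nn n j).
  by rewrite cardsT card_ord ltnW// nn_lt_Mdeg.
have := H _ (pole_with_balanced cB); rewrite pole_with_sum.
rewrite (eq_bigr (fun _ => y (inl k0))) => [|k _]; last exact: swap.
by rewrite sumr_const cB /= mulrN mulr_natr => /eqP; rewrite addr_eq0 => /eqP.
Qed.

(** The incidence matrix of all balanced sets annihilates the non-zero vector eps, so its rank is at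
    most (N + 1) - 1 = N, and N sets suffice to span its rows. *)
Theorem balanced_sets : exists S : 'I_N -> {set idx}, (forall al, \sum_(r in S al) eps R r = 0) /\
  forall y, (forall al, \sum_(r in S al) y r = 0) -> exists k, forall r, y r = k * eps R r.
Proof.
pose P : {set {set idx}} := finset (fun S : {set idx} => \sum_(r in S) eps R r == 0).
pose A : 'M[C]_(#|P|, #|{: idx}|) := \matrix_(i, c) ((enum_val c \in (enum_val i : {set idx})) : nat)%:R.
pose cl y : 'cV[C]_(#|{: idx}|) := \col_c y (enum_val c).
have AE y i : (A *m cl y) i 0 = \sum_(r in (enum_val i : {set idx})) y r.
  rewrite mxE [RHS]big_mkcond /=.
  rewrite [RHS](reindex _ (onW_bij _ (@enum_val_bij idx))) /=.
  by apply: eq_bigr => c _; rewrite !mxE; case: ifP => _; rewrite ?mul1r ?mul0r.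
have rkA : (\rank A <= N)%N.
  have A0 : A *m cl (eps R (n := n)) = 0.
    apply/matrixP => i z; rewrite (ord1 z) AE [RHS]mxE.
    by have := enum_valP i; rewrite inE => /eqP.
  have nz : (0 < \rank (cl (eps R (n := n))))%N.
    rewrite lt0n mxrank_eq0; apply/eqP => E.
    have := congr1 (fun B : 'cV[C]_(#|{: idx}|) => B (enum_rank (inr (Ordinal m_gt0) : idx)) 0) E.
    by rewrite !mxE enum_rankK => /eqP; rewrite (negPf (eps_neq0 R n_gt0 _)).
  have := leq_trans (mulmx0_rank_max A0) (eq_leq (card_idx n_gt0)).
  by move: nz; set x := \rank A; set z := \rank _; lia.
(* The default, the empty set, is balanced and imposes the trivial relation. *)
pose S (al : 'I_N) : {set idx} := if insub (val al) is Some i then enum_val (maxrankfun A i) else finset.set0.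
have Si (i : 'I_(\rank A)) : exists al, S al = enum_val (maxrankfun A i).
  by exists (widen_ord rkA i); rewrite /S /= valK.
exists S; split=> [al|y Hy].
  rewrite /S; case: insub => [i|]; last by rewrite finset.big_set0.
  by have := enum_valP (maxrankfun A i); rewrite inE => /eqP.
have A0 : A *m cl y = 0.
  have [B ->] : exists B, A = B *m rowsub (maxrankfun A) A.
    by apply/submxP; rewrite eq_maxrowsub.
  rewrite -mulmxA; have -> : rowsub (maxrankfun A) A *m cl y = 0; last by rewrite mulmx0.
  apply/matrixP => i z; rewrite (ord1 z) mul_rowsub_mx !mxE.
  have [al E] := Si i; have := AE y (maxrankfun A i); rewrite mxE => ->.
  by rewrite -E.
apply: balanced_kernel => T TP; have TP' : T \in P by rewrite inE TP.
have := AE y (enum_rank_in TP' T); rewrite enum_rankK_in// => <-.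
by rewrite A0 mxE.
Qed.

End BalancedSets.

Section RowMaps.
Local Open Scope complex_scope.
Variables (R : realType) (N : nat).
Local Notation C := (cplx R).
Local Notation pt := 'rV[C]_N.

Lemma rows_jacobian (t : pt -> pt) b (D : 'M[C]_N) :
  (forall al, vder (crd t al) b (fun k => D k al)) -> differentiable t b /\ 'J t b = D.
Proof.
move=> H; have dt : differentiable t b.
  have -> : t = \sum_(al < N) (fun c => crd t al c *: (delta_mx 0 al : pt)).
    by apply: functional_extensionality_dep => c; rewrite fct_sumE {1}[t c]row_sum_delta.
  apply: differentiable_sum => al; apply: differentiableZl.
  exact: (vder_differentiable (H al)).
split=> //; apply/matrixP => k al; rewrite -(pd_coord _ _ dt) /pd.
have [_ ->] := vder_Dv (delta_mx 0 k) (H al).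
rewrite (bigD1 k)//= mxE !eqxx mul1r big1 ?addr0// => l lk.
by rewrite mxE (negPf lk) andbF mul0r.
Qed.
End RowMaps.

(** * Reconstruction of the point from the zeros and poles *)

Section RootsDetermine.
Variables (R : realType) (m : nat) (n : 'I_m.+1 -> nat).
Hypothesis n_gt0 : forall i, (0 < n i)%N.
Local Notation C := (cplx R).
Local Notation pt := 'rV[C]_(ckp_dim n).

(** Equal zeros and poles give equal lambda. The difference [b - a] moves no pole, so lambda is
    affine along it and its [dl] is the difference of the two functions, that is 0; [fpol_eq0]
    concludes. *)
Lemma rpt_determines (a b : pt) Z Z' : MCKP a -> is_zeros a Z -> is_zeros b Z' ->
  (forall r, rpt Z a r = rpt Z' b r) -> a = b.
Proof.
move=> Ma HZ HZ' E; have Ep j : pole b j = pole a j by exact: (esym (E (inr j))).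
have EZ k : Z k = Z' k by exact: (E (inl k)).
have EV : Vpol a = Vpol b.
  by rewrite HZ HZ'; congr (_ *: _); apply: eq_bigr => k _; rewrite EZ.
have Epp e : polprod b e = polprod a e by apply: eq_bigr => j _; rewrite Ep.
have El z : (forall j, z != pole a j) -> lam b z = lam a z.
  move=> hz; apply: (mulfI (polprod_neq0 (nn n) hz)).
  rewrite -(Vpol_lam hz) EV Vpol_lam ?Epp// => j.
  by rewrite Ep.
have coB i k : coeff ((-1) *: a + b) i k = coeff b i k - coeff a i k.
  by rewrite coeff_lin mulN1r addrC.
have pv j : pole ((-1) *: a + b) j = 0 by rewrite /pole coB -!/(pole _ _) Ep subrr.
have dl0 z : (forall j, z != pole a j) -> dl a ((-1) *: a + b) z = 0.
  move=> hz; have := El z hz; rewrite !lamE -!addrA => /addrI /eqP.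
  rewrite -subr_eq0 => /eqP <-; rewrite /dl opprD addrACA -!sumrB; congr (_ + _).
    by apply: eq_bigr => k _; rewrite coB mulrBl.
  apply: eq_bigr => j _; rewrite -sumrB; apply: eq_bigr => k _.
  by rewrite pv mulr0 mul0r addr0 coB Ep mulrBl.
have f0 : fpol a ((-1) *: a + b) = 0.
  apply: (@poly_eq_nonpole R m n a) => z hz; rewrite (fpol_dl _ hz) dl0// mulr0.
  by rewrite horner0.
have /eqP := fpol_eq0 n_gt0 Ma f0.
by rewrite scaleN1r addrC subr_eq0 => /eqP ->.
Qed.
End RootsDetermine.

(** * Flat coordinates made of sums of zeros and poles *)

Section RootSums.
Variables (R : realType) (m : nat) (n : 'I_m.+1 -> nat).
Hypothesis n_gt0 : forall i, (0 < n i)%N.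
Local Notation C := (cplx R).
Local Notation N := (ckp_dim n).
Local Notation M := (Mdeg n).
Local Notation pt := 'rV[C]_N.
Local Notation idx := ('I_M + 'I_m)%type.
Local Notation e_ k := (delta_mx 0 k : pt).
Implicit Types (a b u v : pt).
Variable S : 'I_N -> {set idx}.
Hypotheses (S_balanced : forall al, \sum_(r in S al) eps R r = 0)
  (S_kernel : forall y : idx -> C, (forall al, \sum_(r in S al) y r = 0) ->
     exists k, forall r, y r = k * eps R r).
Variables (a0 : pt) (Z : 'I_M -> pt -> C) (r0 : R).
Hypotheses (r0_gt0 : 0 < r0)
  (HB : forall b, box a0 r0 b -> [/\ MCKP b, is_zeros b (Z^~ b), injective (rpt (Z^~ b) b) &
     forall s, vder (fun c => rpt (Z^~ c) c s) b (fun k => uX b (Z^~ b) (e_ k) s)]).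
Local Notation X b := (rpt (Z^~ b) b).
Local Notation UX b v := (uX b (Z^~ b) v).

(** By [density0E], component [al] is F_{gam,0} for a curve winding once around the points of [S al]
    and not around the others. *)
Definition root_sum b : pt := \row_al - \sum_(r in S al) eps R r * X b r.
Definition root_sum_jac b : 'M[C]_N := \matrix_(k, al) - \sum_(r in S al) eps R r * UX b (e_ k) r.
Definition root_gram : 'M[C]_N := \matrix_(al, be) - \sum_(r in S al | r \in S be) eps R r.

Lemma root_sum_vder b al : box a0 r0 b -> vder (crd root_sum al) b (fun k => root_sum_jac b k al).
Proof.
move=> Hb; have [_ _ _ HV] := HB Hb.
have D := ucderN (ucder_sum (index_enum (idx : finType)) (P := mem (S al))
  (fun r _ => ucderZ (eps R r) (HV r))).
have -> : crd root_sum al = fun c => - \sum_(r in S al) eps R r * X c r.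
  by apply: functional_extensionality_dep => c; rewrite /crd mxE.
by apply: ucder_eq D => k s _; rewrite mxE.
Qed.

Lemma root_sum_jacE b v al : (v *m root_sum_jac b) 0 al = - \sum_(r in S al) eps R r * UX b v r.
Proof.
rewrite mxE; under eq_bigr do rewrite mxE mulrN mulr_sumr.
rewrite sumrN exchange_big /=; congr (- _); apply: eq_bigr => r _.
by rewrite uX_sum mulr_sumr; apply: eq_bigr => k _; rewrite mulrCA.
Qed.

Lemma n0C_neq0 : (n ord0)%:R != 0 :> C.
Proof. by rewrite pnatr_eq0 -lt0n n_gt0. Qed.

(** By [S_kernel], eps y is a multiple of eps, so [y] is constant; as sum_r eps_r = n_0 is not 0,
    the full sum forces this constant to be 0. *)
Lemma balanced_const b (y : idx -> C) : box a0 r0 b -> \sum_r eps R r * y r = 0 ->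
  (forall al, \sum_(r in S al) eps R r * y r = 0) -> forall r, y r = 0.
Proof.
move=> Hb H0 Hy; have [Mb HZ Xi _] := HB Hb.
have [k Hk] := S_kernel Hy; have yk r : y r = k.
  by apply: (mulfI (eps_neq0 R n_gt0 r)); rewrite Hk mulrC.
have : k * (n ord0)%:R = 0.
  rewrite -(sum_eps n_gt0 HZ Xi) mulr_sumr -[RHS]H0; apply: eq_bigr => r _.
  by rewrite yk mulrC.
by move=> /eqP; rewrite mulf_eq0 (negPf n0C_neq0) orbF => /eqP k0 r; rewrite yk.
Qed.

Lemma root_sum_jac_unit b : box a0 r0 b -> root_sum_jac b \in unitmx.
Proof.
move=> Hb; have [Mb HZ Xi _] := HB Hb; apply: unitmx_inj => u Hu.
have u0 : forall r, UX b u r = 0.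
  apply: (balanced_const Hb); first exact: (sum_eps_uX n_gt0 HZ Xi u).
  move=> al; have := root_sum_jacE b u al; rewrite Hu mxE => /esym/eqP.
  by rewrite oppr_eq0 => /eqP.
have uG : u *m form_mx (rmetric b (Z^~ b)) = 0.
  apply/rowP => l; rewrite (form_row _ _ (rmetric_bilin b (Z^~ b))) mxE /rmetric.
  by rewrite big1 ?oppr0// => r _; rewrite u0 mulr0 mul0r.
by rewrite -[u]mulmx1 -(metric_cometric n_gt0 Mb HZ Xi) mulmxA uG mul0mx.
Qed.

(** The contravariant metric in the coordinates [root_sum]. It depends only on the sets [S], not on
    [b], which is flatness. *)
Lemma root_sum_gram b : box a0 r0 b ->
  (root_sum_jac b)^T *m cometric_mx b *m root_sum_jac b = root_gram.
Proof.
move=> Hb; have [Mb HZ Xi _] := HB Hb; have GC := metric_cometric n_gt0 Mb HZ Xi.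
apply/matrixP => be al; rewrite [RHS]mxE.
(* [v] is dual to the column [be] for the metric, so that [UX b v] is the indicator of [S be]. *)
pose v : pt := row be ((root_sum_jac b)^T *m cometric_mx b).
have -> : ((root_sum_jac b)^T *m cometric_mx b *m root_sum_jac b) be al = (v *m root_sum_jac b) 0 al.
  by rewrite /v -row_mul [in RHS]mxE.
rewrite root_sum_jacE; congr (- _).
have vG : v *m form_mx (rmetric b (Z^~ b)) = row be (root_sum_jac b)^T.
  by rewrite /v -row_mul -mulmxA (mulmx1C GC) mulmx1.
pose y r : C := UX b v r - (r \in S be)%:R.
have Sy (c : idx -> C) : \sum_r eps R r * (r \in S be)%:R * c r = \sum_(r in S be) eps R r * c r.
  rewrite [RHS]big_mkcond; apply: eq_bigr => r _; case: ifP => _; first by rewrite mulr1.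
  by rewrite mulr0 mul0r.
have y0 : forall r, y r = 0.
  apply: (uX_separates n_gt0 Mb HZ Xi).
    rewrite /y; under eq_bigr do rewrite mulrBr.
    rewrite sumrB (sum_eps_uX n_gt0 HZ Xi) sub0r.
    have := Sy (fun _ => 1); under eq_bigr do rewrite mulr1.
    by move=> ->; under eq_bigr do rewrite mulr1; rewrite S_balanced oppr0.
  have Hk k : \sum_r eps R r * y r * UX b (e_ k) r = 0.
    rewrite /y; under eq_bigr do rewrite mulrBr mulrBl.
    rewrite sumrB Sy; have := congr1 (fun u : pt => u 0 k) vG.
    rewrite (form_row _ _ (rmetric_bilin b (Z^~ b))) !mxE /rmetric => /oppr_inj ->.
    by rewrite subrr.
  move=> w; under eq_bigr do rewrite uX_sum mulr_sumr.
  rewrite exchange_big big1// => k _ /=.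
  transitivity (w 0 k * \sum_r eps R r * y r * UX b (e_ k) r); last by rewrite Hk mulr0.
  rewrite mulr_sumr; apply: eq_bigr => r _.
  by rewrite mulrCA.
rewrite [LHS](eq_bigr (fun r => if r \in S be then eps R r else 0)); last first.
  move=> r _; have /eqP := y0 r; rewrite subr_eq0 => /eqP ->.
  by case: ifP => _; rewrite ?mulr1 ?mulr0.
rewrite -big_mkcondr /=; apply: eq_bigl => r.
by rewrite andbC.
Qed.

Lemma root_gram_unit : root_gram \in unitmx.
Proof.
have B0 : box a0 r0 a0 by move=> k; rewrite subrr nc0.
have [Mb HZ Xi _] := HB B0; have [_ cu] := mulmx1_unit (metric_cometric n_gt0 Mb HZ Xi).
by rewrite -(root_sum_gram B0) !unitmx_mul unitmx_tr root_sum_jac_unit// cu.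
Qed.

(** The index is adjusted by the constant metric so that [theta0], which lowers it again, gives back
    [root_sum]. *)
Definition root_coord b : pt := root_sum b *m invmx root_gram.

Lemma root_coord_jac b : box a0 r0 b ->
  differentiable root_coord b /\ 'J root_coord b = root_sum_jac b *m invmx root_gram.
Proof.
move=> Hb; apply: rows_jacobian => al.
have D := ucder_sum (index_enum 'I_N) (P := xpredT)
  (fun be _ => ucderZ (invmx root_gram be al) (@root_sum_vder b be Hb)).
have -> : crd root_coord al = fun c => \sum_be invmx root_gram be al * crd root_sum be c.
  by apply: functional_extensionality_dep => c; rewrite /crd mxE; apply: eq_bigr => be _; rewrite mulrC.
by apply: ucder_eq D => k s _; rewrite mxE; apply: eq_bigr => be _; rewrite mulrC.
Qed.

Lemma root_coord_gup b : box a0 r0 b ->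
  gup root_coord b = (invmx root_gram)^T.
Proof.
move=> Hb; have [Mb _ _ _] := HB Hb; have [_ E] := root_coord_jac Hb.
rewrite (gupE n_gt0 root_coord Mb) E trmx_mul.
rewrite -!mulmxA (mulmxA (root_sum_jac b)^T) (mulmxA _ (root_sum_jac b)) (root_sum_gram Hb).
by rewrite mulmxV ?mulmx1 ?root_gram_unit.
Qed.

Lemma root_coord_theta0 b al : box a0 r0 b -> theta0 root_coord al b = root_sum b 0 al.
Proof.
move=> Hb; have -> : theta0 root_coord al b = (root_coord b *m (gdown root_coord b)^T) 0 al.
  by rewrite mxE; apply: eq_bigr => be _; rewrite mulrC; congr (_ * _); rewrite mxE.
rewrite /gdown (root_coord_gup Hb) trmx_inv ?invmxK ?trmxK ?invmxK /root_coord.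
by rewrite mulmxKV ?root_gram_unit.
Qed.

Lemma sum_eps_root_const b : box a0 r0 b ->
  \sum_r eps R r * X b r = \sum_r eps R r * X a0 r.
Proof.
have D b' (Hb : box a0 r0 b') : vder (fun c => \sum_r eps R r * X c r) b' (fun _ => 0).
  have [Mb HZ Xi HV] := HB Hb.
  have D := ucder_sum (index_enum (idx : finType)) (P := xpredT) (fun r _ => ucderZ (eps R r) (HV r)).
  by apply: ucder_eq D => k s _; exact: (sum_eps_uX n_gt0 HZ Xi).
move=> Hb; apply: (pd0_box r0_gt0 (f := fun c => \sum_r eps R r * X c r)) Hb => [c Hc|c k Hc].
  exact: (vder_differentiable (D c Hc)).
have [_ E] := vder_Dv (e_ k) (D c Hc).
by rewrite /pd E big1// => l _; rewrite mulr0.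
Qed.

(** The differences of the X_r at the two points satisfy the relations of [balanced_const], hence
    vanish, and [rpt_determines] applies. *)
Lemma root_coord_inj : {in box a0 r0 &, injective root_coord}.
Proof.
move=> b c; rewrite !inE => Hb Hc E.
have [Mb HZb _ _] := HB Hb; have [_ HZc _ _] := HB Hc.
have E2 : root_sum b = root_sum c.
  by rewrite -[LHS](mulmxKV root_gram_unit) -[RHS](mulmxKV root_gram_unit) -!/(root_coord _) E.
apply: (rpt_determines n_gt0 Mb HZb HZc) => r; apply/eqP; rewrite -subr_eq0; apply/eqP; move: r.
apply: (balanced_const Hb).
  under eq_bigr do rewrite mulrBr.
  by rewrite sumrB (sum_eps_root_const Hb) (sum_eps_root_const Hc) subrr.
move=> al; under eq_bigr do rewrite mulrBr.
rewrite sumrB; have := congr1 (fun u : pt => u 0 al) E2; rewrite !mxE => /oppr_inj ->.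
by rewrite subrr.
Qed.

Lemma root_coord_flat U : open U -> U `<=` box a0 r0 -> flat_coordinates U root_coord.
Proof.
move=> oU UB; split.
- by move=> b /UB /HB[Mb HZ Xi _]; exact (@rpt_Mhat R m n n_gt0 b (Z^~ b) Mb HZ Xi).
- split=> // [b /UB Hb|b c].
    have [d ->] := root_coord_jac Hb; split=> //.
    by rewrite unitmx_mul root_sum_jac_unit// unitmx_inv root_gram_unit.
  by rewrite !inE => /UB Hb /UB Hc; apply: root_coord_inj; rewrite inE.
by move=> b c /UB Hb /UB Hc; rewrite (root_coord_gup Hb) (root_coord_gup Hc).
Qed.

End RootSums.

(** * Logarithms of lambda along a curve, continuous in the point *)

Section LogBranch.
Local Open Scope complex_scope.
Variables (R : realType) (m : nat) (n : 'I_m.+1 -> nat).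
Hypothesis n_gt0 : forall i, (0 < n i)%N.
Local Notation C := (cplx R).
Local Notation N := (ckp_dim n).
Local Notation pt := 'rV[C]_N.
Variables (U : set pt) (a0 : pt) (Z : 'I_(Mdeg n) -> C) (gam d : R -> C).
Hypotheses (Ua0 : U a0) (HZ : is_zeros a0 Z) (Xi : injective (rpt Z a0))
  (cg : {within `[0, 1], continuous gam}) (cd : contC 0 1 d) (Hd : forall t, rder gam t (d t))
  (avoid : forall b, U b -> forall s, 0 <= s <= 1 -> ~ is_pole b (gam s) /\ lam b (gam s) != 0).
Local Notation g := (ext gam).
Local Notation X := (rpt Z a0).

Lemma ext_not_pole b : U b -> forall t : R, 0 <= t <= 1 -> forall j, g t != pole b j.
Proof.
move=> Ub t tI j; rewrite extE//; apply/eqP => E; have [+ _] := avoid Ub tI; apply.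
by exists (lift ord0 j).
Qed.

Lemma lam_ext_neq0 b : U b -> forall t : R, 0 <= t <= 1 -> lam b (g t) != 0.
Proof. by move=> Ub t tI; rewrite extE//; have [] := avoid Ub tI. Qed.

Lemma lam_jc b : U b -> jc b (fun c t => lam c (g t)).
Proof.
move=> Ub; have cgt (t : R) : 0 <= t <= 1 -> g s @[s --> t] --> g t by move=> _; exact: ext_cvg.
exact: (ucder_jc (lam_ucder cgt (ext_not_pole Ub))).
Qed.

Lemma lam_contC b : U b -> contC 0 1 (fun t => lam b (g t)).
Proof. by move=> Ub; have [_ H] := lam_jc Ub; apply/contCP; exact: (nbhs_singleton H). Qed.

Let off t : 0 <= t <= 1 -> forall r, g t != X r.
Proof. by move=> tI; exact: (g_off HZ (avoid Ua0) tI). Qed.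
Local Notation dz := (fun t => \sum_r eps R r / (g t - X r)).

(** A primitive F of d log lambda along the curve makes e^F / lambda constant; a constant [c0] with
    suitable exponential corrects the initial value. *)
Lemma log_lift : exists l : R -> C, (forall t, l s @[s --> t] --> l t) /\
  forall t, 0 <= t <= 1 -> cexp (l t) = lam a0 (g t).
Proof.
have cz := dlog_cont HZ cg (avoid Ua0).
have [F HF] := primitive (contCM cz cd).
have n0 (t : R) : 0 <= t <= 1 -> lam a0 (g t) != 0 by exact: lam_ext_neq0.
have [c0 Hc0] : exists c0, cexp c0 = lam a0 (g 0) / cexp (F 0).
  by apply: cexp_surj; rewrite mulf_neq0 ?invr_eq0 ?cexp_neq0// n0 ?itv01.
pose h t := cexp (F t) / lam a0 (g t).
have cF : contC 0 1 (fun t => cexp (F t)).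
  apply/contCP => t tI; exact: (cvg_comp _ _ (rder_cvg (HF t tI)) (@cexp_cvg R (F t))).
have ch : contC 0 1 h by exact: (contCM cF (contCV (lam_contC Ua0) n0)).
have Dh t : 0 < t < 1 -> rder h t 0.
  move=> tI; have tI' : 0 <= t <= 1 by case/andP: tI => h1 h2; rewrite !ltW.
  have Dz : zder (lam a0) (g t) (dz t * lam a0 (g t)).
    have D := zder_lam (rpt_not_pole (off tI')).
    have E := dlog_z n_gt0 HZ Xi (off tI').
    have -> : dz t * lam a0 (g t) = (lam a0)^`()%classic (g t) by rewrite -E (divfK (n0 t tI')).
    by rewrite (zder_derive1 D); exact D.
  have Dl := rder_comp Dz (ext_rder tI (Hd t)).
  have DF := rder_comp (zder_cexp (F t)) (HF t tI').
  have nl : forall s : R, 0 <= s <= 1 -> lam a0 (g t) != 0 by move=> s _; exact: n0.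
  have D := ucderM DF (ucderV nl Dl).
  apply: ucder_eq D => k s _; have := n0 t tI'.
  move: (lam a0 (g t)) (dz t) (cexp (F t)) => x y z x0 /=.
  by field.
have h_const t : 0 <= t <= 1 -> h t = h 0.
  move=> /andP[t0 t1]; have [<-//|tn0] := eqVneq 0 t.
  have tp : 0 < t by rewrite lt_neqAle tn0.
  have c0' : contC 0 t (fun _ => 0) by exact: contC_cst.
  have ch' : contC 0 t h.
    by apply/contCP => s /andP[s0 st]; apply: (contCP _ _ _).1 ch _ _; rewrite s0 (le_trans st).
  have Dt s : 0 < s < t -> rder h s 0.
    by move=> /andP[s0 st]; apply: Dh; rewrite s0 (lt_le_trans st).
  have E1 := cFTC tp c0' ch' Dt.
  have E2 := cFTC tp c0' (@contC_cst R 0 t 0) (fun s _ => ucder_cst (@xR R) s 0).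
  by apply/eqP; rewrite -subr_eq0 -E1 E2 subrr.
exists (fun t => c0 + F (clamp t)); split=> [t|t tI].
  have c1 : F s @[s --> clamp t] --> F (clamp t) by exact: (rder_cvg (HF _ (clamp_in t))).
  have c2 : cst c0 s @[s --> t] --> c0 by exact: cvg_cst.
  exact: (cvgD c2 (cvg_comp _ _ (@clamp_cvg R t) c1)).
rewrite (clampE tI) cexpD Hc0; have /esym := h_const t tI; rewrite /h => E.
have e0 := cexp_neq0 (F 0); have := n0 0 (@itv01 R).1; have := n0 t tI.
move: E e0; move: (lam a0 (g t)) (lam a0 (g 0)) (cexp (F t)) (cexp (F 0)) => x y u v E v0 x0 y0.
have -> : u = v / y * x by rewrite E mulfVK.
by field; rewrite v0 y0.
Qed.

(** The ratio lambda_b / lambda_a0 stays in the right half-plane, where [clog] is continuous; its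
    principal logarithm is added to the lift at [a0]. *)
Lemma log_branch_exists : (forall b, U b -> forall t : R, 0 <= t <= 1 ->
    0 < complex.Re (lam b (g t) / lam a0 (g t))) -> exists L, log_branch U gam L.
Proof.
move=> Hre; have [l [cl Hl]] := log_lift.
pose q (b : pt) t := lam b (g t) / lam a0 (g t).
have cV : contC 0 1 (fun t => (lam a0 (g t))^-1) by exact: (contCV (lam_contC Ua0) (lam_ext_neq0 Ua0)).
have jq b : U b -> jc b q.
  move=> Ub; have jV : jc b (fun _ t => (lam a0 (g t))^-1) by apply: jc_t; apply/contCP.
  exact: (jcM (lam_jc Ub) jV).
exists (fun b t => l t + clog (q b t)); split=> [b Ub|].
  split=> [|t tI].
    apply: continuous_in_subspaceT => t; rewrite inE /= in_itv /= => tI.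
    have [_ H] := jq b Ub; have c1 : q b s @[s --> t] --> q b t by exact: (nbhs_singleton H).
    exact: (cvgD (cl t) (clog_cvg (Hre b Ub t tI) c1)).
  rewrite cexpD (clogK (Hre b Ub t tI)) (Hl t tI) /q mulrCA mulfV ?mulr1 ?extE//.
  by have := lam_ext_neq0 Ua0 tI; rewrite extE.
apply: continuous_in_subspaceT => -[b t]; rewrite inE => -[/= Ub]; rewrite in_itv /= => tI.
have [H _] := jq b Ub; have c1 := H t tI.
have c2 : p.2 @[p --> (b, t)] --> t by exact: cvg_snd.
exact: (cvgD (cvg_comp _ _ c2 (cl t)) (clog_cvg (Hre b Ub t tI) c1)).
Qed.

End LogBranch.

(** * Existence of complete systems *)

Section PartTwo.
Local Open Scope complex_scope.
Variables (R : realType) (m : nat) (n : 'I_m.+1 -> nat).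
Hypothesis n_gt0 : forall i, (0 < n i)%N.
Local Notation C := (cplx R).
Local Notation N := (ckp_dim n).
Local Notation pt := 'rV[C]_N.

(** The curves are drawn for the roots at [a0]. Avoidance, winding numbers and positivity of the
    real part of lambda_b / lambda_a0 persist near [a0], the last by compactness of [0, 1]; finitely
    many conditions leave a common box [U]. *)
Theorem complete_system : (0 < m)%N -> forall a0 : pt, Mhat R n a0 ->
  exists (U : set pt) (t : pt -> pt) (gam : 'I_N -> R -> C) (L : 'I_N -> pt -> R -> C),
    [/\ U a0, flat_coordinates U t,
        forall al, [/\ simple_closed_curve (gam al), positively_oriented (gam al),
          forall a, U a -> zero_winding a (gam al) & log_branch U (gam al) (L al)] &
        hamiltonian_densities U t (fun al => F_density (gam al) (L al))].
Proof.
move=> m_gt0 a0 Ha0; have [Z [r1 [r10 HB]]] := local_roots n_gt0 Ha0.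
have [S [Sb Sk]] := @balanced_sets R m n n_gt0 m_gt0.
have B0 : box a0 r1 a0 by move=> k; rewrite subrr nc0.
have [Ma HZ Xi HV] := HB a0 B0.
have /choice[gam Hgam] : forall al, exists gam : R -> C,
    [/\ simple_closed_curve gam, positively_oriented gam,
        forall r, ~ curve_image gam (rpt (Z^~ a0) a0 r),
        forall r, winding_number gam (rpt (Z^~ a0) a0 r) = (r \in S al)%:R &
        exists2 d : R -> C, contC 0 1 d & forall t, rder gam t (d t)].
  by move=> al; exact: (curve_around Xi (mem (S al))).
have Xcvg r : rpt (Z^~ b) b r @[b --> a0] --> rpt (Z^~ a0) a0 r by exact: (jc_sE (ucder_jc (HV r))).
pose A al b := (forall r, ~ curve_image (gam al) (rpt (Z^~ b) b r)) /\
  (forall r, winding_number (gam al) (rpt (Z^~ b) b r) = (r \in S al)%:R).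
have nearA al : \forall b \near a0, A al b.
  have [[cg Hg cl _] _ H1 H2 _] := Hgam al.
  have N1 : \forall b \near a0, forall r, ~ curve_image (gam al) (rpt (Z^~ b) b r).
    by apply: (@near_all pt _ a0) => r; exact: (near_comp (Xcvg r) (image_open cg (H1 r))).
  have N2 : \forall b \near a0, forall r, winding_number (gam al) (rpt (Z^~ b) b r) = (r \in S al)%:R.
    apply: (@near_all pt _ a0) => r; rewrite -(H2 r).
    exact: (near_comp (Xcvg r) (winding_locally cg Hg cl (H1 r))).
  exact: (filterI N1 N2).
have avoidA al b : box a0 r1 b -> A al b -> forall s : R, 0 <= s <= 1 ->
    ~ is_pole b (gam al s) /\ lam b (gam al s) != 0.
  move=> Hb [H1 _] s sI; have [Mb HZb _ _] := HB b Hb.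
  have off r : gam al s != rpt (Z^~ b) b r.
    by apply/eqP => E; apply: (H1 r); exists s; rewrite //= in_itv.
  split; last exact: (lam_neq0 n_gt0 HZb off).
  move=> [i i0 E]; case: (unliftP ord0 i) i0 E => [j ->|->]; last by rewrite eqxx.
  by move=> _ E; have := off (inr j); rewrite E /= /pole eqxx.
have A0 al : A al a0 by exact: (nbhs_singleton (nearA al)).
have nearB al : \forall b \near a0, forall t : R, 0 <= t <= 1 ->
    0 < complex.Re (lam b (ext (gam al) t) / lam a0 (ext (gam al) t)).
  have [[cg Hg cl _] _ _ _ _] := Hgam al.
  pose U0 := [set b : pt | box a0 r1 b /\ A al b].
  have av b : U0 b -> forall s : R, 0 <= s <= 1 -> ~ is_pole b (gam al s) /\ lam b (gam al s) != 0.
    by move=> [h1 h2]; exact: avoidA.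
  have Ua0 : U0 a0 by [].
  have cV : contC 0 1 (fun t => (lam a0 (ext (gam al) t))^-1).
    exact: (contCV (lam_contC cg av Ua0) (lam_ext_neq0 av Ua0)).
  have jV : jc a0 (fun _ t => (lam a0 (ext (gam al) t))^-1) by apply: jc_t; apply/contCP.
  apply: (jc_near (P := fun z => 0 < complex.Re z) (jcM (lam_jc cg av Ua0) jV)) => t tI.
  rewrite mulfV ?(lam_ext_neq0 av Ua0 tI)//.
  apply/nbhs_ncP; exists 1 => // z Hz; have := le_lt_trans (Re_le_nc (z - 1)) Hz.
  by rewrite ReB /= ltr_norml => /andP[+ _]; rewrite ltrBrDl subrr.
have NA : \forall b \near a0, forall al, A al b by exact: (@near_all pt _ a0).
have NB : \forall b \near a0, forall al (t : R), 0 <= t <= 1 ->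
    0 < complex.Re (lam b (ext (gam al) t) / lam a0 (ext (gam al) t)) by exact: (@near_all pt _ a0).
pose W : set pt := [set b | ((forall al, A al b) /\ forall al (t : R), 0 <= t <= 1 ->
    0 < complex.Re (lam b (ext (gam al) t) / lam a0 (ext (gam al) t))) /\ box a0 r1 b].
have NW : nbhs a0 W by exact: (filterI (filterI NA NB) (@box_nbhs R N a0 r1 r10)).
have [e e0 He] := (@nbhs_rVP R N a0 _).1 NW.
pose U := box a0 e.
have oU : open U by rewrite openE => c; exact: (@box_open R N a0 e e0 c).
have UB : U `<=` box a0 r1 by move=> b /He[].
have UA al b : U b -> A al b by move=> /He[[H _] _].
have Ua0 : U a0 by move=> k; rewrite subrr nc0.
have UR al b : U b -> forall t : R, 0 <= t <= 1 ->
    0 < complex.Re (lam b (ext (gam al) t) / lam a0 (ext (gam al) t)) by move=> /He[[_ H] _] t tI; exact: H.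
have UV al b : U b -> forall s : R, 0 <= s <= 1 -> ~ is_pole b (gam al s) /\ lam b (gam al s) != 0.
  by move=> Ub; exact: (avoidA al b (UB b Ub) (UA al b Ub)).
have /choice[L HL] : forall al, exists L, log_branch U (gam al) L.
  move=> al; have [[cg Hg cl _] _ _ _ [d cd Hd]] := Hgam al.
  exact: (log_branch_exists n_gt0 Ua0 HZ Xi cg cd Hd (UV al) (UR al)).
have HW al b : U b -> zero_winding b (gam al).
  move=> Ub; split; first exact: UV.
  have [[cg Hg cl _] _ _ _ _] := Hgam al; have [Mb HZb Xib _] := HB b (UB b Ub).
  (* The argument principle gives the sum of eps over [S al], and this set is balanced. *)
  rewrite (winding_lam n_gt0 HZb Xib cg Hg (UV al b Ub)) -[RHS](Sb al) [RHS]big_mkcond.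
  apply: eq_bigr => r _; have [_ ->] := UA al b Ub.
  by case: ifP => _; rewrite ?mulr1 ?mulr0.
have HF := root_coord_flat n_gt0 Sb Sk r10 HB oU UB.
exists U, (root_coord S Z), gam, L; split=> //.
  by move=> al; have [H1 H2 _ _ _] := Hgam al; split=> //; exact: HW.
move=> al; have [[cg Hg cl _] _ _ _ _] := Hgam al; split.
  exact: (density_chainP n_gt0 oU cg Hg cl (HW al) (HL al) HF).
move=> b Ub; have [Mb HZb Xib _] := HB b (UB b Ub).
rewrite (root_coord_theta0 n_gt0 Sb Sk r10 HB al (UB b Ub)) mxE /F_density.
have [Hl _] := HL al; have [av wn] := HW al b Ub.
rewrite (density0E n_gt0 HZb Xib cg Hg cl av (Hl b Ub) wn); congr (- _).
rewrite [RHS]big_mkcond; apply: eq_bigr => r _; have [_ ->] := UA al b Ub.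
by case: ifP => _; rewrite ?mulr1 ?mulr0.
Qed.

End PartTwo.

(** * Orders of meromorphic functions and lists with multiplicities *)

Section MeromorphicOrder.
Variable R : realType.
Local Notation C := (cplx R).

(** Two orders k < l would give h = (z - w)^(l-k) h' near [w], so h would vanish there. *)
Lemma mero_order_lt (f : C -> C) w (k l : int) : k < l ->
  is_mero_order f w k -> is_mero_order f w l -> False.
Proof.
move=> kl [h [hh h0 H]] [h' [hh' h0' H']]; move/eqP: h0; apply.
have [d dE] : exists d : nat, l = k + d.+1%:Z by exists (`|l - k|%N.-1); lia.
have c1 := holomorphic_cvg hh; have c2 := holomorphic_cvg hh'.
pose h2 (z : C) : C := (z - w) ^+ d.+1 * h' z.
have c3 : h2 z @[z --> w] --> h2 w.
  have c4 : (fun z : C => z - w) z @[z --> w] --> w - w.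
    exact: (cvgB (@cvg_ident C w) (@cvg_const C C w w)).
  have c5 : (fun z : C => (z - w) ^+ d.+1) z @[z --> w] --> (w - w) ^+ d.+1.
    by exact: (@cvg_expc R C (nbhs w) _ _ _ d.+1 c4).
  exact: (cvgM c5 c2).
have E : \forall z \near w^', h z = h2 z.
  have [e e0 He] := (dnbhs_nc _ _).1 H; have [e' e0' He'] := (dnbhs_nc _ _).1 H'.
  apply/dnbhs_nc; exists (Num.min e e') => [|z zw]; first by rewrite lt_min e0.
  rewrite lt_min => /andP[ze ze']; have n0 : z - w != 0 by rewrite subr_eq0.
  apply: (mulfI (expfz_neq0 k n0)).
  by rewrite -(He z zw ze) (He' z zw ze') dE expfzDr// /h2 -exprnP mulrA.
by rewrite (punctured_eq c1 c3 E) /h2 subrr expr0n mul0r.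
Qed.

Lemma mero_order_uniq (f : C -> C) w (k l : int) :
  is_mero_order f w k -> is_mero_order f w l -> k = l.
Proof.
move=> Hk Hl; have [kl|lk|//] := ltgtP k l.
  by case: (mero_order_lt kl Hk Hl).
by case: (mero_order_lt lk Hl Hk).
Qed.

Lemma mero_orderE (f : C -> C) w (k : int) : is_mero_order f w k -> mero_order f w = k.
Proof.
move=> Hk; rewrite /mero_order.
have H : is_mero_order f w (xget 0 [set k | is_mero_order f w k]) by exact: (xgetPex 0 (ex_intro _ k Hk)).
exact: mero_order_uniq H Hk.
Qed.

(** A list with these multiplicities is a permutation of the concatenation of blocks of [e i] copies
    of [x i]. *)
Lemma listed_sums (I : finType) (x : I -> C) (e : I -> nat) (A : set C) (s : seq C) :
  lists_in A (fun w => \sum_(i | x i == w) e i)%N s ->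
  size s = (\sum_(i | `[< A (x i) >]) e i)%N /\
  \sum_(p <- s) p = \sum_(i | `[< A (x i) >]) (e i)%:R * x i.
Proof.
move=> H; pose js := [seq i <- index_enum I | `[< A (x i) >]].
pose t := flatten [seq nseq (e i) (x i) | i <- js].
have st : perm_eq s t.
  apply/allP => w _; apply/eqP; rewrite (H w) /t count_flatten -map_comp sumnE big_map.
  rewrite /js big_filter [RHS]big_mkcond /=.
  have [Aw|nA] := boolP `[< A w >].
    rewrite big_mkcond; apply: eq_bigr => i _; rewrite count_nseq /=.
    have [->|_] := eqVneq (x i) w; first by rewrite Aw mul1n.
    by rewrite mul0n if_same.
  rewrite big1// => i _; rewrite count_nseq /=.
  by have [->|_] := eqVneq (x i) w; rewrite ?(negPf nA) ?mul0n ?if_same.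
split.
  rewrite (perm_size st) /t size_flatten /shape -map_comp sumnE big_map /js big_filter.
  by apply: eq_bigr => i _ /=; rewrite size_nseq.
rewrite (perm_big _ st) /= /t big_flatten big_map /js big_filter.
apply: eq_bigr => i _; rewrite big_nseq -Monoid.iteropE /=.
by rewrite mulr_natl; elim: (e i) => // k IH; rewrite mulrS.
Qed.

End MeromorphicOrder.

(** * The formula for F_{gam,0} *)

Section PartThree.
Variables (R : realType) (m : nat) (n : 'I_m.+1 -> nat).
Hypothesis n_gt0 : forall i, (0 < n i)%N.
Local Notation C := (cplx R).
Local Notation M := (Mdeg n).
Local Notation pt := 'rV[C]_(ckp_dim n).
Variables (a : pt) (Z : 'I_M -> C).
Hypotheses (HZ : is_zeros a Z) (Xi : injective (rpt Z a)).

Lemma lam_order w : is_mero_order (lam a) w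
  ((\sum_(k | Z k == w) 1)%N%:Z - (\sum_(j | pole a j == w) nn n j)%N%:Z).
Proof.
set A := (\sum_(k | Z k == w) 1)%N; set B := (\sum_(j | pole a j == w) nn n j)%N.
pose p : {poly C} := (n ord0)%:R^-1 *: \prod_(k | Z k != w) ('X - (Z k)%:P).
pose q : {poly C} := \prod_(j | pole a j != w) ('X - (pole a j)%:P) ^+ nn n j.
have qz z : q.[z] = \prod_(j | pole a j != w) (z - pole a j) ^+ nn n j.
  by rewrite /q horner_prod; apply: eq_bigr => j _; rewrite horner_exp hornerXsubC.
have pz z : p.[z] = (n ord0)%:R^-1 * \prod_(k | Z k != w) (z - Z k).
  by rewrite /p hornerZ horner_prod; congr (_ * _); apply: eq_bigr => k _; rewrite hornerXsubC.
have q0 : q.[w] != 0.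
  by rewrite qz; apply/prodf_neq0 => j jw; rewrite expf_neq0// subr_eq0 eq_sym.
exists (fun z => p.[z] / q.[z]); split; first exact: holomorphic_rat.
  rewrite mulf_neq0 ?invr_eq0// pz mulf_neq0 ?invr_eq0 ?(n0_neq0 R n_gt0)//.
  by apply/prodf_neq0 => k kw; rewrite subr_eq0 eq_sym.
have [e e0 He] := (nbhs_ncP _ _).1 (cvg_neq0 (@horner_cvg R q w) q0).
apply/dnbhs_nc; exists e => // z zw ze; have qz0 := He z ze.
have zw0 : z - w != 0 by rewrite subr_eq0.
have hz j : z != pole a j.
  apply/eqP => E; have jw : pole a j != w by rewrite -E.
  have nj : (0 < nn n j)%N by exact: n_gt0.
  move: nj; move: qz0; rewrite qz (bigD1 j)//= E subrr expr0n.
  by case: (nn n j) => // k; rewrite mul0r eqxx.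
have EA : \prod_k (z - Z k) = (z - w) ^+ A * \prod_(k | Z k != w) (z - Z k).
  rewrite (bigID (fun k => Z k == w)) /=; congr (_ * _).
  by rewrite /A -prodrXr; apply: eq_bigr => k /eqP ->; rewrite expr1.
have EB : (polprod a (nn n)).[z] = (z - w) ^+ B * q.[z].
  rewrite qz /polprod horner_prod (bigID (fun j => pole a j == w)) /=; congr (_ * _).
    rewrite /B -prodrXr; apply: eq_bigr => j /eqP ->.
    by rewrite horner_exp hornerXsubC.
  by apply: eq_bigr => j _; rewrite horner_exp hornerXsubC.
have E1 := Vpol_lam hz; have E2 := Vpol_zero HZ z.
have E3 : (\prod_k ('X - (Z k)%:P)).[z] = \prod_k (z - Z k).
  by rewrite horner_prod; apply: eq_bigr => k _; rewrite hornerXsubC.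
have wA := expf_neq0 A zw0; have wB := expf_neq0 B zw0.
have -> : lam a z = (Vpol a).[z] / (polprod a (nn n)).[z].
  by rewrite E1 mulrC mulKf// polprod_neq0.
rewrite E2 E3 EA EB pz expfzDr// -exprnN -exprnP.
move: wA wB qz0; move: ((z - w) ^+ A) ((z - w) ^+ B) q.[z] (\prod_(k | Z k != w) (z - Z k)) => x y u v x0 y0 u0.
have n0 := n0_neq0 R n_gt0.
by field; rewrite n0 y0 u0.
Qed.

(** No cancellation occurs in [lam_order], so the sign of the order separates [zero_mult] from
    [pole_mult]. *)
Lemma pole_or_zero w : (\sum_(k | Z k == w) 1)%N = 0%N \/ (\sum_(j | pole a j == w) nn n j)%N = 0%N.
Proof.
have [k /eqP kw|nk] := pickP (fun k => Z k == w); last by left; rewrite big_pred0.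
right; rewrite big_pred0// => j; apply/negP => /eqP jw.
by have := Xi (_ : rpt Z a (inl k) = rpt Z a (inr j)); rewrite /= kw jw => /(_ erefl).
Qed.

Lemma zero_multE w : zero_mult (lam a) w = (\sum_(k | Z k == w) 1)%N.
Proof.
rewrite /zero_mult (mero_orderE (lam_order w)).
case: (pole_or_zero w) => ->; last by rewrite subr0.
by rewrite sub0r; case: (\sum_(j | _) _)%N.
Qed.

Lemma pole_multE w : pole_mult (lam a) w = (\sum_(j | pole a j == w) nn n j)%N.
Proof.
rewrite /pole_mult (mero_orderE (lam_order w)).
case: (pole_or_zero w) => ->; last by rewrite subr0.
by rewrite sub0r; case: (\sum_(j | _) _)%N.
Qed.

(** Positive orientation makes the winding numbers the indicator of the enclosed region. The
    argument principle then equates the two sizes, and [density0E] gives the sum. *)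
Lemma density0_poles_zeros (gam l : R -> C) (ps qs : seq C) :
  simple_closed_curve gam -> positively_oriented gam -> zero_winding a gam -> log_along gam (lam a) l ->
  lists_in (enclosed gam) (pole_mult (lam a)) ps ->
  lists_in (enclosed gam) (zero_mult (lam a)) qs ->
  size ps = size qs /\ log_density gam l 0 = \sum_(p <- ps) p - \sum_(q <- qs) q.
Proof.
move=> [cg Hg cl _] pos [av wn] Hl Hps Hqs.
pose b z : bool := `[< enclosed gam z >].
have wnE r : winding_number gam (rpt Z a r) = (b (rpt Z a r))%:R.
  rewrite /b; case: asboolP => [/pos//|ne].
  exact: (winding_outside cg Hg cl (rpt_off HZ av (r := r)) ne).
have [Sp Pp] := @listed_sums R _ (pole a) (nn n) (enclosed gam) ps
  (fun w => etrans (Hps w) (congr1 (fun k => if _ then k else 0%N) (pole_multE w))).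
have [Sq Pq] := @listed_sums R _ Z (fun _ => 1%N) (enclosed gam) qs
  (fun w => etrans (Hqs w) (congr1 (fun k => if _ then k else 0%N) (zero_multE w))).
split.
  have := winding_lam n_gt0 HZ Xi cg Hg av; rewrite wn big_sumType /=.
  have -> : \sum_k 1 * winding_number gam (Z k) = (size qs)%:R.
    rewrite Sq natr_sum [RHS]big_mkcond; apply: eq_bigr => k _.
    by rewrite mul1r (wnE (inl k)) /= /b; case: ifP.
  have -> : \sum_j - (nn n j)%:R * winding_number gam (pole a j) = - (size ps)%:R.
    rewrite Sp natr_sum -sumrN [RHS]big_mkcond; apply: eq_bigr => j _.
    by rewrite (wnE (inr j)) /= /b; case: ifP; rewrite ?mulr1 ?mulr0.
  by move=> /esym/eqP; rewrite subr_eq0 eqr_nat eq_sym => /eqP.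
rewrite (density0E n_gt0 HZ Xi cg Hg cl av Hl wn) big_sumType /= Pp Pq opprD addrC; congr (_ + _).
  rewrite -sumrN [RHS]big_mkcond; apply: eq_bigr => j _; rewrite (wnE (inr j)) /= /b.
  by case: ifP => _; rewrite ?mulr1 ?mulr0 ?mulNr ?opprK ?oppr0.
congr (- _); rewrite [RHS]big_mkcond; apply: eq_bigr => k _; rewrite (wnE (inl k)) /= /b.
by case: ifP => _; rewrite ?mulr1 ?mulr0.
Qed.

End PartThree.

Theorem theorem1p2 (R : realType) (m : nat) (n : 'I_m.+1 -> nat)
    (n_gt0 : forall i, (0 < n i)%N) :
  [/\ (* for each curve, F_{gam,p} is a chain of Hamiltonian densities *)
      forall (U : set 'rV[cplx R]_(ckp_dim n))
             (t : 'rV[cplx R]_(ckp_dim n) -> 'rV[cplx R]_(ckp_dim n))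
             (gam : R -> cplx R) (L : 'rV[cplx R]_(ckp_dim n) -> R -> cplx R),
        connected U -> flat_coordinates U t ->
        simple_closed_curve gam ->
        (forall a, U a -> zero_winding a gam) ->
        log_branch U gam L ->
        hamiltonian_density_chain U t (F_density gam L),
      (* these chains make up complete systems of Hamiltonian densities *)
      (0 < m)%N -> forall a0 : 'rV[cplx R]_(ckp_dim n), Mhat R n a0 ->
        exists (U : set 'rV[cplx R]_(ckp_dim n))
               (t : 'rV[cplx R]_(ckp_dim n) -> 'rV[cplx R]_(ckp_dim n))
               (gam : 'I_(ckp_dim n) -> R -> cplx R)
               (L : 'I_(ckp_dim n) -> 'rV[cplx R]_(ckp_dim n) -> R -> cplx R),
          [/\ U a0, flat_coordinates U t,
              forall al, [/\ simple_closed_curve (gam al),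
                             positively_oriented (gam al),
                             forall a, U a -> zero_winding a (gam al) &
                             log_branch U (gam al) (L al)] &
              hamiltonian_densities U t (fun al => F_density (gam al) (L al))] &
      (* F_{gam,0} is the sum of the poles minus the sum of the zeros *)
      forall (a : 'rV[cplx R]_(ckp_dim n)) (gam l : R -> cplx R)
             (ps qs : seq (cplx R)),
        Mhat R n a ->
        simple_closed_curve gam -> positively_oriented gam ->
        zero_winding a gam -> log_along gam (lam a) l ->
        lists_in (enclosed gam) (pole_mult (lam a)) ps ->
        lists_in (enclosed gam) (zero_mult (lam a)) qs ->
        size ps = size qs /\
        log_density gam l 0 = \sum_(p <- ps) p - \sum_(q <- qs) q].
Proof.
split=> [U t gam L cU HU [cg Hg cl _] HW HL|m_gt0 a0|a gam l ps qs Ha].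
- have oU : open U by case: HU => _ [].
  exact: (densities_chain n_gt0 oU cg Hg cl HW HL HU cU).
- exact: (complete_system n_gt0 m_gt0).
have [Z HZ] := zeros_exist n_gt0 a.
exact: (density0_poles_zeros n_gt0 HZ (Mhat_rpt_inj n_gt0 Ha.1 HZ Ha)).
Qed.
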